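(* Let $E$ be a complete, minimal annular end in $\mathbb{R}^3$ that is conformally a punctured disk, with Weierstrass data $(g,dh)$. Suppose that $dg/g$ and $dh$ each have a double pole at the puncture and that $dh$ has no residue at the puncture. If $E$ contains a vertical ray and a horizontal ray, then a sub-end of $E$ is embedded and is asymptotic to a helicoid.
   Context: A minimal annular end $E$ that is conformally a punctured disk is the image of a conformal minimal immersion $X$ of a punctured disk $D^*$ (a punctured neighborhood of a point $p_\infty$, the puncture, in a Riemann surface) into $\mathbb{R}^3$. It is complete if every divergent path in $D^*$ tending to the puncture has infinite length in the induced metric. Weierstrass data: $g$ is the (meromorphic) stereographic projection of the Gauss map of $X$, and $dh$ is the holomorphic one-form on $D^*$ with $\operatorname{Re}\, dh = dx_3$ (only $dh$, not $h$, need be globally defined). The immersion is given by $$X(p)=X(p_0)+\operatorname{Re}\int_{p_0}^p\Phi,\qquad \Phi=\left(\tfrac12(g^{-1}-g),\ \tfrac{i}{2}(g^{-1}+g),\ 1\right)dh .$$ The statement that $dg/g$ or $dh$ has a double pole at the puncture means that this one-form extends meromorphically to the puncture with a pole of order exactly two there. Vertical means parallel to the $x_3$-axis; horizontal means orthogonal to the $x_3$-axis. A ray is a closed half-line in $\mathbb{R}^3$. A sub-end of $E$ is the image under $X$ of a smaller punctured neighborhood of the puncture. A helicoid is the complete minimal surface given, up to rigid motions and scaling of $\mathbb{R}^3$, by the Weierstrass data $g=e^z$, $dh=-i\,dz$ on $\mathbb{C}$. An end $E$ is asymptotic to a helicoid $\mathcal H$ if for every $\epsilon>0$ some sub-end of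 $E$ is contained in the $\epsilon$-neighborhood of $\mathcal H$ in $\mathbb{R}^3$. *)

(* Defs.v *)
From Stdlib Require Import Reals.
From Coquelicot Require Import Coquelicot.

Open Scope R_scope.

(** * Euclidean three-space *)

Definition R3 : Type := (R * R * R)%type.

Definition x1 (p : R3) : R := fst (fst p).
Definition x2 (p : R3) : R := snd (fst p).
Definition x3 (p : R3) : R := snd p.

Definition norm3 (v : R3) : R := sqrt (x1 v ^ 2 + x2 v ^ 2 + x3 v ^ 2).
Definition dist3 (p q : R3) : R :=
  sqrt ((x1 p - x1 q) ^ 2 + (x2 p - x2 q) ^ 2 + (x3 p - x3 q) ^ 2).

(* Orientation-reversing motions are included, so that the helicoids of both
   handednesses are congruent to one another. *)
Definition rigid_motion (T : R3 -> R3) : Prop :=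
  forall p q : R3, dist3 (T p) (T q) = dist3 p q.

Definition vertical (v : R3) : Prop := x1 v = 0 /\ x2 v = 0.
Definition horizontal (v : R3) : Prop := x3 v = 0.

(* The closed half-line issuing from [a] in the direction [v <> 0]. *)
Definition ray (a v : R3) (q : R3) : Prop :=
  exists t : R, 0 <= t /\
    q = (x1 a + t * x1 v, x2 a + t * x2 v, x3 a + t * x3 v).

Definition contains_ray (E : R3 -> Prop) (direction : R3 -> Prop) : Prop :=
  exists a v : R3, v <> (0, 0, 0) /\ direction v /\
    (forall q : R3, ray a v q -> E q).

Definition image (X : C -> R3) (D : C -> Prop) (q : R3) : Prop :=
  exists z : C, D z /\ q = X z.

(** * Holomorphic and meromorphic functions *)

Definition holomorphic_at (f : C -> C) (p : C) : Prop :=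
  locally p (fun z : C => ex_derive (K := C_AbsRing) (V := C_NormedModule) f z).

(* [f] agrees near [p], [p] excluded, with a meromorphic function having a pole
   of order exactly [n] at [p]; the value [f p] plays no role. *)
Definition has_pole (f : C -> C) (p : C) (n : nat) : Prop :=
  exists u : C -> C, holomorphic_at u p /\ u p <> RtoC 0 /\
    locally' p (fun z : C => f z = (u z / (z - p) ^ n)%C).

(* A meromorphic function is represented by a total function whose values at
   its poles are irrelevant. *)
Definition meromorphic_at (f : C -> C) (p : C) : Prop :=
  holomorphic_at f p \/ exists n : nat, (0 < n)%nat /\ has_pole f p n.

(* [c] is the coefficient of [1 / (z - p)] in the Laurent expansion of [f] at
   [p], [p] being at worst a pole. *)
Definition has_residue (f : C -> C) (p c : C) : Prop :=
  exists (N : nat) (a : nat -> C) (u : C -> C),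
    holomorphic_at u p /\ a 0%nat = c /\
    locally' p (fun z : C =>
      f z = (sum_n (fun k : nat => a k / (z - p) ^ (S k)) N + u z)%C).

(* The coefficient of the one-form dg/g with respect to dz. *)
Definition dlog (g : C -> C) (z : C) : C := (C_derive g z / g z)%C.

Definition Cexp (z : C) : C := (exp (Re z) * cos (Im z), exp (Re z) * sin (Im z)).

(** * Paths *)

Definition C1_at (gamma dgamma : R -> C) (t : R) : Prop :=
  is_derive (K := R_AbsRing) (V := C_R_NormedModule) gamma t (dgamma t) /\
  continuous (U := C_UniformSpace) dgamma t.

Definition path_integral (phi : C -> C) (gamma dgamma : R -> C) : C :=
  RInt (V := C_R_CompleteNormedModule)
    (fun t : R => (phi (gamma t) * dgamma t)%C) 0 1.

(** * Minimal immersions with Weierstrass data *)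

Definition immersion_on (D : C -> Prop) (X : C -> R3) : Prop :=
  forall p : C, D p -> exists L : C -> R3,
    filterdiff (K := R_AbsRing) (U := C_R_NormedModule)
      (V := prod_NormedModule R_AbsRing
              (prod_NormedModule R_AbsRing R_NormedModule R_NormedModule)
              R_NormedModule)
      X (locally p) L /\
    (forall v : C, L v = (0, 0, 0) -> v = RtoC 0).

(* [X] is the conformal minimal immersion of the open set [D] with Weierstrass
   data [(g, dh)], where [dh = f dz].  The forms [(1/2)(1/g - g) dh] and
   [(i/2)(1/g + g) dh] are holomorphic on [D], with coefficients [phi1] and
   [phi2]; the formulas for the latter are only meaningful off the zeros and
   poles of [g].  That the integral formula holds along every path contains the
   assertion that [Phi] has no real periods. *)
Record weierstrass_immersion
    (D : C -> Prop) (g f : C -> C) (X : C -> R3) : Prop := {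
  gauss_meromorphic : forall p : C, D p -> meromorphic_at g p;
  dh_holomorphic : forall p : C, D p -> holomorphic_at f p;
  is_immersion : immersion_on D X;
  weierstrass_formula : exists phi1 phi2 : C -> C,
    (forall p : C, D p ->
      holomorphic_at phi1 p /\ holomorphic_at phi2 p /\
      locally' p (fun z : C =>
        g z <> RtoC 0 /\
        phi1 z = (/ 2 * (/ g z - g z) * f z)%C /\
        phi2 z = (Ci / 2 * (/ g z + g z) * f z)%C)) /\
    (forall gamma dgamma : R -> C,
      (forall t : R, 0 <= t <= 1 -> D (gamma t) /\ C1_at gamma dgamma t) ->
      x1 (X (gamma 1)) =
        x1 (X (gamma 0)) + Re (path_integral phi1 gamma dgamma) /\
      x2 (X (gamma 1)) =
        x2 (X (gamma 0)) + Re (path_integral phi2 gamma dgamma) /\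
      x3 (X (gamma 1)) =
        x3 (X (gamma 0)) + Re (path_integral f gamma dgamma))
}.

(** * Annular ends *)

(* The puncture is the origin. *)
Definition punctured_disk (r : R) (z : C) : Prop := 0 < Cmod z <= r.
Definition open_punctured_disk (r : R) (z : C) : Prop := 0 < Cmod z < r.

(* An annular end has compact boundary: its parameter domain is the closed
   punctured disk, on whose interior [X] is a minimal immersion.  Without a
   bound on [X] near the outer circle, a ray contained in the image could run
   off to infinity there instead of at the puncture. *)
Record minimal_annular_end (r : R) (g f : C -> C) (X : C -> R3) : Prop := {
  end_radius : 0 < r;
  end_immersion : weierstrass_immersion (open_punctured_disk r) g f X;
  end_continuous : continuous_on
    (T := C_UniformSpace)
    (U := prod_UniformSpace (prod_UniformSpace R_UniformSpace R_UniformSpace)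
            R_UniformSpace)
    (punctured_disk r) X
}.

(* The speed of [gamma] in the metric induced by [X]. *)
Definition induced_speed (X : C -> R3) (gamma : R -> C) (t : R) : R :=
  norm3 (Derive (fun s : R => x1 (X (gamma s))) t,
         Derive (fun s : R => x2 (X (gamma s))) t,
         Derive (fun s : R => x3 (X (gamma s))) t).

(* Only paths in the interior matter, as a path tending to the puncture is
   eventually there; piecewise C1 paths can be reparametrized as C1 ones. *)
Definition complete_end (r : R) (X : C -> R3) : Prop :=
  forall gamma dgamma : R -> C,
    (forall t : R, 0 <= t ->
      open_punctured_disk r (gamma t) /\ C1_at gamma dgamma t) ->
    filterlim gamma (Rbar_locally p_infty)
      (locally (T := C_UniformSpace) (RtoC 0)) ->
    is_lim (fun T : R => RInt (induced_speed X gamma) 0 T) p_infty p_infty.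

(* An injective immersion that is a homeomorphism onto its image. *)
Definition embedded_end (s : R) (X : C -> R3) : Prop :=
  immersion_on (punctured_disk s) X /\
  continuous_on
    (T := C_UniformSpace)
    (U := prod_UniformSpace (prod_UniformSpace R_UniformSpace R_UniformSpace)
            R_UniformSpace)
    (punctured_disk s) X /\
  (forall z w : C, punctured_disk s z -> punctured_disk s w ->
    X z = X w -> z = w) /\
  (forall z : C, punctured_disk s z -> forall eps : R, 0 < eps ->
    exists delta : R, 0 < delta /\
      forall w : C, punctured_disk s w ->
        dist3 (X w) (X z) < delta -> Cmod (w - z) < eps).

(** * Helicoids *)

Definition helicoid (H : R3 -> Prop) : Prop :=
  exists (Y : C -> R3) (T : R3 -> R3) (c : R),
    weierstrass_immersion (fun _ : C => True) Cexp (fun _ : C => (- Ci)%C) Y /\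
    rigid_motion T /\ 0 < c /\
    (forall q : R3, H q <->
      exists z : C, q = T (c * x1 (Y z), c * x2 (Y z), c * x3 (Y z))).

(* The end is [X] on [punctured_disk s]. *)
Definition asymptotic_to (s : R) (X : C -> R3) (H : R3 -> Prop) : Prop :=
  forall eps : R, 0 < eps ->
    exists s' : R, 0 < s' <= s /\
      forall p : R3, image X (punctured_disk s') p ->
        exists q : R3, H q /\ dist3 p q < eps.

(* Main.v *)
Require Import Defs.
From Stdlib Require Import Reals Lra Lia Psatz ClassicalEpsilon Cantor.
From Coquelicot Require Import Coquelicot.

Open Scope R_scope.

(* Since dh has no residue it has a primitive near the puncture, which serves as
   coordinate w on a neighbourhood of infinity, with x3 = Re w.  There
   dg/g = (al + be/w + O(1/w^2)) dw with al <> 0, and F = x1 + i x2 satisfies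
   dF = (conj (dw/g) - g dw) / 2.  Single-valuedness of |g| makes be real.

   The points of the end over a line are isolated unless dF degenerates along it
   there, so they are only countably many unless degeneration occurs at
   non-isolated points.  As a ray is uncountable, the horizontal ray forces
   Re al = 0, and the vertical ray forces |g| = 1 and Re (dg / (g dw)) = 0 at
   points of arbitrary height, whence be = 0.  So al = i tau and
   g = exp (i tau w) E with E holomorphic at infinity.  The points over the
   vertical ray then form a line Im w = const, along which |g| = 1 and F is
   constant; moving it to the real axis, the identity theorem gives
   g(w) conj (g(conj w)) = 1, so that F is constant, with the same value b, on
   both halves of the axis.  Integrating dF from the axis shows that F is b plus
   a rotating multiple of sinh (tau Im w), with relative error O(1/w). *)

(** * Wirtinger derivatives *)

(** That a ray lies in the image says nothing about how its preimages vary with the parameter: they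
    may jump, and several may share a height. The rays are therefore used at first only through
    cardinality. A preimage curve over the vertical ray becomes available once [F] is known to
    separate points of a vertical line of the w-plane by at least a third of their distance, which
    makes the point at each large height unique.

    The Gauss map has an essential singularity at infinity, so the reflection identity is proved for
    [E], which is bounded above and below, and then passed on through the exponential factor, which
    satisfies the same identity.

    The final error is relative: far from the axis the horizontal error can be large, but as an
    angle about the axis it is small, and a helicoid converts a small turn of its ruling into a
    small change of height. The relative error also settles injectivity for points on opposite sides
    of the removed disc, where no vertical segment of the domain joins them. *)

Ltac Ceq := apply injective_projections; simpl; try ring.

(** Searches a nest of [Rmin] for the entry on the right-hand side, so that one radius can be
    subject to many conditions. *)
Ltac rmin := first
  [ apply Rmin_l | apply Rmin_r
  | eapply Rle_trans; [apply Rmin_l | rmin] | eapply Rle_trans; [apply Rmin_r | rmin] ].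

Lemma im_le_Cmod (z : C) : Rabs (Im z) <= Cmod z.
Proof.
  eapply Rle_trans; [ | apply Rmax_Cmod]. apply Rmax_r.
Qed.

Lemma Cmod_le_components (z : C) : Cmod z <= Rabs (Re z) + Rabs (Im z).
Proof.
  replace z with (RtoC (Re z) + Ci * RtoC (Im z))%C at 1 by (destruct z; Ceq).
  eapply Rle_trans; [apply Cmod_triangle|].
  rewrite Cmod_mult, Cmod_Ci, !Cmod_R. lra.
Qed.

Lemma Cmod_sub_sym (x y : C) : Cmod (x - y) = Cmod (y - x).
Proof. rewrite <- Cmod_opp. f_equal. ring. Qed.

Lemma Cmod_sub_triangle (x y z : C) : Cmod (x - z) <= Cmod (x - y) + Cmod (y - z).
Proof.
  replace (x - z)%C with ((x - y) + (y - z))%C by ring. apply Cmod_triangle.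
Qed.

Lemma Cmod_triangle_rev (x y : C) : Cmod x - Cmod y <= Cmod (x - y).
Proof.
  pose proof (Cmod_triangle (x - y) y). replace (x - y + y)%C with x in H by ring. lra.
Qed.

Lemma Cmod_scal (t : R) (z : C) : Cmod (RtoC t * z) = Rabs t * Cmod z.
Proof. now rewrite Cmod_mult, Cmod_R. Qed.

Lemma Cmod_sub_self (z : C) : Cmod (z - z) = 0.
Proof. replace (z - z)%C with (RtoC 0) by ring. apply Cmod_0. Qed.

Lemma Cmod_neq_0 (z : C) : 0 < Cmod z -> z <> RtoC 0.
Proof. intros H. now apply Cmod_gt_0. Qed.

Lemma Csub_neq_0 (z w : C) : z <> w -> (z - w)%C <> RtoC 0.
Proof.
  intros H E. apply H. replace z with ((z - w) + w)%C by ring. rewrite E. ring.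
Qed.

Lemma Re_mult (z w : C) : Re (z * w) = Re z * Re w - Im z * Im w.
Proof. reflexivity. Qed.

Lemma Cmod_sqr (z : C) : Cmod z * Cmod z = Re z * Re z + Im z * Im z.
Proof. pose proof (Cmod2_alt z). lra. Qed.

Lemma locally_Cmod (p : C) (P : C -> Prop) :
  locally p P <-> exists d : R, 0 < d /\ forall z : C, Cmod (z - p) < d -> P z.
Proof.
  rewrite locally_C. split.
  - intros [d Hd]. exists d. split; [apply cond_pos|]. intros z Hz. apply Hd, Hz.
  - intros (d & Hd & H). exists (mkposreal d Hd). intros z Hz. apply H, Hz.
Qed.

Lemma locally'_Cmod (p : C) (P : C -> Prop) :
  locally' p P <->
  exists d : R, 0 < d /\ forall z : C, z <> p -> Cmod (z - p) < d -> P z.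
Proof.
  unfold locally', within. rewrite locally_Cmod.
  split; intros (d & Hd & H); exists d; auto.
Qed.

(* [F (p + h) = F p + a h + b (conj h) + o(h)], i.e. [a] and [b] are the
   Wirtinger derivatives of [F] at [p]. *)
Definition wder (F : C -> C) (p a b : C) : Prop :=
  forall eps : R, 0 < eps -> exists d : R, 0 < d /\
    forall z : C, Cmod (z - p) < d ->
      Cmod (F z - F p - (a * (z - p) + b * Cconj (z - p))) <= eps * Cmod (z - p).

(** Componentwise, so that scalar tactics such as [auto_derive] apply; [cderiv_eps] restates it with
    one complex remainder and [cderiv_is_derive] matches the derivative in [C1_at]. *)
Definition cderiv (phi : R -> C) (t : R) (d : C) : Prop :=
  is_derive (fun s => Re (phi s)) t (Re d) /\ is_derive (fun s => Im (phi s)) t (Im d).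

Definition ccont (F : C -> C) (p : C) : Prop :=
  forall eps : R, 0 < eps -> exists d : R, 0 < d /\
    forall z : C, Cmod (z - p) < d -> Cmod (F z - F p) < eps.

Lemma is_derive_norm {V : NormedModule R_AbsRing} (f : R -> V) (t : R) (l : V) :
  is_derive f t l <-> forall eps, 0 < eps -> exists d, 0 < d /\
    forall s : R, Rabs (s - t) < d ->
      norm (minus (minus (f s) (f t)) (scal (s - t) l)) <= eps * Rabs (s - t).
Proof.
  split.
  - intros [_ H] eps Heps.
    destruct (H t (fun P h => h) (mkposreal eps Heps)) as [d Hd].
    exists d. split; [apply cond_pos|]. intros s Hs. exact (Hd s Hs).
  - intros H. split; [apply is_linear_scal_l|].
    intros x Hx eps.
    assert (E : t = x) by exact (is_filter_lim_locally_unique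
                  (K := R_AbsRing) (V := R_NormedModule) t x Hx).
    subst x.
    destruct (H eps (cond_pos eps)) as (d & Hd & Hs).
    exists (mkposreal d Hd). intros s Hb. exact (Hs s Hb).
Qed.

Lemma is_derive_eps (f : R -> R) (t l : R) :
  is_derive f t l <-> forall eps, 0 < eps -> exists d, 0 < d /\
    forall s, Rabs (s - t) < d -> Rabs (f s - f t - l * (s - t)) <= eps * Rabs (s - t).
Proof.
  rewrite is_derive_norm.
  split; intros H eps Heps; destruct (H eps Heps) as (d & Hd & K);
    exists d; (split; [exact Hd|]); intros s Hs; specialize (K s Hs).
  - replace (f s - f t - l * (s - t)) with (f s - f t - (s - t) * l) by ring. exact K.
  - replace (f s - f t - l * (s - t)) with (f s - f t - (s - t) * l) in K by ring. exact K.
Qed.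

Lemma norm_C_R (z : C) : norm (V := C_R_NormedModule) z = Cmod z.
Proof.
  unfold norm, Cmod. simpl. unfold prod_norm, norm. simpl. unfold abs. simpl.
  f_equal. rewrite !Rmult_1_r. now rewrite <- !Rabs_mult, !Rabs_pos_eq by apply Rle_0_sqr.
Qed.

Lemma cderiv_eps (phi : R -> C) (t : R) (l : C) :
  cderiv phi t l <-> forall eps, 0 < eps -> exists d, 0 < d /\
    forall s, Rabs (s - t) < d ->
      Cmod (phi s - phi t - l * RtoC (s - t)) <= eps * Rabs (s - t).
Proof.
  unfold cderiv. rewrite !is_derive_eps. split.
  - intros [H1 H2] eps Heps.
    destruct (H1 (eps / 2)) as (d1 & Hd1 & K1); [lra|].
    destruct (H2 (eps / 2)) as (d2 & Hd2 & K2); [lra|].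
    exists (Rmin d1 d2). split; [apply Rmin_pos; lra|].
    intros s Hs. pose proof (Rmin_l d1 d2). pose proof (Rmin_r d1 d2).
    eapply Rle_trans; [apply Cmod_le_components|].
    specialize (K1 s ltac:(lra)). specialize (K2 s ltac:(lra)).
    destruct (phi s) as [u v], (phi t) as [u0 v0], l as [a b].
    unfold Re, Im in *. simpl in *.
    replace (u + - u0 + - (a * (s - t) - b * 0)) with (u - u0 - a * (s - t)) by ring.
    replace (v + - v0 + - (a * 0 + b * (s - t))) with (v - v0 - b * (s - t)) by ring.
    lra.
  - intros H. split; intros eps Heps; destruct (H eps Heps) as (d & Hd & K);
      exists d; (split; [exact Hd|]); intros s Hs; specialize (K s Hs);
      eapply Rle_trans; try exact K.
    + replace (Re (phi s) - Re (phi t) - Re l * (s - t))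
        with (Re (phi s - phi t - l * RtoC (s - t))%C).
      * apply re_le_Cmod.
      * destruct (phi s), (phi t), l; unfold Re; simpl; ring.
    + replace (Im (phi s) - Im (phi t) - Im l * (s - t))
        with (Im (phi s - phi t - l * RtoC (s - t))%C).
      * apply im_le_Cmod.
      * destruct (phi s), (phi t), l; unfold Im; simpl; ring.
Qed.

Lemma cderiv_is_derive (phi : R -> C) (t : R) (l : C) :
  cderiv phi t l <->
  is_derive (K := R_AbsRing) (V := C_R_NormedModule) phi t l.
Proof.
  rewrite cderiv_eps, is_derive_norm.
  split; intros H eps Heps; destruct (H eps Heps) as (d & Hd & K);
    exists d; (split; [exact Hd|]); intros s Hs; specialize (K s Hs).
  - rewrite norm_C_R. eapply Rle_trans; [|exact K]. right. f_equal.
    destruct (phi s), (phi t), l. Ceq; unfold scal, minus, mult, plus, opp; simpl; unfold mult; simpl; ring.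
  - rewrite norm_C_R in K. eapply Rle_trans; [|exact K]. right. f_equal.
    destruct (phi s), (phi t), l. Ceq; unfold scal, minus, mult, plus, opp; simpl; unfold mult; simpl; ring.
Qed.

(** A vanishing conjugate coefficient is the Cauchy-Riemann equation; holomorphic functions and the
    merely real-differentiable [F] thus share one calculus. *)
Lemma wder_is_derive (f : C -> C) (p l : C) :
  wder f p l 0 <-> is_derive (K := C_AbsRing) (V := C_NormedModule) f p l.
Proof.
  split.
  - intros H. split; [apply is_linear_scal_l|].
    intros x Hx eps.
    assert (E : p = x) by exact (is_filter_lim_locally_unique
                  (K := C_AbsRing) (V := AbsRing_NormedModule C_AbsRing) p x Hx).
    subst x.
    destruct (H eps (cond_pos eps)) as (d & Hd & K).
    exists (mkposreal d Hd). intros s Hb. specialize (K s Hb).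
    eapply Rle_trans; [|exact K]. right. simpl.
    change (Cmod (f s - f p - (s - p) * l) = Cmod (f s - f p - (l * (s - p) + 0 * Cconj (s - p)))).
    f_equal. ring.
  - intros [_ H] eps Heps.
    destruct (H p (fun P h => h) (mkposreal eps Heps)) as [d Hd].
    exists d. split; [apply cond_pos|]. intros s Hs. specialize (Hd s Hs).
    eapply Rle_trans; [|exact Hd]. right. simpl.
    change (Cmod (f s - f p - (l * (s - p) + 0 * Cconj (s - p))) = Cmod (f s - f p - (s - p) * l)).
    f_equal. ring.
Qed.

Lemma holomorphic_at_Cmod (f : C -> C) (p : C) :
  holomorphic_at f p <-> exists r, 0 < r /\
    forall z, Cmod (z - p) < r -> exists l, wder f z l 0.
Proof.
  unfold holomorphic_at. rewrite locally_Cmod.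
  split; intros (d & Hd & H); exists d; (split; [exact Hd|]); intros z Hz;
    destruct (H z Hz) as [l Hl]; exists l; apply wder_is_derive, Hl.
Qed.

Lemma wder_cont (F : C -> C) (p a b : C) : wder F p a b -> ccont F p.
Proof.
  intros H eps Heps. destruct (H 1 Rlt_0_1) as (d & Hd & K).
  set (M := 1 + Cmod a + Cmod b).
  assert (HM : 0 < M) by (unfold M; pose proof (Cmod_ge_0 a); pose proof (Cmod_ge_0 b); lra).
  exists (Rmin d (eps / M)). split; [apply Rmin_pos; [lra|now apply Rdiv_lt_0_compat]|].
  intros z Hz. pose proof (Rmin_l d (eps / M)). pose proof (Rmin_r d (eps / M)).
  specialize (K z ltac:(lra)).
  apply Rle_lt_trans with (M * Cmod (z - p)).
  - replace (F z - F p)%C with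
      ((F z - F p - (a * (z - p) + b * Cconj (z - p))) +
       (a * (z - p) + b * Cconj (z - p)))%C by ring.
    eapply Rle_trans; [apply Cmod_triangle|].
    pose proof (Cmod_triangle (a * (z - p)) (b * Cconj (z - p))) as T.
    rewrite !Cmod_mult, Cmod_conj in T. unfold M. lra.
  - apply Rlt_le_trans with (M * (eps / M)); [apply Rmult_lt_compat_l; lra|].
    right. field. lra.
Qed.

Lemma wder_ext (F H : C -> C) (p a b : C) (r : R) :
  0 < r -> (forall z, Cmod (z - p) < r -> F z = H z) -> wder F p a b -> wder H p a b.
Proof.
  intros Hr E W eps Heps. destruct (W eps Heps) as (d & Hd & K).
  exists (Rmin d r). split; [now apply Rmin_pos|].
  intros z Hz. pose proof (Rmin_l d r). pose proof (Rmin_r d r).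
  rewrite <- !E; [apply K; lra| |lra].
  now rewrite Cmod_sub_self.
Qed.

Lemma wder_const (c p : C) : wder (fun _ => c) p 0 0.
Proof.
  intros eps Heps. exists 1. split; [lra|]. intros z _.
  replace (c - c - (0 * (z - p) + 0 * Cconj (z - p)))%C with (RtoC 0) by ring.
  rewrite Cmod_0. apply Rmult_le_pos; [lra|apply Cmod_ge_0].
Qed.

Lemma wder_id (p : C) : wder (fun z => z) p 1 0.
Proof.
  intros eps Heps. exists 1. split; [lra|]. intros z _.
  replace (z - p - (1 * (z - p) + 0 * Cconj (z - p)))%C with (RtoC 0) by ring.
  rewrite Cmod_0. apply Rmult_le_pos; [lra|apply Cmod_ge_0].
Qed.

Lemma wder_plus (F H : C -> C) (p a b a' b' : C) :
  wder F p a b -> wder H p a' b' -> wder (fun z => F z + H z)%C p (a + a') (b + b').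
Proof.
  intros W1 W2 eps Heps.
  destruct (W1 (eps / 2)) as (d1 & Hd1 & K1); [lra|].
  destruct (W2 (eps / 2)) as (d2 & Hd2 & K2); [lra|].
  exists (Rmin d1 d2). split; [now apply Rmin_pos|].
  intros z Hz. pose proof (Rmin_l d1 d2). pose proof (Rmin_r d1 d2).
  specialize (K1 z ltac:(lra)). specialize (K2 z ltac:(lra)).
  match goal with |- Cmod ?x <= _ => replace x with
    ((F z - F p - (a * (z - p) + b * Cconj (z - p))) +
     (H z - H p - (a' * (z - p) + b' * Cconj (z - p))))%C by ring end.
  eapply Rle_trans; [apply Cmod_triangle|]. lra.
Qed.

(** Conjugating a first-order expansion interchanges its two coefficients, whence the crossed
    terms. *)
Lemma wder_comp (F H : C -> C) (p a b a' b' : C) :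
  wder F p a b -> wder H (F p) a' b' ->
  wder (fun z => H (F z)) p (a' * a + b' * Cconj b) (a' * b + b' * Cconj a).
Proof.
  intros W1 W2 eps Heps.
  pose proof (Cmod_ge_0 a). pose proof (Cmod_ge_0 b).
  pose proof (Cmod_ge_0 a'). pose proof (Cmod_ge_0 b').
  set (M := 1 + Cmod a + Cmod b). set (M' := 1 + Cmod a' + Cmod b').
  assert (HM : 0 < M) by (unfold M; lra). assert (HM' : 0 < M') by (unfold M'; lra).
  (* Half of [eps] goes to each expansion; the cap 1 in [e1] keeps [Cmod D] below [M * Cmod h]. *)
  set (e2 := eps / (2 * M)). set (e1 := Rmin 1 (eps / (2 * M'))).
  assert (He2 : 0 < e2) by (apply Rdiv_lt_0_compat; lra).
  assert (He1 : 0 < e1) by (apply Rmin_pos; [lra|apply Rdiv_lt_0_compat; lra]).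
  destruct (W2 e2 He2) as (d2 & Hd2 & K2).
  destruct (W1 e1 He1) as (d1 & Hd1 & K1).
  destruct (wder_cont _ _ _ _ W1 d2 Hd2) as (d3 & Hd3 & K3).
  exists (Rmin d1 d3). split; [now apply Rmin_pos|].
  intros z Hz. pose proof (Rmin_l d1 d3). pose proof (Rmin_r d1 d3).
  specialize (K1 z ltac:(lra)). specialize (K3 z ltac:(lra)).
  specialize (K2 (F z) K3).
  set (D := (F z - F p)%C) in *. set (h := (z - p)%C) in *.
  set (r1 := (D - (a * h + b * Cconj h))%C) in *.
  pose proof (Cmod_ge_0 h) as Hh.
  assert (HD : Cmod D <= M * Cmod h).
  { replace D with (r1 + (a * h + b * Cconj h))%C by (unfold r1; ring).
    eapply Rle_trans; [apply Cmod_triangle|].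
    pose proof (Cmod_triangle (a * h) (b * Cconj h)) as T.
    rewrite !Cmod_mult, Cmod_conj in T.
    assert (e1 <= 1) by rmin. unfold M. nra. }
  match goal with |- Cmod ?x <= _ => replace x with
    ((H (F z) - H (F p) - (a' * D + b' * Cconj D)) + (a' * r1 + b' * Cconj r1))%C end.
  2:{ unfold r1. rewrite !Cminus_conj, !Cplus_conj, !Cmult_conj, !Cconj_conj. ring. }
  eapply Rle_trans; [apply Cmod_triangle|].
  pose proof (Cmod_triangle (a' * r1) (b' * Cconj r1)) as T.
  rewrite !Cmod_mult, Cmod_conj in T.
  assert (E1 : M' * Cmod r1 <= eps / 2 * Cmod h).
  { apply Rle_trans with (M' * (e1 * Cmod h)); [apply Rmult_le_compat_l; lra|].
    rewrite <- Rmult_assoc. apply Rmult_le_compat_r; [lra|].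
    apply Rle_trans with (M' * (eps / (2 * M'))).
    - apply Rmult_le_compat_l; [lra|apply Rmin_r].
    - right. field. lra. }
  assert (E2 : e2 * Cmod D <= eps / 2 * Cmod h).
  { apply Rle_trans with (e2 * (M * Cmod h)); [apply Rmult_le_compat_l; lra|].
    right. unfold e2. field. lra. }
  pose proof (Cmod_ge_0 r1). unfold M' in E1. lra.
Qed.

Lemma wder_conj (p : C) : wder Cconj p 0 1.
Proof.
  intros eps Heps. exists 1. split; [lra|]. intros z _.
  rewrite Cminus_conj.
  match goal with |- Cmod ?x <= _ => replace x with (RtoC 0) by ring end.
  rewrite Cmod_0. apply Rmult_le_pos; [lra|apply Cmod_ge_0].
Qed.

Lemma wder_mult (F H : C -> C) (p a b a' b' : C) :
  wder F p a b -> wder H p a' b' ->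
  wder (fun z => F z * H z)%C p (a * H p + F p * a') (b * H p + F p * b').
Proof.
  intros W1 W2 eps Heps.
  pose proof (Cmod_ge_0 a). pose proof (Cmod_ge_0 b).
  pose proof (Cmod_ge_0 (F p)). pose proof (Cmod_ge_0 (H p)).
  set (M := 2 + Cmod a + Cmod b + Cmod (F p) + Cmod (H p)).
  assert (HM : 0 < M) by (unfold M; lra).
  (* The four terms of the product remainder are each at most [e * Cmod h * M], a quarter of the
     allowance. *)
  set (e := eps / (4 * M)).
  assert (He : 0 < e) by (apply Rdiv_lt_0_compat; lra).
  destruct (W1 (Rmin 1 e)) as (d1 & Hd1 & K1); [apply Rmin_pos; lra|].
  destruct (W2 e He) as (d2 & Hd2 & K2).
  destruct (wder_cont _ _ _ _ W2 (Rmin 1 e)) as (d3 & Hd3 & K3); [apply Rmin_pos; lra|].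
  exists (Rmin d1 (Rmin d2 d3)). split; [repeat apply Rmin_pos; lra|].
  intros z Hz. pose proof (Rmin_l d1 (Rmin d2 d3)). pose proof (Rmin_r d1 (Rmin d2 d3)).
  pose proof (Rmin_l d2 d3). pose proof (Rmin_r d2 d3).
  specialize (K1 z ltac:(lra)). specialize (K2 z ltac:(lra)). specialize (K3 z ltac:(lra)).
  set (D := (H z - H p)%C) in *. set (h := (z - p)%C) in *.
  set (r1 := (F z - F p - (a * h + b * Cconj h))%C) in *.
  set (r2 := (D - (a' * h + b' * Cconj h))%C) in *.
  match goal with |- Cmod ?x <= _ => replace x with
    (r1 * D + r1 * H p + F p * r2 + (a * h + b * Cconj h) * D)%C by (unfold r1, r2, D; ring) end.
  pose proof (Rmin_l 1 e). pose proof (Rmin_r 1 e).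
  pose proof (Cmod_ge_0 h). pose proof (Cmod_ge_0 D).
  pose proof (Cmod_ge_0 r1). pose proof (Cmod_ge_0 r2).
  assert (R1 : Cmod r1 <= e * Cmod h) by nra.
  eapply Rle_trans; [eapply Rle_trans; [apply Cmod_triangle|]; apply Rplus_le_compat_r;
    eapply Rle_trans; [apply Cmod_triangle|]; apply Rplus_le_compat_r; apply Cmod_triangle|].
  rewrite !Cmod_mult.
  pose proof (Cmod_triangle (a * h) (b * Cconj h)) as T.
  rewrite !Cmod_mult, Cmod_conj in T.
  assert (T1 : Cmod r1 * Cmod D <= e * Cmod h * 1) by (apply Rmult_le_compat; lra).
  assert (T2 : Cmod r1 * Cmod (H p) <= e * Cmod h * M)
    by (apply Rmult_le_compat; unfold M; lra).
  assert (T3 : Cmod (F p) * Cmod r2 <= M * (e * Cmod h))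
    by (apply Rmult_le_compat; unfold M; lra).
  assert (T4 : Cmod (a * h + b * Cconj h) * Cmod D <= (M * Cmod h) * e).
  { apply Rmult_le_compat; [apply Cmod_ge_0|lra| |lra]. unfold M. nra. }
  assert (T5 : e * Cmod h * 1 <= e * Cmod h * M).
  { apply Rmult_le_compat_l; [nra|unfold M; lra]. }
  assert (e * Cmod h * M = eps / 4 * Cmod h) by (unfold e; field; lra).
  lra.
Qed.

Lemma wder_inv (p : C) : p <> RtoC 0 -> wder Cinv p (- / (p * p)) 0.
Proof.
  intros Hp eps Heps.
  assert (P : 0 < Cmod p) by now apply Cmod_gt_0.
  set (m := Cmod p) in *.
  (* The remainder equals [(z - p)^2 / (p^2 z)]. The first bound keeps [Cmod z] above [m / 2]; the
     second then makes one factor [z - p] absorb [eps]. *)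
  exists (Rmin (m / 2) (eps * m ^ 3 / 2)).
  assert (0 < m ^ 3) by now apply pow_lt.
  split; [apply Rmin_pos; nra|].
  intros z Hz. pose proof (Rmin_l (m / 2) (eps * m ^ 3 / 2)).
  pose proof (Rmin_r (m / 2) (eps * m ^ 3 / 2)).
  assert (Hz2 : m / 2 < Cmod z).
  { pose proof (Cmod_triangle_rev p (p - z)). replace (p - (p - z))%C with z in H2 by ring.
    rewrite (Cmod_sub_sym p z) in H2. fold m in H2. lra. }
  assert (z <> RtoC 0) by (apply Cmod_neq_0; lra).
  replace (/ z - / p - (- / (p * p) * (z - p) + 0 * Cconj (z - p)))%C
    with ((z - p) * (z - p) * / (p * p * z))%C by (field; auto).
  assert (p * p * z <> 0)%C by (repeat apply Cmult_neq_0; auto).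
  rewrite !Cmod_mult, Cmod_inv, !Cmod_mult by auto. fold m.
  set (k := Cmod (z - p)) in *. assert (0 <= k) by apply Cmod_ge_0.
  apply Rle_trans with (k * k * / (m * m * (m / 2))).
  - apply Rmult_le_compat_l; [nra|]. apply Rinv_le_contravar; [nra|].
    apply Rmult_le_compat_l; nra.
  - rewrite (Rmult_comm eps). rewrite Rmult_assoc. apply Rmult_le_compat_l; [lra|].
    apply Rle_trans with ((eps * m ^ 3 / 2) * / (m * m * (m / 2))).
    + apply Rmult_le_compat_r; [|lra]. left. apply Rinv_0_lt_compat. nra.
    + right. field. lra.
Qed.

Lemma wder_cderiv (F : C -> C) (phi : R -> C) (t : R) (a b d : C) :
  cderiv phi t d -> wder F (phi t) a b ->
  cderiv (fun s => F (phi s)) t (a * d + b * Cconj d).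
Proof.
  rewrite !cderiv_eps. intros H W.
  (* The curve is extended to the plane by [z |-> phi (Re z)]. *)
  assert (P : wder (fun z => phi (Re z)) (RtoC t) (d / 2) (d / 2)).
  { intros eps Heps. destruct (H eps Heps) as (e & He & K).
    exists e. split; [exact He|]. intros z Hz.
    change (Re (RtoC t)) with t.
    assert (L : Rabs (Re z - t) <= Cmod (z - RtoC t)).
    { apply (re_le_Cmod (z - RtoC t)). }
    replace (d / 2 * (z - RtoC t) + d / 2 * Cconj (z - RtoC t))%C
      with (d * RtoC (Re z - t))%C.
    - eapply Rle_trans; [apply K; lra|]. apply Rmult_le_compat_l; lra.
    - destruct z, d. unfold Re. Ceq; field. }
  pose proof (wder_comp _ _ _ _ _ _ _ P W) as Q.
  intros eps Heps. destruct (Q eps Heps) as (e & He & K).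
  exists e. split; [exact He|]. intros s Hs.
  specialize (K (RtoC s)). rewrite <- RtoC_minus, Cmod_R in K. specialize (K Hs).
  change (Re (RtoC s)) with s in K. change (Re (RtoC t)) with t in K.
  eapply Rle_trans; [|exact K]. right.
  match goal with |- Cmod ?x = Cmod ?y => assert (E : x = y); [|now rewrite E] end.
  apply (f_equal (fun u => F (phi s) - F (phi t) - u)%C).
  destruct a, b, d. Ceq; field.
Qed.

Lemma wder_RtoC_scal (F : C -> C) (p a b c : C) :
  wder F p a b -> wder (fun z => c * F z)%C p (c * a) (c * b).
Proof.
  intros W. pose proof (wder_mult _ _ _ _ _ _ _ (wder_const c p) W) as Q.
  replace (c * a)%C with (0 * F p + c * a)%C by ring.
  replace (c * b)%C with (0 * F p + c * b)%C by ring. exact Q.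
Qed.

Lemma wder_eq (F : C -> C) (p a b a' b' : C) :
  wder F p a b -> a = a' -> b = b' -> wder F p a' b'.
Proof. now intros W <- <-. Qed.

Lemma Cconj_0 : Cconj 0 = RtoC 0.
Proof. Ceq. Qed.

Lemma holo_plus (F H : C -> C) (p a a' : C) :
  wder F p a 0 -> wder H p a' 0 -> wder (fun z => F z + H z)%C p (a + a') 0.
Proof.
  intros W1 W2. apply (wder_eq _ _ _ _ _ _ (wder_plus _ _ _ _ _ _ _ W1 W2)); ring.
Qed.

Lemma holo_minus (F H : C -> C) (p a a' : C) :
  wder F p a 0 -> wder H p a' 0 -> wder (fun z => F z - H z)%C p (a - a') 0.
Proof.
  intros W1 W2. apply (wder_ext (fun z => F z + -1 * H z)%C _ _ _ _ 1); [lra|intros; ring|].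
  apply (wder_eq _ _ _ _ _ _
    (wder_plus _ _ _ _ _ _ _ W1 (wder_RtoC_scal _ _ _ _ (-1) W2))); ring.
Qed.

Lemma holo_mult (F H : C -> C) (p a a' : C) :
  wder F p a 0 -> wder H p a' 0 -> wder (fun z => F z * H z)%C p (a * H p + F p * a') 0.
Proof.
  intros W1 W2. apply (wder_eq _ _ _ _ _ _ (wder_mult _ _ _ _ _ _ _ W1 W2)); ring.
Qed.

Lemma holo_comp (F H : C -> C) (p a a' : C) :
  wder F p a 0 -> wder H (F p) a' 0 -> wder (fun z => H (F z)) p (a' * a) 0.
Proof.
  intros W1 W2.
  apply (wder_eq _ _ _ _ _ _ (wder_comp _ _ _ _ _ _ _ W1 W2)); rewrite ?Cconj_0; ring.
Qed.

Lemma holo_inv (F : C -> C) (p a : C) :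
  F p <> RtoC 0 -> wder F p a 0 -> wder (fun z => / F z)%C p (- a / (F p * F p)) 0.
Proof.
  intros H W. apply (wder_eq _ _ _ _ _ _ (holo_comp _ _ _ _ _ W (wder_inv _ H))).
  - field. exact H.
  - reflexivity.
Qed.

(** * Curves and integrals *)

Definition rcont (phi : R -> C) (t : R) : Prop :=
  forall eps : R, 0 < eps -> exists d : R, 0 < d /\
    forall s : R, Rabs (s - t) < d -> Cmod (phi s - phi t) < eps.

Lemma rcont_continuous (phi : R -> C) (t : R) :
  rcont phi t <-> continuous (U := C_UniformSpace) phi t.
Proof.
  unfold continuous. rewrite filterlim_locally. split.
  - intros H eps. destruct (H eps (cond_pos eps)) as (d & Hd & K).
    exists (mkposreal d Hd). intros s Hs. specialize (K s Hs).
    apply C_NormedModule_mixin_compat1. exact K.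
  - intros H eps Heps.
    assert (H2 : 0 < sqrt 2) by (apply sqrt_lt_R0; lra).
    destruct (H (mkposreal (eps / sqrt 2) (Rdiv_lt_0_compat _ _ Heps H2))) as [d Hd].
    exists d. split; [apply cond_pos|]. intros s Hs. specialize (Hd s Hs).
    apply C_NormedModule_mixin_compat2 in Hd. simpl in Hd.
    replace (sqrt 2 * (eps / sqrt 2)) with eps in Hd by (field; lra). exact Hd.
Qed.

Lemma cderiv_rcont (phi : R -> C) (t : R) (d : C) : cderiv phi t d -> rcont phi t.
Proof.
  rewrite cderiv_is_derive, rcont_continuous. intros H.
  apply (ex_derive_continuous (K := R_AbsRing) (V := C_R_NormedModule)).
  now exists d.
Qed.

Lemma rcont_ccont (F : C -> C) (phi : R -> C) (t : R) :
  rcont phi t -> ccont F (phi t) -> rcont (fun s => F (phi s)) t.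
Proof.
  intros H K eps Heps. destruct (K eps Heps) as (d & Hd & K1).
  destruct (H d Hd) as (e & He & H1). exists e. split; [exact He|].
  intros s Hs. apply K1, H1, Hs.
Qed.

Lemma rcont_components (phi : R -> C) (t : R) :
  rcont phi t <->
  continuous (fun s => Re (phi s)) t /\ continuous (fun s => Im (phi s)) t.
Proof.
  rewrite rcont_continuous. split.
  - intros H. split.
    + apply (continuous_comp (U := R_UniformSpace) (V := C_UniformSpace) phi Re); [exact H|].
      destruct (phi t). apply (continuous_fst (U := R_UniformSpace) (V := R_UniformSpace)).
    + apply (continuous_comp (U := R_UniformSpace) (V := C_UniformSpace) phi Im); [exact H|].
      destruct (phi t). apply (continuous_snd (U := R_UniformSpace) (V := R_UniformSpace)).
  - intros [H1 H2].
    apply (continuous_ext (fun s => (Re (phi s), Im (phi s)))).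
    { intros s. now destruct (phi s). }
    apply (continuous_comp_2 (fun s => Re (phi s)) (fun s => Im (phi s)) (fun x y => (x, y))
             t H1 H2).
    apply (continuous_ext (fun x => x)); [now intros [x y]|]. apply continuous_id.
Qed.

Lemma rcont_mult (phi psi : R -> C) (t : R) :
  rcont phi t -> rcont psi t -> rcont (fun s => phi s * psi s)%C t.
Proof.
  rewrite !rcont_components. intros [H1 H2] [H3 H4].
  split.
  - apply (continuous_minus (V := R_NormedModule)
       (fun s => Re (phi s) * Re (psi s)) (fun s => Im (phi s) * Im (psi s)));
    now apply (continuous_mult (K := R_AbsRing)).
  - apply (continuous_plus (V := R_NormedModule)
       (fun s => Re (phi s) * Im (psi s)) (fun s => Im (phi s) * Re (psi s)));
    now apply (continuous_mult (K := R_AbsRing)).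
Qed.

Lemma rcont_plus (phi psi : R -> C) (t : R) :
  rcont phi t -> rcont psi t -> rcont (fun s => phi s + psi s)%C t.
Proof.
  rewrite !rcont_components. intros [H1 H2] [H3 H4].
  split.
  - now apply (continuous_plus (V := R_NormedModule)
       (fun s => Re (phi s)) (fun s => Re (psi s))).
  - now apply (continuous_plus (V := R_NormedModule)
       (fun s => Im (phi s)) (fun s => Im (psi s))).
Qed.

Lemma rcont_const (c : C) (t : R) : rcont (fun _ => c) t.
Proof.
  intros eps Heps. exists 1. split; [lra|]. intros s _.
  now rewrite Cmod_sub_self.
Qed.

Notation CInt := (RInt (V := C_R_CompleteNormedModule)).
Notation is_CInt := (is_RInt (V := C_R_NormedModule)).

Lemma is_CInt_rcont (phi : R -> C) (a b : R) :
  a <= b -> (forall t, a <= t <= b -> rcont phi t) -> is_CInt phi a b (CInt phi a b).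
Proof.
  intros Hab H. apply (RInt_correct (V := C_R_CompleteNormedModule)).
  apply (ex_RInt_continuous (V := C_R_CompleteNormedModule)).
  rewrite Rmin_left, Rmax_right by exact Hab. intros t Ht.
  now apply rcont_continuous, H.
Qed.

Lemma CInt_unique (phi : R -> C) (a b : R) (l : C) : is_CInt phi a b l -> CInt phi a b = l.
Proof. apply (is_RInt_unique (V := C_R_CompleteNormedModule)). Qed.

Lemma is_CInt_components (phi : R -> C) (a b : R) (l : C) :
  is_CInt phi a b l <->
  is_RInt (fun t => Re (phi t)) a b (Re l) /\ is_RInt (fun t => Im (phi t)) a b (Im l).
Proof.
  split.
  - intros H. split.
    + exact (is_RInt_fct_extend_fst (U := R_NormedModule) (V := R_NormedModule) _ _ _ _ H).
    + exact (is_RInt_fct_extend_snd (U := R_NormedModule) (V := R_NormedModule) _ _ _ _ H).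
  - intros [H1 H2]. destruct l as [u v].
    exact (is_RInt_fct_extend_pair (U := R_NormedModule) (V := R_NormedModule) _ _ _ _ _ H1 H2).
Qed.

Lemma is_CInt_scal (phi : R -> C) (a b : R) (l c : C) :
  is_CInt phi a b l -> is_CInt (fun t => c * phi t)%C a b (c * l)%C.
Proof.
  rewrite !is_CInt_components. intros [H1 H2]. split.
  - apply (is_RInt_minus (V := R_NormedModule) (fun t => Re c * Re (phi t))
             (fun t => Im c * Im (phi t)) a b (Re c * Re l) (Im c * Im l));
    now apply (is_RInt_scal (V := R_NormedModule)).
  - apply (is_RInt_plus (V := R_NormedModule) (fun t => Re c * Im (phi t))
             (fun t => Im c * Re (phi t)) a b (Re c * Im l) (Im c * Re l));
    now apply (is_RInt_scal (V := R_NormedModule)).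
Qed.

Lemma is_CInt_bound (phi : R -> C) (a b M : R) (l : C) :
  a <= b -> (forall t, a <= t <= b -> Cmod (phi t) <= M) ->
  is_CInt phi a b l -> Cmod l <= M * (b - a).
Proof.
  intros Hab H K. rewrite <- norm_C_R, Rmult_comm.
  apply (norm_RInt_le_const (V := C_R_NormedModule) phi a b l M Hab); [|exact K].
  intros x Hx. rewrite norm_C_R. now apply H.
Qed.

Lemma is_CInt_derive (phi dphi : R -> C) (a b : R) :
  a <= b -> (forall t, a <= t <= b -> cderiv phi t (dphi t)) ->
  (forall t, a <= t <= b -> rcont dphi t) ->
  is_CInt dphi a b (phi b - phi a)%C.
Proof.
  intros Hab H K.
  apply (is_RInt_derive (V := C_R_CompleteNormedModule) phi dphi);
    rewrite Rmin_left, Rmax_right by exact Hab; intros t Ht.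
  - now apply cderiv_is_derive, H.
  - now apply rcont_continuous, K.
Qed.

(* Taking the inner product with [phi b - phi a] reduces this to the scalar mean
   value theorem. *)
Lemma Cmod_increment_le (phi dphi : R -> C) (kappa dkappa : R -> R) (a b : R) :
  a <= b ->
  (forall t, a <= t <= b -> cderiv phi t (dphi t)) ->
  (forall t, a <= t <= b -> is_derive kappa t (dkappa t)) ->
  (forall t, a <= t <= b -> Cmod (dphi t) <= dkappa t) ->
  Cmod (phi b - phi a) <= kappa b - kappa a.
Proof.
  intros Hab H1 H2 H3.
  set (u := (phi b - phi a)%C).
  set (f := fun t => (Re u * Re (phi t) + Im u * Im (phi t)) - Cmod u * kappa t).
  set (df := fun t => (Re u * Re (dphi t) + Im u * Im (dphi t)) - Cmod u * dkappa t).
  destruct (MVT_gen f a b df) as (c & Hc & E).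
  - rewrite Rmin_left, Rmax_right by exact Hab. intros t Ht.
    destruct (H1 t ltac:(lra)) as [R1 R2]. pose proof (H2 t ltac:(lra)) as R3.
    apply (is_derive_minus (V := R_NormedModule)
      (fun t => Re u * Re (phi t) + Im u * Im (phi t)) (fun t => Cmod u * kappa t)).
    + apply (is_derive_plus (V := R_NormedModule)
        (fun t => Re u * Re (phi t)) (fun t => Im u * Im (phi t)));
      now apply is_derive_scal.
    + now apply is_derive_scal.
  - rewrite Rmin_left, Rmax_right by exact Hab. intros t Ht.
    apply continuity_pt_filterlim.
    destruct (H1 t Ht) as [R1 R2]. pose proof (H2 t Ht) as R3.
    apply (ex_derive_continuous (V := R_NormedModule) f). exists (df t).
    apply (is_derive_minus (V := R_NormedModule)
      (fun t => Re u * Re (phi t) + Im u * Im (phi t)) (fun t => Cmod u * kappa t)).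
    + apply (is_derive_plus (V := R_NormedModule)
        (fun t => Re u * Re (phi t)) (fun t => Im u * Im (phi t)));
      now apply is_derive_scal.
    + now apply is_derive_scal.
  - rewrite Rmin_left, Rmax_right in Hc by exact Hab.
    assert (D : df c <= 0).
    { unfold df. pose proof (H3 c Hc).
      assert (Re u * Re (dphi c) + Im u * Im (dphi c) <= Cmod u * Cmod (dphi c)).
      { replace (Re u * Re (dphi c) + Im u * Im (dphi c)) with (Re (Cconj u * dphi c))
          by (rewrite Re_mult; unfold Cconj, Re, Im; simpl; ring).
        eapply Rle_trans; [apply Rle_abs|]. eapply Rle_trans; [apply re_le_Cmod|].
        rewrite Cmod_mult, Cmod_conj. lra. }
      pose proof (Cmod_ge_0 u). nra. }
    assert (F : f b - f a <= 0) by (rewrite E; nra).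
    unfold f in F.
    assert (S : Cmod u * Cmod u = Re u * (Re (phi b) - Re (phi a)) + Im u * (Im (phi b) - Im (phi a))).
    { rewrite Cmod_sqr. unfold u. reflexivity. }
    pose proof (Cmod_ge_0 u) as P.
    (* When the increment of [phi] vanishes the inner product is trivial, and it remains to see that
       [kappa] does not decrease; its derivative dominates a modulus. *)
    destruct (Req_dec (Cmod u) 0) as [Z|Z].
    + rewrite Z.
      destruct (MVT_gen kappa a b dkappa) as (c' & Hc' & E').
      * rewrite Rmin_left, Rmax_right by exact Hab. intros t Ht. apply H2; lra.
      * rewrite Rmin_left, Rmax_right by exact Hab. intros t Ht.
        apply continuity_pt_filterlim.
        apply (ex_derive_continuous (V := R_NormedModule) kappa). exists (dkappa t). now apply H2.
      * rewrite Rmin_left, Rmax_right in Hc' by exact Hab.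
        pose proof (H3 c' Hc'). pose proof (Cmod_ge_0 (dphi c')). rewrite E'. nra.
    + assert (Cmod u * (Cmod u - (kappa b - kappa a)) <= 0) by lra.
      apply Rnot_lt_le. intros L. nra.
Qed.

Lemma Cmod_increment_le_const (phi dphi : R -> C) (K a b : R) :
  a <= b -> (forall t, a <= t <= b -> cderiv phi t (dphi t)) ->
  (forall t, a <= t <= b -> Cmod (dphi t) <= K) ->
  Cmod (phi b - phi a) <= K * (b - a).
Proof.
  intros Hab H1 H2.
  replace (K * (b - a)) with (K * b - K * a) by ring.
  apply (Cmod_increment_le phi dphi (fun t => K * t) (fun _ => K)); auto.
  intros t _. auto_derive; [trivial|ring].
Qed.

(** * Cauchy's theorem for homotopies *)

Lemma nested_intervals : forall (u v : nat -> R) (x y : R), x <= u O -> v O <= y ->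
  (forall n, u n <= u (S n)) -> (forall n, v (S n) <= v n) -> (forall n, u n <= v n) ->
  exists s, x <= s <= y /\ forall n, u n <= s <= v n.
Proof.
  intros u v x y Hx Hy Hu Hv Huv.
    assert (Hv0 : forall n, v n <= v O).
    { induction n; [lra|]. specialize (Hv n). lra. }
    assert (Mu : forall n k, u n <= u (n + k)%nat).
    { intros n k. induction k; [rewrite Nat.add_0_r; lra|].
      rewrite Nat.add_succ_r. specialize (Hu (n + k)%nat). lra. }
    assert (Mv : forall n k, v (n + k)%nat <= v n).
    { intros n k. induction k; [rewrite Nat.add_0_r; lra|].
      rewrite Nat.add_succ_r. specialize (Hv (n + k)%nat). lra. }
    destruct (ex_finite_lim_seq_incr u (v O) Hu) as [s Hs].
    { intros n. specialize (Huv n). specialize (Hv0 n). lra. }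
    assert (K : forall n, u n <= s <= v n).
    { intros n. split.
      - apply (is_lim_seq_incr_compare u s Hs Hu).
      - apply (is_lim_seq_le_loc u (fun _ => v n) s (v n)); [|exact Hs|apply is_lim_seq_const].
        exists n. intros k Hk. replace k with (n + (k - n))%nat by lia.
        specialize (Huv (n + (k - n))%nat). specialize (Mv n (k - n)%nat). lra. }
    exists s. split; [|exact K]. specialize (K O). lra.
Qed.

(** * Goursat's quartering argument *)

Section Bisection.

(** [J a b c d] plays the integral around the boundary of [[a, b]] times [[c, d]]. Quartering uses
    only additivity under subdivision and, near each point, a bound of smaller order than the square
    of the size. *)
Variable J : R -> R -> R -> R -> C.
Variables a0 b0 c0 d0 : R.
Hypothesis Hab0 : a0 <= b0.
Hypothesis Hcd0 : c0 <= d0.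
Hypothesis split_s : forall a m b c d, a0 <= a -> a <= m -> m <= b -> b <= b0 ->
  c0 <= c -> c <= d -> d <= d0 -> J a b c d = (J a m c d + J m b c d)%C.
Hypothesis split_t : forall a b c m d, a0 <= a -> a <= b -> b <= b0 ->
  c0 <= c -> c <= m -> m <= d -> d <= d0 -> J a b c d = (J a b c m + J a b m d)%C.
Hypothesis local : forall s t, a0 <= s <= b0 -> c0 <= t <= d0 -> forall eps, 0 < eps ->
  exists delta, 0 < delta /\ forall a b c d,
    a0 <= a -> a <= s <= b -> b <= b0 -> c0 <= c -> c <= t <= d -> d <= d0 ->
    (b - a) + (d - c) < delta -> Cmod (J a b c d) <= eps * ((b - a) + (d - c)) ^ 2.

Record quad := Quad { qa : R; qb : R; qc : R; qd : R }.

(** The threshold is quadratic in the half-perimeter, so halving the sides divides it by four, the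
    number of pieces among which [J] is shared. *)
Let bad (e : R) (q : quad) : Prop :=
  e * ((qb q - qa q) + (qd q - qc q)) ^ 2 < Cmod (J (qa q) (qb q) (qc q) (qd q)).

(** The fourth quarter is an untested default: if the other three are not bad, additivity makes it
    bad. *)
Let step (e : R) (q : quad) : quad :=
  let (a, b, c, d) := q in
  let m := (a + b) / 2 in let n := (c + d) / 2 in
  let good r := Rlt_dec (e * ((qb r - qa r) + (qd r - qc r)) ^ 2)
                 (Cmod (J (qa r) (qb r) (qc r) (qd r))) in
  if good (Quad a m c n) then Quad a m c n else
  if good (Quad a m n d) then Quad a m n d else
  if good (Quad m b c n) then Quad m b c n else Quad m b n d.

Let sub (q r : quad) : Prop :=
  qa r <= qa q /\ qa q <= qb q /\ qb q <= qb r /\ qc r <= qc q /\ qc q <= qd q /\ qd q <= qd r.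

Lemma step_spec (e : R) (q : quad) :
  sub q (Quad a0 b0 c0 d0) -> bad e q ->
  sub (step e q) q /\ bad e (step e q) /\
  (qb (step e q) - qa (step e q)) + (qd (step e q) - qc (step e q)) =
    ((qb q - qa q) + (qd q - qc q)) / 2.
Proof.
  destruct q as [a b c d]. unfold sub, bad, step. simpl. intros S B.
  set (m := (a + b) / 2). set (n := (c + d) / 2).
  assert (Em : m = (a + b) / 2) by reflexivity. assert (En : n = (c + d) / 2) by reflexivity.
  repeat (destruct Rlt_dec; simpl; [repeat split; try lra; try assumption|]).
  simpl in *. repeat split; try lra.
  apply Rnot_le_lt. intros n3.
  assert (T : Cmod (J a b c d) <= Cmod (J a m c n) + Cmod (J a m n d)
                + (Cmod (J m b c n) + Cmod (J m b n d))).
  { rewrite (split_s a m b c d), (split_t a m c n d), (split_t m b c n d) by lra.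
    eapply Rle_trans; [apply Cmod_triangle|]. apply Rplus_le_compat; apply Cmod_triangle. }
  assert (Q : forall x y : R, x = ((b - a) + (d - c)) / 2 -> e * (x * (x * 1)) = e * (b - a + (d - c)) ^ 2 / 4).
  { intros x _ ->. field. }
  rewrite (Q (m - a + (n - c)) 0) in n0 by lra.
  rewrite (Q (m - a + (d - n)) 0) in n1 by lra.
  rewrite (Q (b - m + (n - c)) 0) in n2 by lra.
  rewrite (Q (b - m + (d - n)) 0) in n3 by lra. simpl in *. lra.
Qed.

Let itq (e : R) (n : nat) : quad := Nat.iter n (step e) (Quad a0 b0 c0 d0).

(** A nonzero value would produce nested bad rectangles shrinking to a point, where [local]
    contradicts badness. *)
Lemma bisection : J a0 b0 c0 d0 = RtoC 0.
Proof.
  apply Cmod_eq_0. apply Rle_antisym; [|apply Cmod_ge_0].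
  apply Rnot_lt_le. intros Hpos.
  set (l := (b0 - a0) + (d0 - c0)).
  (* Chosen so that the whole rectangle is bad; the added 1 covers [l = 0]. *)
  set (e := Cmod (J a0 b0 c0 d0) / (2 * (l ^ 2 + 1))).
  assert (Hl : 0 <= l) by (unfold l; lra).
  assert (He : 0 < e) by (apply Rdiv_lt_0_compat; nra).
  assert (B0 : bad e (Quad a0 b0 c0 d0)).
  { unfold bad. simpl. fold l.
    assert (e * (2 * (l ^ 2 + 1)) = Cmod (J a0 b0 c0 d0)) by (unfold e; field; nra).
    simpl in *. nra. }
  assert (I : forall n, sub (itq e n) (Quad a0 b0 c0 d0) /\ bad e (itq e n) /\
     (qb (itq e n) - qa (itq e n)) + (qd (itq e n) - qc (itq e n)) = l / 2 ^ n).
  { induction n as [|n (I1 & I2 & I3)].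
    - split; [unfold sub; simpl; lra|split; [exact B0|]]. simpl. unfold l. field.
    - change (itq e (S n)) with (step e (itq e n)).
      destruct (step_spec e _ I1 I2) as (S1 & S2 & S3).
      split; [|split; [exact S2|]].
      + unfold sub in *. simpl in *. lra.
      + rewrite S3, I3. simpl. field. apply pow_nonzero. lra. }
  assert (M : forall n, sub (itq e (S n)) (itq e n)).
  { intros n. apply (step_spec e (itq e n)); apply I. }
  destruct (nested_intervals (fun n => qa (itq e n)) (fun n => qb (itq e n)) a0 b0) as (s & Hs & Ks);
    try (cbn; lra);
    try (intros n; cbv beta; pose proof (M n) as M1; pose proof (proj1 (I n)) as M2;
         unfold sub in M1, M2; cbn [qa qb qc qd] in M1, M2; lra).
  destruct (nested_intervals (fun n => qc (itq e n)) (fun n => qd (itq e n)) c0 d0) as (t & Ht & Kt);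
    try (cbn; lra);
    try (intros n; cbv beta; pose proof (M n) as M1; pose proof (proj1 (I n)) as M2;
         unfold sub in M1, M2; cbn [qa qb qc qd] in M1, M2; lra).
  destruct (local s t Hs Ht e He) as (delta & Hd & K).
  assert (exists n, l / 2 ^ n < delta) as [n Hn].
  { assert (is_lim_seq (fun n => l * (/ 2) ^ n) (l * 0)) as Z.
    { apply (is_lim_seq_scal_l _ l 0). apply is_lim_seq_geom. rewrite Rabs_pos_eq; lra. }
    rewrite Rmult_0_r in Z. apply is_lim_seq_spec in Z. destruct (Z (mkposreal delta Hd)) as [N HN].
    exists N. specialize (HN N (Nat.le_refl N)). simpl in HN.
    rewrite Rminus_0_r in HN. apply Rabs_def2 in HN. rewrite pow_inv in HN. unfold Rdiv. lra. }
  destruct (I n) as (I1 & I2 & I3). specialize (Ks n). specialize (Kt n).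
  unfold sub, bad in *. simpl in *.
  specialize (K (qa (itq e n)) (qb (itq e n)) (qc (itq e n)) (qd (itq e n))).
  simpl in K. specialize (K ltac:(lra) ltac:(lra) ltac:(lra) ltac:(lra) ltac:(lra) ltac:(lra) ltac:(lra)).
  lra.
Qed.

End Bisection.

(** Affine functions have a primitive, so the affine part of [f] at a point contributes nothing
    around a closed contour. *)
Lemma wder_quadratic (A B z0 z : C) :
  wder (fun w => A * w + B / 2 * ((w - z0) * (w - z0)))%C z (A + B * (z - z0)) 0.
Proof.
  pose proof (wder_RtoC_scal _ z _ _ A (wder_id z)) as W1.
  assert (W2 : wder (fun w => w - z0)%C z 1 0).
  { pose proof (wder_plus _ _ z _ _ _ _ (wder_id z) (wder_const (- z0) z)) as W.
    replace (1 + 0)%C with (RtoC 1) in W by ring. replace (0 + 0)%C with (RtoC 0) in W by ring.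
    exact W. }
  pose proof (wder_RtoC_scal _ z _ _ (B / 2) (wder_mult _ _ z _ _ _ _ W2 W2)) as W3.
  pose proof (wder_plus _ _ z _ _ _ _ W1 W3) as W.
  replace (A + B * (z - z0))%C with (A * 1 + B / 2 * (1 * (z - z0) + (z - z0) * 1))%C by field.
  replace (RtoC 0) with (A * 0 + B / 2 * (0 * (z - z0) + (z - z0) * 0))%C by field.
  exact W.
Qed.

(** The affine approximation integrates exactly to an increment of [P]; what is left is an integrand
    of modulus at most [M * K]. *)
Lemma edge_estimate (f : C -> C) (A B z0 : C) (gam dgam : R -> C) (u v K M : R) :
  u <= v -> 0 <= K -> 0 <= M ->
  (forall t, u <= t <= v -> cderiv gam t (dgam t)) ->
  (forall t, u <= t <= v -> rcont dgam t) ->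
  (forall t, u <= t <= v -> Cmod (dgam t) <= K) ->
  (forall t, u <= t <= v -> ccont f (gam t)) ->
  (forall t, u <= t <= v -> Cmod (f (gam t) - (A + B * (gam t - z0))) <= M) ->
  let P := fun w => (A * w + B / 2 * ((w - z0) * (w - z0)))%C in
  Cmod (CInt (fun t => (f (gam t) * dgam t)%C) u v - (P (gam v) - P (gam u))) <= M * K * (v - u).
Proof.
  intros Huv HK HM H1 H2 H3 H4 H5 P.
  assert (I1 : is_CInt (fun t => (f (gam t) * dgam t)%C) u v (CInt (fun t => (f (gam t) * dgam t)%C) u v)).
  { apply is_CInt_rcont; [exact Huv|]. intros t Ht.
    apply rcont_mult; [|now apply H2]. apply rcont_ccont; [|now apply H4].
    apply cderiv_rcont with (dgam t). now apply H1. }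
  assert (I2 : is_CInt (fun t => ((A + B * (gam t - z0)) * dgam t)%C) u v (P (gam v) - P (gam u))%C).
  { apply (is_CInt_derive (fun t => P (gam t))); [exact Huv| |].
    - intros t Ht.
      pose proof (wder_cderiv P gam t _ _ _ (H1 t Ht) (wder_quadratic A B z0 (gam t))) as W.
      replace ((A + B * (gam t - z0)) * dgam t)%C with
        ((A + B * (gam t - z0)) * dgam t + 0 * Cconj (dgam t))%C by ring. exact W.
    - intros t Ht. apply rcont_mult; [|now apply H2].
      apply rcont_plus; [apply rcont_const|]. apply rcont_mult; [apply rcont_const|].
      apply rcont_plus; [|apply rcont_const]. apply cderiv_rcont with (dgam t). now apply H1. }
  pose proof (is_RInt_minus (V := C_R_NormedModule) _ _ _ _ _ _ I1 I2) as I.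
  apply (is_CInt_bound _ u v (M * K) _ Huv) in I; [exact I|].
  intros t Ht.
  change (Cmod (f (gam t) * dgam t - (A + B * (gam t - z0)) * dgam t) <= M * K).
  replace (f (gam t) * dgam t - (A + B * (gam t - z0)) * dgam t)%C
    with ((f (gam t) - (A + B * (gam t - z0))) * dgam t)%C by ring.
  rewrite Cmod_mult. apply Rmult_le_compat; try apply Cmod_ge_0; auto.
Qed.

Lemma Cmod_lipschitz (phi dphi : R -> C) (K a b u v : R) :
  (forall t, a <= t <= b -> cderiv phi t (dphi t)) ->
  (forall t, a <= t <= b -> Cmod (dphi t) <= K) ->
  a <= u <= b -> a <= v <= b -> Cmod (phi u - phi v) <= K * Rabs (u - v).
Proof.
  intros H1 H2 Hu Hv. destruct (Rle_dec v u) as [L|L].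
  - rewrite Rabs_pos_eq by lra. apply Cmod_increment_le_const with dphi; auto;
    intros t Ht; [apply H1|apply H2]; lra.
  - rewrite Rabs_left by lra. rewrite Cmod_sub_sym.
    replace (- (u - v)) with (v - u) by ring.
    apply Cmod_increment_le_const with dphi; auto; try lra;
    intros t Ht; [apply H1|apply H2]; lra.
Qed.

Lemma CInt_Chasles (phi : R -> C) (a m b : R) : a <= m -> m <= b ->
  (forall t, a <= t <= b -> rcont phi t) -> CInt phi a b = (CInt phi a m + CInt phi m b)%C.
Proof.
  intros H1 H2 H. apply CInt_unique.
  apply (is_RInt_Chasles (V := C_R_NormedModule) _ a m b);
    apply is_CInt_rcont; auto; intros t Ht; apply H; lra.
Qed.

(** Goursat's argument is run on the parameter rectangle. It uses complex differentiability at the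
    points of the image alone; the image may overlap itself, and [G] needs bounded first
    derivatives, each continuous in its own variable, but no mixed second ones. Circles and segments
    can thus be deformed without any topology of the plane. *)
Theorem Goursat_homotopy (f : C -> C) (G G1 G2 : R -> R -> C) (a b c d K : R) :
  a <= b -> c <= d ->
  (forall s t, a <= s <= b -> c <= t <= d ->
     cderiv (fun s => G s t) s (G1 s t) /\ cderiv (G s) t (G2 s t) /\
     rcont (fun s => G1 s t) s /\ rcont (G2 s) t /\
     Cmod (G1 s t) <= K /\ Cmod (G2 s t) <= K /\
     exists l, wder f (G s t) l 0) ->
  (CInt (fun s => f (G s c) * G1 s c) a b + CInt (fun t => f (G b t) * G2 b t) c d
   = CInt (fun t => f (G a t) * G2 a t) c d + CInt (fun s => f (G s d) * G1 s d) a b)%C.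
Proof.
  intros Hab Hcd H.
  set (J := fun a b c d => (CInt (fun s => f (G s c) * G1 s c)%C a b
    + CInt (fun t => f (G b t) * G2 b t)%C c d
    - CInt (fun t => f (G a t) * G2 a t)%C c d - CInt (fun s => f (G s d) * G1 s d)%C a b)%C).
  assert (HK : 0 <= K).
  { destruct (H a c) as (_ & _ & _ & _ & K1 & _); [lra|lra|].
    pose proof (Cmod_ge_0 (G1 a c)). lra. }
  assert (Cf : forall s t, a <= s <= b -> c <= t <= d -> ccont f (G s t)).
  { intros s t Hs Ht. destruct (H s t Hs Ht) as (_ & _ & _ & _ & _ & _ & l & W).
    exact (wder_cont _ _ _ _ W). }
  assert (R1 : forall s t, a <= s <= b -> c <= t <= d -> rcont (fun s => f (G s t) * G1 s t)%C s).
  { intros s t Hs Ht. apply rcont_mult; [|now apply H].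
    apply (rcont_ccont f (fun s => G s t)); [|now apply Cf].
    apply cderiv_rcont with (G1 s t). now apply H. }
  assert (R2 : forall s t, a <= s <= b -> c <= t <= d -> rcont (fun t => f (G s t) * G2 s t)%C t).
  { intros s t Hs Ht. apply rcont_mult; [|now apply H].
    apply (rcont_ccont f (G s)); [|now apply Cf].
    apply cderiv_rcont with (G2 s t). now apply H. }
  assert (Z : J a b c d = RtoC 0).
  { apply bisection; auto.
    - intros a' m b' c' d' ? ? ? ? ? ? ?. unfold J.
      rewrite (CInt_Chasles (fun s => f (G s c') * G1 s c')%C a' m b'),
        (CInt_Chasles (fun s => f (G s d') * G1 s d')%C a' m b');
        try lra; try ring; intros t Ht; apply R1; lra.
    - intros a' b' c' m d' ? ? ? ? ? ? ?. unfold J.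
      rewrite (CInt_Chasles (fun t => f (G b' t) * G2 b' t)%C c' m d'),
        (CInt_Chasles (fun t => f (G a' t) * G2 a' t)%C c' m d');
        try lra; try ring; intros t Ht; apply R2; lra.
    - intros s t Hs Ht eps Heps.
      destruct (H s t Hs Ht) as (_ & _ & _ & _ & _ & _ & l & W).
      (* The four edges have total length [2 * D] and each integrand error is at most
         [eta * (K * D) * K], which gives the factor [2 * K * K]; the 1 covers [K = 0]. *)
      set (eta := eps / (2 * K * K + 1)).
      assert (Heta : 0 < eta) by (apply Rdiv_lt_0_compat; nra).
      destruct (W eta Heta) as (dl & Hdl & Wd).
      exists (dl / (K + 1)). split; [apply Rdiv_lt_0_compat; lra|].
      intros a' b' c' d' ? ? ? ? ? ? Hsmall.
      set (D := b' - a' + (d' - c')) in *.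
      assert (HD : (K + 1) * D < dl).
      { apply Rlt_le_trans with ((K + 1) * (dl / (K + 1)));
          [apply Rmult_lt_compat_l; lra|right; field; lra]. }
      assert (L : forall s' t', a' <= s' <= b' -> c' <= t' <= d' ->
                Cmod (G s' t' - G s t) <= K * D).
      { intros s' t' Hs' Ht'.
        eapply Rle_trans; [apply (Cmod_sub_triangle _ (G s t'))|].
        apply Rle_trans with (K * Rabs (s' - s) + K * Rabs (t' - t)).
        - apply Rplus_le_compat.
          + apply (Cmod_lipschitz (fun s => G s t') (fun s => G1 s t') K a b); try lra;
            intros x Hx; apply H; lra.
          + apply (Cmod_lipschitz (G s) (G2 s) K c d); try lra;
            intros x Hx; apply H; lra.
        - rewrite <- Rmult_plus_distr_l. apply Rmult_le_compat_l; [exact HK|].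
          assert (Rabs (s' - s) <= b' - a') by (apply Rabs_le; lra).
          assert (Rabs (t' - t) <= d' - c') by (apply Rabs_le; lra). unfold D. lra. }
      assert (Est : forall s' t', a' <= s' <= b' -> c' <= t' <= d' ->
                Cmod (f (G s' t') - (f (G s t) + l * (G s' t' - G s t))) <= eta * (K * D)).
      { intros s' t' Hs' Ht'. pose proof (L s' t' Hs' Ht') as L1.
        assert (0 <= D) by (unfold D; lra).
        specialize (Wd (G s' t') ltac:(lra)).
        replace (f (G s' t') - (f (G s t) + l * (G s' t' - G s t)))%C with
          (f (G s' t') - f (G s t) - (l * (G s' t' - G s t) + 0 * Cconj (G s' t' - G s t)))%C by ring.
        eapply Rle_trans; [exact Wd|]. apply Rmult_le_compat_l; lra. }
      assert (HM : 0 <= eta * (K * D)).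
      { apply Rmult_le_pos; [lra|]. apply Rmult_le_pos; [lra|unfold D; lra]. }
      assert (E1 : forall t', c' <= t' <= d' -> _ ) by
        (intros t' Ht'; refine (edge_estimate f (f (G s t)) l (G s t) (fun s => G s t') (fun s => G1 s t')
           a' b' K (eta * (K * D)) _ HK HM _ _ _ _ _); [lra| | | | | ]; intros x Hx;
         [apply H|apply H|apply H|apply Cf|apply Est]; lra).
      assert (E2 : forall s', a' <= s' <= b' -> _ ) by
        (intros s' Hs'; refine (edge_estimate f (f (G s t)) l (G s t) (G s') (G2 s')
           c' d' K (eta * (K * D)) _ HK HM _ _ _ _ _); [lra| | | | | ]; intros x Hx;
         [apply H|apply H|apply H|apply Cf|apply Est]; lra).
      (* The four increments of this primitive cancel around the rectangle. *)
      set (P := fun w : C => (f (G s t) * w + l / 2 * ((w - G s t) * (w - G s t)))%C) in *.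
      pose proof (E1 c' ltac:(lra)) as Q1. pose proof (E1 d' ltac:(lra)) as Q2.
      pose proof (E2 a' ltac:(lra)) as Q3. pose proof (E2 b' ltac:(lra)) as Q4.
      cbv beta in Q1, Q2, Q3, Q4. unfold J.
      match goal with |- Cmod (?w1 + ?w2 - ?w3 - ?w4) <= _ =>
        replace (w1 + w2 - w3 - w4)%C with
         ((w1 - (P (G b' c') - P (G a' c'))) + (w2 - (P (G b' d') - P (G b' c')))
          + - (w3 - (P (G a' d') - P (G a' c'))) + - (w4 - (P (G b' d') - P (G a' d'))))%C by ring
      end.
      eapply Rle_trans; [eapply Rle_trans; [apply Cmod_triangle|]; apply Rplus_le_compat_r;
        eapply Rle_trans; [apply Cmod_triangle|]; apply Rplus_le_compat_r; apply Cmod_triangle|].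
      rewrite !Cmod_opp.
      apply Rle_trans with (eta * (K * D) * K * (2 * D)); [unfold D in *; lra|].
      replace (eta * (K * D) * K * (2 * D)) with (eta * (2 * K * K) * D ^ 2) by ring.
      apply Rmult_le_compat_r; [apply pow2_ge_0|].
      apply Rle_trans with (eta * (2 * K * K + 1)); [nra|].
      right. unfold eta. field. nra. }
  unfold J in Z.
  match type of Z with (?w1 + ?w2 - ?w3 - ?w4)%C = _ =>
    replace (w1 + w2)%C with ((w1 + w2 - w3 - w4) + (w3 + w4))%C by ring end.
  rewrite Z. ring.
Qed.

(** * Cauchy's formula and Taylor expansion *)

Definition Cis (t : R) : C := (cos t, sin t).

Lemma Cmod_Cis (t : R) : Cmod (Cis t) = 1.
Proof.
  unfold Cmod, Cis. simpl. pose proof (sin2_cos2 t) as H. unfold Rsqr in H.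
  replace (cos t * (cos t * 1) + sin t * (sin t * 1)) with 1 by lra. apply sqrt_1.
Qed.

Lemma Cis_neq_0 (t : R) : Cis t <> RtoC 0.
Proof. apply Cmod_neq_0. rewrite Cmod_Cis. lra. Qed.

Lemma Cis_2PI : Cis (2 * PI) = Cis 0.
Proof. unfold Cis. now rewrite cos_2PI, sin_2PI, cos_0, sin_0. Qed.

Lemma cderiv_Cis (t : R) : cderiv Cis t (Ci * Cis t).
Proof.
  split; unfold Cis, Re, Im; simpl; auto_derive; trivial; ring.
Qed.

Lemma cderiv_scal (c : C) (phi : R -> C) (t : R) (d : C) :
  cderiv phi t d -> cderiv (fun s => c * phi s)%C t (c * d).
Proof.
  intros H.
  pose proof (wder_cderiv _ _ _ _ _ _ H (wder_RtoC_scal _ (phi t) _ _ c (wder_id _))) as W.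
  replace (c * d)%C with (c * 1 * d + c * 0 * Cconj d)%C by ring. exact W.
Qed.

Lemma cderiv_linear (p v : C) (t : R) : cderiv (fun s => p + RtoC s * v)%C t v.
Proof.
  destruct p, v.
  split; unfold Re, Im; simpl; auto_derive; trivial; ring.
Qed.

Lemma cderiv_ext (phi psi : R -> C) (t : R) (d : C) :
  (forall s, phi s = psi s) -> cderiv phi t d -> cderiv psi t d.
Proof.
  intros E [H1 H2].
  split; [apply (is_derive_ext (fun s => Re (phi s)))|apply (is_derive_ext (fun s => Im (phi s)))];
    auto; intros s; now rewrite E.
Qed.

Lemma rcont_Cis (t : R) : rcont Cis t.
Proof. apply cderiv_rcont with (Ci * Cis t)%C. apply cderiv_Cis. Qed.

Lemma rcont_Ci_Cis (c : C) (t : R) : rcont (fun t => c * (Ci * Cis t))%C t.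
Proof. repeat apply rcont_mult; try apply rcont_const. apply rcont_Cis. Qed.

Lemma CInt_ext (phi psi : R -> C) (a b : R) : a <= b ->
  (forall t, a <= t <= b -> phi t = psi t) -> CInt phi a b = CInt psi a b.
Proof.
  intros Hab H. apply (RInt_ext (V := C_R_CompleteNormedModule)).
  rewrite Rmin_left, Rmax_right by exact Hab. intros t Ht. apply H. lra.
Qed.

Lemma is_CInt_const (c : C) (a b : R) : is_CInt (fun _ => c) a b (RtoC (b - a) * c)%C.
Proof.
  apply is_CInt_components.
  destruct c as [u v].
  split.
  - replace (Re (RtoC (b - a) * (u, v))) with ((b - a) * u) by (unfold Re; simpl; ring).
    apply (is_RInt_const (V := R_NormedModule)).
  - replace (Im (RtoC (b - a) * (u, v))) with ((b - a) * v) by (unfold Im; simpl; ring).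
    apply (is_RInt_const (V := R_NormedModule)).
Qed.

Lemma Cmod_circle (rho : R) (t : R) : 0 <= rho -> Cmod (RtoC rho * Cis t) = rho.
Proof. intros H. rewrite Cmod_scal, Cmod_Cis, Rabs_pos_eq by exact H. ring. Qed.

Lemma circle_sub_neq_0 (rho t : R) (z : C) :
  Cmod z < rho -> (RtoC rho * Cis t - z)%C <> RtoC 0.
Proof.
  intros H. apply Cmod_neq_0. pose proof (Cmod_triangle_rev (RtoC rho * Cis t) z).
  pose proof (Cmod_ge_0 z). rewrite Cmod_circle in H0; lra.
Qed.

(** In a homotopy of closed curves the two sides traced by the common endpoint give the same
    integral; this removes them from the Goursat identity. *)
Lemma Cplus_cancel_swap (u v w : C) : (u + v = w + u)%C -> v = w.
Proof. intros E. replace v with ((u + v) - u)%C by ring. rewrite E. ring. Qed.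

(* The circle is translated from centre [0] to centre [- z] without meeting the
   pole of the inverse. *)
Lemma winding_integral (rho : R) (z : C) : Cmod z < rho ->
  CInt (fun t => / (RtoC rho * Cis t - z) * (RtoC rho * (Ci * Cis t)))%C 0 (2 * PI)
  = (RtoC (2 * PI) * Ci)%C.
Proof.
  intros Hz. pose proof (Cmod_ge_0 z) as Hz0. pose proof PI_RGT_0.
  set (G := fun s t => (RtoC rho * Cis t - RtoC s * z)%C).
  assert (Hs : forall s, 0 <= s <= 1 -> Cmod (RtoC s * z) < rho).
  { intros s Hs. rewrite Cmod_scal, Rabs_pos_eq by lra. nra. }
  pose proof (Goursat_homotopy Cinv G (fun _ _ => (- z)%C)
    (fun _ t => (RtoC rho * (Ci * Cis t))%C) 0 1 0 (2 * PI) rho) as Q. cbv beta in Q.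
  rewrite (CInt_ext (fun s => / G s (2 * PI)%R * - z)%C (fun s => / G s 0 * - z)%C) in Q.
  2: lra. 2:{ intros t _. unfold G. now rewrite Cis_2PI. }
  rewrite (CInt_ext (fun t => / G 0 t * (RtoC rho * (Ci * Cis t)))%C (fun _ => Ci)) in Q.
  2: lra. 2:{ intros t _. unfold G. pose proof (Cis_neq_0 t).
    assert (RtoC rho <> RtoC 0) by (apply Cmod_neq_0; rewrite Cmod_R, Rabs_pos_eq; lra).
    replace (RtoC rho * Cis t - RtoC 0 * z)%C with (RtoC rho * Cis t)%C by ring.
    field. split; assumption. }
  rewrite (CInt_unique (fun _ => Ci) 0 (2 * PI) (RtoC (2 * PI - 0) * Ci)%C (is_CInt_const _ _ _)) in Q.
  rewrite Rminus_0_r in Q.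
  rewrite (CInt_ext _ (fun t => / G 1 t * (RtoC rho * (Ci * Cis t)))%C); [|lra|].
  2:{ intros t _. unfold G. now rewrite Cmult_1_l. }
  refine (Cplus_cancel_swap _ _ _ (Q _ _ _)); [lra|lra|].
  { intros s t Hs1 Ht.
    split; [|split; [|split; [|split; [|split; [|split]]]]].
    - destruct z. unfold G. split; unfold Re, Im; simpl; auto_derive; trivial; ring.
    - destruct z. unfold G. split; unfold Re, Im; simpl; auto_derive; trivial; ring.
    - apply rcont_const.
    - apply rcont_Ci_Cis.
    - rewrite Cmod_opp. lra.
    - replace (RtoC rho * (Ci * Cis t))%C with (Ci * (RtoC rho * Cis t))%C by ring.
      rewrite Cmod_mult, Cmod_Ci, Cmod_circle by lra. lra.
    - exists (- / (G s t * G s t))%C. apply wder_inv. unfold G.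
      apply circle_sub_neq_0. now apply Hs. }
Qed.

Lemma wder_quotient (f : C -> C) (z w l : C) : w <> z ->
  wder f w l 0 -> exists l', wder (fun w => (f w - f z) * / (w - z))%C w l' 0.
Proof.
  intros Hw W. eexists. apply holo_mult.
  - apply holo_minus; [exact W|apply wder_const].
  - apply (holo_inv (fun w => w - z)%C); [now apply Csub_neq_0|].
    apply holo_minus; [apply wder_id|apply wder_const].
Qed.

Section CauchyDisc.

Variables (f : C -> C) (r rho : R).
Hypothesis Hrho : 0 < rho < r.
Hypothesis Hf : forall z, Cmod z < r -> exists l, wder f z l 0.

Let zeta (t : R) : C := (RtoC rho * Cis t)%C.

Lemma ccont_disc (z : C) : Cmod z < r -> ccont f z.
Proof. intros H. destruct (Hf z H) as [l W]. exact (wder_cont _ _ _ _ W). Qed.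

Lemma zeta_mod (t : R) : Cmod (zeta t) = rho.
Proof. apply Cmod_circle. lra. Qed.

Lemma rcont_zeta (t : R) : rcont zeta t.
Proof. apply rcont_mult; [apply rcont_const|apply rcont_Cis]. Qed.

Lemma rcont_f_zeta (t : R) : rcont (fun t => f (zeta t)) t.
Proof.
  apply rcont_ccont; [apply rcont_zeta|]. apply ccont_disc. rewrite zeta_mod. lra.
Qed.

Lemma cauchy_difference_quotient (z : C) : Cmod z < rho ->
  CInt (fun t => (f (zeta t) - f z) * / (zeta t - z) * (RtoC rho * (Ci * Cis t)))%C 0 (2 * PI)
  = RtoC 0.
Proof.
  intros Hz. pose proof PI_RGT_0.
  set (k := fun w => ((f w - f z) * / (w - z))%C).
  match goal with |- ?I = _ => set (I0 := I) end.
  destruct (Hf z) as [l Wl]; [lra|].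
  destruct (Wl 1 Rlt_0_1) as (dl & Hdl & Kl).
  assert (Bound : forall e, 0 < e < 1 -> e * (2 * rho) < dl ->
             Cmod I0 <= (Cmod l + 1) * (e * rho) * (2 * PI - 0)).
  { intros e He He2.
    set (G := fun s t => (z + RtoC s * (zeta t - z))%C).
    assert (Gz : forall s t, 0 <= s -> Cmod (G s t - z) <= s * (2 * rho)).
    { intros s t Hs. unfold G. replace (z + RtoC s * (zeta t - z) - z)%C with (RtoC s * (zeta t - z))%C by ring.
      rewrite Cmod_scal, Rabs_pos_eq by lra. apply Rmult_le_compat_l; [lra|].
      pose proof (Cmod_triangle (zeta t) (- z)). rewrite Cmod_opp, zeta_mod in H0.
      unfold Cminus. lra. }
    assert (Gn : forall s t, 0 < s -> G s t <> z).
    { intros s t Hs E. apply (circle_sub_neq_0 rho t z Hz).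
      assert (RtoC s <> RtoC 0) by (apply Cmod_neq_0; rewrite Cmod_R, Rabs_pos_eq; lra).
      fold (zeta t). replace (zeta t - z)%C with (/ RtoC s * (G s t - z))%C by (unfold G; field; auto).
      rewrite E. ring. }
    assert (Gr : forall s t, 0 <= s <= 1 -> Cmod (G s t) < r).
    { intros s t Hs. unfold G.
      replace (z + RtoC s * (zeta t - z))%C with (RtoC (1 - s) * z + RtoC s * zeta t)%C
        by (rewrite RtoC_minus; ring).
      eapply Rle_lt_trans; [apply Cmod_triangle|].
      rewrite !Cmod_scal, !Rabs_pos_eq, zeta_mod by lra. nra. }
    pose proof (Goursat_homotopy k G (fun _ t => (zeta t - z)%C)
      (fun s t => (RtoC (s * rho) * (Ci * Cis t))%C) e 1 0 (2 * PI) (2 * rho)) as Q. cbv beta in Q.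
    assert (Z2 : zeta (2 * PI) = zeta 0) by (unfold zeta; now rewrite Cis_2PI).
    rewrite (CInt_ext (fun s => k (G s (2 * PI)%R) * (zeta (2 * PI)%R - z))%C
               (fun s => k (G s 0) * (zeta 0 - z))%C) in Q.
    2: lra. 2:{ intros t _. unfold G. now rewrite Z2. }
    assert (E' := fun HA => Cplus_cancel_swap _ _ _ (Q ltac:(lra) ltac:(lra) HA)).
    lapply E'; clear E'; [intros E'|].
    2:    { intros s t Hs Ht. split; [|split; [|split; [|split; [|split; [|split]]]]].
      - destruct z. unfold G, zeta. split; unfold Re, Im; simpl; auto_derive; trivial; ring.
      - destruct z. unfold G, zeta. split; unfold Re, Im; simpl; auto_derive; trivial; ring.
      - apply rcont_const.
      - apply rcont_Ci_Cis.
      - pose proof (Cmod_triangle (zeta t) (- z)). rewrite Cmod_opp, zeta_mod in H0.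
        unfold Cminus. lra.
      - replace (RtoC (s * rho) * (Ci * Cis t))%C with (RtoC s * (Ci * zeta t))%C
          by (unfold zeta; rewrite RtoC_mult; ring).
        rewrite Cmod_scal, Cmod_mult, Cmod_Ci, zeta_mod, Rabs_pos_eq by lra. nra.
      - destruct (Hf (G s t)) as [l' W']; [apply Gr; lra|].
        apply (wder_quotient f z (G s t) l'); [apply Gn; lra|exact W']. }
    assert (EI : I0 = CInt (fun t => k (G 1 t) * (RtoC (1 * rho) * (Ci * Cis t)))%C 0 (2 * PI)).
    { unfold I0. apply CInt_ext; [lra|]. intros t _.
      assert (G 1 t = zeta t) as -> by (unfold G; ring). now rewrite Rmult_1_l. }
    rewrite EI, E'.
    apply (is_CInt_bound (fun t => k (G e t) * (RtoC (e * rho) * (Ci * Cis t)))%C); [lra| |].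
    - intros t Ht. rewrite Cmod_mult.
      rewrite Cmod_scal, Cmod_mult, Cmod_Ci, Cmod_Cis, Rabs_pos_eq by nra.
      rewrite !Rmult_1_r. apply Rmult_le_compat_r; [nra|].
      pose proof (Gz e t ltac:(lra)) as L1. specialize (Kl (G e t) ltac:(lra)).
      assert (Hn : 0 < Cmod (G e t - z)).
      { apply Cmod_gt_0, Csub_neq_0, Gn. lra. }
      unfold k. rewrite Cmod_mult, Cmod_inv by (apply Cmod_gt_0; exact Hn).
      apply Rmult_le_reg_r with (Cmod (G e t - z)); [exact Hn|].
      rewrite Rmult_assoc, Rinv_l, Rmult_1_r by lra.
      replace (f (G e t) - f z)%C with
        ((f (G e t) - f z - (l * (G e t - z) + 0 * Cconj (G e t - z))) + l * (G e t - z))%C by ring.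
      eapply Rle_trans; [apply Cmod_triangle|]. rewrite Cmod_mult. lra.
    - apply is_CInt_rcont; [lra|]. intros t Ht.
      apply rcont_mult; [|apply rcont_Ci_Cis].
      apply rcont_ccont.
      + unfold G. apply rcont_plus; [apply rcont_const|].
        apply rcont_mult; [apply rcont_const|]. apply rcont_plus; [apply rcont_zeta|apply rcont_const].
      + destruct (Hf (G e t)) as [l' W']; [apply Gr; lra|].
        destruct (wder_quotient f z (G e t) l') as [l'' W'']; [apply Gn; lra|exact W'|].
        exact (wder_cont _ _ _ _ W''). }
  apply Cmod_eq_0. apply Rle_antisym; [|apply Cmod_ge_0].
  apply Rnot_lt_le. intros Hp. pose proof (Cmod_ge_0 l).
  set (A := (Cmod l + 1) * rho * (2 * PI)).
  assert (HA : 0 < A) by (unfold A; apply Rmult_lt_0_compat; [nra|lra]).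
  (* The middle entry brings the contracted circle within [dl] of [z]; the last makes [e * A] at
     most half of [Cmod I0], against the bound. *)
  set (e := Rmin (1 / 2) (Rmin (dl / (4 * rho)) (Cmod I0 / (2 * A)))).
  assert (e <= 1 / 2) by rmin.
  assert (He1 : e <= dl / (4 * rho)) by rmin.
  assert (He2 : e <= Cmod I0 / (2 * A)) by rmin.
  assert (0 < e).
  { repeat apply Rmin_pos; try lra; apply Rdiv_lt_0_compat; lra. }
  assert (B1 : e * (2 * rho) < dl).
  { apply Rle_lt_trans with (dl / (4 * rho) * (2 * rho)); [apply Rmult_le_compat_r; lra|].
    replace (dl / (4 * rho) * (2 * rho)) with (dl / 2) by (field; lra). lra. }
  specialize (Bound e ltac:(lra) B1).
  assert (e * A <= Cmod I0 / 2).
  { apply Rle_trans with (Cmod I0 / (2 * A) * A); [apply Rmult_le_compat_r; lra|right; field; lra]. }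
  unfold A in *. nra.
Qed.

Lemma is_CInt_plus (phi psi : R -> C) (a b : R) (l m : C) :
  is_CInt phi a b l -> is_CInt psi a b m -> is_CInt (fun t => phi t + psi t)%C a b (l + m)%C.
Proof. apply (is_RInt_plus (V := C_R_NormedModule)). Qed.

Lemma rcont_inv (phi : R -> C) (t : R) :
  rcont phi t -> phi t <> RtoC 0 -> rcont (fun s => / phi s)%C t.
Proof.
  intros H H0. apply rcont_ccont; [exact H|]. exact (wder_cont _ _ _ _ (wder_inv _ H0)).
Qed.

Lemma zeta_sub_neq_0 (z : C) (t : R) : Cmod z < rho -> (zeta t - z)%C <> RtoC 0.
Proof. apply circle_sub_neq_0. Qed.

Lemma rcont_cauchy_kernel (z : C) (t : R) : Cmod z < rho ->
  rcont (fun t => / (zeta t - z))%C t.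
Proof.
  intros Hz. apply rcont_inv; [|now apply zeta_sub_neq_0].
  apply rcont_plus; [apply rcont_zeta|apply rcont_const].
Qed.

(** Writing [f (zeta t)] as its difference from [f z] plus [f z] splits the integral into the
    vanishing one above and a multiple of the winding integral. *)
Theorem cauchy_formula (z : C) : Cmod z < rho ->
  is_CInt (fun t => f (zeta t) * / (zeta t - z) * (RtoC rho * (Ci * Cis t)))%C 0 (2 * PI)
    (RtoC (2 * PI) * Ci * f z)%C.
Proof.
  intros Hz. pose proof PI_RGT_0.
  assert (I1 := is_CInt_rcont
    (fun t => (f (zeta t) - f z) * / (zeta t - z) * (RtoC rho * (Ci * Cis t)))%C 0 (2 * PI)).
  rewrite cauchy_difference_quotient in I1 by exact Hz.
  assert (I2 := is_CInt_rcont
    (fun t => / (zeta t - z) * (RtoC rho * (Ci * Cis t)))%C 0 (2 * PI)).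
  assert (E : CInt (fun t => / (zeta t - z) * (RtoC rho * (Ci * Cis t)))%C 0 (2 * PI)
     = (RtoC (2 * PI) * Ci)%C) by exact (winding_integral rho z Hz).
  rewrite E in I2.
  pose proof (is_CInt_plus _ _ _ _ _ _ (I1 ltac:(lra) ltac:(
    intros t _; apply rcont_mult; [|apply rcont_Ci_Cis]; apply rcont_mult;
    [apply rcont_plus; [apply rcont_f_zeta|apply rcont_const]|now apply rcont_cauchy_kernel]))
    (is_CInt_scal _ _ _ _ (f z) (I2 ltac:(lra) ltac:(intros t _; apply rcont_mult;
       [now apply rcont_cauchy_kernel|apply rcont_Ci_Cis])))) as I.
  replace (RtoC (2 * PI) * Ci * f z)%C with (0 + f z * (RtoC (2 * PI) * Ci))%C by ring.
  apply (is_RInt_ext (V := C_R_NormedModule)) with (2 := I).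
  intros t _. simpl. ring.
Qed.

(** The geometric expansion of the Cauchy kernel, stopped after [n] terms: [Rem n z] is the Cauchy
    integral with the extra factor [(z / zeta)^n]. Exact remainders obeying a one-step recursion
    replace the convergence of power series. *)
Theorem taylor_remainder : exists (a : nat -> C) (Rem : nat -> C -> C) (M : R),
  forall z, Cmod z <= rho / 2 ->
    Rem O z = f z /\ forall n,
      Rem n z = (a n * z ^ n + Rem (S n) z)%C /\ Cmod (Rem n z) <= M * (Cmod z / rho) ^ n.
Proof.
  pose proof PI_RGT_0.
  assert (exists M, 0 <= M /\ forall t, 0 <= t <= 2 * PI -> Cmod (f (zeta t)) <= M) as (M & HM0 & HM).
  { destruct (continuity_ab_maj (fun t => Cmod (f (zeta t))) 0 (2 * PI)) as (m & Hm & _); [lra| |].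
    - intros t _ eps Heps. destruct (rcont_f_zeta t eps Heps) as (d & Hd & K).
      exists d. split; [exact Hd|]. intros s [_ Hs]. simpl in *. unfold Rdist in *.
      specialize (K s Hs). cbv beta in K. apply Rabs_def1.
      + pose proof (Cmod_triangle_rev (f (zeta s)) (f (zeta t))). lra.
      + pose proof (Cmod_triangle_rev (f (zeta t)) (f (zeta s))).
        rewrite Cmod_sub_sym in H0. lra.
    - exists (Cmod (f (zeta m))). split; [apply Cmod_ge_0|exact Hm]. }
  set (c := (/ (RtoC (2 * PI) * Ci))%C).
  assert (P0 : RtoC (2 * PI) <> RtoC 0) by (apply Cmod_neq_0; rewrite Cmod_R, Rabs_pos_eq; lra).
  assert (Ci0 : Ci <> RtoC 0) by (apply Cmod_neq_0; rewrite Cmod_Ci; lra).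
  assert (Z0 : forall t, zeta t <> RtoC 0) by (intros t; apply Cmod_neq_0; rewrite zeta_mod; lra).
  set (ra := fun n t => (f (zeta t) * / zeta t ^ S n * (RtoC rho * (Ci * Cis t)))%C).
  set (rk := fun n z t => (f (zeta t) * (z / zeta t) ^ n * / (zeta t - z) * (RtoC rho * (Ci * Cis t)))%C).
  assert (Cpow_cont : forall (phi : R -> C) t n, rcont phi t -> rcont (fun s => phi s ^ n)%C t).
  { intros phi t n Hp. induction n; simpl; [apply rcont_const|now apply rcont_mult]. }
  assert (Ra : forall n t, rcont (ra n) t).
  { intros n t. apply rcont_mult; [|apply rcont_Ci_Cis].
    apply rcont_mult; [apply rcont_f_zeta|].
    apply (rcont_inv (fun t => zeta t ^ S n)%C); [apply Cpow_cont, rcont_zeta|].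
    now apply Cpow_nz. }
  assert (Rk : forall n z t, Cmod z < rho -> rcont (rk n z) t).
  { intros n z t Hz. apply rcont_mult; [|apply rcont_Ci_Cis].
    apply rcont_mult; [apply rcont_mult; [apply rcont_f_zeta|]|now apply rcont_cauchy_kernel].
    apply (Cpow_cont (fun t => z / zeta t)%C). apply rcont_mult; [apply rcont_const|].
    apply rcont_inv; [apply rcont_zeta|apply Z0]. }
  exists (fun n => c * CInt (ra n) 0 (2 * PI))%C,
    (fun n z => c * CInt (rk n z) 0 (2 * PI))%C, (2 * M).
  intros z Hz. assert (Hz' : Cmod z < rho) by lra. split.
  - assert (E : CInt (rk O z) 0 (2 * PI) = (RtoC (2 * PI) * Ci * f z)%C).
    { apply CInt_unique. apply (is_RInt_ext (V := C_R_NormedModule)) with (2 := cauchy_formula z Hz').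
      intros t _. unfold rk. simpl. ring. }
    rewrite E. unfold c. field. auto.
  - intros n. split.
    + assert (E : CInt (rk n z) 0 (2 * PI) =
        (z ^ n * CInt (ra n) 0 (2 * PI) + CInt (rk (S n) z) 0 (2 * PI))%C).
      { apply CInt_unique.
        apply (is_RInt_ext (V := C_R_NormedModule) (fun t => z ^ n * ra n t + rk (S n) z t)%C).
        - intros t _. unfold rk, ra.
          pose proof (zeta_sub_neq_0 z t Hz') as N1. pose proof (Z0 t) as N2.
          assert (N3 : (zeta t ^ n)%C <> RtoC 0) by now apply Cpow_nz.
          unfold Cdiv. rewrite !Cpow_mult_l, !Cpow_inv by exact N2. simpl. field. auto.
        - apply is_CInt_plus; [apply is_CInt_scal|]; apply is_CInt_rcont; auto; try lra. }
      rewrite E. ring.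
    + assert (B : Cmod (CInt (rk n z) 0 (2 * PI)) <= (M * (Cmod z / rho) ^ n * 2) * (2 * PI - 0)).
      { apply (is_CInt_bound (rk n z)); [lra| |apply is_CInt_rcont; auto; lra].
        intros t Ht. unfold rk. rewrite !Cmod_mult, Cmod_pow, Cmod_inv by now apply zeta_sub_neq_0.
        rewrite Cmod_div by apply Z0.
        rewrite Cmod_R, Cmod_Ci, Cmod_Cis, zeta_mod, Rabs_pos_eq by lra.
        (* On the disc of half the radius the kernel denominator is at least [rho / 2]; this is the
           factor 2 in the constant. *)
        assert (K : / Cmod (zeta t - z) * (rho * (1 * 1)) <= 2).
        { pose proof (Cmod_triangle_rev (zeta t) z) as T. rewrite zeta_mod in T.
          apply Rle_trans with (/ (rho / 2) * (rho * (1 * 1))).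
          - apply Rmult_le_compat_r; [lra|]. apply Rinv_le_contravar; lra.
          - right. field. lra. }
        assert (0 <= (Cmod z / rho) ^ n).
        { apply pow_le. apply Rmult_le_pos; [apply Cmod_ge_0|]. left. apply Rinv_0_lt_compat. lra. }
        assert (0 < / Cmod (zeta t - z)).
        { apply Rinv_0_lt_compat, Cmod_gt_0. now apply zeta_sub_neq_0. }
        rewrite (Rmult_assoc (_ * _ ^ n)). apply Rmult_le_compat; auto.
        - apply Rmult_le_pos; [apply Cmod_ge_0|assumption].
        - apply Rmult_le_pos; lra.
        - apply Rmult_le_compat_r; auto. }
      rewrite Cmod_mult. unfold c. rewrite Cmod_inv, Cmod_mult, Cmod_Ci, Cmod_R, Rabs_pos_eq;
        try lra; [|now apply Cmult_neq_0].
      apply Rle_trans with (/ (2 * PI * 1) * ((M * (Cmod z / rho) ^ n * 2) * (2 * PI - 0))).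
      * apply Rmult_le_compat_l; [left; apply Rinv_0_lt_compat; lra|exact B].
      * right. field. lra.
Qed.

End CauchyDisc.

(** Third order is what [limit_at_infinity] requires: the inverted function carries a factor [x^2],
    and an error [O(x^3)] there is [O(1/w)] for the original. The radius [r / 4] is half that of the
    auxiliary circle. *)
Lemma taylor_order3 (f : C -> C) (r : R) : 0 < r ->
  (forall z, Cmod z < r -> exists l, wder f z l 0) ->
  exists a0 a1 a2 : C, exists M, 0 <= M /\ forall z, Cmod z <= r / 4 ->
    Cmod (f z - (a0 + a1 * z + a2 * z * z)) <= M * Cmod z ^ 3.
Proof.
  intros Hr Hf.
  destruct (taylor_remainder f r (r / 2) ltac:(lra) Hf) as (a & Rem & M & T).
  exists (a 0%nat), (a 1%nat), (a 2%nat), (M / (r / 2) ^ 3).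
  assert (0 < (r / 2) ^ 3) by (apply pow_lt; lra).
  assert (HM : 0 <= M).
  { destruct (T 0 ltac:(rewrite Cmod_0; lra)) as [_ T0].
    destruct (T0 O) as [_ T1]. simpl in T1. pose proof (Cmod_ge_0 (Rem O 0)). lra. }
  split; [apply Rmult_le_pos; [lra|left; now apply Rinv_0_lt_compat]|].
  intros z Hz. destruct (T z ltac:(lra)) as [T0 T1].
  destruct (T1 0%nat) as [E0 _]. destruct (T1 1%nat) as [E1 _].
  destruct (T1 2%nat) as [E2 _]. destruct (T1 3%nat) as [_ B].
  rewrite <- T0, E0, E1, E2.
  replace (a 0%nat * z ^ 0 + (a 1%nat * z ^ 1 + (a 2%nat * z ^ 2 + Rem 3%nat z))
     - (a 0%nat + a 1%nat * z + a 2%nat * z * z))%C with (Rem 3%nat z) by ring.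
  eapply Rle_trans; [exact B|]. right. field. lra.
Qed.

(** The Taylor coefficients vanish in turn: on the segment of zeros the first surviving term
    [a n * x^n] must cancel a remainder of order [x^(n+1)]. Then [f] equals every remainder, and
    these tend to 0. The sign [sg] allows for zeros on either side of the origin. *)
Lemma identity_theorem (f : C -> C) (r e sg : R) : 0 < r -> 0 < e -> (sg = 1 \/ sg = -1) ->
  (forall z, Cmod z < r -> exists l, wder f z l 0) ->
  (forall x, 0 < x < e -> f (RtoC (sg * x)) = RtoC 0) ->
  forall z, Cmod z <= r / 4 -> f z = RtoC 0.
Proof.
  intros Hr He Hsg Hf Hx.
  destruct (taylor_remainder f r (r / 2) ltac:(lra) Hf) as (a & Rem & M & T).
  assert (Q : forall n, forall z, Cmod z <= r / 4 -> Rem n z = f z).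
  { induction n as [|n IH]; intros z Hz; destruct (T z ltac:(lra)) as [T0 T1]; [exact T0|].
    destruct (T1 n) as [E _].
    assert (Z : a n = RtoC 0).
    { apply Cmod_eq_0, Rle_antisym; [|apply Cmod_ge_0]. apply Rnot_lt_le. intros P.
      set (A := Rabs M / (r / 2) ^ S n).
      assert (HA : 0 <= A).
      { apply Rmult_le_pos; [apply Rabs_pos|]. left. apply Rinv_0_lt_compat, pow_lt. lra. }
      (* The last entry gives [A * x < Cmod (a n)], contrary to the comparison of orders. *)
      set (x := Rmin (e / 2) (Rmin (r / 4) (Cmod (a n) / (2 * (A + 1))))).
      assert (x <= e / 2) by rmin.
      assert (x <= r / 4) by rmin.
      assert (Hxa : x <= Cmod (a n) / (2 * (A + 1))) by rmin.
      assert (0 < x).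
      { repeat apply Rmin_pos; try lra. apply Rdiv_lt_0_compat; lra. }
      assert (Cx : Cmod (RtoC (sg * x)) = x).
      { rewrite Cmod_R. destruct Hsg as [-> | ->]; [rewrite Rabs_pos_eq|rewrite Rabs_left]; lra. }
      destruct (T (RtoC (sg * x)) ltac:(lra)) as [_ Tx].
      destruct (Tx n) as [Ex _]. destruct (Tx (S n)) as [_ Bx].
      rewrite IH, Hx in Ex by lra.
      assert (E1 : (a n * RtoC (sg * x) ^ n)%C = (- Rem (S n) (RtoC (sg * x)))%C).
      { replace (a n * RtoC (sg * x) ^ n)%C with
          (a n * RtoC (sg * x) ^ n + Rem (S n) (RtoC (sg * x)) - Rem (S n) (RtoC (sg * x)))%C by ring.
        rewrite <- Ex. ring. }
      assert (E2 : Cmod (a n) * x ^ n <= A * x ^ S n).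
      { replace (Cmod (a n) * x ^ n) with (Cmod (a n * RtoC (sg * x) ^ n))
          by (rewrite Cmod_mult, Cmod_pow, Cx; reflexivity).
        rewrite E1, Cmod_opp. eapply Rle_trans; [exact Bx|]. rewrite Cx.
        unfold A, Rdiv. rewrite Rpow_mult_distr, pow_inv.
        assert (0 <= x ^ S n * / (r * / 2) ^ S n).
        { apply Rmult_le_pos; [apply pow_le; lra|left; apply Rinv_0_lt_compat, pow_lt; lra]. }
        pose proof (Rle_abs M). nra. }
      assert (0 < x ^ n) by (apply pow_lt; lra).
      assert (Cmod (a n) <= A * x).
      { apply Rmult_le_reg_r with (x ^ n); [lra|]. simpl in E2. lra. }
      assert (x * (2 * (A + 1)) <= Cmod (a n)).
      { apply Rle_trans with (Cmod (a n) / (2 * (A + 1)) * (2 * (A + 1)));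
          [apply Rmult_le_compat_r; lra|right; field; lra]. }
      nra. }
    rewrite <- (IH z Hz), E, Z. ring. }
  intros z Hz. apply Cmod_eq_0, Rle_antisym; [|apply Cmod_ge_0].
  destruct (T z ltac:(lra)) as [_ T1].
  assert (B : forall n, Cmod (f z) <= Rabs M * (/ 2) ^ n).
  { intros n. rewrite <- (Q n z Hz). destruct (T1 n) as [_ B].
    eapply Rle_trans; [exact B|].
    assert (P1 : 0 <= Cmod z / (r / 2) <= / 2).
    { split; [apply Rmult_le_pos; [apply Cmod_ge_0|left; apply Rinv_0_lt_compat; lra]|].
      apply Rmult_le_reg_r with (r / 2); [lra|].
      replace (Cmod z / (r / 2) * (r / 2)) with (Cmod z) by (field; lra). lra. }
    pose proof (pow_incr _ _ n P1). pose proof (pow_le _ n (proj1 P1)). pose proof (Rle_abs M).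
    pose proof (Rabs_pos M). nra. }
  apply Rnot_lt_le. intros P.
  assert (L : is_lim_seq (fun n => Rabs M * (/ 2) ^ n) 0).
  { replace 0 with (Rabs M * 0) by ring. apply (is_lim_seq_scal_l _ (Rabs M) 0).
    apply is_lim_seq_geom. rewrite Rabs_pos_eq; lra. }
  pose proof (is_lim_seq_le (fun _ => Cmod (f z)) _ (Cmod (f z)) 0 B (is_lim_seq_const _) L) as N.
  simpl in N. lra.
Qed.

(** * Primitives on discs *)

(** [V] is the radial integral. The homotopy fills the triangle with vertices [0], [z] and [z'], one
    side of the parameter square being collapsed to [0], so the increment of [V] is the integral
    over the segment from [z] to [z']. *)
Lemma disc_primitive (v : C -> C) (r : R) :
  (forall z, Cmod z < r -> exists l, wder v z l 0) ->
  exists V : C -> C, forall z, Cmod z < r -> wder V z (v z) 0.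
Proof.
  intros Hv.
  assert (Hc : forall z, Cmod z < r -> ccont v z).
  { intros z Hz. destruct (Hv z Hz) as [l W]. exact (wder_cont _ _ _ _ W). }
  set (V := fun z => CInt (fun t => v (RtoC t * z) * z)%C 0 1).
  exists V. intros z Hz.
  assert (Seg : forall p q s, Cmod p < r -> Cmod q < r -> 0 <= s <= 1 ->
            Cmod (p + RtoC s * (q - p)) < r).
  { intros p q s Hp Hq Hs.
    replace (p + RtoC s * (q - p))%C with (RtoC (1 - s) * p + RtoC s * q)%C
      by (rewrite RtoC_minus; ring).
    eapply Rle_lt_trans; [apply Cmod_triangle|].
    rewrite !Cmod_scal, !Rabs_pos_eq by lra. 
    destruct (Rle_dec (Cmod p) (Cmod q)).
    - apply Rle_lt_trans with (Cmod q); [nra|exact Hq].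
    - apply Rle_lt_trans with (Cmod p); [nra|exact Hp]. }
  assert (Rc : forall p d s, Cmod (p + RtoC s * d) < r -> rcont (fun s => v (p + RtoC s * d) * d)%C s).
  { intros p d s Hs. apply rcont_mult; [|apply rcont_const].
    apply (rcont_ccont v (fun s => p + RtoC s * d)%C); [|now apply Hc].
    apply cderiv_rcont with d. apply cderiv_linear. }
  assert (D : forall z', Cmod z' < r ->
     (V z' - V z)%C = CInt (fun s => v (z + RtoC s * (z' - z)) * (z' - z))%C 0 1).
  { intros z' Hz'.
    pose proof (Goursat_homotopy v (fun s t => RtoC t * (z + RtoC s * (z' - z)))%C
       (fun s t => RtoC t * (z' - z))%C (fun s t => z + RtoC s * (z' - z))%C 0 1 0 1
       (r + Cmod (z' - z))) as Q. cbv beta in Q.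
    specialize (Q ltac:(lra) ltac:(lra)).
    lapply Q; clear Q; [intros Q|].
    - rewrite (CInt_ext (fun s => v (RtoC 0 * (z + RtoC s * (z' - z))) * (RtoC 0 * (z' - z)))%C
        (fun _ => RtoC 0)) in Q; [|lra|intros t _; ring].
      rewrite (CInt_unique (fun _ => RtoC 0) 0 1 _ (is_CInt_const _ _ _)) in Q.
      rewrite (CInt_ext (fun t => v (RtoC t * (z + RtoC 1 * (z' - z))) * (z + RtoC 1 * (z' - z)))%C
        (fun t => v (RtoC t * z') * z')%C) in Q;
        [|lra|intros t _; replace (z + RtoC 1 * (z' - z))%C with z' by ring; reflexivity].
      rewrite (CInt_ext (fun t => v (RtoC t * (z + RtoC 0 * (z' - z))) * (z + RtoC 0 * (z' - z)))%C
        (fun t => v (RtoC t * z) * z)%C) in Q;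
        [|lra|intros t _; replace (z + RtoC 0 * (z' - z))%C with z by ring; reflexivity].
      rewrite (CInt_ext (fun s => v (RtoC 1 * (z + RtoC s * (z' - z))) * (RtoC 1 * (z' - z)))%C
        (fun s => v (z + RtoC s * (z' - z)) * (z' - z))%C) in Q;
        [|lra|intros t _; rewrite !Cmult_1_l; reflexivity].
      unfold V.
      match type of Q with (_ + ?A)%C = (?B + ?D)%C => replace A with (RtoC (1 - 0) * 0 + A)%C by ring end.
      rewrite Q. ring.
    - intros s t Hs Ht. pose proof (Seg z z' s Hz Hz' Hs) as Hst.
      split; [|split; [|split; [|split; [|split; [|split]]]]].
      + destruct z, z'. split; unfold Re, Im; simpl; auto_derive; trivial; ring.
      + destruct z, z'. split; unfold Re, Im; simpl; auto_derive; trivial; ring.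
      + apply rcont_const.
      + apply rcont_const.
      + rewrite Cmod_scal, Rabs_pos_eq by lra. pose proof (Cmod_ge_0 (z' - z)).
        pose proof (Cmod_ge_0 z). nra.
      + pose proof (Cmod_ge_0 (z' - z)). lra.
      + apply Hv. rewrite Cmod_scal, Rabs_pos_eq by lra.
        pose proof (Cmod_ge_0 (z + RtoC s * (z' - z))). nra. }
  intros eps Heps. destruct (Hc z Hz eps Heps) as (d & Hd & K).
  exists (Rmin d (r - Cmod z)). split; [apply Rmin_pos; lra|].
  intros z' Hz'. pose proof (Rmin_l d (r - Cmod z)). pose proof (Rmin_r d (r - Cmod z)).
  assert (Hr' : Cmod z' < r).
  { pose proof (Cmod_triangle_rev z' z). lra. }
  rewrite (D z' Hr').
  assert (I : is_CInt (fun s => v (z + RtoC s * (z' - z)) * (z' - z) + - v z * (z' - z))%C 0 1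
     (CInt (fun s => v (z + RtoC s * (z' - z)) * (z' - z))%C 0 1
        + RtoC (1 - 0) * (- v z * (z' - z)))%C).
  { apply (is_RInt_plus (V := C_R_NormedModule)); [|apply is_CInt_const].
    apply is_CInt_rcont; [lra|]. intros s Hs. apply Rc. now apply Seg. }
  apply (is_CInt_bound _ 0 1 (eps * Cmod (z' - z))) in I; [|lra|].
  - match goal with |- Cmod ?x <= _ => match type of I with Cmod ?y <= _ => replace x with y end end.
    + lra.
    + rewrite Rminus_0_r. ring.
  - intros s Hs. replace (v (z + RtoC s * (z' - z)) * (z' - z) + - v z * (z' - z))%C
      with ((v (z + RtoC s * (z' - z)) - v z) * (z' - z))%C by ring.
    rewrite Cmod_mult. apply Rmult_le_compat_r; [apply Cmod_ge_0|]. left. apply K.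
    replace (z + RtoC s * (z' - z) - z)%C with (RtoC s * (z' - z))%C by ring.
    rewrite Cmod_scal, Rabs_pos_eq by lra. pose proof (Cmod_ge_0 (z' - z)). nra.
Qed.

(** * Polar paths *)

Lemma polar_form (z : C) : exists th, - PI <= th <= PI /\ z = (RtoC (Cmod z) * Cis th)%C.
Proof.
  destruct (Req_dec (Cmod z) 0) as [E|E].
  { exists 0. pose proof PI_RGT_0. split; [lra|]. rewrite E. apply Cmod_eq_0 in E. rewrite E. ring. }
  pose proof (Cmod_ge_0 z). set (m := Cmod z) in *.
  pose proof (Cmod_sqr z) as S. fold m in S.
  set (u := Re z / m).
  assert (Hu : Re z = m * u) by (unfold u; field; lra).
  assert (Bu : -1 <= u <= 1).
  { pose proof (re_le_Cmod z) as B. fold m in B. rewrite Hu in B. apply Rabs_le_between in B. nra. }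
  assert (Q : Im z * Im z = m * m * (1 - u * u)) by (rewrite Hu in S; nra).
  pose proof (acos_bound u).
  assert (Sq : sqrt (1 - u ^ 2) * sqrt (1 - u ^ 2) = 1 - u * u).
  { rewrite sqrt_sqrt; [ring|nra]. }
  pose proof (sqrt_pos (1 - u ^ 2)).
  assert (C1 : cos (acos u) = u) by (apply cos_acos; lra).
  assert (S1 : sin (acos u) = sqrt (1 - u ^ 2)).
  { rewrite sin_acos by lra. unfold Rsqr. f_equal. ring. }
  set (k := sqrt (1 - u ^ 2)) in *.
  destruct (Rle_dec 0 (Im z)) as [P|P].
  - exists (acos u). split; [lra|]. unfold Cis. rewrite C1, S1.
    assert (Im z = m * k).
    { apply Rsqr_inj; [lra|nra|]. unfold Rsqr. rewrite Q, <- Sq. ring. }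
    destruct z; unfold Re, Im in *; simpl in *. Ceq; lra.
  - exists (- acos u). split; [lra|]. unfold Cis. rewrite cos_neg, sin_neg, C1, S1.
    assert (- Im z = m * k).
    { apply Rsqr_inj; [lra|nra|]. unfold Rsqr. rewrite <- Sq in Q. nra. }
    destruct z; unfold Re, Im in *; simpl in *. Ceq; lra.
Qed.

Lemma cderiv_spiral (m0 m1 th0 th1 t : R) :
  cderiv (fun t => RtoC (m0 + t * m1) * Cis (th0 + t * th1))%C t
    (RtoC m1 * Cis (th0 + t * th1) + RtoC (m0 + t * m1) * (RtoC th1 * (Ci * Cis (th0 + t * th1)))).
Proof.
  split; unfold Cis, Re, Im; simpl; auto_derive; trivial; ring.
Qed.

Lemma interpolation_bounds (a b t : R) : 0 <= t <= 1 ->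
  Rmin a b <= a + t * (b - a) <= Rmax a b.
Proof. intros H. unfold Rmin, Rmax. destruct Rle_dec; split; nra. Qed.

Lemma cderiv_unique_0 (D : C -> C) (P : C -> Prop) :
  (forall z, P z -> wder D z 0 0) ->
  forall (phi dphi : R -> C) (a b : R), a <= b ->
    (forall t, a <= t <= b -> P (phi t) /\ cderiv phi t (dphi t)) -> D (phi a) = D (phi b).
Proof.
  intros HD phi dphi a b Hab H.
  assert (B : Cmod (D (phi b) - D (phi a)) <= 0 * (b - a)).
  { apply (Cmod_increment_le_const (fun t => D (phi t)) (fun _ => RtoC 0) 0 a b Hab).
    - intros t Ht. destruct (H t Ht) as [H1 H2].
      pose proof (wder_cderiv _ _ _ _ _ _ H2 (HD _ H1)) as W.
      replace (RtoC 0) with (0 * dphi t + 0 * Cconj (dphi t))%C by ring. exact W.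
    - intros t _. rewrite Cmod_0. lra. }
  assert (E : (D (phi b) - D (phi a))%C = RtoC 0).
  { apply Cmod_eq_0. pose proof (Cmod_ge_0 (D (phi b) - D (phi a))). lra. }
  replace (D (phi b)) with (D (phi b) - D (phi a) + D (phi a))%C by ring. rewrite E. ring.
Qed.

(* [a] and [b] are joined by an Archimedean spiral inside the annulus. *)
Lemma annulus_constant (D : C -> C) (r1 : R) (r2 : Rbar) :
  (0 <= r1) ->
  (forall z, r1 < Cmod z -> Rbar_lt (Cmod z) r2 -> wder D z 0 0) ->
  forall a b, r1 < Cmod a -> Rbar_lt (Cmod a) r2 -> r1 < Cmod b -> Rbar_lt (Cmod b) r2 -> D a = D b.
Proof.
  intros H1 HD a b Ha1 Ha2 Hb1 Hb2.
  destruct (polar_form a) as (tha & _ & Ea). destruct (polar_form b) as (thb & _ & Eb).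
  set (phi := fun t => (RtoC (Cmod a + t * (Cmod b - Cmod a)) * Cis (tha + t * (thb - tha)))%C).
  assert (P0 : phi 0 = a).
  { transitivity (RtoC (Cmod a) * Cis tha)%C; [|now symmetry].
    unfold phi. f_equal; f_equal; ring. }
  assert (P1 : phi 1 = b).
  { transitivity (RtoC (Cmod b) * Cis thb)%C; [|now symmetry].
    unfold phi. f_equal; f_equal; ring. }
  rewrite <- P0, <- P1.
  apply (cderiv_unique_0 D (fun z => r1 < Cmod z /\ Rbar_lt (Cmod z) r2)) with
    (dphi := fun t => (RtoC (Cmod b - Cmod a) * Cis (tha + t * (thb - tha))
      + RtoC (Cmod a + t * (Cmod b - Cmod a)) * (RtoC (thb - tha) * (Ci * Cis (tha + t * (thb - tha)))))%C); [|lra|].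
  - intros z [K1 K2]. now apply HD.
  - intros t Ht. split; [|apply cderiv_spiral].
    unfold phi. rewrite Cmod_circle
      by (pose proof (Cmod_ge_0 a); pose proof (Cmod_ge_0 b); nra).
    set (ca := Cmod a) in *. set (cb := Cmod b) in *.
    pose proof (interpolation_bounds ca cb t Ht) as [B1 B2].
    split; [apply Rlt_le_trans with (2 := B1); now apply Rmin_glb_lt|].
    apply Rbar_le_lt_trans with (Rmax ca cb); [exact B2|].
    unfold Rmax. now destruct Rle_dec.
Qed.

(** * The end near the puncture *)

(** Differentiability at a single point, whereas [holomorphic_at] asks for a whole neighbourhood. *)
Definition hol (f : C -> C) (z : C) : Prop := exists l, wder f z l 0.

Lemma hol_ccont (f : C -> C) (z : C) : hol f z -> ccont f z.
Proof. intros [l W]. exact (wder_cont _ _ _ _ W). Qed.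

Lemma hol_const (c z : C) : hol (fun _ => c) z.
Proof. eexists. apply wder_const. Qed.

Lemma hol_id (z : C) : hol (fun z => z) z.
Proof. eexists. apply wder_id. Qed.

Lemma hol_plus (f g : C -> C) (z : C) : hol f z -> hol g z -> hol (fun z => f z + g z)%C z.
Proof. intros [l W] [l' W']. eexists. apply holo_plus; eassumption. Qed.

Lemma hol_minus (f g : C -> C) (z : C) : hol f z -> hol g z -> hol (fun z => f z - g z)%C z.
Proof. intros [l W] [l' W']. eexists. apply holo_minus; eassumption. Qed.

Lemma hol_mult (f g : C -> C) (z : C) : hol f z -> hol g z -> hol (fun z => f z * g z)%C z.
Proof. intros [l W] [l' W']. eexists. apply holo_mult; eassumption. Qed.

Lemma hol_inv (f : C -> C) (z : C) : f z <> RtoC 0 -> hol f z -> hol (fun z => / f z)%C z.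
Proof. intros H [l W]. eexists. apply holo_inv; eassumption. Qed.

Lemma hol_pow (f : C -> C) (n : nat) (z : C) : hol f z -> hol (fun z => f z ^ n)%C z.
Proof. intros H. induction n; simpl; [apply hol_const|now apply hol_mult]. Qed.

Lemma hol_ext (f g : C -> C) (z : C) (r : R) : 0 < r ->
  (forall w, Cmod (w - z) < r -> f w = g w) -> hol f z -> hol g z.
Proof. intros Hr E [l W]. exists l. exact (wder_ext _ _ _ _ _ _ Hr E W). Qed.

Lemma holomorphic_at_hol (f : C -> C) (p : C) :
  holomorphic_at f p <-> exists r, 0 < r /\ forall z, Cmod (z - p) < r -> hol f z.
Proof. apply holomorphic_at_Cmod. Qed.

Lemma wder_C_derive (f : C -> C) (z l : C) : wder f z l 0 -> C_derive f z = l.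
Proof. intros W. apply is_C_derive_unique, wder_is_derive, W. Qed.

Lemma ccont_neq_0 (f : C -> C) (p : C) : ccont f p -> f p <> RtoC 0 ->
  exists d, 0 < d /\ forall z, Cmod (z - p) < d -> f z <> RtoC 0.
Proof.
  intros H Hp. apply Cmod_gt_0 in Hp. destruct (H _ Hp) as (d & Hd & K).
  exists d. split; [exact Hd|]. intros z Hz E. specialize (K z Hz).
  rewrite E in K. replace (0 - f p)%C with (- f p)%C in K by ring. rewrite Cmod_opp in K. lra.
Qed.

Lemma ccont_bounded (f : C -> C) (p : C) : ccont f p ->
  exists d, 0 < d /\ forall z, Cmod (z - p) < d -> Cmod (f z) <= Cmod (f p) + 1.
Proof.
  intros H. destruct (H _ Rlt_0_1) as (d & Hd & K).
  exists d. split; [exact Hd|]. intros z Hz. specialize (K z Hz).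
  pose proof (Cmod_triangle_rev (f z) (f p)). lra.
Qed.

(** Carries formulas known off a point, such as those for the Weierstrass forms, to the point
    itself. *)
Lemma ccont_agree (f g : C -> C) (p : C) (d : R) : 0 < d -> ccont f p -> ccont g p ->
  (forall z, z <> p -> Cmod (z - p) < d -> f z = g z) -> f p = g p.
Proof.
  intros Hd Hf Hg E.
  destruct (Req_dec (Cmod (f p - g p)) 0) as [Z|Z].
  { apply Cmod_eq_0 in Z. replace (f p) with (f p - g p + g p)%C by ring. rewrite Z. ring. }
  exfalso. pose proof (Cmod_ge_0 (f p - g p)).
  set (e := Cmod (f p - g p) / 2). assert (He : 0 < e) by (unfold e; lra).
  destruct (Hf e He) as (d1 & Hd1 & K1). destruct (Hg e He) as (d2 & Hd2 & K2).
  set (m := Rmin d (Rmin d1 d2)).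
  assert (0 < m) by (repeat apply Rmin_pos; lra).
  assert (m <= d) by rmin.
  assert (m <= d1) by rmin.
  assert (m <= d2) by rmin.
  set (z := (p + RtoC (m / 2))%C).
  assert (Hz : Cmod (z - p) = m / 2).
  { unfold z. replace (p + RtoC (m / 2) - p)%C with (RtoC (m / 2)) by ring.
    rewrite Cmod_R, Rabs_pos_eq; lra. }
  assert (z <> p).
  { intros E1. rewrite E1 in Hz. replace (p - p)%C with (RtoC 0) in Hz by ring.
    rewrite Cmod_0 in Hz. lra. }
  specialize (K1 z ltac:(lra)). specialize (K2 z ltac:(lra)).
  rewrite <- (E z) in K2 by (auto; lra).
  pose proof (Cmod_sub_triangle (f p) (f z) (g p)) as T. rewrite (Cmod_sub_sym (f p) (f z)) in T.
  unfold e in *. lra.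
Qed.

Lemma exp_le (a b : R) : a <= b -> exp a <= exp b.
Proof. intros [H | ->]; [left; now apply exp_increasing|lra]. Qed.

Lemma is_derive_ln_Cmod (phi : R -> C) (t : R) (d : C) : phi t <> RtoC 0 ->
  cderiv phi t d -> is_derive (fun s => ln (Cmod (phi s))) t (Re (d / phi t)).
Proof.
  intros H [H1 H2].
  assert (P : 0 < Cmod (phi t)) by now apply Cmod_gt_0.
  assert (P2 : 0 < Re (phi t) ^ 2 + Im (phi t) ^ 2).
  { rewrite <- Cmod2_alt. now apply pow_lt. }
  apply (is_derive_ext (fun s => ln (sqrt (Re (phi s) ^ 2 + Im (phi s) ^ 2)))).
  { intros s. reflexivity. }
  replace (Re (d / phi t)) with ((Re d * Re (phi t) + Im d * Im (phi t)) / (Re (phi t) ^ 2 + Im (phi t) ^ 2)).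
  - evar_last.
    + apply (is_derive_comp ln (fun s => sqrt (Re (phi s) ^ 2 + Im (phi s) ^ 2))).
      * apply is_derive_Reals, derivable_pt_lim_ln. now apply sqrt_lt_R0.
      * apply (is_derive_comp sqrt (fun s => Re (phi s) ^ 2 + Im (phi s) ^ 2)).
        -- apply is_derive_Reals, derivable_pt_lim_sqrt. exact P2.
        -- apply (is_derive_plus (V := R_NormedModule) (fun s => Re (phi s) ^ 2) (fun s => Im (phi s) ^ 2));
           apply is_derive_pow; eassumption.
    + unfold scal, plus. simpl. unfold mult. simpl.
      set (q := Re (phi t) * (Re (phi t) * 1) + Im (phi t) * (Im (phi t) * 1)).
      simpl in P2. fold q in P2.
      assert (0 < sqrt q) by now apply sqrt_lt_R0.
      assert (S : sqrt q * sqrt q = q) by (apply sqrt_sqrt; lra).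
      assert (E : forall a : R, a * / (2 * sqrt q) * / sqrt q = a / (2 * q)).
      { intros a. rewrite <- S at 3. field. lra. }
      rewrite E. field. lra.
  - unfold Cdiv, Cinv, Re, Im in *. destruct (phi t), d. simpl in *. field. lra.
Qed.

Lemma Rabs_increment_le (f df : R -> R) (K a b : R) : a <= b ->
  (forall t, a <= t <= b -> is_derive f t (df t)) ->
  (forall t, a <= t <= b -> Rabs (df t) <= K) -> Rabs (f b - f a) <= K * (b - a).
Proof.
  intros Hab H1 H2. rewrite <- Cmod_R, RtoC_minus.
  apply (Cmod_increment_le_const (fun t => RtoC (f t)) (fun t => RtoC (df t))); auto.
  - intros t Ht. split; [now apply H1|].
    exact (is_derive_const (V := R_NormedModule) 0 t).
  - intros t Ht. rewrite Cmod_R. now apply H2.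
Qed.

(** The derivative of [ln |g|] along a segment is [Re l], so [ln |g|] stays bounded on a segment of
    finite length. One segment ending at [p] is enough to exclude a zero or a pole there. *)
Lemma log_derivative_bound (g l : C -> C) (p : C) (d M : R) : 0 < d -> 0 <= M ->
  (forall z, z <> p -> Cmod (z - p) < d ->
     g z <> RtoC 0 /\ wder g z (g z * l z) 0 /\ Cmod (l z) <= M) ->
  exists A B, 0 < A /\ forall x, 0 < x < d -> A <= Cmod (g (p + RtoC x)%C) <= B.
Proof.
  intros Hd HM H.
  assert (P : forall x, 0 < x < d -> (p + RtoC x)%C <> p /\ Cmod (p + RtoC x - p) < d).
  { intros x Hx. replace (p + RtoC x - p)%C with (RtoC x) by ring.
    rewrite Cmod_R, Rabs_pos_eq by lra. split; [|lra].
    intros E. assert (E' : (p + RtoC x - p)%C = RtoC 0) by (rewrite E; ring).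
    replace (p + RtoC x - p)%C with (RtoC x) in E' by ring. injection E'. lra. }
  assert (D : forall x, 0 < x < d -> is_derive (fun x => ln (Cmod (g (p + RtoC x)%C))) x (Re (l (p + RtoC x)%C))).
  { intros x Hx. destruct (P x Hx) as [P1 P2]. destruct (H _ P1 P2) as (H1 & H2 & _).
    evar_last.
    - apply (is_derive_ln_Cmod (fun x => g (p + RtoC x)%C) x (g (p + RtoC x)%C * l (p + RtoC x))%C); [exact H1|].
      assert (Lx : cderiv (fun x => p + RtoC x)%C x 1).
      { apply (cderiv_ext (fun x => p + RtoC x * 1)%C); [intros; ring|apply cderiv_linear]. }
      pose proof (wder_cderiv g _ x _ _ _ Lx H2) as W.
      replace (g (p + RtoC x)%C * l (p + RtoC x))%C with
        (g (p + RtoC x)%C * l (p + RtoC x) * 1 + 0 * Cconj 1)%C by ring. exact W.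
    - f_equal. field. exact H1. }
  set (x0 := d / 2). set (L0 := ln (Cmod (g (p + RtoC x0)%C))).
  assert (B : forall x, 0 < x < d -> Rabs (ln (Cmod (g (p + RtoC x)%C)) - L0) <= M * d).
  { intros x Hx.
    assert (K : forall a b, 0 < a -> b < d -> a <= b ->
       Rabs (ln (Cmod (g (p + RtoC b)%C)) - ln (Cmod (g (p + RtoC a)%C))) <= M * d).
    { intros a b Ha Hb Hab. apply Rle_trans with (M * (b - a)); [|apply Rmult_le_compat_l; lra].
      apply (Rabs_increment_le (fun x => ln (Cmod (g (p + RtoC x)%C))) (fun x => Re (l (p + RtoC x)%C))); auto.
      - intros t Ht. apply D. lra.
      - intros t Ht. eapply Rle_trans; [apply re_le_Cmod|]. destruct (P t ltac:(lra)) as [P1 P2].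
        apply (H _ P1 P2). }
    unfold L0, x0. destruct (Rle_dec (d / 2) x).
    - apply K; lra.
    - rewrite Rabs_minus_sym. apply K; lra. }
  exists (exp (L0 - M * d)), (exp (L0 + M * d)). split; [apply exp_pos|].
  intros x Hx. destruct (P x Hx) as [P1 P2]. destruct (H _ P1 P2) as (H1 & _ & _).
  apply Cmod_gt_0 in H1. specialize (B x Hx). apply Rabs_le_between in B.
  rewrite <- (exp_ln (Cmod (g (p + RtoC x)%C))) by exact H1.
  split; apply exp_le; lra.
Qed.

Lemma Cmod_pos_dist (z p : C) : z <> p -> 0 < Cmod (z - p).
Proof. intros H. now apply Cmod_gt_0, Csub_neq_0. Qed.

Lemma Csub_0_r (z : C) : (z - 0)%C = z.
Proof. ring. Qed.

Lemma dlog_wder (g : C -> C) (z : C) : g z <> RtoC 0 -> hol g z ->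
  wder g z (g z * dlog g z) 0.
Proof.
  intros H [l W]. unfold dlog. rewrite (wder_C_derive _ _ _ W).
  replace (g z * (l / g z))%C with l; [exact W|]. field. exact H.
Qed.

(** Zeros and poles of [g] are poles of [dg/g], which has none near the puncture except the puncture
    itself. Concretely, [|g|] would tend to 0 or to infinity at such a point, although the
    logarithmic derivative agrees around it with a function continuous there. *)
Lemma gauss_map_regular (r : R) (g f : C -> C) (X : C -> R3) : 0 < r ->
  weierstrass_immersion (open_punctured_disk r) g f X -> has_pole (dlog g) (RtoC 0) 2 ->
  exists (r0 : R) (u : C -> C), 0 < r0 <= r /\ (forall z, Cmod z < r0 -> hol u z) /\
    u (RtoC 0) <> RtoC 0 /\
    forall z, z <> RtoC 0 -> Cmod z < r0 ->
      g z <> RtoC 0 /\ wder g z (g z * (u z * / (z * z))) 0.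
Proof.
  intros Hr HW (u & Hu & Hu0 & Hd).
  apply holomorphic_at_hol in Hu. destruct Hu as (ru & Hru & Hu).
  apply locally'_Cmod in Hd. destruct Hd as (rd & Hrd & Hd).
  set (r0 := Rmin r (Rmin ru rd)).
  assert (r0 <= r) by rmin.
  assert (r0 <= ru) by rmin.
  assert (r0 <= rd) by rmin.
  assert (H2 : 0 < r0) by (repeat apply Rmin_pos; lra).
  assert (Hu' : forall z, Cmod z < r0 -> hol u z).
  { intros z Hz. apply Hu. rewrite Csub_0_r. lra. }
  exists r0, u. split; [lra|]. split; [exact Hu'|]. split; [exact Hu0|].
  intros p Hp0 Hp.
  set (l := fun z => (u z * / (z * z))%C).
  assert (El : forall z, z <> RtoC 0 -> Cmod z < r0 -> dlog g z = l z).
  { intros z Hz Hz2. rewrite Hd by (auto; rewrite Csub_0_r; lra).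
    unfold l, Cdiv. rewrite Csub_0_r. simpl. now rewrite Cmult_1_r. }
  assert (Pp : 0 < Cmod p) by now apply Cmod_gt_0.
  assert (Dp : open_punctured_disk r p) by (unfold open_punctured_disk; lra).
  assert (Cl : ccont l p).
  { apply hol_ccont. apply hol_mult; [now apply Hu'|].
    apply (hol_inv (fun z => z * z)%C); [now apply Cmult_neq_0|].
    apply hol_mult; apply hol_id. }
  destruct (ccont_bounded _ _ Cl) as (e2 & He2 & B2).
  (* The formulas supply the nonvanishing of [g] near [p], off [p], so that [ln |g|] is meaningful
     along the segment. *)
  destruct (weierstrass_formula _ _ _ _ HW) as (phi1 & phi2 & Hphi & _).
  destruct (Hphi p Dp) as (_ & _ & Hg). apply locally'_Cmod in Hg.
  destruct Hg as (e1 & He1 & Hg).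
  assert (near : forall z, Cmod (z - p) < Rmin (Cmod p) (r0 - Cmod p) -> z <> RtoC 0 /\ Cmod z < r0).
  { intros z Hz. pose proof (Rmin_l (Cmod p) (r0 - Cmod p)).
    pose proof (Rmin_r (Cmod p) (r0 - Cmod p)). split.
    - intros ->. replace (0 - p)%C with (- p)%C in Hz by ring. rewrite Cmod_opp in Hz. lra.
    - pose proof (Cmod_triangle_rev z p). lra. }
  set (M := Cmod (l p) + 1) in *.
  assert (HM : 0 <= M) by (unfold M; pose proof (Cmod_ge_0 (l p)); lra).
  assert (key : forall e, 0 < e -> (forall z, z <> p -> Cmod (z - p) < e -> hol g z) ->
    exists d A B, 0 < d /\ 0 < A /\ forall x, 0 < x < d -> A <= Cmod (g (p + RtoC x)%C) <= B).
  { intros e He Hol.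
    set (d := Rmin (Rmin e e1) (Rmin e2 (Rmin (Cmod p) (r0 - Cmod p)))).
    assert (d <= e) by rmin.
    assert (d <= e1) by rmin.
    assert (d <= e2) by rmin.
    assert (d <= Rmin (Cmod p) (r0 - Cmod p)) by rmin.
    assert (Hdp : 0 < d) by (repeat apply Rmin_pos; lra).
    destruct (log_derivative_bound g l p d M Hdp HM) as (A & B & HA & HB).
    - intros z Hz Hzd. destruct (near z ltac:(lra)) as [N1 N2].
      destruct (Hg z Hz ltac:(lra)) as [G0 _].
      split; [exact G0|]. split; [|apply B2; lra].
      rewrite <- El by auto. apply dlog_wder; [exact G0|]. apply Hol; [exact Hz|lra].
    - exists d, A, B. auto. }
  destruct (gauss_meromorphic _ _ _ _ HW p Dp) as [Hol | (n & Hn & v & Hv & Hv0 & Hgv)].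
  - apply holomorphic_at_hol in Hol. destruct Hol as (e & He & Hol).
    assert (Hgp : hol g p).
    { apply Hol. now rewrite Cmod_sub_self. }
    destruct (key e He (fun z _ => Hol z)) as (d & A & B & Hdp & HA & HB).
    assert (G0 : g p <> RtoC 0).
    { intros E. destruct (hol_ccont _ _ Hgp A HA) as (d' & Hd' & K).
      set (x := Rmin d d' / 2).
      pose proof (Rmin_l d d'). pose proof (Rmin_r d d').
      assert (0 < Rmin d d') by (apply Rmin_pos; lra).
      specialize (HB x ltac:(unfold x; lra)). specialize (K (p + RtoC x)%C).
      replace (p + RtoC x - p)%C with (RtoC x) in K by ring.
      rewrite Cmod_R, Rabs_pos_eq in K by (unfold x; lra). specialize (K ltac:(unfold x; lra)).
      rewrite E, Csub_0_r in K. lra. }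
    split; [exact G0|]. change (u p * / (p * p))%C with (l p). rewrite <- El by auto.
    now apply dlog_wder.
  - exfalso. apply holomorphic_at_hol in Hv. destruct Hv as (e & He & Hv).
    apply locally'_Cmod in Hgv. destruct Hgv as (e' & He' & Hgv).
    assert (Hvp : ccont v p).
    { apply hol_ccont, Hv. now rewrite Cmod_sub_self. }
    destruct (key (Rmin e e')) as (d & A & B & Hdp & HA & HB).
    + now apply Rmin_pos.
    + intros z Hz Hzd. pose proof (Rmin_l e e'). pose proof (Rmin_r e e').
      pose proof (Cmod_pos_dist _ _ Hz).
      apply (hol_ext (fun z => v z * / (z - p) ^ n)%C _ _ (Rmin (Cmod (z - p)) (e' - Cmod (z - p)))).
      * apply Rmin_pos; lra.
      * intros w Hw. pose proof (Rmin_l (Cmod (z - p)) (e' - Cmod (z - p))).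
        pose proof (Rmin_r (Cmod (z - p)) (e' - Cmod (z - p))).
        symmetry. apply Hgv.
        -- intros ->. rewrite Cmod_sub_sym in Hw. lra.
        -- pose proof (Cmod_sub_triangle w z p). lra.
      * apply hol_mult; [apply Hv; lra|].
        apply (hol_inv (fun z => (z - p) ^ n)%C); [now apply Cpow_nz, Csub_neq_0|].
        apply hol_pow, hol_minus; [apply hol_id|apply hol_const].
    + apply Cmod_gt_0 in Hv0.
      destruct (Hvp (Cmod (v p) / 2)) as (d2 & Hd2 & K); [lra|].
      set (q := Cmod (v p) / 2) in *. assert (Hq : 0 < q) by (unfold q; lra).
      (* At this point [|v|] is at least [q] by continuity, while boundedness of [|g|] gives
         [|v| <= B * x^n], which is below [q]. *)
      set (x := Rmin (Rmin (d / 2) (d2 / 2)) (Rmin (Rmin (e' / 2) 1) (q / (2 * (Rabs B + 1))))).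
      pose proof (Rabs_pos B).
      assert (x <= d / 2) by rmin.
      assert (x <= d2 / 2) by rmin.
      assert (x <= e' / 2) by rmin.
      assert (x <= 1) by rmin.
      assert (Xq : x <= q / (2 * (Rabs B + 1))) by rmin.
      assert (0 < x).
      { repeat apply Rmin_pos; try lra. apply Rdiv_lt_0_compat; lra. }
      assert (Ex : (p + RtoC x - p)%C = RtoC x) by ring.
      assert (Mx : Cmod (RtoC x) = x) by (rewrite Cmod_R, Rabs_pos_eq; lra).
      assert (Nx : (p + RtoC x)%C <> p).
      { intros E. rewrite E in Ex. replace (p - p)%C with (RtoC 0) in Ex by ring.
        rewrite <- Ex, Cmod_0 in Mx. lra. }
      specialize (K (p + RtoC x)%C). rewrite Ex, Mx in K. specialize (K ltac:(lra)).
      specialize (HB x ltac:(lra)).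
      rewrite Hgv in HB by (auto; rewrite Ex, Mx; lra).
      rewrite Ex, Cmod_div, Cmod_pow, Mx in HB.
      2:{ apply Cpow_nz, Cmod_neq_0. lra. }
      pose proof (Cmod_triangle_rev (v p) (v (p + RtoC x)%C)) as T.
      rewrite (Cmod_sub_sym (v p)) in T.
      assert (V1 : q <= Cmod (v (p + RtoC x)%C)) by (unfold q in *; lra).
      assert (V2 : x ^ n <= x).
      { destruct n; [lia|]. simpl. assert (0 <= x ^ n <= 1).
        { split; [apply pow_le; lra|]. rewrite <- (pow1 n). apply pow_incr. lra. } nra. }
      assert (V3 : 0 < x ^ n) by (apply pow_lt; lra).
      assert (V4 : Cmod (v (p + RtoC x)%C) <= B * x ^ n).
      { apply Rle_trans with (Cmod (v (p + RtoC x)%C) / x ^ n * x ^ n).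
        - right. field. lra.
        - apply Rmult_le_compat_r; lra. }
      assert (V5 : x * (2 * (Rabs B + 1)) <= q).
      { apply Rle_trans with (q / (2 * (Rabs B + 1)) * (2 * (Rabs B + 1)));
          [apply Rmult_le_compat_r; lra|right; field; lra]. }
      pose proof (Rle_abs B). unfold q in *. nra.
Qed.

(** Index [k] carries the power [z^-(k+1)], so growth of order two leaves only the first two
    coefficients: a nonzero last coefficient beyond them would dominate both the bound and the lower
    terms as [z] tends to 0. *)
Lemma laurent_tail (a : nat -> C) (N : nat) (M d : R) : 0 < d ->
  (forall z, z <> RtoC 0 -> Cmod z < d ->
     Cmod (sum_n (fun k => a k / z ^ S k)%C N) <= M / Cmod z ^ 2) ->
  exists c, forall z, z <> RtoC 0 -> sum_n (fun k => a k / z ^ S k)%C N = (a 0%nat / z + c / (z * z))%C.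
Proof.
  revert M d. induction N as [|N IH]; intros M d Hd H.
  - exists (RtoC 0). intros z Hz. rewrite sum_O. simpl. field. exact Hz.
  - destruct N as [|N].
    { exists (a 1%nat). intros z Hz. rewrite sum_Sn, sum_O. unfold plus. simpl. field. exact Hz. }
    assert (Z : a (S (S N)) = RtoC 0).
    { apply Cmod_eq_0, Rle_antisym; [|apply Cmod_ge_0]. apply Rnot_lt_le. intros P.
      assert (B : exists K, 0 <= K /\ forall z, z <> RtoC 0 -> Cmod z <= 1 ->
        Cmod (sum_n (fun k => a k / z ^ S k)%C (S N)) <= K / Cmod z ^ S (S N)).
      { generalize (S N) as n. induction n as [|n (K & HK & IHn)].
        - exists (Cmod (a 0%nat)). split; [apply Cmod_ge_0|]. intros z Hz Hz1. rewrite sum_O.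
          rewrite Cmod_div, Cmod_pow by now apply Cpow_nz. lra.
        - exists (K + Cmod (a (S n))). split; [pose proof (Cmod_ge_0 (a (S n))); lra|].
          intros z Hz Hz1. rewrite sum_Sn.
          eapply Rle_trans; [apply Cmod_triangle|].
          rewrite Cmod_div, Cmod_pow by now apply Cpow_nz.
          unfold Rdiv. rewrite Rmult_plus_distr_r. apply Rplus_le_compat_r.
          eapply Rle_trans; [now apply IHn|]. apply Rmult_le_compat_l; [exact HK|].
          apply Cmod_gt_0 in Hz. apply Rinv_le_contravar; [now apply pow_lt|].
          change (Cmod z ^ S (S n)) with (Cmod z * Cmod z ^ S n).
          assert (0 < Cmod z ^ S n) by now apply pow_lt. nra. }
      destruct B as (K & HK & B).
      set (x := Rmin (Rmin (d / 2) 1) (Cmod (a (S (S N))) / (2 * (K + Rabs M + 1)))).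
      pose proof (Rabs_pos M).
      assert (x <= d / 2) by rmin.
      assert (x <= 1) by rmin.
      assert (Xq : x <= Cmod (a (S (S N))) / (2 * (K + Rabs M + 1))) by rmin.
      assert (0 < x).
      { repeat apply Rmin_pos; try lra. apply Rdiv_lt_0_compat; lra. }
      assert (Mx : Cmod (RtoC x) = x) by (rewrite Cmod_R, Rabs_pos_eq; lra).
      assert (Nx : RtoC x <> RtoC 0) by (apply Cmod_neq_0; lra).
      specialize (B (RtoC x) Nx ltac:(lra)). specialize (H (RtoC x) Nx ltac:(lra)).
      rewrite sum_Sn in H. rewrite Mx in *.
      set (s := sum_n (fun k => a k / RtoC x ^ S k)%C (S N)) in *.
      set (t := (a (S (S N)) / RtoC x ^ S (S (S N)))%C) in *.
      change (Cmod (s + t) <= M / x ^ 2) in H.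
      assert (T : Cmod t <= Cmod (s + t) + Cmod s).
      { replace t with ((s + t) + - s)%C at 1 by ring.
        eapply Rle_trans; [apply Cmod_triangle|]. rewrite Cmod_opp. lra. }
      assert (Et : Cmod t = Cmod (a (S (S N))) / x ^ S (S (S N))).
      { unfold t. rewrite Cmod_div, Cmod_pow, Mx by now apply Cpow_nz. reflexivity. }
      assert (Px : 0 < x ^ S (S (S N))) by now apply pow_lt.
      assert (Q : Cmod (a (S (S N))) <= (M / x ^ 2 + K / x ^ S (S N)) * x ^ S (S (S N))).
      { apply Rle_trans with (Cmod t * x ^ S (S (S N))).
        - right. rewrite Et. field. lra.
        - apply Rmult_le_compat_r; lra. }
      replace ((M / x ^ 2 + K / x ^ S (S N)) * x ^ S (S (S N))) with (M * x ^ S N + K * x) in Q.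
      2:{ simpl. field. split; [apply pow_nonzero; lra|lra]. }
      assert (x ^ S N <= x).
      { simpl. assert (0 <= x ^ N <= 1).
        { split; [apply pow_le; lra|]. rewrite <- (pow1 N). apply pow_incr. lra. } nra. }
      assert (0 < x ^ S N) by now apply pow_lt.
      assert (V5 : x * (2 * (K + Rabs M + 1)) <= Cmod (a (S (S N)))).
      { apply Rle_trans with (Cmod (a (S (S N))) / (2 * (K + Rabs M + 1)) * (2 * (K + Rabs M + 1)));
          [apply Rmult_le_compat_r; lra|right; field; lra]. }
      pose proof (Rle_abs M). assert (M * x ^ S N <= Rabs M * x) by nra. nra. }
    assert (E : forall z, z <> RtoC 0 -> sum_n (fun k => a k / z ^ S k)%C (S (S N))
        = sum_n (fun k => a k / z ^ S k)%C (S N)).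
    { intros z Hz. rewrite sum_Sn, Z. unfold plus. simpl. unfold Cdiv. ring. }
    destruct (IH M d Hd) as [c Hc].
    + intros z Hz Hzd. rewrite <- E by exact Hz. now apply H.
    + exists c. intros z Hz. rewrite E by exact Hz. now apply Hc.
Qed.

(** The double pole bounds the Laurent sum by a multiple of [|z|^-2], which removes the higher
    terms, and the residue condition removes [1/z]. If [c] were 0, the numerator [u] of the pole
    would agree with [z^2 v] and vanish at the puncture. *)
Lemma height_form (f : C -> C) : has_pole f (RtoC 0) 2 -> has_residue f (RtoC 0) (RtoC 0) ->
  exists (r0 : R) (c : C) (v : C -> C), 0 < r0 /\ c <> RtoC 0 /\
    (forall z, Cmod z < r0 -> hol v z) /\
    forall z, z <> RtoC 0 -> Cmod z < r0 -> f z = (c / (z * z) + v z)%C.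
Proof.
  intros (u & Hu & Hu0 & Hfu) (N & a & v & Hv & Ha & Hfv).
  apply holomorphic_at_hol in Hu. destruct Hu as (ru & Hru & Hu).
  apply holomorphic_at_hol in Hv. destruct Hv as (rv & Hrv & Hv).
  apply locally'_Cmod in Hfu. destruct Hfu as (r1 & Hr1 & Hfu).
  apply locally'_Cmod in Hfv. destruct Hfv as (r2 & Hr2 & Hfv).
  assert (E0 : (RtoC 0 - RtoC 0)%C = RtoC 0) by ring.
  assert (Cu : ccont u (RtoC 0)) by (apply hol_ccont, Hu; now rewrite E0, Cmod_0).
  assert (Cv : ccont v (RtoC 0)) by (apply hol_ccont, Hv; now rewrite E0, Cmod_0).
  destruct (ccont_bounded _ _ Cu) as (du & Hdu & Bu).
  destruct (ccont_bounded _ _ Cv) as (dv & Hdv & Bv).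
  set (r0 := Rmin (Rmin (Rmin rv 1) (Rmin r1 r2)) (Rmin du dv)).
  assert (r0 <= rv) by rmin.
  assert (r0 <= 1) by rmin.
  assert (r0 <= r1) by rmin.
  assert (r0 <= r2) by rmin.
  assert (r0 <= du) by rmin.
  assert (r0 <= dv) by rmin.
  assert (P0 : 0 < r0) by (repeat apply Rmin_pos; lra).
  destruct (laurent_tail a N (Cmod (u 0) + 1 + (Cmod (v 0) + 1)) r0 P0) as [c Hc].
  { intros z Hz Hzr. specialize (Hfu z Hz). specialize (Hfv z Hz). rewrite Csub_0_r in *.
    specialize (Hfu ltac:(lra)). specialize (Hfv ltac:(lra)).
    specialize (Bu z). specialize (Bv z). rewrite Csub_0_r in *.
    specialize (Bu ltac:(lra)). specialize (Bv ltac:(lra)).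
    rewrite Hfu in Hfv.
    replace (sum_n (fun k => a k / z ^ S k)%C N) with (u z / z ^ 2 - v z)%C
      by (rewrite Hfv; ring).
    unfold Cminus. eapply Rle_trans; [apply Cmod_triangle|].
    rewrite Cmod_opp, Cmod_div, Cmod_pow by now apply Cpow_nz.
    apply Cmod_gt_0 in Hz.
    unfold Rdiv. rewrite Rmult_plus_distr_r.
    assert (Q : 1 <= / Cmod z ^ 2).
    { rewrite <- Rinv_1. apply Rinv_le_contravar; [now apply pow_lt|].
      rewrite <- (pow1 2). apply pow_incr. lra. }
    pose proof (Cmod_ge_0 (v z)). apply Rplus_le_compat; [|nra].
    apply Rmult_le_compat_r; lra. }
  assert (F : forall z, z <> RtoC 0 -> Cmod z < r0 -> f z = (c / (z * z) + v z)%C).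
  { intros z Hz Hzr. specialize (Hfv z Hz). rewrite Csub_0_r in Hfv.
    rewrite Hfv by lra. rewrite Hc by exact Hz. rewrite Ha. field. exact Hz. }
  exists r0, c, v. split; [exact P0|]. split; [|split; [|exact F]].
  - intros ->. apply Hu0.
    replace (RtoC 0) with ((fun z => z * z * v z)%C (RtoC 0)) at 2 by (cbv beta; ring).
    apply (ccont_agree u (fun z => z * z * v z)%C 0 r0 P0 Cu).
    + apply hol_ccont. apply hol_mult; [apply hol_mult; apply hol_id|].
      apply Hv. now rewrite E0, Cmod_0.
    + intros z Hz Hzr. specialize (Hfu z Hz). rewrite Csub_0_r in *.
      rewrite F in Hfu by auto. specialize (Hfu ltac:(lra)).
      replace (u z) with (z * z * (u z / z ^ 2))%C by (field; auto).
      rewrite <- Hfu. field. exact Hz.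
  - intros z Hz. apply Hv. rewrite Csub_0_r. lra.
Qed.

(** The real part of [phi dz] is [(phi dz + conj (phi dz)) / 2], whence the halves. Straight
    segments from [p] suffice for the estimate. *)
Lemma potential_wder (D : C -> Prop) (x : C -> R) (phi : C -> C) (p : C) (d0 : R) : 0 < d0 ->
  (forall z, Cmod (z - p) < d0 -> D z /\ ccont phi z) ->
  (forall gamma dgamma : R -> C,
     (forall t, 0 <= t <= 1 -> D (gamma t) /\ C1_at gamma dgamma t) ->
     x (gamma 1) = x (gamma 0) + Re (path_integral phi gamma dgamma)) ->
  wder (fun z => RtoC (x z)) p (phi p / 2) (Cconj (phi p) / 2).
Proof.
  intros Hd0 HD Hx eps Heps.
  destruct (HD p) as [_ Cp]; [now rewrite Cmod_sub_self|].
  destruct (Cp eps Heps) as (d & Hd & K).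
  exists (Rmin d d0). split; [now apply Rmin_pos|]. intros z Hz.
  pose proof (Rmin_l d d0). pose proof (Rmin_r d d0).
  set (h := (z - p)%C) in *.
  assert (Seg : forall t, 0 <= t <= 1 -> Cmod (p + RtoC t * h - p) <= Cmod h).
  { intros t Ht. replace (p + RtoC t * h - p)%C with (RtoC t * h)%C by ring.
    rewrite Cmod_scal, Rabs_pos_eq by lra. pose proof (Cmod_ge_0 h). nra. }
  specialize (Hx (fun t => p + RtoC t * h)%C (fun _ => h)).
  cbv beta in Hx.
  replace (p + RtoC 1 * h)%C with z in Hx by (unfold h; ring).
  replace (p + RtoC 0 * h)%C with p in Hx by ring.
  assert (Rc : forall t, 0 <= t <= 1 -> rcont (fun t => phi (p + RtoC t * h) * h)%C t).
  { intros t Ht. apply rcont_mult; [|apply rcont_const].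
    apply (rcont_ccont phi (fun t => p + RtoC t * h)%C).
    - apply cderiv_rcont with h. apply cderiv_linear.
    - apply HD. specialize (Seg t Ht). lra. }
  rewrite Hx.
  2:{ intros t Ht. split; [apply HD; specialize (Seg t Ht); lra|]. split.
      - apply cderiv_is_derive, cderiv_linear.
      - apply continuous_const. }
  change (path_integral phi (fun t => p + RtoC t * h)%C (fun _ => h))
    with (CInt (fun t => phi (p + RtoC t * h) * h)%C 0 1).
  set (I := CInt (fun t => phi (p + RtoC t * h) * h)%C 0 1).
  assert (I1 : is_CInt (fun t => phi (p + RtoC t * h) * h + - phi p * h)%C 0 1
     (I + RtoC (1 - 0) * (- phi p * h))%C).
  { apply (is_RInt_plus (V := C_R_NormedModule)); [|apply is_CInt_const].
    apply is_CInt_rcont; [lra|exact Rc]. }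
  apply (is_CInt_bound _ 0 1 (eps * Cmod h)) in I1; [|lra|].
  - match goal with |- Cmod ?y <= _ => replace y with (RtoC (Re (I + RtoC (1 - 0) * (- phi p * h))%C)) end.
    + rewrite Cmod_R. eapply Rle_trans; [apply re_le_Cmod|]. lra.
    + generalize (phi p). intros q. destruct q as [q1 q2], h as [h1 h2], I as [i1 i2].
      unfold Re. Ceq; field.
  - intros t Ht. replace (phi (p + RtoC t * h) * h + - phi p * h)%C
      with ((phi (p + RtoC t * h)%C - phi p) * h)%C by ring.
    rewrite Cmod_mult. apply Rmult_le_compat_r; [apply Cmod_ge_0|]. left. apply K.
    specialize (Seg t Ht). lra.
Qed.

(** * Inversion of the height coordinate *)

(** The Lipschitz bound turns an error small against [k w' - k w] into one small against
    [w' - w]. *)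
Lemma inverse_wder (h k : C -> C) (w l : C) (C0 d : R) : 0 < d -> 0 <= C0 -> l <> RtoC 0 ->
  wder h (k w) l 0 ->
  (forall w', Cmod (w' - w) < d -> h (k w') = w' /\ Cmod (k w' - k w) <= C0 * Cmod (w' - w)) ->
  wder k w (/ l) 0.
Proof.
  intros Hd HC Hl W H eps Heps.
  assert (Pl : 0 < Cmod l) by now apply Cmod_gt_0.
  set (e := eps * Cmod l / (C0 + 1)).
  assert (He : 0 < e) by (apply Rdiv_lt_0_compat; nra).
  destruct (W e He) as (d1 & Hd1 & K).
  exists (Rmin d (d1 / (C0 + 1))).
  split; [apply Rmin_pos; [lra|apply Rdiv_lt_0_compat; lra]|].
  intros w' Hw'. pose proof (Rmin_l d (d1 / (C0 + 1))). pose proof (Rmin_r d (d1 / (C0 + 1))).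
  destruct (H w' ltac:(lra)) as [E1 B].
  destruct (H w) as [E0 _]; [now rewrite Cmod_sub_self|].
  set (m := Cmod (w' - w)) in *. assert (0 <= m) by apply Cmod_ge_0.
  assert (Hm : (C0 + 1) * m < d1).
  { apply Rlt_le_trans with ((C0 + 1) * (d1 / (C0 + 1))); [apply Rmult_lt_compat_l; lra|right; field; lra]. }
  specialize (K (k w') ltac:(nra)). rewrite E0, E1 in K.
  set (rho := (w' - w - (l * (k w' - k w) + 0 * Cconj (k w' - k w)))%C) in *.
  replace (k w' - k w - (/ l * (w' - w) + 0 * Cconj (w' - w)))%C with (- rho / l)%C
    by (unfold rho; field; exact Hl).
  rewrite Cmod_div, Cmod_opp by exact Hl.
  apply Rmult_le_reg_r with (Cmod l); [exact Pl|].
  replace (Cmod rho / Cmod l * Cmod l) with (Cmod rho) by (field; lra).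
  apply Rle_trans with (e * (C0 * m)); [eapply Rle_trans; [exact K|]; apply Rmult_le_compat_l; lra|].
  apply Rle_trans with (e * ((C0 + 1) * m)); [apply Rmult_le_compat_l; nra|].
  right. unfold e. field. lra.
Qed.

Lemma cauchy_halving (u : nat -> R) (A : R) :
  (forall n, Rabs (u (S n) - u n) <= A * (/ 2) ^ n) -> exists l : R, is_lim_seq u l.
Proof.
  intros H.
  assert (E : ex_series (fun n => u (S n) - u n)).
  { apply (ex_series_le (K := R_AbsRing) (V := R_CompleteNormedModule) _ (fun n => A * (/ 2) ^ n)).
    - exact H.
    - apply (ex_series_scal_l (K := R_AbsRing) (V := R_NormedModule) A (fun n => (/ 2) ^ n)).
      apply ex_series_geom. rewrite Rabs_pos_eq; lra. }
  destruct E as [l Hl]. exists (l + u O).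
  apply is_lim_seq_incr_1.
  apply (is_lim_seq_ext (fun n => sum_n (fun n => u (S n) - u n) n + u O)).
  - induction n as [|n IH]; [rewrite sum_O; ring|]. rewrite sum_Sn. unfold plus. simpl.
    rewrite <- IH. ring.
  - apply is_lim_seq_plus'; [exact Hl|apply is_lim_seq_const].
Qed.

Lemma contraction_fixpoint (T : C -> C) (rho : R) : 0 <= rho ->
  (forall z, Cmod z <= rho -> Cmod (T z) <= rho) ->
  (forall z z', Cmod z <= rho -> Cmod z' <= rho -> Cmod (T z - T z') <= / 2 * Cmod (z - z')) ->
  exists z, Cmod z <= rho /\ T z = z.
Proof.
  intros Hr H1 H2.
  set (u := fun n => Nat.iter n T (RtoC 0)).
  assert (B : forall n, Cmod (u n) <= rho).
  { induction n; [unfold u; simpl; rewrite Cmod_0; lra|]. now apply H1. }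
  assert (S1 : forall n, Cmod (u (S n) - u n) <= (2 * rho) * (/ 2) ^ n).
  { induction n.
    - unfold Cminus. eapply Rle_trans; [apply Cmod_triangle|]. rewrite Cmod_opp.
      pose proof (B 0%nat). pose proof (B 1%nat). simpl pow. lra.
    - change (u (S (S n))) with (T (u (S n))). change (u (S n)) with (T (u n)) at 2.
      eapply Rle_trans; [apply H2; apply B|]. simpl pow. lra. }
  destruct (cauchy_halving (fun n => Re (u n)) (2 * rho)) as [a Ha].
  { intros n. eapply Rle_trans; [|apply S1]. apply (re_le_Cmod (u (S n) - u n)). }
  destruct (cauchy_halving (fun n => Im (u n)) (2 * rho)) as [b Hb].
  { intros n. eapply Rle_trans; [|apply S1]. apply (im_le_Cmod (u (S n) - u n)). }
  set (z := (a, b) : C).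
  assert (L : forall eps, 0 < eps -> exists N, forall n, (N <= n)%nat -> Cmod (u n - z) < eps).
  { intros eps Heps. apply is_lim_seq_spec in Ha. apply is_lim_seq_spec in Hb.
    assert (P : 0 < eps / 2) by lra.
    destruct (Ha (mkposreal _ P)) as [N1 K1]. destruct (Hb (mkposreal _ P)) as [N2 K2].
    exists (Nat.max N1 N2). intros n Hn.
    specialize (K1 n ltac:(lia)). specialize (K2 n ltac:(lia)). simpl in K1, K2.
    eapply Rle_lt_trans; [apply Cmod_le_components|].
    change (Rabs (Re (u n) - a) + Rabs (Im (u n) - b) < eps). lra. }
  assert (Bz : Cmod z <= rho).
  { apply Rnot_lt_le. intros P. destruct (L (Cmod z - rho)) as [N K]; [lra|].
    specialize (K N (Nat.le_refl N)). rewrite Cmod_sub_sym in K.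
    pose proof (Cmod_triangle_rev z (u N)). pose proof (B N). lra. }
  exists z. split; [exact Bz|].
  destruct (Req_dec (Cmod (T z - z)) 0) as [E|E].
  { apply Cmod_eq_0 in E. replace (T z) with (T z - z + z)%C by ring. rewrite E. ring. }
  exfalso. pose proof (Cmod_ge_0 (T z - z)).
  destruct (L (Cmod (T z - z) / 4)) as [N K]; [lra|].
  pose proof (K N (Nat.le_refl N)) as K1. specialize (K (S N) ltac:(lia)).
  pose proof (Cmod_sub_triangle (T z) (u (S N)) z) as T1.
  pose proof (H2 z (u N) Bz (B N)) as T2. change (T (u N)) with (u (S N)) in T2.
  rewrite (Cmod_sub_sym z (u N)) in T2. lra.
Qed.

(** Solving [h z = w] amounts to the fixed point equation [z = - c / (w - V z)], a contraction for
    large [w]. The main term [- c / z] also bounds [|h z - h z'|] below by a multiple of [|z - z'|],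
    which gives uniqueness and the Lipschitz bound for [k]. The last clause makes the puncture
    correspond to infinity. *)
Lemma height_inverse (c : C) (v V : C -> C) (r0 : R) : 0 < r0 -> c <> RtoC 0 ->
  (forall z, Cmod z < r0 -> hol v z) -> (forall z, Cmod z < r0 -> wder V z (v z) 0) ->
  let h := fun z => (- c / z + V z)%C in
  exists (r1 R0 K : R) (k : C -> C), 0 < r1 < r0 /\ 1 < R0 /\ 0 <= K /\
    (forall w, R0 < Cmod w ->
       k w <> RtoC 0 /\ Cmod (k w) < r1 /\ h (k w) = w /\
       Cmod (k w + c / w) <= K / (Cmod w * Cmod w) /\
       c / (k w * k w) + v (k w) <> 0 /\ wder k w (/ (c / (k w * k w) + v (k w))) 0)%C /\
    (forall z, z <> RtoC 0 -> Cmod z < r1 -> R0 < Cmod (h z) -> k (h z) = z) /\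
    (forall M, exists rho, 0 < rho < r1 /\ forall z, z <> RtoC 0 -> Cmod z < rho -> M < Cmod (h z)).
Proof.
  intros Hr0 Hc Hv HV h.
  assert (Pc : 0 < Cmod c) by now apply Cmod_gt_0.
  assert (C0 : Cmod 0 < r0) by (rewrite Cmod_0; lra).
  destruct (ccont_bounded _ _ (hol_ccont _ _ (Hv _ C0))) as (d1 & Hd1 & B1).
  destruct (ccont_bounded V 0) as (d2 & Hd2 & B2).
  { exact (wder_cont _ _ _ _ (HV _ C0)). }
  set (b1 := Cmod (v 0) + 1) in *. set (b0 := Cmod (V 0) + 1) in *.
  assert (P1 : 0 < b1) by (unfold b1; pose proof (Cmod_ge_0 (v 0)); lra).
  assert (P0 : 0 < b0) by (unfold b0; pose proof (Cmod_ge_0 (V 0)); lra).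
  (* The last entry, with [r1 <= 1], yields [b1 * r1^2 <= |c| / 2]: the derivative of [V] is at most
     half that of [- c / z] in modulus. *)
  set (r1 := Rmin (Rmin (r0 / 2) (Rmin d1 d2)) (Rmin 1 (Cmod c / (2 * b1)))).
  assert (r1 <= r0 / 2) by rmin.
  assert (r1 <= d1) by rmin.
  assert (r1 <= d2) by rmin.
  assert (r1 <= 1) by rmin.
  assert (Hq : r1 <= Cmod c / (2 * b1)) by rmin.
  assert (Pr : 0 < r1).
  { repeat apply Rmin_pos; try lra. apply Rdiv_lt_0_compat; lra. }
  assert (Hb : b1 * (r1 * r1) <= Cmod c / 2).
  { apply Rle_trans with (b1 * (Cmod c / (2 * b1) * 1)).
    - apply Rmult_le_compat_l; [lra|]. apply Rmult_le_compat; lra.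
    - right. field. lra. }
  assert (Bv : forall z, Cmod z < r1 -> Cmod (v z) <= b1).
  { intros z Hz. apply B1. rewrite Csub_0_r. lra. }
  assert (BV : forall z, Cmod z < r1 -> Cmod (V z) <= b0).
  { intros z Hz. apply B2. rewrite Csub_0_r. lra. }
  assert (LV : forall z z', Cmod z < r1 -> Cmod z' < r1 -> Cmod (V z - V z') <= b1 * Cmod (z - z')).
  { intros z z' Hz Hz'.
    assert (Seg : forall s, 0 <= s <= 1 -> Cmod (z' + RtoC s * (z - z')) < r1).
    { intros s Hs.
      replace (z' + RtoC s * (z - z'))%C with (RtoC (1 - s) * z' + RtoC s * z)%C
        by (rewrite RtoC_minus; ring).
      eapply Rle_lt_trans; [apply Cmod_triangle|].
      rewrite !Cmod_scal, !Rabs_pos_eq by lra.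
      destruct (Rle_dec (Cmod z) (Cmod z')).
      - apply Rle_lt_trans with (Cmod z'); [nra|exact Hz'].
      - apply Rle_lt_trans with (Cmod z); [nra|exact Hz]. }
    pose proof (Cmod_increment_le_const (fun s => V (z' + RtoC s * (z - z'))%C)
      (fun s => v (z' + RtoC s * (z - z')) * (z - z'))%C (b1 * Cmod (z - z')) 0 1 ltac:(lra)) as Q.
    cbv beta in Q. replace (z' + RtoC 1 * (z - z'))%C with z in Q by ring.
    replace (z' + RtoC 0 * (z - z'))%C with z' in Q by ring.
    rewrite Rminus_0_r, Rmult_1_r in Q. apply Q.
    - intros t Ht. pose proof (wder_cderiv V (fun s => z' + RtoC s * (z - z'))%C t _ _ _
        (cderiv_linear z' (z - z') t) (HV (z' + RtoC t * (z - z'))%C ltac:(specialize (Seg t Ht); lra))) as W.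
      rewrite Cmult_0_l, Cplus_0_r in W. exact W.
    - intros t Ht. rewrite Cmod_mult. apply Rmult_le_compat_r; [apply Cmod_ge_0|]. apply Bv, Seg, Ht. }
  (* Beyond [R0] one has [|w - V z| >= 2 |c| / r1], so the map sends the disc of radius [r1 / 2]
     into itself, and also [|V z| <= |w| / 2]. *)
  set (R0 := 2 * b0 + 2 * (Cmod c / r1) + 1).
  assert (Pcr : 0 < Cmod c / r1) by now apply Rdiv_lt_0_compat.
  assert (fix_ex : forall w, R0 < Cmod w -> exists z, z <> RtoC 0 /\ Cmod z < r1 /\ h z = w).
  { intros w Hw.
    assert (Dn : forall z, Cmod z < r1 -> 2 * Cmod c / r1 <= Cmod (w - V z)).
    { intros z Hz. specialize (BV z Hz). pose proof (Cmod_triangle_rev w (V z)).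
      replace (2 * Cmod c / r1) with (2 * (Cmod c / r1)) by (field; lra). unfold R0 in Hw. lra. }
    assert (Dp : 0 < 2 * Cmod c / r1) by lra.
    assert (Dz : forall z, Cmod z < r1 -> (w - V z)%C <> RtoC 0).
    { intros z Hz. apply Cmod_neq_0. specialize (Dn z Hz). lra. }
    assert (Db : forall z, Cmod z < r1 -> Cmod (c / (w - V z)) <= r1 / 2).
    { intros z Hz. rewrite Cmod_div by now apply Dz. unfold Rdiv.
      apply Rle_trans with (Cmod c * / (2 * Cmod c / r1)).
      - apply Rmult_le_compat_l; [lra|]. apply Rinv_le_contravar; [lra|]. now apply Dn.
      - right. field. lra. }
    destruct (contraction_fixpoint (fun z => - c / (w - V z))%C (r1 / 2) ltac:(lra)) as (z & Bz & E).
    - intros z Hz. replace (- c / (w - V z))%C with (- (c / (w - V z)))%C by (unfold Cdiv; ring).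
      rewrite Cmod_opp. apply Db. lra.
    - intros z z' Hz Hz'.
      assert (N1 : Cmod z < r1) by lra. assert (N2 : Cmod z' < r1) by lra.
      replace (- c / (w - V z) - - c / (w - V z'))%C with
        (- (/ c * (c / (w - V z)) * (c / (w - V z')) * (V z - V z')))%C
        by (field; auto).
      rewrite Cmod_opp, !Cmod_mult, Cmod_inv by exact Hc.
      pose proof (Db z N1). pose proof (Db z' N2). pose proof (LV z z' N1 N2).
      pose proof (Cmod_ge_0 (c / (w - V z))). pose proof (Cmod_ge_0 (c / (w - V z'))).
      pose proof (Cmod_ge_0 (z - z')). pose proof (Cmod_ge_0 (V z - V z')).
      apply Rle_trans with (/ Cmod c * (r1 / 2) * (r1 / 2) * (b1 * Cmod (z - z'))).
      + assert (0 < / Cmod c) by now apply Rinv_0_lt_compat.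
        apply Rmult_le_compat; [repeat apply Rmult_le_pos; lra|lra| |lra].
        apply Rmult_le_compat; [apply Rmult_le_pos; lra|lra| |lra].
        apply Rmult_le_compat_l; lra.
      + replace (/ Cmod c * (r1 / 2) * (r1 / 2) * (b1 * Cmod (z - z')))
          with ((b1 * (r1 * r1)) * (/ Cmod c / 4 * Cmod (z - z'))) by (field; lra).
        apply Rle_trans with (Cmod c / 2 * (/ Cmod c / 4 * Cmod (z - z'))).
        * apply Rmult_le_compat_r; [|exact Hb].
          assert (0 < / Cmod c) by now apply Rinv_0_lt_compat. apply Rmult_le_pos; lra.
        * replace (Cmod c / 2 * (/ Cmod c / 4 * Cmod (z - z'))) with (Cmod (z - z') / 8) by (field; lra).
          lra.
    - assert (N1 : Cmod z < r1) by lra. cbv beta in E.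
      assert (Nz : z <> RtoC 0).
      { intros Z. rewrite Z in E. apply Hc.
        replace c with (- (- c / (w - V 0) * (w - V 0)))%C
          by (field; apply Dz; rewrite Cmod_0; lra).
        rewrite E. ring. }
      exists z. split; [exact Nz|]. split; [exact N1|].
      unfold h. replace (- c / z)%C with (w - V z)%C; [ring|].
      transitivity (- c / (- c / (w - V z)))%C; [field; auto|now rewrite E]. }
  (* Since [|z z'| <= 1], the main terms differ by at least [|c| |z - z'|], and [V] cancels at most
     half of their difference. *)
  assert (inj : forall z z', z <> RtoC 0 -> z' <> RtoC 0 -> Cmod z < r1 -> Cmod z' < r1 ->
     Cmod (z - z') <= (2 / Cmod c) * Cmod (h z - h z')).
  { intros z z' Nz Nz' Hz Hz'. unfold h.
    replace (- c / z + V z - (- c / z' + V z'))%C with (c * (z - z') / (z * z') - (V z' - V z))%C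
      by (field; auto).
    pose proof (Cmod_triangle_rev (c * (z - z') / (z * z')) (V z' - V z)) as T.
    rewrite Cmod_div, !Cmod_mult in T by now apply Cmult_neq_0.
    pose proof (LV z' z Hz' Hz) as L. rewrite (Cmod_sub_sym z' z) in L.
    apply Cmod_gt_0 in Nz. apply Cmod_gt_0 in Nz'.
    pose proof (Cmod_ge_0 (z - z')).
    set (m := Cmod z * Cmod z') in *. assert (Pm : 0 < m <= r1 * r1)
      by (unfold m; split; [apply Rmult_lt_0_compat; lra|apply Rmult_le_compat; lra]).
    assert (r1 * r1 <= 1) by nra.
    assert (Q : Cmod c * Cmod (z - z') <= Cmod c * Cmod (z - z') / m).
    { apply Rmult_le_reg_r with m; [lra|].
      replace (Cmod c * Cmod (z - z') / m * m) with (Cmod c * Cmod (z - z')) by (field; lra).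
      assert (X : 0 <= Cmod c * Cmod (z - z')) by (apply Rmult_le_pos; lra).
      rewrite <- (Rmult_1_r (Cmod c * Cmod (z - z'))) at 2. apply Rmult_le_compat_l; lra. }
    assert (Q2 : b1 * Cmod (z - z') <= Cmod c * Cmod (z - z') / m / 2).
    { apply Rmult_le_reg_r with m; [lra|].
      replace (Cmod c * Cmod (z - z') / m / 2 * m) with (Cmod c / 2 * Cmod (z - z')) by (field; lra).
      assert (X : b1 * m <= Cmod c / 2)
        by (apply Rle_trans with (b1 * (r1 * r1)); [apply Rmult_le_compat_l; lra|lra]).
      apply (Rmult_le_compat_r (Cmod (z - z'))) in X; lra. }
    apply Rmult_le_reg_l with (Cmod c / 2); [lra|].
    match goal with |- _ <= ?a * (?b * ?d) => replace (a * (b * d)) with d by (field; lra) end.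
    lra. }
  exists r1, R0, (2 * Cmod c * b0),
    (fun w => epsilon (inhabits (RtoC 0)) (fun z => z <> RtoC 0 /\ Cmod z < r1 /\ h z = w)).
  assert (HR0 : 1 < R0) by (unfold R0; lra).
  assert (ks : forall w, R0 < Cmod w ->
    let z := epsilon (inhabits (RtoC 0)) (fun z => z <> RtoC 0 /\ Cmod z < r1 /\ h z = w) in
    z <> RtoC 0 /\ Cmod z < r1 /\ h z = w).
  { intros w Hw. apply epsilon_spec. now apply fix_ex. }
  set (k := fun w => epsilon (inhabits (RtoC 0)) (fun z => z <> RtoC 0 /\ Cmod z < r1 /\ h z = w)) in *.
  split; [lra|]. split; [exact HR0|]. split; [nra|]. split; [|split].
  - intros w Hw. destruct (ks w Hw) as (N & L & E). fold (k w) in N, L, E.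
    split; [exact N|]. split; [exact L|]. split; [exact E|].
    assert (Nl : (c / (k w * k w) + v (k w))%C <> RtoC 0).
    { apply Cmod_neq_0.
      pose proof (Cmod_triangle_rev (c / (k w * k w)) (- v (k w))) as T.
      replace (c / (k w * k w) - - v (k w))%C with (c / (k w * k w) + v (k w))%C in T by ring.
      rewrite Cmod_opp, Cmod_div, Cmod_mult in T by now apply Cmult_neq_0.
      specialize (Bv _ L). apply Cmod_gt_0 in N.
      set (m := Cmod (k w) * Cmod (k w)) in *. assert (Pm : 0 < m <= r1 * r1)
      by (unfold m; split; [apply Rmult_lt_0_compat; lra|apply Rmult_le_compat; lra]).
      assert (b1 < Cmod c / m).
      { apply Rmult_lt_reg_r with m; [lra|]. replace (Cmod c / m * m) with (Cmod c) by (field; lra).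
        assert (X : b1 * m <= Cmod c / 2)
          by (apply Rle_trans with (b1 * (r1 * r1)); [apply Rmult_le_compat_l; lra|lra]).
        lra. }
      lra. }
    split; [|split; [exact Nl|]].
    + unfold h in E. assert (Nw : w <> RtoC 0) by (apply Cmod_neq_0; lra).
      specialize (BV _ L). pose proof (Cmod_triangle_rev w (V (k w))) as T.
      assert (Nv : (w - V (k w))%C <> RtoC 0) by (apply Cmod_neq_0; unfold R0 in Hw; lra).
      assert (Ek : k w = (- c / (w - V (k w)))%C).
      { assert (Ew : (w - V (k w))%C = (- c / k w)%C)
          by (clear - E; set (q := k w) in *; clearbody q; rewrite <- E; ring).
        rewrite Ew. field. auto. }
      change (Cmod (k w + c / w) <= 2 * Cmod c * b0 / (Cmod w * Cmod w)).
      rewrite Ek.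
      replace (- c / (w - V (k w)) + c / w)%C with (- (c * V (k w) / (w * (w - V (k w)))))%C by (field; auto).
      rewrite Cmod_opp, Cmod_div, !Cmod_mult by now apply Cmult_neq_0.
      assert (Hh : Cmod w / 2 <= Cmod (w - V (k w))) by (unfold R0 in Hw; lra).
      unfold Rdiv. apply Rle_trans with (Cmod c * b0 * / (Cmod w * (Cmod w / 2))).
      * apply Rmult_le_compat.
        -- apply Rmult_le_pos; [lra|apply Cmod_ge_0].
        -- left. apply Rinv_0_lt_compat. apply Rmult_lt_0_compat; lra.
        -- apply Rmult_le_compat_l; lra.
        -- apply Rinv_le_contravar; nra.
      * right. field. lra.
    + change (wder k w (/ (c / (k w * k w) + v (k w)))%C 0).
      apply (inverse_wder h k w _ (2 / Cmod c) (Cmod w - R0)); [lra| |exact Nl| |].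
      * left. apply Rdiv_lt_0_compat; lra.
      * unfold h. apply (wder_eq _ _ (- (- c * 1) / (k w * k w) + v (k w))%C 0).
        -- apply holo_plus; [|apply HV; lra].
           apply (wder_ext (fun z => - c * / z)%C _ _ _ _ 1); [lra|intros; reflexivity|].
           apply (wder_eq _ _ (0 * / k w + - c * (- (RtoC 1) / (k w * k w)))%C 0).
           ++ apply (holo_mult (fun _ => - c)%C); [apply wder_const|].
              apply (holo_inv (fun z => z)); [exact N|apply wder_id].
           ++ field. exact N.
           ++ reflexivity.
        -- f_equal. field. exact N.
        -- reflexivity.
      * intros w' Hw'. pose proof (Cmod_triangle_rev w w') as T. rewrite Cmod_sub_sym in T.
        destruct (ks w' ltac:(lra)) as (N' & L' & E'). fold (k w') in N', L', E'.
        split; [exact E'|].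
        pose proof (inj (k w') (k w) N' N L' L) as I. rewrite E, E' in I. exact I.
  - intros z Nz Hz Hhz. destruct (ks (h z) Hhz) as (N & L & E). fold (k (h z)) in N, L, E.
    pose proof (inj (k (h z)) z N Nz L Hz) as I. rewrite E in I.
    replace (h z - h z)%C with (RtoC 0) in I by ring. rewrite Cmod_0 in I.
    assert (Z : (k (h z) - z)%C = RtoC 0).
    { apply Cmod_eq_0. pose proof (Cmod_ge_0 (k (h z) - z)). lra. }
    transitivity (k (h z) - z + z)%C; [|rewrite Z; ring].
    change (k (h z) = k (h z) - z + z)%C. ring.
  - intros M. set (rho := Rmin (r1 / 2) (Cmod c / (Rabs M + b0 + 1))).
    pose proof (Rabs_pos M). pose proof (Rle_abs M).
    assert (rho <= r1 / 2) by rmin.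
    assert (Hrho : rho <= Cmod c / (Rabs M + b0 + 1)) by rmin.
    assert (0 < rho) by (apply Rmin_pos; [lra|apply Rdiv_lt_0_compat; lra]).
    exists rho. split; [lra|]. intros z Nz Hz.
    unfold h. pose proof (Cmod_triangle_rev (- c / z) (- V z)) as T.
    replace (- c / z - - V z)%C with (- c / z + V z)%C in T by ring.
    rewrite Cmod_opp, Cmod_div, Cmod_opp in T by exact Nz.
    specialize (BV z ltac:(lra)). apply Cmod_gt_0 in Nz.
    assert (Rabs M + b0 + 1 <= Cmod c / Cmod z).
    { apply Rmult_le_reg_r with (Cmod z); [lra|].
      replace (Cmod c / Cmod z * Cmod z) with (Cmod c) by (field; lra).
      apply Rle_trans with ((Rabs M + b0 + 1) * (Cmod c / (Rabs M + b0 + 1)));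
        [apply Rmult_le_compat_l; lra|right; field; lra]. }
    lra.
Qed.

(* The end in the coordinate [w] with [dh = dw], defined for [R0 < |w|]: [G] is
   the Gauss map, [F = x1 + i x2], and [L dw = dG / G]. *)
Record height_end (R0 : R) (G F L : C -> C) (al be : C) (K : R) : Prop := {
  he_R0 : 1 < R0;
  he_G : forall w, R0 < Cmod w -> G w <> RtoC 0 /\ wder G w (G w * L w) 0;
  he_F : forall w, R0 < Cmod w -> wder F w (- G w / 2) (Cconj (/ G w) / 2);
  he_L : forall w, R0 < Cmod w -> Cmod (L w - (al + be / w)) <= K / (Cmod w * Cmod w)
}.

Definition horizontal_part (X : C -> R3) (z : C) : C := (x1 (X z), x2 (X z)).

Lemma wder_Re (H : C -> C) (p a : C) : wder H p a 0 ->
  wder (fun z => RtoC (Re (H z))) p (a / 2) (Cconj a / 2).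
Proof.
  intros W.
  pose proof (wder_comp _ _ _ _ _ _ _ W (wder_conj (H p))) as W1.
  pose proof (wder_RtoC_scal _ _ _ _ (/ 2) (wder_plus _ _ _ _ _ _ _ W W1)) as W2.
  cbv beta in W2.
  apply (wder_ext (fun z => / 2 * (H z + Cconj (H z)))%C _ _ _ _ 1); [lra| |].
  - intros z _. destruct (H z) as [x y]. unfold Re. Ceq; field.
  - apply (wder_eq _ _ _ _ _ _ W2); rewrite ?Cconj_0; field.
Qed.

(** With [F = x1 + i x2] the two coefficients are [(phi1 + i phi2) / 2] and the conjugate of
    [(phi1 - i phi2) / 2]; each combination leaves just one of [g] and [1/g]. The formulas for
    [phi1] and [phi2] hold near [p], off [p], and are extended by continuity. *)
Lemma immersion_potentials (r : R) (g f : C -> C) (X : C -> R3) (p : C) :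
  weierstrass_immersion (open_punctured_disk r) g f X -> open_punctured_disk r p ->
  g p <> RtoC 0 -> hol g p ->
  wder (horizontal_part X) p (- (g p * f p) / 2) (Cconj (f p / g p) / 2) /\
  wder (fun z => RtoC (x3 (X z))) p (f p / 2) (Cconj (f p) / 2).
Proof.
  intros HW Dp Gp Hg.
  destruct (weierstrass_formula _ _ _ _ HW) as (phi1 & phi2 & Hphi & Hint).
  assert (Hc : forall (phi : C -> C) (z : C), holomorphic_at phi z -> hol phi z).
  { intros phi z Hz. apply holomorphic_at_hol in Hz. destruct Hz as (e & He & Hz).
    apply Hz. now rewrite Cmod_sub_self. }
  set (d0 := Rmin (Cmod p) (r - Cmod p)).
  unfold open_punctured_disk in Dp.
  assert (Hd0 : 0 < d0) by (apply Rmin_pos; lra).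
  assert (Dn : forall z, Cmod (z - p) < d0 -> open_punctured_disk r z).
  { intros z Hz. pose proof (Rmin_l (Cmod p) (r - Cmod p)). pose proof (Rmin_r (Cmod p) (r - Cmod p)).
    fold d0 in H, H0. pose proof (Cmod_triangle_rev z p).
    pose proof (Cmod_triangle_rev p z). rewrite (Cmod_sub_sym p z) in H2.
    unfold open_punctured_disk. lra. }
  assert (W1 : wder (fun z => RtoC (x1 (X z))) p (phi1 p / 2) (Cconj (phi1 p) / 2)).
  { apply (potential_wder (open_punctured_disk r) _ _ _ d0 Hd0).
    - intros z Hz. split; [now apply Dn|]. now apply hol_ccont, Hc, Hphi, Dn.
    - intros gam dgam H. now apply Hint. }
  assert (W2 : wder (fun z => RtoC (x2 (X z))) p (phi2 p / 2) (Cconj (phi2 p) / 2)).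
  { apply (potential_wder (open_punctured_disk r) _ _ _ d0 Hd0).
    - intros z Hz. split; [now apply Dn|]. now apply hol_ccont, Hc, Hphi, Dn.
    - intros gam dgam H. now apply Hint. }
  assert (Hf : hol f p) by (apply Hc, (dh_holomorphic _ _ _ _ HW); exact Dp).
  destruct (Hphi p Dp) as (H1 & H2 & H3). apply locally'_Cmod in H3. destruct H3 as (e & He & H3).
  assert (E1 : phi1 p = (/ 2 * (/ g p - g p) * f p)%C).
  { apply (ccont_agree phi1 (fun z => / 2 * (/ g z - g z) * f z)%C p e He).
    - now apply hol_ccont, Hc.
    - apply hol_ccont. apply hol_mult; [|exact Hf]. apply hol_mult; [apply hol_const|].
      apply hol_minus; [now apply hol_inv|exact Hg].
    - intros z Hz Hz2. apply (H3 z Hz Hz2). }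
  assert (E2 : phi2 p = (Ci / 2 * (/ g p + g p) * f p)%C).
  { apply (ccont_agree phi2 (fun z => Ci / 2 * (/ g z + g z) * f z)%C p e He).
    - now apply hol_ccont, Hc.
    - apply hol_ccont. apply hol_mult; [|exact Hf]. apply hol_mult; [apply hol_const|].
      apply hol_plus; [now apply hol_inv|exact Hg].
    - intros z Hz Hz2. apply (H3 z Hz Hz2). }
  split.
  - pose proof (wder_plus _ _ _ _ _ _ _ W1 (wder_RtoC_scal _ _ _ _ Ci W2)) as W.
    apply (wder_ext (fun z => RtoC (x1 (X z)) + Ci * RtoC (x2 (X z)))%C _ _ _ _ 1); [lra| |].
    { intros z _. unfold horizontal_part. Ceq. }
    apply (wder_eq _ _ _ _ _ _ W).
    + rewrite E1, E2. replace (Ci * (Ci / 2 * (/ g p + g p) * f p / 2))%C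
        with (- (/ 2 * (/ g p + g p) * f p / 2))%C.
      * field. exact Gp.
      * transitivity ((Ci * Ci) * (/ 2 * (/ g p + g p) * f p / 2))%C; [|unfold Cdiv; ring].
        replace (Ci * Ci)%C with (- (1))%C by Ceq. ring.
    + rewrite E1, E2. unfold Cdiv. rewrite !Cmult_conj, !Cminus_conj, !Cplus_conj.
      assert (I2 : Cconj (/ 2) = (/ 2)%C) by (unfold Cconj, Cinv; Ceq; field).
      assert (ICi : Cconj Ci = (- Ci)%C) by (unfold Cconj, Ci; Ceq).
      rewrite I2, ICi.
      set (q := Cconj (/ g p)). set (q' := Cconj (g p)). set (q'' := Cconj (f p)).
      transitivity ((/ 2 * (q - q') * q'' - (Ci * Ci) * (/ 2 * (q + q') * q'')) * / 2)%C; [ring|].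
      replace (Ci * Ci)%C with (- (1))%C by Ceq. field.
  - apply (potential_wder (open_punctured_disk r) (fun z => x3 (X z)) f p d0 Hd0).
    + intros z Hz. split; [now apply Dn|].
      apply hol_ccont, Hc, (dh_holomorphic _ _ _ _ HW), Dn, Hz.
    + intros gam dgam H. now apply Hint.
Qed.

(** In the coordinate [w = h z] the function [L] is the quotient of [dg/g] by [dh], holomorphic and
    nonzero at the puncture because both poles are double. Its Taylor expansion in [z], with
    [z = - c / w + O(1/w^2)], yields [al = a0] and [be = - a1 c]. *)
Lemma end_in_height_coordinate (r : R) (g f : C -> C) (X : C -> R3) :
  minimal_annular_end r g f X ->
  has_pole (dlog g) (RtoC 0) 2 -> has_pole f (RtoC 0) 2 -> has_residue f (RtoC 0) (RtoC 0) ->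
  exists (r1 R0 K : R) (h k L : C -> C) (al be : C),
    0 < r1 < r /\ al <> RtoC 0 /\
    (forall w, R0 < Cmod w -> k w <> RtoC 0 /\ Cmod (k w) < r1 /\ h (k w) = w) /\
    (forall z, z <> RtoC 0 -> Cmod z < r1 -> R0 < Cmod (h z) -> k (h z) = z) /\
    (forall M, exists rho, 0 < rho < r1 /\ forall z, z <> RtoC 0 -> Cmod z < rho -> M < Cmod (h z)) /\
    (forall z, z <> RtoC 0 -> Cmod z < r1 -> x3 (X z) = Re (h z)) /\
    height_end R0 (fun w => g (k w)) (fun w => horizontal_part X (k w)) L al be K.
Proof.
  intros [Hr HW HC] Hdg Hdh Hres.
  destruct (gauss_map_regular r g f X Hr HW Hdg) as (ra & u & Hra & Hu & Hu0 & Hg).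
  destruct (height_form f Hdh Hres) as (rb & c & v & Hrb & Hc & Hv & Hf).
  (* This is [z^2 f], so that [u / den] is the quotient of [dg/g] by [dh] with the two double poles
     cancelled. *)
  set (den := fun z => (c + z * z * v z)%C).
  assert (C0 : Cmod 0 = 0) by apply Cmod_0.
  assert (Hden : forall z, Cmod z < rb -> hol den z).
  { intros z Hz. apply hol_plus; [apply hol_const|].
    apply hol_mult; [apply hol_mult; apply hol_id|now apply Hv]. }
  assert (D0 : den 0 = c) by (unfold den; ring).
  destruct (ccont_neq_0 den 0) as (rc & Hrc & Nden).
  { apply hol_ccont, Hden. lra. }
  { now rewrite D0. }
  set (rq := Rmin (Rmin ra rb) (Rmin rc 1)).
  assert (rq <= ra) by rmin.
  assert (rq <= rb) by rmin.
  assert (rq <= rc) by rmin.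
  assert (rq <= 1) by rmin.
  assert (Prq : 0 < rq) by (repeat apply Rmin_pos; lra).
  assert (Dz : forall z, Cmod z < rq -> den z <> RtoC 0).
  { intros z Hz. apply Nden. rewrite Csub_0_r. lra. }
  set (q := fun z => (u z * / den z)%C).
  destruct (taylor_order3 q rq Prq) as (a0 & a1 & a2 & M & HM & HT).
  { intros z Hz. apply hol_mult; [apply Hu; lra|]. apply hol_inv; [now apply Dz|apply Hden; lra]. }
  set (r0 := rq / 4).
  assert (Pr0 : 0 < r0) by (unfold r0; lra).
  assert (Lr0 : r0 < rq) by (unfold r0; lra).
  assert (A0 : a0 = (u 0 / c)%C).
  { specialize (HT 0). rewrite C0 in HT. specialize (HT ltac:(lra)).
    replace (M * 0 ^ 3) with 0 in HT by ring.
    assert (Z : (q 0 - (a0 + a1 * 0 + a2 * 0 * 0))%C = RtoC 0).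
    { apply Cmod_eq_0, Rle_antisym; [exact HT|apply Cmod_ge_0]. }
    unfold q in Z. rewrite D0 in Z.
    replace a0 with (u 0 * / c - (u 0 * / c - (a0 + a1 * 0 + a2 * 0 * 0)))%C by ring.
    rewrite Z. unfold Cdiv. ring. }
  destruct (disc_primitive v r0) as [V0 HV0].
  { intros z Hz. apply Hv. lra. }
  assert (Wh : forall (V : C -> C) z, z <> RtoC 0 -> wder V z (v z) 0 ->
     wder (fun z => - c / z + V z)%C z (c / (z * z) + v z) 0).
  { intros V z Nz W. apply holo_plus; [|exact W].
    apply (wder_ext (fun z => - c * / z)%C _ _ _ _ 1); [lra|intros; reflexivity|].
    apply (wder_eq _ _ (0 * / z + - c * (- (RtoC 1) / (z * z)))%C 0).
    - apply (holo_mult (fun _ => - c)%C); [apply wder_const|].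
      apply (holo_inv (fun z => z)); [exact Nz|apply wder_id].
    - field. exact Nz.
    - reflexivity. }
  assert (Pot : forall z, z <> RtoC 0 -> Cmod z < r0 ->
     wder (horizontal_part X) z (- (g z * f z) / 2) (Cconj (f z / g z) / 2) /\
     wder (fun z => RtoC (x3 (X z))) z (f z / 2) (Cconj (f z) / 2)).
  { intros z Nz Hz. destruct (Hg z Nz ltac:(lra)) as [G0 Gd].
    apply immersion_potentials with r; auto.
    - apply Cmod_gt_0 in Nz. unfold open_punctured_disk. lra.
    - eexists; exact Gd. }
  assert (exists kap, forall z, z <> RtoC 0 -> Cmod z < r0 ->
     x3 (X z) = Re (- c / z + V0 z)%C + kap) as [kap Hkap].
  { set (D := fun z => (RtoC (x3 (X z)) - RtoC (Re (- c / z + V0 z)))%C).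
    set (zb := RtoC (r0 / 2)).
    assert (Hzb : Cmod zb = r0 / 2) by (unfold zb; rewrite Cmod_R, Rabs_pos_eq; lra).
    exists (x3 (X zb) - Re (- c / zb + V0 zb)%C). intros z Nz Hz.
    assert (E : D z = D zb).
    { apply (annulus_constant D 0 r0); try lra; try (simpl; lra); try now apply Cmod_gt_0.
      intros z' Hz1 Hz2. apply Cmod_gt_0 in Hz1. simpl in Hz2.
      destruct (Pot z' Hz1 Hz2) as [_ P3].
      pose proof (wder_Re _ _ _ (Wh V0 z' Hz1 (HV0 z' Hz2))) as P4.
      rewrite <- Hf in P4 by (auto; lra).
      pose proof (wder_plus _ _ _ _ _ _ _ P3 (wder_RtoC_scal _ _ _ _ (-1) P4)) as P5.
      apply (wder_ext _ D _ _ _ 1 Rlt_0_1) in P5; [|intros; unfold D; ring].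
      apply (wder_eq _ _ _ _ _ _ P5); ring. }
    unfold D in E. injection E as E. unfold Re in *. simpl in *. lra. }
  (* A primitive of [dh] is fixed up to a constant, whose real part is chosen here to make [x3]
     equal to [Re h] exactly. *)
  set (V := fun z => (V0 z + RtoC kap)%C).
  assert (HV : forall z, Cmod z < r0 -> wder V z (v z) 0).
  { intros z Hz. apply (wder_eq _ _ (v z + 0)%C 0); [|ring|reflexivity].
    apply holo_plus; [now apply HV0|apply wder_const]. }
  destruct (height_inverse c v V r0 Pr0 Hc) as (r1 & R0 & K & k & Hr1 & HR0 & HK & Hk & Hki & Hinf).
  { intros z Hz. apply Hv. lra. }
  { exact HV. }
  set (h := fun z => (- c / z + V z)%C) in *.
  (* The constant collects [a1 (z + c / w)], [a2 z^2] and the cubic remainder, using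
     [|z| <= (|c| + K) / |w|] and [|z| <= 1]. *)
  exists r1, R0, (Cmod a1 * K + (Cmod a2 + M) * ((Cmod c + K) * (Cmod c + K))), h, k,
    (fun w => q (k w)), a0, (- (a1 * c))%C.
  split; [lra|]. split.
  { rewrite A0. apply Cmult_neq_0; [exact Hu0|]. apply Cmod_neq_0. rewrite Cmod_inv by exact Hc.
    apply Rinv_0_lt_compat. now apply Cmod_gt_0. }
  split; [intros w Hw; destruct (Hk w Hw) as (N & B & E & _); auto|].
  split; [exact Hki|]. split; [exact Hinf|].
  split.
  { intros z Nz Hz. rewrite Hkap by (auto; lra). unfold h, V, Re. simpl. ring. }
  constructor; [exact HR0| | |].
  - intros w Hw. destruct (Hk w Hw) as (N & B & E & _ & Nl & Wk).
    destruct (Hg (k w) N ltac:(lra)) as [G0 Gd]. split; [exact G0|].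
    apply (wder_eq _ _ _ _ _ _ (holo_comp _ _ _ _ _ Wk Gd)); [|reflexivity].
    assert (Nd : den (k w) <> RtoC 0) by (apply Dz; lra).
    unfold q. unfold den in *. field. auto.
  - intros w Hw. destruct (Hk w Hw) as (N & B & E & _ & Nl & Wk).
    destruct (Hg (k w) N ltac:(lra)) as [G0 Gd].
    destruct (Pot (k w) N ltac:(lra)) as [P1 _].
    rewrite Hf in P1 by (auto; lra).
    set (fz := (c / (k w * k w) + v (k w))%C) in *.
    apply (wder_eq _ _ _ _ _ _ (wder_comp _ _ _ _ _ _ _ Wk P1)).
    + rewrite Cconj_0. field. auto.
    + rewrite Cmult_0_r, Cplus_0_l.
      replace (Cconj (/ g (k w))) with (Cconj (fz / g (k w)) * Cconj (/ fz))%C.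
      * unfold Cdiv. ring.
      * rewrite <- Cmult_conj. f_equal. field. auto.
  - intros w Hw. destruct (Hk w Hw) as (N & B & E & Bk & _).
    assert (Pw : 0 < Cmod w) by lra.
    assert (Nw : w <> RtoC 0) by (apply Cmod_neq_0; lra).
    set (z := k w) in *. set (m := Cmod w) in *.
    specialize (HT z ltac:(unfold r0 in Hr1; lra)).
    assert (Bz : Cmod z <= (Cmod c + K) / m).
    { replace z with (z + c / w + - (c / w))%C by ring.
      eapply Rle_trans; [apply Cmod_triangle|].
      rewrite Cmod_opp, Cmod_div by exact Nw. fold m.
      assert (K / (m * m) <= K / m).
      { apply Rmult_le_compat_l; [exact HK|]. apply Rinv_le_contravar; nra. }
      unfold Rdiv in *. lra. }
    assert (Cz1 : Cmod z <= 1) by lra.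
    pose proof (Cmod_ge_0 z).
    replace (q z - (a0 + - (a1 * c) / w))%C with
      ((q z - (a0 + a1 * z + a2 * z * z)) + a1 * (z + c / w) + a2 * z * z)%C by (field; auto).
    eapply Rle_trans; [eapply Rle_trans; [apply Cmod_triangle|]; apply Rplus_le_compat_r; apply Cmod_triangle|].
    rewrite !Cmod_mult.
    assert (S2 : Cmod z * Cmod z <= (Cmod c + K) / m * ((Cmod c + K) / m))
      by (apply Rmult_le_compat; lra).
    assert (S3 : M * Cmod z ^ 3 <= M * (Cmod z * Cmod z)).
    { apply Rmult_le_compat_l; [exact HM|]. simpl. nra. }
    assert (S4 : M * (Cmod z * Cmod z) <= M * ((Cmod c + K) / m * ((Cmod c + K) / m)))
      by (apply Rmult_le_compat_l; lra).
    assert (S5 : Cmod a2 * (Cmod z * Cmod z) <= Cmod a2 * ((Cmod c + K) / m * ((Cmod c + K) / m)))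
      by (apply Rmult_le_compat_l; [apply Cmod_ge_0|exact S2]).
    assert (S6 : Cmod a1 * Cmod (z + c / w) <= Cmod a1 * (K / (m * m)))
      by (apply Rmult_le_compat_l; [apply Cmod_ge_0|exact Bk]).
    replace ((Cmod a1 * K + (Cmod a2 + M) * ((Cmod c + K) * (Cmod c + K))) / (m * m)) with
      (Cmod a1 * (K / (m * m)) + Cmod a2 * ((Cmod c + K) / m * ((Cmod c + K) / m))
        + M * ((Cmod c + K) / m * ((Cmod c + K) / m))) by (field; lra).
    lra.
Qed.

(** * Compactness and rays *)

(** Compactness of a square containing the disc. Stability of [Q z d] under shrinking [d] lets every
    local radius be replaced by one common lower bound. *)
Lemma compact_local_uniform (B : R) (Q : C -> R -> Prop) :
  (forall z d d', 0 < d' -> d' <= d -> Q z d -> Q z d') ->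
  (forall t, exists d, 0 < d /\ forall z, Cmod (z - t) < d -> Q z d) ->
  exists d, 0 < d /\ forall z, Cmod z <= B -> Q z d.
Proof.
  intros mono H.
  assert (H' : forall u v : R, exists d : posreal,
     forall z : C, Rabs (Re z - u) < d -> Rabs (Im z - v) < d -> Q z d).
  { intros u v. destruct (H (u, v)) as (d & Hd & K).
    assert (Hd2 : 0 < d / 2) by lra. exists (mkposreal _ Hd2). simpl.
    intros z H1 H2. apply mono with d; [lra|lra|]. apply K.
    eapply Rle_lt_trans; [apply Cmod_le_components|].
    change (Rabs (Re z - u) + Rabs (Im z - v) < d). lra. }
  set (delta := fun u v => epsilon (inhabits (mkposreal 1 Rlt_0_1))
    (fun d : posreal => forall z : C, Rabs (Re z - u) < d -> Rabs (Im z - v) < d -> Q z d)).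
  assert (Hdelta : forall u v (z : C), Rabs (Re z - u) < delta u v ->
            Rabs (Im z - v) < delta u v -> Q z (delta u v)).
  { intros u v. apply (epsilon_spec _ _ (H' u v)). }
  destruct (compactness_value_2d (- B) B (- B) B delta) as [d Hd].
  exists d. split; [apply cond_pos|]. intros z Hz.
  pose proof (re_le_Cmod z) as Z1. pose proof (im_le_Cmod z) as Z2.
  assert (Y1 : Rabs (Re z) <= B) by lra. assert (Y2 : Rabs (Im z) <= B) by lra.
  apply Rabs_le_between in Y1. apply Rabs_le_between in Y2.
  apply NNPP. intros N. apply (Hd (Re z) (Im z) Y1 Y2).
  intros (u & v & _ & _ & K1 & K2 & K3). apply N.
  apply mono with (delta u v); [apply cond_pos|exact K3|]. now apply Hdelta.
Qed.

Lemma continuous_on_eps (D : C -> Prop) (X : C -> R3) (t : C) (eps : R) :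
  continuous_on
    (T := C_UniformSpace)
    (U := prod_UniformSpace (prod_UniformSpace R_UniformSpace R_UniformSpace) R_UniformSpace)
    D X ->
  D t -> 0 < eps -> exists d, 0 < d /\ forall z, D z -> Cmod (z - t) < d ->
    Rabs (x1 (X z) - x1 (X t)) < eps /\ Rabs (x2 (X z) - x2 (X t)) < eps /\
    Rabs (x3 (X z) - x3 (X t)) < eps.
Proof.
  intros H Dt Heps. specialize (H t Dt).
  assert (L : locally (T := prod_UniformSpace (prod_UniformSpace R_UniformSpace R_UniformSpace)
      R_UniformSpace) (X t) (fun q : R3 => Rabs (x1 q - x1 (X t)) < eps /\
      Rabs (x2 q - x2 (X t)) < eps /\ Rabs (x3 q - x3 (X t)) < eps)).
  { exists (mkposreal eps Heps). intros q [[B1 B2] B3]. split; [exact B1|split; [exact B2|exact B3]]. }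
  apply H in L. unfold filtermap, within in L. apply locally_Cmod in L.
  destruct L as (d & Hd & K). exists d. split; [exact Hd|]. intros z Dz Hz. now apply K.
Qed.

Definition annulus (d r : R) (z : C) : Prop := d <= Cmod z <= r.

Lemma annulus_closed (d r : R) (t : C) : ~ annulus d r t ->
  exists e, 0 < e /\ forall z, Cmod (z - t) < e -> ~ annulus d r z.
Proof.
  intros N. unfold annulus in *.
  destruct (Rlt_dec (Cmod t) d) as [H|H].
  - exists (d - Cmod t). split; [lra|]. intros z Hz. pose proof (Cmod_triangle_rev z t). lra.
  - exists (Cmod t - r). split; [lra|]. intros z Hz. pose proof (Cmod_triangle_rev t z) as T.
    rewrite Cmod_sub_sym in T. lra.
Qed.

Lemma bounded_on_annulus (d r : R) (X : C -> R3) : 0 < d ->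
  continuous_on
    (T := C_UniformSpace)
    (U := prod_UniformSpace (prod_UniformSpace R_UniformSpace R_UniformSpace) R_UniformSpace)
    (punctured_disk r) X ->
  exists B, forall z, annulus d r z ->
    Rabs (x1 (X z)) <= B /\ Rabs (x2 (X z)) <= B /\ Rabs (x3 (X z)) <= B.
Proof.
  intros Hd HC.
  (* The bound is written as [/ e], so that shrinking [e] weakens the property, as the compactness
     lemma requires. *)
  destruct (compact_local_uniform r (fun z e => annulus d r z ->
     Rabs (x1 (X z)) <= / e /\ Rabs (x2 (X z)) <= / e /\ Rabs (x3 (X z)) <= / e)) as (e & He & K).
  - intros z e e' He' Hee' Q A. destruct (Q A) as (Q1 & Q2 & Q3).
    assert (/ e <= / e') by (apply Rinv_le_contravar; lra). lra.
  - intros t. destruct (classic (annulus d r t)) as [A|A].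
    + assert (Dt : punctured_disk r t) by (unfold annulus, punctured_disk in *; lra).
      destruct (continuous_on_eps _ X t 1 HC Dt Rlt_0_1) as (e & He & K).
      set (m := Rabs (x1 (X t)) + Rabs (x2 (X t)) + Rabs (x3 (X t)) + 1).
      pose proof (Rabs_pos (x1 (X t))). pose proof (Rabs_pos (x2 (X t))).
      pose proof (Rabs_pos (x3 (X t))).
      assert (0 < m) by (unfold m; lra).
      exists (Rmin e (/ m)). assert (0 < / m) by now apply Rinv_0_lt_compat.
      split; [now apply Rmin_pos|]. intros z Hz Az.
      pose proof (Rmin_l e (/ m)). pose proof (Rmin_r e (/ m)).
      destruct (K z) as (K1 & K2 & K3); [unfold annulus, punctured_disk in *; lra|lra|].
      assert (m <= / Rmin e (/ m)).
      { rewrite <- (Rinv_inv m) at 1. apply Rinv_le_contravar; [now apply Rmin_pos|lra]. }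
      pose proof (Rabs_triang_inv (x1 (X z)) (x1 (X t))).
      pose proof (Rabs_triang_inv (x2 (X z)) (x2 (X t))).
      pose proof (Rabs_triang_inv (x3 (X z)) (x3 (X t))). unfold m in *. lra.
    + destruct (annulus_closed _ _ _ A) as (e & He & K).
      exists e. split; [exact He|]. intros z Hz Az. now destruct (K z Hz).
  - exists (/ e). intros z A. apply K; [apply A|exact A].
Qed.

(* Away from the puncture the end is the continuous image of a compact annulus. *)
Lemma ray_near_puncture (r : R) (g f : C -> C) (X : C -> R3) (a v : R3) :
  minimal_annular_end r g f X -> v <> (0, 0, 0) ->
  (forall q, ray a v q -> image X (punctured_disk r) q) ->
  forall rho, 0 < rho -> exists t0, 0 <= t0 /\ forall t, t0 <= t -> exists z,
    z <> RtoC 0 /\ Cmod z < rho /\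
    X z = (x1 a + t * x1 v, x2 a + t * x2 v, x3 a + t * x3 v).
Proof.
  intros [Hr HW HC] Hv Hray rho Hrho.
  destruct (bounded_on_annulus rho r X Hrho HC) as [B HB].
  assert (far : forall p u, u <> 0 -> exists t0, 0 <= t0 /\ forall t, t0 <= t -> B < Rabs (p + t * u)).
  { intros p u Hu. assert (0 < Rabs u) by now apply Rabs_pos_lt.
    pose proof (Rabs_pos B). pose proof (Rabs_pos p). pose proof (Rle_abs B).
    exists ((Rabs B + Rabs p + 1) / Rabs u). split; [apply Rmult_le_pos; [lra|left; now apply Rinv_0_lt_compat]|].
    intros t Ht.
    assert (Rabs B + Rabs p + 1 <= t * Rabs u).
    { apply Rle_trans with ((Rabs B + Rabs p + 1) / Rabs u * Rabs u);
        [right; field; lra|apply Rmult_le_compat_r; lra]. }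
    assert (0 <= t).
    { apply Rle_trans with (2 := Ht). apply Rmult_le_pos; [lra|left; now apply Rinv_0_lt_compat]. }
    pose proof (Rabs_triang (p + t * u) (- p)) as T.
    replace (p + t * u + - p) with (t * u) in T by ring.
    rewrite Rabs_mult, (Rabs_pos_eq t), Rabs_Ropp in T by assumption. lra. }
  assert (exists t0, 0 <= t0 /\ forall t, t0 <= t -> B < Rabs (x1 a + t * x1 v) \/
    B < Rabs (x2 a + t * x2 v) \/ B < Rabs (x3 a + t * x3 v)) as (t0 & Ht0 & F).
  { destruct (Req_dec (x1 v) 0) as [E1|E1].
    - destruct (Req_dec (x2 v) 0) as [E2|E2].
      + destruct (Req_dec (x3 v) 0) as [E3|E3].
        * exfalso. apply Hv. destruct v as [[v1 v2] v3]. unfold x1, x2, x3 in *. simpl in *. now subst.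
        * destruct (far (x3 a) (x3 v) E3) as (t0 & Ht0 & F). exists t0. split; auto.
      + destruct (far (x2 a) (x2 v) E2) as (t0 & Ht0 & F). exists t0. split; auto.
    - destruct (far (x1 a) (x1 v) E1) as (t0 & Ht0 & F). exists t0. split; auto. }
  exists t0. split; [exact Ht0|]. intros t Ht.
  destruct (Hray (x1 a + t * x1 v, x2 a + t * x2 v, x3 a + t * x3 v)) as (z & Dz & E).
  { exists t. split; [lra|reflexivity]. }
  exists z. destruct Dz as [D1 D2]. split; [now apply Cmod_gt_0|]. split; [|now symmetry].
  apply Rnot_le_lt. intros L. destruct (HB z (conj L D2)) as (B1 & B2 & B3).
  rewrite <- E in B1, B2, B3. unfold x1, x2, x3 in *. simpl in *.
  destruct (F t Ht) as [F1|[F1|F1]]; lra.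
Qed.

Section Rays.

Variables (r : R) (g f : C -> C) (X : C -> R3) (r1 R0 : R) (h k : C -> C).
Hypothesis Hend : minimal_annular_end r g f X.
Hypothesis Hki : forall z, z <> RtoC 0 -> Cmod z < r1 -> R0 < Cmod (h z) -> k (h z) = z.
Hypothesis Hinf : forall M, exists rho, 0 < rho < r1 /\
  forall z, z <> RtoC 0 -> Cmod z < rho -> M < Cmod (h z).
Hypothesis Hx3 : forall z, z <> RtoC 0 -> Cmod z < r1 -> x3 (X z) = Re (h z).

(** The sign [sg] tells whether the ray points up or down. Points of the ray beyond [t0] come from
    near the puncture, where the coordinate [w] is available; nothing is claimed about how [w]
    depends on [s]. *)
Lemma vertical_ray_height : contains_ray (image X (punctured_disk r)) vertical ->
  exists (b : C) (sg s0 : R), (sg = 1 \/ sg = -1) /\ forall s, s0 <= s -> exists w,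
    R0 < Cmod w /\ Re w = sg * s /\ horizontal_part X (k w) = b.
Proof.
  intros (a & v & Hv & [V1 V2] & Hray).
  destruct (Hinf R0) as (rho & Hrho & Hbig).
  destruct (ray_near_puncture r g f X a v Hend Hv Hray rho) as (t0 & Ht0 & F); [lra|].
  assert (V3 : x3 v <> 0).
  { intros E. apply Hv. destruct v as [[v1 v2] v3]. unfold x1, x2, x3 in *. simpl in *. now subst. }
  set (sg := if Rlt_dec 0 (x3 v) then 1 else -1).
  assert (Hsg : sg = 1 \/ sg = -1) by (unfold sg; destruct Rlt_dec; auto).
  assert (P : 0 < sg * x3 v) by (unfold sg; destruct Rlt_dec; lra).
  assert (S2 : sg * sg = 1) by (destruct Hsg as [-> | ->]; ring).
  exists (x1 a, x2 a), sg, (sg * x3 a + t0 * (sg * x3 v)). split; [exact Hsg|].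
  intros s Hs. set (t := (s - sg * x3 a) / (sg * x3 v)).
  assert (Et : t * (sg * x3 v) = s - sg * x3 a) by (unfold t; field; lra).
  destruct (F t) as (z & Nz & Hz & E).
  { apply Rmult_le_reg_r with (sg * x3 v); [exact P|]. rewrite Et. lra. }
  assert (B := Hbig z Nz Hz).
  exists (h z). split; [exact B|].
  rewrite Hki by (auto; lra). rewrite <- Hx3 by (auto; lra). unfold horizontal_part.
  rewrite E, V1, V2. unfold x1, x2, x3 in *. simpl. split.
  - assert (Es : s = sg * (snd a + t * snd v)).
    { rewrite Rmult_plus_distr_l. replace (sg * (t * snd v)) with (t * (sg * snd v)) by ring.
      rewrite Et. ring. }
    rewrite Es, <- Rmult_assoc, S2. ring.
  - f_equal; ring.
Qed.

(** The bound [R'] is left free because far points of the ray come from arbitrarily small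
    neighbourhoods of the puncture. *)
Lemma horizontal_ray_height : contains_ray (image X (punctured_disk r)) horizontal ->
  exists (c : R) (a v : C), v <> RtoC 0 /\ forall R', R0 <= R' ->
    exists t0, forall t, t0 <= t -> exists w,
      R' < Cmod w /\ Re w = c /\ horizontal_part X (k w) = (a + RtoC t * v)%C.
Proof.
  intros (a & v & Hv & V3 & Hray). unfold horizontal in V3.
  exists (x3 a), (x1 a, x2 a), (x1 v, x2 v). split.
  { intros E. injection E as E1 E2. apply Hv.
    destruct v as [[v1 v2] v3]. unfold x1, x2, x3 in *. simpl in *. now subst. }
  intros R' HR'.
  destruct (Hinf R') as (rho & Hrho & Hbig).
  destruct (ray_near_puncture r g f X a v Hend Hv Hray rho) as (t0 & Ht0 & F); [lra|].
  exists t0. intros t Ht. destruct (F t Ht) as (z & Nz & Hz & E).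
  assert (B := Hbig z Nz Hz).
  exists (h z). split; [exact B|].
  rewrite Hki by (auto; lra). rewrite <- Hx3 by (auto; lra). unfold horizontal_part.
  rewrite E, V3. unfold x1, x2, x3. simpl. split; [ring|]. Ceq.
Qed.

End Rays.

(** * Discrete sets *)

Definition countable_set (S : C -> Prop) : Prop :=
  exists e : nat -> C, forall w, S w -> exists n, e n = w.

Lemma countable_union (S S' : C -> Prop) :
  countable_set S -> countable_set S' -> countable_set (fun w => S w \/ S' w).
Proof.
  intros [e He] [e' He'].
  exists (fun n => let (i, m) := Cantor.of_nat n in match i with O => e m | _ => e' m end).
  intros w [H|H].
  - destruct (He w H) as [m Hm]. exists (Cantor.to_nat (0, m)%nat). now rewrite Cantor.cancel_of_to.
  - destruct (He' w H) as [m Hm]. exists (Cantor.to_nat (1, m)%nat). now rewrite Cantor.cancel_of_to.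
Qed.

(* Points isolated at scale [1 / (m + 1)] are told apart by the cell of a grid
   of mesh [1 / (2 (m + 1))] containing them. *)
Lemma isolated_countable (S : C -> Prop) :
  (forall p, S p -> exists d, 0 < d /\ forall q, S q -> Cmod (q - p) < d -> q = p) ->
  countable_set S.
Proof.
  intros H.
  set (cell := fun (m : nat) (x : R) => Int_part (2 * (INR m + 1) * x)).
  set (good := fun (m : nat) (p : C) =>
    S p /\ forall q, S q -> Cmod (q - p) < / (INR m + 1) -> q = p).
  set (dec := fun n => let (a, b) := Cantor.of_nat n in (Z.of_nat a - Z.of_nat b)%Z).
  assert (Hdec : forall i, exists n, dec n = i).
  { intros i. exists (Cantor.to_nat (Z.to_nat i, Z.to_nat (- i))). unfold dec.
    rewrite Cantor.cancel_of_to. lia. }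
  exists (fun n => let (m, n') := Cantor.of_nat n in let (i, j) := Cantor.of_nat n' in
    epsilon (inhabits (RtoC 0)) (fun p => good m p /\ cell m (Re p) = dec i /\ cell m (Im p) = dec j)).
  intros p Hp. destruct (H p Hp) as (d & Hd & K).
  destruct (archimed_cor1 d Hd) as (m & Hm & Pm).
  assert (Pm' : 0 < INR m) by now apply lt_0_INR.
  assert (Gp : good m p).
  { split; [exact Hp|]. intros q Hq Hqp. apply K; [exact Hq|].
    assert (/ (INR m + 1) <= / INR m) by (apply Rinv_le_contravar; lra). lra. }
  destruct (Hdec (cell m (Re p))) as [i Hi]. destruct (Hdec (cell m (Im p))) as [j Hj].
  exists (Cantor.to_nat (m, Cantor.to_nat (i, j))). rewrite !Cantor.cancel_of_to.
  match goal with |- epsilon ?a ?P = _ => pose proof (epsilon_spec a P) as E; set (q := epsilon a P) in * end.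
  destruct E as (Gq & E1 & E2).
  { exists p. auto. }
  destruct Gq as [Sq _]. apply Gp; [exact Sq|].
  assert (near : forall x y, cell m x = cell m y -> Rabs (x - y) < / (INR m + 1) / 2).
  { intros x y E. unfold cell in E.
    destruct (base_Int_part (2 * (INR m + 1) * x)) as [X1 X2].
    destruct (base_Int_part (2 * (INR m + 1) * y)) as [Y1 Y2]. rewrite E in X1, X2.
    apply Rabs_def1; apply Rmult_lt_reg_l with (2 * (INR m + 1)); try lra;
      replace (2 * (INR m + 1) * (/ (INR m + 1) / 2)) with 1 by (field; lra);
      try replace (2 * (INR m + 1) * - (/ (INR m + 1) / 2)) with (-1) by (field; lra); lra. }
  eapply Rle_lt_trans; [apply Cmod_le_components|].
  assert (N1 : Rabs (Re q - Re p) < / (INR m + 1) / 2) by (apply near; congruence).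
  assert (N2 : Rabs (Im q - Im p) < / (INR m + 1) / 2) by (apply near; congruence).
  change (Rabs (Re q - Re p) + Rabs (Im q - Im p) < / (INR m + 1)). lra.
Qed.

(** Cantor's nested intervals: stage [n] keeps an outer third that avoids [u n]. *)
Lemma interval_not_enumerable (u : nat -> R) (a b : R) : a < b ->
  exists t, a <= t <= b /\ forall n, u n <> t.
Proof.
  intros Hab.
  set (step := fun (n : nat) (I : R * R) => let (x, y) := I in
    if Rlt_dec (x + (y - x) / 3) (u n) then (x, x + (y - x) / 3) else (y - (y - x) / 3, y)).
  set (I := fix I n := match n with O => (a, b) | S m => step m (I m) end).
  assert (P : forall n, fst (I n) < snd (I n)).
  { induction n; [exact Hab|]. simpl. destruct (I n) as [x y]. simpl in *. destruct Rlt_dec; simpl; lra. }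
  assert (M : forall n, fst (I n) <= fst (I (S n)) /\ snd (I (S n)) <= snd (I n)).
  { intros n. specialize (P n). simpl. destruct (I n) as [x y]. simpl in *. destruct Rlt_dec; simpl; lra. }
  destruct (nested_intervals (fun n => fst (I n)) (fun n => snd (I n)) a b) as (t & Ht & K);
    try (simpl; lra); try (intros n; apply M).
  { intros n. left. apply P. }
  exists t. split; [exact Ht|]. intros n E.
  specialize (K (S n)). specialize (P n). simpl in K. destruct (I n) as [x y]. simpl in *.
  destruct Rlt_dec; simpl in K; lra.
Qed.

Lemma countable_no_interval (S : C -> Prop) (phi : C -> R) (a b : R) : a < b ->
  countable_set S -> ~ (forall t, a <= t <= b -> exists w, S w /\ phi w = t).
Proof.
  intros Hab [e He] H.
  destruct (interval_not_enumerable (fun n => phi (e n)) a b Hab) as (t & Ht & N).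
  destruct (H t Ht) as (w & Sw & E). destruct (He w Sw) as [n En].
  apply (N n). now rewrite En.
Qed.

(** * Consequences of the rays *)

(** Turns [dF] into [G / 2] times [- dw + |G|^-2 conj dw]. In this form it is visible that [dF]
    never kills a vertical vector and kills horizontal ones exactly when [|G| = 1]. *)
Lemma Cconj_inv (G : C) : G <> RtoC 0 -> Cconj (/ G) = (RtoC (/ (Cmod G * Cmod G)) * G)%C.
Proof.
  intros H. assert (P : 0 < Cmod G) by now apply Cmod_gt_0.
  pose proof (Cmod_sqr G) as E. assert (0 < Cmod G * Cmod G) by nra.
  rewrite E. rewrite E in H0. destruct G as [x y]. unfold Re, Im, Cconj, Cinv in *. simpl in *.
  Ceq; field; lra.
Qed.

Section HeightEnd.

Variables (R0 : R) (G F L : C -> C) (al be : C) (K : R).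
Hypothesis HE : height_end R0 G F L al be K.

Lemma height_L_close (w : C) : R0 < Cmod w ->
  Cmod (L w - al) <= (Cmod be + Rabs K) / Cmod w.
Proof.
  intros Hw. pose proof (he_R0 _ _ _ _ _ _ _ HE).
  pose proof (he_L _ _ _ _ _ _ _ HE w Hw) as B.
  assert (Nw : w <> RtoC 0) by (apply Cmod_neq_0; lra).
  replace (L w - al)%C with ((L w - (al + be / w)) + be / w)%C by ring.
  eapply Rle_trans; [apply Cmod_triangle|]. rewrite Cmod_div by exact Nw.
  assert (K / (Cmod w * Cmod w) <= Rabs K / Cmod w).
  { apply Rle_trans with (Rabs K / (Cmod w * Cmod w)).
    - apply Rmult_le_compat_r; [left; apply Rinv_0_lt_compat; nra|apply Rle_abs].
    - apply Rmult_le_compat_l; [apply Rabs_pos|]. apply Rinv_le_contravar; nra. }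
  unfold Rdiv in *. lra.
Qed.

(** Along [Re w = c] the derivative of [F] in [Im w] is a negative multiple of [i G], so [F] is
    tangent to a line of direction [v] only where [Re (conj v G)] vanishes. Where it does, the
    derivative of that quantity is a nonzero multiple of [Re L]. If [Re al] were nonzero, both kinds
    of points would be isolated far out, and countably many points cannot cover a ray. *)
Lemma horizontal_ray_al (c : R) (a v : C) : v <> RtoC 0 ->
  (forall R', R0 <= R' -> exists t0, forall t, t0 <= t -> exists w,
     R' < Cmod w /\ Re w = c /\ F w = (a + RtoC t * v)%C) ->
  Re al = 0.
Proof.
  intros Hv H. destruct (Req_dec (Re al) 0) as [E|Nal]; [exact E|exfalso].
  pose proof (he_R0 _ _ _ _ _ _ _ HE) as HR0.
  assert (Pv : 0 < Cmod v) by now apply Cmod_gt_0.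
  assert (Pal : 0 < Rabs (Re al)) by now apply Rabs_pos_lt.
  set (b := Cmod be + Rabs K).
  assert (Hb : 0 <= b) by (unfold b; pose proof (Cmod_ge_0 be); pose proof (Rabs_pos K); lra).
  set (R' := Rmax R0 (b / Rabs (Re al))).
  assert (HR' : R0 <= R') by apply Rmax_l.
  assert (HL : forall w, R' < Cmod w -> Re (L w) <> 0).
  { intros w Hw Z. assert (Hw0 : R0 < Cmod w) by lra.
    pose proof (height_L_close w Hw0) as B. fold b in B.
    assert (b / Rabs (Re al) < Cmod w) by (pose proof (Rmax_r R0 (b / Rabs (Re al))); unfold R' in Hw; lra).
    pose proof (re_le_Cmod (L w - al)) as T.
    change (Re (L w - al)) with (Re (L w) - Re al) in T. rewrite Z in T.
    replace (0 - Re al) with (- Re al) in T by ring. rewrite Rabs_Ropp in T.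
    assert (Rabs (Re al) * Cmod w <= b).
    { apply Rle_trans with (b / Cmod w * Cmod w); [apply Rmult_le_compat_r; lra|right; field; lra]. }
    assert (b < Rabs (Re al) * Cmod w).
    { apply Rle_lt_trans with (Rabs (Re al) * (b / Rabs (Re al))); [right; field; lra|].
      apply Rmult_lt_compat_l; lra. }
    lra. }
  (* [S1] holds the points over the line where [F] crosses it transversally; [S2] holds all points
     where [F] moves parallel to [v], on the line or not. *)
  set (S1 := fun w => R' < Cmod w /\ Re w = c /\ (exists t, F w = (a + RtoC t * v)%C) /\
     Re (Cconj v * G w) <> 0).
  set (S2 := fun w => R' < Cmod w /\ Re w = c /\ Re (Cconj v * G w) = 0).
  assert (delta : forall p q : C, Re p = c -> Re q = c ->
            (q - p)%C = (Ci * RtoC (Im q - Im p))%C /\ Cmod (q - p) = Rabs (Im q - Im p)).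
  { intros p q Hp Hq.
    assert (E : (q - p)%C = (Ci * RtoC (Im q - Im p))%C).
    { destruct p, q. unfold Re, Im in *. simpl in *. subst. Ceq. }
    split; [exact E|]. rewrite E, Cmod_mult, Cmod_Ci, Cmod_R. ring. }
  assert (finish : forall p q : C, Re p = c -> Re q = c -> Rabs (Im q - Im p) <= 0 -> q = p).
  { intros p q Hp Hq Z. destruct (delta p q Hp Hq) as [_ E].
    assert (Z' : (q - p)%C = RtoC 0) by (apply Cmod_eq_0; pose proof (Rabs_pos (Im q - Im p)); lra).
    replace q with (q - p + p)%C by ring. rewrite Z'. ring. }
  assert (C1 : countable_set S1).
  { apply isolated_countable. intros p (P1 & P2 & (t & P3) & P4).
    destruct (he_G _ _ _ _ _ _ _ HE p ltac:(lra)) as [G0 _].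
    pose proof (he_F _ _ _ _ _ _ _ HE p ltac:(lra)) as W.
    set (kap := Re (Cconj v * G p)) in *. assert (Pk : 0 < Rabs kap) by now apply Rabs_pos_lt.
    destruct (W (Rabs kap / (4 * Cmod v))) as (d & Hd & B).
    { apply Rdiv_lt_0_compat; lra. }
    exists d. split; [exact Hd|]. intros q (Q1 & Q2 & (t' & Q3) & _) Hqp.
    destruct (delta p q P2 Q2) as [E1 E2]. apply finish; auto.
    specialize (B q Hqp). rewrite E2 in B. set (dy := Im q - Im p) in *.
    rewrite E1 in B. rewrite Cconj_inv in B by exact G0.
    set (m := / (Cmod (G p) * Cmod (G p))) in *.
    assert (Pm : 0 < m).
    { unfold m. apply Rinv_0_lt_compat. apply Cmod_gt_0 in G0. nra. }
    set (X := (F q - F p - (- G p / 2 * (Ci * RtoC dy) + RtoC m * G p / 2 * Cconj (Ci * RtoC dy)))%C) in *.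
    assert (I : Im (Cconj v * X) = dy / 2 * (kap * (1 + m))).
    { unfold X, kap. rewrite P3, Q3.
      generalize (G p). intros g0. destruct v as [v1 v2], g0 as [g1 g2], a as [a1 a2].
      unfold Im, Re, Cconj. simpl. field. }
    pose proof (im_le_Cmod (Cconj v * X)) as T. rewrite I, Cmod_mult, Cmod_conj in T.
    assert (T2 : Cmod v * Cmod X <= Rabs kap / 4 * Rabs dy).
    { apply Rle_trans with (Cmod v * (Rabs kap / (4 * Cmod v) * Rabs dy)).
      - apply Rmult_le_compat_l; lra.
      - right. field. lra. }
    unfold Rdiv in T at 1. rewrite !Rabs_mult in T.
    rewrite (Rabs_pos_eq (1 + m)), (Rabs_pos_eq (/ 2)) in T by lra.
    pose proof (Rabs_pos dy). apply Rnot_lt_le. intros Pd.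
    assert (0 < Rabs dy * Rabs kap) by nra. nra. }
  assert (C2 : countable_set S2).
  { apply isolated_countable. intros p (P1 & P2 & P3).
    destruct (he_G _ _ _ _ _ _ _ HE p ltac:(lra)) as [G0 W].
    pose proof (HL p P1) as NL.
    set (kap := Im (Cconj v * G p)).
    assert (Ek : (Cconj v * G p)%C = (Ci * RtoC kap)%C).
    { unfold kap. clear - P3. revert P3. generalize (Cconj v * G p)%C. intros [x y].
      unfold Re, Im. simpl. intros ->. Ceq. }
    assert (Pk : 0 < Rabs kap).
    { apply Rabs_pos_lt. intros Z. rewrite Z in Ek.
      assert (Z' : Cmod (Cconj v * G p) = 0) by (rewrite Ek, Cmod_mult, Cmod_0; ring).
      rewrite Cmod_mult, Cmod_conj in Z'. apply Cmod_gt_0 in G0. nra. }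
    assert (PL : 0 < Rabs (Re (L p))) by now apply Rabs_pos_lt.
    set (e := Rabs kap * Rabs (Re (L p)) / (2 * Cmod v)).
    assert (He : 0 < e) by (apply Rdiv_lt_0_compat; nra).
    destruct (W e He) as (d & Hd & B).
    exists d. split; [exact Hd|]. intros q (Q1 & Q2 & Q3) Hqp.
    destruct (delta p q P2 Q2) as [E1 E2]. apply finish; auto.
    specialize (B q Hqp). rewrite E2 in B. set (dy := Im q - Im p) in *. rewrite E1 in B.
    set (X := (G q - G p - (G p * L p * (Ci * RtoC dy) + 0 * Cconj (Ci * RtoC dy)))%C) in *.
    assert (I : Re (Cconj v * X) = kap * Re (L p) * dy).
    { replace (Cconj v * X)%C with
        (Cconj v * G q - Cconj v * G p - (Cconj v * G p) * L p * (Ci * RtoC dy))%C by (unfold X; ring).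
      rewrite Ek.
      change (Re (Cconj v * G q) - Re (Ci * RtoC kap) - Re (Ci * RtoC kap * L p * (Ci * RtoC dy))
         = kap * Re (L p) * dy).
      rewrite Q3. destruct (L p) as [l1 l2]. unfold Re. simpl. ring. }
    pose proof (re_le_Cmod (Cconj v * X)) as T. rewrite I, Cmod_mult, Cmod_conj, !Rabs_mult in T.
    assert (T2 : Cmod v * Cmod X <= Rabs kap * Rabs (Re (L p)) / 2 * Rabs dy).
    { apply Rle_trans with (Cmod v * (e * Rabs dy)).
      - apply Rmult_le_compat_l; lra.
      - right. unfold e. field. lra. }
    pose proof (Rabs_pos dy). apply Rnot_lt_le. intros Pd.
    assert (0 < Rabs kap * Rabs (Re (L p))) by nra. nra. }
  destruct (H R' HR') as [t0 Ht].
  (* This function recovers the parameter [t] of the ray from [F w]. *)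
  apply (countable_no_interval _ (fun w => Re (Cconj v * (F w - a)) / (Cmod v * Cmod v)) t0 (t0 + 1))
    with (2 := countable_union _ _ C1 C2); [lra|].
  intros t Htt. destruct (Ht t ltac:(lra)) as (w & W1 & W2 & W3). exists w. split.
  - destruct (Req_dec (Re (Cconj v * G w)) 0) as [Z|Z].
    + right. split; auto.
    + left. split; [exact W1|]. split; [exact W2|]. split; [now exists t|exact Z].
  - rewrite W3. assert (Pvv : 0 < Cmod v * Cmod v) by nra. rewrite Cmod_sqr in *.
    clear - Pvv. destruct v as [v1 v2], a as [a1 a2]. unfold Re, Im, Cconj in *. simpl in *. field. lra.
Qed.

(** Around a circle [ln |G|] and [Re (al w)] return to their values, so integrating [Re (dG / G)]
    leaves only [- 2 PI Im be] and an error of order [1 / rho], which must cancel. *)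
Lemma be_real : Im be = 0.
Proof.
  pose proof (he_R0 _ _ _ _ _ _ _ HE) as HR0. pose proof PI_RGT_0.
  assert (B : forall rho, R0 < rho -> Rabs (2 * PI * Im be) <= K / rho * (2 * PI - 0)).
  { intros rho Hrho.
    set (w := fun t => (RtoC rho * Cis t)%C).
    assert (Mw : forall t, Cmod (w t) = rho) by (intros t; apply Cmod_circle; lra).
    assert (Dw : forall t, cderiv w t (Ci * w t)).
    { intros t. replace (Ci * w t)%C with (RtoC rho * (Ci * Cis t))%C by (unfold w; ring).
      apply cderiv_scal, cderiv_Cis. }
    set (phi := fun t => ln (Cmod (G (w t))) - Re (al * w t) + Im be * t).
    replace (2 * PI * Im be) with (phi (2 * PI) - phi 0).
    2:{ unfold phi, w. rewrite Cis_2PI. ring. }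
    apply (Rabs_increment_le phi (fun t => Re ((L (w t) - (al + be / w t)) * (Ci * w t))%C)); [lra| |].
    - intros t _. destruct (he_G _ _ _ _ _ _ _ HE (w t)) as [G0 W]; [rewrite Mw; lra|].
      pose proof (wder_cderiv _ _ _ _ _ _ (Dw t) W) as D1.
      assert (D2 : is_derive (fun t => ln (Cmod (G (w t)))) t (Re (L (w t) * (Ci * w t))%C)).
      { replace (L (w t) * (Ci * w t))%C with
          ((G (w t) * L (w t) * (Ci * w t) + 0 * Cconj (Ci * w t)) / G (w t))%C by (field; exact G0).
        exact (is_derive_ln_Cmod (fun t => G (w t)) _ _ G0 D1). }
      destruct (cderiv_scal al _ _ _ (Dw t)) as [D3 _].
      evar_last.
      + apply (is_derive_plus (V := R_NormedModule) (fun t => ln (Cmod (G (w t))) - Re (al * w t))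
          (fun t => Im be * t)).
        * apply (is_derive_minus (V := R_NormedModule) (fun t => ln (Cmod (G (w t))))
            (fun t => Re (al * w t)%C)); [exact D2|exact D3].
        * apply (is_derive_scal (fun t => t) t (Im be) 1). apply (is_derive_id (K := R_AbsRing)).
      + assert (Nw : w t <> RtoC 0) by (apply Cmod_neq_0; rewrite Mw; lra).
        replace ((L (w t) - (al + be / w t)) * (Ci * w t))%C with
          (L (w t) * (Ci * w t) - al * (Ci * w t) - be * Ci)%C by (field; exact Nw).
        generalize (L (w t) * (Ci * w t))%C, (al * (Ci * w t))%C. intros y1 y2.
        unfold minus, plus, opp, Re, Im. simpl. ring.
    - intros t _. eapply Rle_trans; [apply re_le_Cmod|].
      rewrite !Cmod_mult, Cmod_Ci, Mw.
      pose proof (he_L _ _ _ _ _ _ _ HE (w t)) as B. rewrite Mw in B. specialize (B Hrho).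
      apply Rle_trans with (K / (rho * rho) * (1 * rho)); [apply Rmult_le_compat_r; lra|].
      right. field. lra. }
  destruct (Req_dec (Im be) 0) as [E|N]; [exact E|exfalso].
  assert (P : 0 < Rabs (Im be)) by now apply Rabs_pos_lt.
  set (rho := R0 + 1 + Rabs K / Rabs (Im be)).
  assert (Q : 0 <= Rabs K / Rabs (Im be)).
  { apply Rmult_le_pos; [apply Rabs_pos|left; now apply Rinv_0_lt_compat]. }
  specialize (B rho ltac:(unfold rho; lra)). assert (0 < rho) by (unfold rho; lra).
  rewrite !Rabs_mult, (Rabs_pos_eq 2), (Rabs_pos_eq PI), Rminus_0_r in B by lra.
  assert (Rabs (Im be) <= K / rho).
  { apply Rmult_le_reg_r with (2 * PI); [lra|]. lra. }
  assert (Rabs (Im be) * rho <= K).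
  { apply Rle_trans with (K / rho * rho); [apply Rmult_le_compat_r; lra|right; field; lra]. }
  assert (Rabs (Im be) * (Rabs K / Rabs (Im be)) = Rabs K) by (field; lra).
  pose proof (Rle_abs K). unfold rho in *. nra.
Qed.

(** Where [|G|] differs from 1 the differential of [F] is invertible; where [|G| = 1] its kernel is
    the real direction, along which [|G|^2] changes at rate [2 Re L]. Points over the ray are
    therefore isolated unless [|G| = 1] and [Re L = 0]. With [Re al = 0] and [be] real, [Re L = 0]
    forces [|be| |Re w| <= K], which fails at large heights. *)
Lemma vertical_ray_be (b : C) (sg s0 : R) : Re al = 0 -> (sg = 1 \/ sg = -1) ->
  (forall s, s0 <= s -> exists w, R0 < Cmod w /\ Re w = sg * s /\ F w = b) ->
  be = RtoC 0.
Proof.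
  intros Hal Hsg Hray. pose proof be_real as Hbe. pose proof (he_R0 _ _ _ _ _ _ _ HE) as HR0.
  destruct (Req_dec (Re be) 0) as [E|Nb].
  { destruct be as [b1 b2]. unfold Re, Im in *. simpl in *. now subst. }
  exfalso.
  set (S1 := fun w => R0 < Cmod w /\ F w = b /\ Cmod (G w) <> 1).
  set (S2 := fun w => R0 < Cmod w /\ F w = b /\ Cmod (G w) = 1 /\ Re (L w) <> 0).
  assert (finish : forall p q : C, Cmod (q - p) <= 0 -> q = p).
  { intros p q Z. assert (Z' : (q - p)%C = RtoC 0) by (apply Cmod_eq_0; pose proof (Cmod_ge_0 (q - p)); lra).
    replace q with (q - p + p)%C by ring. rewrite Z'. ring. }
  assert (C1 : countable_set S1).
  { apply isolated_countable. intros p (P1 & P2 & P3).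
    destruct (he_G _ _ _ _ _ _ _ HE p P1) as [G0 _].
    pose proof (he_F _ _ _ _ _ _ _ HE p P1) as W.
    assert (Pg : 0 < Cmod (G p)) by now apply Cmod_gt_0.
    set (kap := Rabs (Cmod (G p) - / Cmod (G p))).
    assert (Pk : 0 < kap).
    { apply Rabs_pos_lt. intros Z. apply P3.
      assert (Cmod (G p) * Cmod (G p) = 1).
      { replace 1 with (/ Cmod (G p) * Cmod (G p)) by (field; lra). nra. }
      nra. }
    destruct (W (kap / 4)) as (d & Hd & B); [lra|].
    exists d. split; [exact Hd|]. intros q (Q1 & Q2 & _) Hqp. specialize (B q Hqp).
    apply finish. rewrite P2, Q2 in B. set (dl := (q - p)%C) in *.
    match type of B with Cmod (b - b - ?x) <= _ => replace (b - b - x)%C with (- x)%C in B by ring end.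
    rewrite Cmod_opp in B.
    assert (T : kap / 2 * Cmod dl <= Cmod (- G p / 2 * dl + Cconj (/ G p) / 2 * Cconj dl)).
    { assert (E2 : Cmod 2 = 2) by (rewrite Cmod_R, Rabs_pos_eq; lra).
      assert (N2 : RtoC 2 <> RtoC 0) by (apply Cmod_neq_0; lra).
      assert (M1 : Cmod (- G p / 2 * dl) = Cmod (G p) / 2 * Cmod dl).
      { rewrite Cmod_mult, Cmod_div, Cmod_opp, E2 by exact N2. reflexivity. }
      assert (M2 : Cmod (Cconj (/ G p) / 2 * Cconj dl) = / Cmod (G p) / 2 * Cmod dl).
      { rewrite Cmod_mult, Cmod_div, !Cmod_conj, E2, Cmod_inv by assumption. reflexivity. }
      pose proof (Cmod_triangle_rev (- G p / 2 * dl) (- (Cconj (/ G p) / 2 * Cconj dl))) as T1.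
      pose proof (Cmod_triangle_rev (Cconj (/ G p) / 2 * Cconj dl) (- (- G p / 2 * dl))) as T2.
      rewrite Cmod_opp, M1, M2 in T1, T2.
      replace (- G p / 2 * dl - - (Cconj (/ G p) / 2 * Cconj dl))%C with
        (- G p / 2 * dl + Cconj (/ G p) / 2 * Cconj dl)%C in T1 by ring.
      replace (Cconj (/ G p) / 2 * Cconj dl - - (- G p / 2 * dl))%C with
        (- G p / 2 * dl + Cconj (/ G p) / 2 * Cconj dl)%C in T2 by ring.
      pose proof (Cmod_ge_0 dl).
      unfold kap, Rabs. destruct Rcase_abs; lra. }
    nra. }
  assert (C2 : countable_set S2).
  { apply isolated_countable. intros p (P1 & P2 & P3 & P4).
    destruct (he_G _ _ _ _ _ _ _ HE p P1) as [G0 WG].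
    pose proof (he_F _ _ _ _ _ _ _ HE p P1) as W.
    rewrite Cconj_inv, P3 in W by exact G0.
    replace (/ (1 * 1)) with 1 in W by field. rewrite Cmult_1_l in W.
    pose proof (wder_mult _ _ _ _ _ _ _ WG (wder_comp _ _ _ _ _ _ _ WG (wder_conj (G p)))) as WN.
    cbv beta in WN.
    assert (N1 : (G p * Cconj (G p))%C = RtoC 1).
    { rewrite <- Cmod2_conj, P3. unfold RtoC. Ceq. }
    apply (wder_eq _ _ _ _ (L p) (Cconj (L p))) in WN.
    2:{ rewrite Cconj_0. transitivity ((G p * Cconj (G p)) * L p)%C; [ring|]. rewrite N1. ring. }
    2:{ rewrite Cmult_conj. transitivity ((G p * Cconj (G p)) * Cconj (L p))%C; [ring|]. rewrite N1. ring. }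
    assert (PL : 0 < Rabs (Re (L p))) by now apply Rabs_pos_lt.
    pose proof (Cmod_ge_0 (L p)) as HLp.
    (* The first entry makes [dl] mostly real, [|dl| <= 2 |Re dl|]; the second keeps the errors
       below the first-order change of [|G|^2]. *)
    set (e := Rmin (1 / 2) (Rabs (Re (L p)) / (4 * (1 + Cmod (L p))))).
    assert (e <= 1 / 2) by rmin.
    assert (e <= Rabs (Re (L p)) / (4 * (1 + Cmod (L p)))) by rmin.
    assert (He : 0 < e) by (apply Rmin_pos; [lra|apply Rdiv_lt_0_compat; lra]).
    destruct (W e He) as (d1 & Hd1 & B1). destruct (WN e He) as (d2 & Hd2 & B2).
    exists (Rmin d1 d2). split; [now apply Rmin_pos|]. intros q (Q1 & Q2 & Q3 & _) Hqp.
    pose proof (Rmin_l d1 d2). pose proof (Rmin_r d1 d2).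
    specialize (B1 q ltac:(lra)). specialize (B2 q ltac:(lra)). apply finish.
    assert (N2 : (G q * Cconj (G q))%C = RtoC 1).
    { rewrite <- Cmod2_conj, Q3. unfold RtoC. Ceq. }
    rewrite P2, Q2 in B1. rewrite N1, N2 in B2. set (dl := (q - p)%C) in *.
    pose proof (Cmod_ge_0 dl).
    assert (I1 : Rabs (Im dl) <= e * Cmod dl).
    { eapply Rle_trans; [|exact B1]. right.
      replace (b - b - (- G p / 2 * dl + G p / 2 * Cconj dl))%C with (G p * (Ci * RtoC (Im dl)))%C.
      - rewrite !Cmod_mult, P3, Cmod_Ci, Cmod_R. ring.
      - generalize (G p). intros g0. destruct g0, dl, b. unfold Im. Ceq; field. }
    assert (I2 : 2 * Rabs (Re (L p * dl)) <= e * Cmod dl).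
    { eapply Rle_trans; [|exact B2]. right.
      replace (RtoC 1 - RtoC 1 - (L p * dl + Cconj (L p) * Cconj dl))%C with (RtoC (- 2 * Re (L p * dl))).
      - rewrite Cmod_R, Rabs_mult, (Rabs_left (- 2)) by lra. ring.
      - destruct (L p), dl. unfold Re. Ceq. }
    rewrite Re_mult in I2.
    pose proof (Cmod_le_components dl) as T1. pose proof (im_le_Cmod (L p)) as T2.
    assert (T3 : Rabs (Re (L p)) * Rabs (Re dl) <= e * Cmod dl / 2 + Cmod (L p) * (e * Cmod dl)).
    { rewrite <- Rabs_mult.
      replace (Re (L p) * Re dl) with ((Re (L p) * Re dl - Im (L p) * Im dl) + Im (L p) * Im dl) by ring.
      eapply Rle_trans; [apply Rabs_triang|].
      apply Rplus_le_compat; [lra|]. rewrite Rabs_mult. apply Rmult_le_compat; try apply Rabs_pos; lra. }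
    assert (T4 : Cmod dl <= 2 * Rabs (Re dl)) by nra.
    assert (T5 : e * (4 * (1 + Cmod (L p))) <= Rabs (Re (L p))).
    { apply Rle_trans with (Rabs (Re (L p)) / (4 * (1 + Cmod (L p))) * (4 * (1 + Cmod (L p))));
        [apply Rmult_le_compat_r; lra|right; field; lra]. }
    apply Rnot_lt_le. intros Pd.
    assert (Rabs (Re (L p)) * Cmod dl <= 2 * (Rabs (Re (L p)) * Rabs (Re dl))) by nra.
    assert (e * (4 * (1 + Cmod (L p))) * Cmod dl <= Rabs (Re (L p)) * Cmod dl)
      by (apply Rmult_le_compat_r; lra).
    assert (0 < e * Cmod dl) by nra. nra. }
  assert (Pb : 0 < Rabs (Re be)) by now apply Rabs_pos_lt.
  (* Beyond this height [|be| s] exceeds [K], which excludes the degenerate points. *)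
  set (s1 := Rmax s0 (Rabs K / Rabs (Re be)) + 1).
  assert (s0 < s1) by (unfold s1; pose proof (Rmax_l s0 (Rabs K / Rabs (Re be))); lra).
  assert (Hs1 : Rabs K / Rabs (Re be) < s1)
    by (unfold s1; pose proof (Rmax_r s0 (Rabs K / Rabs (Re be))); lra).
  assert (S2' : sg * sg = 1) by (destruct Hsg as [-> | ->]; ring).
  apply (countable_no_interval _ (fun w => sg * Re w) s1 (s1 + 1))
    with (2 := countable_union _ _ C1 C2); [lra|].
  intros s Hs. destruct (Hray s ltac:(lra)) as (w & W1 & W2 & W3). exists w. split.
  2:{ rewrite W2, <- Rmult_assoc, S2'. ring. }
  destruct (Req_dec (Cmod (G w)) 1) as [G1|G1]; [|left; split; auto].
  right. split; [exact W1|]. split; [exact W3|]. split; [exact G1|]. intros RL.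
  pose proof (he_L _ _ _ _ _ _ _ HE w W1) as B.
  assert (Pw : 0 < Cmod w * Cmod w) by nra.
  pose proof (re_le_Cmod (L w - (al + be / w))) as T.
  assert (E : Re (L w - (al + be / w)) = - (Re be * (sg * s)) / (Cmod w * Cmod w)).
  { change (Re (L w - (al + be / w))) with (Re (L w) - (Re al + Re (be / w))).
    rewrite RL, Hal, <- W2. rewrite Cmod_sqr in *. clear - Hbe Pw.
    destruct be as [b1 b2], w as [u v]. unfold Re, Im in *. simpl in *. subst. field. lra. }
  rewrite E in T. unfold Rdiv in T. rewrite Rabs_mult, Rabs_Ropp, !Rabs_mult in T.
  rewrite (Rabs_pos_eq (/ _)) in T by (left; now apply Rinv_0_lt_compat).
  assert (A1 : Rabs sg = 1) by (destruct Hsg as [-> | ->]; [apply Rabs_pos_eq|rewrite Rabs_left]; lra).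
  rewrite A1 in T.
  assert (Rabs K / Rabs (Re be) < s) by lra.
  assert (0 <= Rabs K / Rabs (Re be)).
  { apply Rmult_le_pos; [apply Rabs_pos|left; now apply Rinv_0_lt_compat]. }
  rewrite (Rabs_pos_eq s) in T by lra.
  assert (Rabs (Re be) * s <= K).
  { apply Rmult_le_reg_r with (/ (Cmod w * Cmod w)); [now apply Rinv_0_lt_compat|]. unfold Rdiv in *. lra. }
  assert (Rabs K < Rabs (Re be) * s).
  { apply Rle_lt_trans with (Rabs (Re be) * (Rabs K / Rabs (Re be))); [right; field; lra|].
    apply Rmult_lt_compat_l; lra. }
  pose proof (Rle_abs K). lra.
Qed.

End HeightEnd.

(** * Asymptotics of the Gauss map *)

Lemma Cexp_plus (z w : C) : Cexp (z + w) = (Cexp z * Cexp w)%C.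
Proof.
  destruct z as [a b], w as [c d]. unfold Cexp, Re, Im. simpl.
  rewrite exp_plus, cos_plus, sin_plus. Ceq.
Qed.

Lemma Cexp_0 : Cexp 0 = RtoC 1.
Proof. unfold Cexp. simpl. rewrite exp_0, cos_0, sin_0. Ceq. Qed.

Lemma Cmod_Cexp (z : C) : Cmod (Cexp z) = exp (Re z).
Proof.
  replace (Cexp z) with (RtoC (exp (Re z)) * Cis (Im z))%C by (unfold Cexp, Cis; Ceq).
  apply Cmod_circle. left. apply exp_pos.
Qed.

Lemma Cexp_neq_0 (z : C) : Cexp z <> RtoC 0.
Proof. apply Cmod_neq_0. rewrite Cmod_Cexp. apply exp_pos. Qed.

Lemma Cexp_opp (z : C) : (Cexp (- z) * Cexp z)%C = RtoC 1.
Proof. rewrite <- Cexp_plus. replace (- z + z)%C with (RtoC 0) by ring. apply Cexp_0. Qed.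

Lemma Cexp_conj (z : C) : Cconj (Cexp z) = Cexp (Cconj z).
Proof.
  destruct z as [a b]. unfold Cexp, Cconj, Re, Im. simpl. rewrite cos_neg, sin_neg. Ceq.
Qed.

(** The addition formula reduces everything to the origin. There the remainders of [exp], [cos] and
    [sin] add up to at most [9 eta |z|], within the allowance [12 eta |z|]. *)
Lemma wder_Cexp (p : C) : wder Cexp p (Cexp p) 0.
Proof.
  assert (W0 : wder Cexp 0 1 0).
  { intros eps Heps. set (eta := Rmin 1 (eps / 12)).
    assert (eta <= 1) by rmin. assert (eta <= eps / 12) by rmin.
    assert (He : 0 < eta) by (apply Rmin_pos; lra).
    pose proof (proj1 (is_derive_eps exp 0 (exp 0)) (is_derive_exp 0) eta He) as (d1 & Hd1 & K1).
    pose proof (proj1 (is_derive_eps cos 0 (- sin 0)) (is_derive_cos 0) eta He) as (d2 & Hd2 & K2).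
    pose proof (proj1 (is_derive_eps sin 0 (cos 0)) (is_derive_sin 0) eta He) as (d3 & Hd3 & K3).
    rewrite exp_0 in K1. rewrite cos_0, sin_0 in K2. rewrite sin_0, cos_0 in K3.
    set (d := Rmin (Rmin d1 d2) (Rmin d3 eta)).
    assert (d <= d1) by rmin.
    assert (d <= d2) by rmin.
    assert (d <= d3) by rmin.
    assert (d <= eta) by rmin.
    exists d. split; [repeat apply Rmin_pos; lra|].
    intros z Hz. rewrite Csub_0_r in *. rewrite Cexp_0.
    pose proof (re_le_Cmod z) as Z1. pose proof (im_le_Cmod z) as Z2.
    set (x := Re z) in *. set (y := Im z) in *. set (m := Cmod z) in *.
    specialize (K1 x ltac:(rewrite Rminus_0_r; lra)).
    specialize (K2 y ltac:(rewrite Rminus_0_r; lra)).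
    specialize (K3 y ltac:(rewrite Rminus_0_r; lra)).
    rewrite !Rminus_0_r in *.
    replace (cos y - 1 - - 0 * y) with (cos y - 1) in K2 by ring.
    assert (Ex : 0 < exp x <= 3).
    { split; [apply exp_pos|]. apply Rle_trans with (exp 1); [|apply exp_le_3].
      apply exp_le. apply Rle_trans with (Rabs x); [apply Rle_abs|lra]. }
    eapply Rle_trans; [apply Cmod_le_components|].
    assert (E1 : Re (Cexp z - 1 - (1 * z + 0 * Cconj z)) = (exp x - 1 - 1 * x) + exp x * (cos y - 1)).
    { unfold x, y, Cexp. destruct z. unfold Re, Im. simpl. ring. }
    assert (E2 : Im (Cexp z - 1 - (1 * z + 0 * Cconj z)) = exp x * (sin y - 1 * y) + (exp x - 1 - 1 * x) * y + x * y).
    { unfold x, y, Cexp. destruct z. unfold Re, Im. simpl. ring. }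
    replace (sin y - 0 - 1 * y) with (sin y - 1 * y) in K3 by ring.
    rewrite E1, E2.
    pose proof (Rabs_pos x). pose proof (Rabs_pos y).
    assert (B1 : Rabs (exp x * (cos y - 1)) <= 3 * (eta * m)).
    { rewrite Rabs_mult, (Rabs_pos_eq (exp x)) by lra.
      apply Rmult_le_compat; try lra; try apply Rabs_pos. nra. }
    assert (B2 : Rabs (exp x * (sin y - 1 * y)) <= 3 * (eta * m)).
    { rewrite Rabs_mult, (Rabs_pos_eq (exp x)) by lra.
      apply Rmult_le_compat; try lra; try apply Rabs_pos. nra. }
    assert (B3 : Rabs ((exp x - 1 - 1 * x) * y) <= eta * m).
    { rewrite Rabs_mult. apply Rle_trans with ((eta * Rabs x) * Rabs y).
      - apply Rmult_le_compat_r; lra.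
      - rewrite Rmult_assoc. apply Rmult_le_compat_l; [lra|].
        rewrite <- (Rmult_1_l m). apply Rmult_le_compat; lra. }
    assert (B4 : Rabs (x * y) <= eta * m).
    { rewrite Rabs_mult. apply Rmult_le_compat; lra. }
    pose proof (Rabs_triang (exp x - 1 - 1 * x) (exp x * (cos y - 1))).
    pose proof (Rabs_triang (exp x * (sin y - 1 * y) + (exp x - 1 - 1 * x) * y) (x * y)).
    pose proof (Rabs_triang (exp x * (sin y - 1 * y)) ((exp x - 1 - 1 * x) * y)).
    assert (0 <= m) by lra. nra. }
  pose proof (holo_minus _ _ p _ _ (wder_id p) (wder_const p p)) as W1.
  assert (Ep : (p - p)%C = RtoC 0) by ring.
  pose proof (holo_comp (fun z => z - p)%C Cexp p (1 - 0) 1 W1) as W2.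
  cbv beta in W2. rewrite Ep in W2. specialize (W2 W0).
  pose proof (wder_RtoC_scal _ _ _ _ (Cexp p) W2) as W3.
  apply (wder_ext (fun z => Cexp p * Cexp (z - p))%C _ _ _ _ 1); [lra| |].
  - intros z _. rewrite <- Cexp_plus. f_equal. ring.
  - apply (wder_eq _ _ _ _ _ _ W3); ring.
Qed.

(* The factor [x^2] makes the inversion differentiable at infinity without
   appealing to the removable singularity theorem. *)
Definition inversion (D : C -> C) (x : C) : C := (x * x * D (/ x))%C.

(** At 0 the quadratic factor beats the bound on [D], so the derivative there is 0; the arbitrary
    value [D (/ 0)] is multiplied by 0. *)
Lemma inversion_hol (D : C -> C) (R1 M : R) : 0 < R1 ->
  (forall w, R1 < Cmod w -> hol D w) -> (forall w, R1 < Cmod w -> Cmod (D w) <= M) ->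
  forall x, Cmod x < / R1 -> hol (inversion D) x.
Proof.
  intros HR HD HM x Hx.
  assert (big : forall y, y <> RtoC 0 -> Cmod y < / R1 -> R1 < Cmod (/ y)).
  { intros y Ny Hy. rewrite Cmod_inv by exact Ny. apply Cmod_gt_0 in Ny.
    rewrite <- (Rinv_inv R1). apply Rinv_lt_contravar; [|exact Hy].
    apply Rmult_lt_0_compat; [exact Ny|now apply Rinv_0_lt_compat]. }
  destruct (Req_dec (Cmod x) 0) as [E|N].
  - apply Cmod_eq_0 in E. subst x. exists (RtoC 0). intros eps Heps.
    set (M' := Rabs M + 1). assert (0 < M') by (unfold M'; pose proof (Rabs_pos M); lra).
    exists (Rmin (/ R1) (eps / M')).
    split; [apply Rmin_pos; [now apply Rinv_0_lt_compat|now apply Rdiv_lt_0_compat]|].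
    intros z Hz. rewrite Csub_0_r in *. unfold inversion.
    pose proof (Rmin_l (/ R1) (eps / M')). pose proof (Rmin_r (/ R1) (eps / M')).
    replace (z * z * D (/ z) - 0 * 0 * D (/ 0) - (0 * z + 0 * Cconj z))%C with (z * z * D (/ z))%C by ring.
    destruct (Req_dec (Cmod z) 0) as [E|N].
    { apply Cmod_eq_0 in E. subst z. rewrite Cmult_0_l, Cmult_0_l, Cmod_0. lra. }
    assert (Nz : z <> RtoC 0) by (apply Cmod_neq_0; pose proof (Cmod_ge_0 z); lra).
    specialize (HM (/ z)%C (big z Nz ltac:(lra))).
    rewrite !Cmod_mult. pose proof (Cmod_ge_0 z). pose proof (Rle_abs M).
    assert (Cmod z * M' <= eps).
    { apply Rle_trans with (eps / M' * M'); [apply Rmult_le_compat_r; lra|right; field; lra]. }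
    pose proof (Cmod_ge_0 (D (/ z)%C)).
    apply Rle_trans with (Cmod z * Cmod z * M'); [apply Rmult_le_compat_l; [nra|unfold M'; lra]|nra].
  - assert (Nx : x <> RtoC 0) by (apply Cmod_neq_0; pose proof (Cmod_ge_0 x); lra).
    destruct (HD (/ x)%C (big x Nx Hx)) as [l W].
    apply hol_mult; [apply hol_mult; apply hol_id|].
    eexists. apply holo_comp; [|exact W]. apply (holo_inv (fun z => z)); [exact Nx|apply wder_id].
Qed.

(** In the expansion of [x^2 D(1/x)] the constant term is the value 0 at the origin, and a linear
    term would make [D] grow like [a1 w]; the coefficient of [x^2] is the limit. *)
Lemma limit_at_infinity (D : C -> C) (R1 M : R) : 0 < R1 ->
  (forall w, R1 < Cmod w -> hol D w) -> (forall w, R1 < Cmod w -> Cmod (D w) <= M) ->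
  exists (D0 : C) (B : R), 0 <= B /\ forall w, 4 * R1 <= Cmod w -> Cmod (D w - D0) <= B / Cmod w.
Proof.
  intros HR HD HM.
  assert (PR : 0 < / R1) by now apply Rinv_0_lt_compat.
  destruct (taylor_order3 (inversion D) (/ R1) PR (inversion_hol D R1 M HR HD HM))
    as (a0 & a1 & a2 & B & HB & T).
  assert (HM0 : 0 <= M).
  { specialize (HM (RtoC (R1 + 1))). rewrite Cmod_R, Rabs_pos_eq in HM by lra.
    specialize (HM ltac:(lra)). pose proof (Cmod_ge_0 (D (RtoC (R1 + 1)))). lra. }
  assert (A0 : a0 = RtoC 0).
  { specialize (T 0). rewrite Cmod_0 in T. specialize (T ltac:(lra)).
    unfold inversion in T. replace (0 * 0 * D (/ 0) - (a0 + a1 * 0 + a2 * 0 * 0))%C with (- a0)%C in T by ring.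
    rewrite Cmod_opp in T. apply Cmod_eq_0. pose proof (Cmod_ge_0 a0). simpl in T. lra. }
  assert (Inv : forall w, 4 * R1 <= Cmod w ->
    Cmod (D w - (a1 * w + a2)) <= B / Cmod w).
  { intros w Hw. assert (Pw : 0 < Cmod w) by lra.
    assert (Nw : w <> RtoC 0) by now apply Cmod_gt_0.
    specialize (T (/ w)%C). rewrite Cmod_inv in T by exact Nw.
    assert (L : / Cmod w <= / R1 / 4).
    { replace (/ R1 / 4) with (/ (4 * R1)) by (field; lra). apply Rinv_le_contravar; lra. }
    specialize (T L). unfold inversion in T. rewrite A0 in T.
    replace (/ w * / w * D (/ / w) - (0 + a1 * / w + a2 * / w * / w))%C
      with (/ w * / w * (D w - (a1 * w + a2)))%C in T.
    2:{ assert (E : (/ / w)%C = w) by (field; exact Nw). rewrite E. field. exact Nw. }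
    rewrite !Cmod_mult, Cmod_inv in T by exact Nw.
    apply Rmult_le_reg_l with (/ Cmod w * / Cmod w); [apply Rmult_lt_0_compat; now apply Rinv_0_lt_compat|].
    eapply Rle_trans; [exact T|]. right. field. lra. }
  assert (A1 : a1 = RtoC 0).
  { apply Cmod_eq_0, Rle_antisym; [|apply Cmod_ge_0]. apply Rnot_lt_le. intros P.
    pose proof (Cmod_ge_0 a2).
    set (x := 4 * R1 + 1 + (M + B + Cmod a2 + 1) / Cmod a1).
    assert (Q : 0 <= (M + B + Cmod a2 + 1) / Cmod a1).
    { apply Rmult_le_pos; [lra|left; now apply Rinv_0_lt_compat]. }
    assert (Mx : Cmod (RtoC x) = x) by (rewrite Cmod_R, Rabs_pos_eq; unfold x; lra).
    specialize (Inv (RtoC x)). specialize (HM (RtoC x)). rewrite Mx in *.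
    specialize (HM ltac:(unfold x; lra)). specialize (Inv ltac:(unfold x; lra)).
    assert (1 <= x) by (unfold x; lra).
    assert (B / x <= B).
    { apply Rmult_le_reg_r with x; [lra|]. replace (B / x * x) with B by (field; lra). nra. }
    assert (Cmod a1 * x <= M + B + Cmod a2).
    { rewrite <- Mx at 1. rewrite <- Cmod_mult.
      replace (a1 * RtoC x)%C with (D (RtoC x) + - (D (RtoC x) - (a1 * RtoC x + a2)) + - a2)%C by ring.
      eapply Rle_trans; [eapply Rle_trans; [apply Cmod_triangle|]; apply Rplus_le_compat_r, Cmod_triangle|].
      rewrite !Cmod_opp. lra. }
    assert (Cmod a1 * ((M + B + Cmod a2 + 1) / Cmod a1) = M + B + Cmod a2 + 1) by (field; lra).
    assert (Cmod a1 * ((M + B + Cmod a2 + 1) / Cmod a1) <= Cmod a1 * x)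
      by (apply Rmult_le_compat_l; unfold x; lra).
    lra. }
  exists a2, B. split; [exact HB|]. intros w Hw. specialize (Inv w Hw).
  rewrite A1 in Inv. replace (0 * w + a2)%C with a2 in Inv by ring. exact Inv.
Qed.

(** The Gauss map without its exponential factor. For an axial end the logarithmic derivative of
    this function is [L - i tau = O(1/w^2)], so that, unlike [G], it extends over infinity. *)
Definition rotation_free (tau : R) (G : C -> C) (w : C) : C := (G w * Cexp (- (Ci * RtoC tau * w)))%C.

(** * Ends with [dG / G = (i tau + O(1/w^2)) dw] *)

Section AxialEnd.

Variables (R0 : R) (G F L : C -> C) (tau K : R).
Hypothesis Htau : tau <> 0.
Hypothesis HE : height_end R0 G F L (Ci * RtoC tau) 0 K.

Let E : C -> C := rotation_free tau G.

Lemma axial_L (w : C) : R0 < Cmod w -> Cmod (L w - Ci * RtoC tau) <= K / (Cmod w * Cmod w).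
Proof.
  intros Hw. pose proof (he_L _ _ _ _ _ _ _ HE w Hw) as B.
  pose proof (he_R0 _ _ _ _ _ _ _ HE).
  replace (L w - Ci * RtoC tau)%C with (L w - (Ci * RtoC tau + 0 / w))%C; [exact B|].
  unfold Cdiv. rewrite Cmult_0_l. ring.
Qed.

Lemma axial_K : 0 <= K.
Proof.
  pose proof (he_R0 _ _ _ _ _ _ _ HE).
  assert (M : Cmod (RtoC (R0 + 1)) = R0 + 1) by (rewrite Cmod_R, Rabs_pos_eq; lra).
  pose proof (axial_L (RtoC (R0 + 1))) as B. rewrite M in B. specialize (B ltac:(lra)).
  pose proof (Cmod_ge_0 (L (RtoC (R0 + 1)) - Ci * RtoC tau)).
  assert (P : 0 < (R0 + 1) * (R0 + 1)) by nra.
  apply Rmult_le_reg_r with (/ ((R0 + 1) * (R0 + 1))); [now apply Rinv_0_lt_compat|].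
  unfold Rdiv in B. lra.
Qed.

Lemma E_spec (w : C) : R0 < Cmod w ->
  E w <> RtoC 0 /\ wder E w (E w * (L w - Ci * RtoC tau)) 0.
Proof.
  intros Hw. destruct (he_G _ _ _ _ _ _ _ HE w Hw) as [G0 W]. split.
  - apply Cmult_neq_0; [exact G0|apply Cexp_neq_0].
  - assert (W1 : wder (fun w => - (Ci * RtoC tau * w))%C w (- (Ci * RtoC tau)) 0).
    { apply (wder_ext (fun w => - (Ci * RtoC tau) * w)%C _ _ _ _ 1); [lra|intros; ring|].
      apply (wder_eq _ _ _ _ _ _ (wder_RtoC_scal _ _ _ _ (- (Ci * RtoC tau)) (wder_id w))); ring. }
    apply (wder_eq _ _ _ _ _ _ (holo_mult _ _ _ _ _ W (holo_comp _ _ _ _ _ W1 (wder_Cexp _)))).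
    + unfold E, rotation_free. ring.
    + reflexivity.
Qed.

Lemma G_of_E (w : C) : G w = (E w * Cexp (Ci * RtoC tau * w))%C.
Proof.
  unfold E, rotation_free. rewrite <- Cmult_assoc, Cexp_opp. ring.
Qed.

(** The variation of [ln |E|] is at most [K PI] along an arc of the circle of radius [R0 + 1], and
    at most the integral of [K / t^2] along a radial half-line. *)
Lemma E_bounded : exists m M, 0 < m /\ forall w, R0 + 1 < Cmod w -> m <= Cmod (E w) <= M.
Proof.
  pose proof (he_R0 _ _ _ _ _ _ _ HE) as HR0. pose proof PI_RGT_0. pose proof axial_K as HK.
  set (R1 := R0 + 1). set (l := fun w => (L w - Ci * RtoC tau)%C).
  assert (D : forall (w : R -> C) t d, R0 < Cmod (w t) -> cderiv w t d ->
            is_derive (fun t => ln (Cmod (E (w t)))) t (Re (l (w t) * d)%C)).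
  { intros w t d Hw Dw. destruct (E_spec (w t) Hw) as [E0 W].
    replace (l (w t) * d)%C with ((E (w t) * l (w t) * d + 0 * Cconj d) / E (w t))%C by (field; exact E0).
    apply (is_derive_ln_Cmod (fun t => E (w t))); [exact E0|].
    exact (wder_cderiv _ _ _ _ _ _ Dw W). }
  assert (Circ : forall th, - PI <= th <= PI ->
     Rabs (ln (Cmod (E (RtoC R1 * Cis th)%C)) - ln (Cmod (E (RtoC R1 * Cis 0)%C))) <= K * PI).
  { intros th Hth.
    assert (M1 : forall t, Cmod (RtoC R1 * Cis t) = R1) by (intros t; apply Cmod_circle; unfold R1; lra).
    assert (B : forall a b, a <= b -> Rabs (ln (Cmod (E (RtoC R1 * Cis b)%C)) - ln (Cmod (E (RtoC R1 * Cis a)%C))) <= K * (b - a)).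
    { intros a b Hab.
      apply (Rabs_increment_le (fun t => ln (Cmod (E (RtoC R1 * Cis t)%C)))
        (fun t => Re (l (RtoC R1 * Cis t) * (RtoC R1 * (Ci * Cis t)))%C) K a b Hab).
      - intros t _. apply (D (fun t => RtoC R1 * Cis t)%C); [rewrite M1; unfold R1; lra|].
        apply cderiv_scal, cderiv_Cis.
      - intros t _. eapply Rle_trans; [apply re_le_Cmod|].
        pose proof (axial_L (RtoC R1 * Cis t)%C) as B. rewrite M1 in B. specialize (B ltac:(unfold R1; lra)).
        rewrite Cmod_mult, Cmod_scal, Cmod_mult, Cmod_Ci, Cmod_Cis, Rabs_pos_eq by (unfold R1; lra).
        apply Rle_trans with (K / (R1 * R1) * (R1 * (1 * 1))).
        + apply Rmult_le_compat_r; [unfold R1; lra|exact B].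
        + replace (K / (R1 * R1) * (R1 * (1 * 1))) with (K * / R1) by (field; unfold R1; lra).
          assert (/ R1 <= 1) by (rewrite <- Rinv_1; apply Rinv_le_contravar; unfold R1; lra). nra. }
    destruct (Rle_dec 0 th) as [P|P].
    - eapply Rle_trans; [apply (B 0 th P)|]. apply Rmult_le_compat_l; lra.
    - rewrite Rabs_minus_sym. eapply Rle_trans; [apply (B th 0)|]; [lra|]. apply Rmult_le_compat_l; lra. }
  assert (Rad : forall th m, R1 <= m ->
     Rabs (ln (Cmod (E (RtoC m * Cis th)%C)) - ln (Cmod (E (RtoC R1 * Cis th)%C))) <= K).
  { intros th m Hm. rewrite <- Cmod_R, RtoC_minus.
    assert (M1 : forall t, R1 <= t -> Cmod (RtoC t * Cis th) = t)
      by (intros t Ht; apply Cmod_circle; unfold R1 in Ht; lra).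
    apply Rle_trans with (- K / m - - K / R1).
    - apply (Cmod_increment_le (fun t => RtoC (ln (Cmod (E (RtoC t * Cis th)%C))))
        (fun t => RtoC (Re (l (RtoC t * Cis th) * Cis th)%C)) (fun t => - K / t) (fun t => K / (t * t)) R1 m Hm).
      + intros t Ht. split.
        * apply (D (fun t => RtoC t * Cis th)%C); [rewrite M1; unfold R1 in *; lra|].
          apply (cderiv_ext (fun t => 0 + RtoC t * Cis th)%C); [intros; ring|apply cderiv_linear].
        * exact (is_derive_const (V := R_NormedModule) 0 t).
      + intros t Ht. assert (0 < t) by (unfold R1 in Ht; lra). auto_derive; [lra|field; lra].
      + intros t Ht. rewrite Cmod_R. eapply Rle_trans; [apply re_le_Cmod|].
        pose proof (axial_L (RtoC t * Cis th)%C) as B. rewrite M1 in B by lra.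
        rewrite Cmod_mult, Cmod_Cis, Rmult_1_r. apply B. unfold R1 in Ht. lra.
    - assert (0 < R1) by (unfold R1; lra).
      assert (/ R1 <= 1) by (rewrite <- Rinv_1; apply Rinv_le_contravar; unfold R1; lra).
      assert (0 < / m) by (apply Rinv_0_lt_compat; lra). unfold Rdiv. nra. }
  set (L0 := ln (Cmod (E (RtoC R1 * Cis 0)%C))).
  exists (exp (L0 - (K + K * PI))), (exp (L0 + (K + K * PI))). split; [apply exp_pos|].
  intros w Hw. unfold R1 in Hw. destruct (polar_form w) as (th & Hth & Ew).
  destruct (E_spec w) as [E0 _]; [lra|]. apply Cmod_gt_0 in E0.
  specialize (Circ th Hth). specialize (Rad th (Cmod w) ltac:(unfold R1; lra)).
  rewrite <- Ew in Rad. apply Rabs_le_between in Circ. apply Rabs_le_between in Rad.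
  rewrite <- (exp_ln (Cmod (E w))) by exact E0. fold L0 in Circ.
  split; apply exp_le; lra.
Qed.

(** The positive lower bound on [|E|] keeps the limit at infinity away from 0. *)
Lemma E_limit : exists (E0 : C) (B R1 : R), E0 <> RtoC 0 /\ 0 <= B /\ R0 < R1 /\
  forall w, R1 < Cmod w -> Cmod (E w - E0) <= B / Cmod w.
Proof.
  pose proof (he_R0 _ _ _ _ _ _ _ HE) as HR0.
  destruct E_bounded as (m & M & Hm & HM).
  destruct (limit_at_infinity E (R0 + 1) M) as (E0 & B & HB & T); [lra| | |].
  - intros w Hw. destruct (E_spec w) as [_ W]; [lra|]. eexists; exact W.
  - intros w Hw. now apply HM.
  - exists E0, B, (4 * (R0 + 1)). split; [|split; [exact HB|split; [lra|intros w Hw; apply T; lra]]].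
    intros ->. set (x := 4 * (R0 + 1) + (B + 1) / m).
    assert (0 < (B + 1) / m) by (apply Rdiv_lt_0_compat; lra).
    assert (Mx : Cmod (RtoC x) = x) by (rewrite Cmod_R, Rabs_pos_eq; unfold x; lra).
    specialize (T (RtoC x)). specialize (HM (RtoC x)). rewrite Mx in *. rewrite Csub_0_r in T.
    specialize (T ltac:(unfold x; lra)). specialize (HM ltac:(unfold x; lra)).
    assert (0 < x) by (unfold x; lra).
    assert (m * x <= B).
    { apply Rle_trans with (B / x * x); [apply Rmult_le_compat_r; lra|right; field; lra]. }
    assert (m * ((B + 1) / m) = B + 1) by (field; lra).
    assert (m * ((B + 1) / m) <= m * x) by (apply Rmult_le_compat_l; unfold x; lra). lra.
Qed.

(* Along a vertical line of the [w]-plane the direction of [dF/dy] stays within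
   a fixed cone. *)
Lemma vertical_expansion : exists R1, R0 < R1 /\ forall s y1 y2, y1 <= y2 ->
  (forall t, y1 <= t <= y2 -> R1 < Cmod (s, t)) -> y2 - y1 <= 3 * Cmod (F (s, y2) - F (s, y1)).
Proof.
  pose proof (he_R0 _ _ _ _ _ _ _ HE) as HR0.
  destruct E_limit as (E0 & B & R1 & NE0 & HB & HR1 & T).
  assert (PE : 0 < Cmod E0) by now apply Cmod_gt_0.
  (* Beyond [R2] the distance of [E] from its limit is at most half of [|E0|]. *)
  set (R2 := R1 + 2 * B / Cmod E0).
  assert (PB : 0 <= 2 * B / Cmod E0) by (apply Rmult_le_pos; [lra|left; now apply Rinv_0_lt_compat]).
  exists R2. split; [unfold R2; lra|]. intros s y1 y2 Hy Hseg.
  (* The limiting direction of [- dF/dy]: the phase of [G] tends to that of [exp (i tau s) E0],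
     which is constant on the vertical line. *)
  set (e := (Ci * (Cexp (Ci * RtoC tau * RtoC s) * E0))%C).
  assert (Me : Cmod e = Cmod E0).
  { unfold e. rewrite !Cmod_mult, Cmod_Ci, Cmod_Cexp.
    replace (Re (Ci * RtoC tau * RtoC s)) with 0 by (unfold Re; simpl; ring). rewrite exp_0. ring. }
  set (dF := fun t => (- G (s, t) / 2 * Ci + Cconj (/ G (s, t)) / 2 * Cconj Ci)%C).
  assert (DF : forall t, y1 <= t <= y2 -> cderiv (fun t => F (s, t)) t (dF t)).
  { intros t Ht. apply (wder_cderiv F (fun t => (s, t)) t).
    - split; unfold Re, Im; simpl; auto_derive; trivial; ring.
    - apply (he_F _ _ _ _ _ _ _ HE). specialize (Hseg t Ht). unfold R2 in Hseg. lra. }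
  assert (Cone : forall t, y1 <= t <= y2 -> Re (Cconj e * dF t) <= - (Cmod E0 / 3)).
  { intros t Ht. specialize (Hseg t Ht). set (w := (s, t) : C) in *.
    assert (Hw : R1 < Cmod w) by (unfold R2 in Hseg; lra).
    specialize (T w Hw).
    destruct (he_G _ _ _ _ _ _ _ HE w ltac:(lra)) as [G0 _].
    unfold dF. fold w. rewrite Cconj_inv by exact G0.
    set (m := / (Cmod (G w) * Cmod (G w))).
    assert (Pg : 0 < Cmod (G w)) by now apply Cmod_gt_0.
    assert (Pm : 0 < m) by (apply Rinv_0_lt_compat; nra).
    assert (EG : G w = (RtoC (exp (- (tau * t))) * Cexp (Ci * RtoC tau * RtoC s) * E w)%C).
    { rewrite G_of_E. replace (Ci * RtoC tau * w)%C with (RtoC (- (tau * t)) + Ci * RtoC tau * RtoC s)%C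
        by (unfold w; Ceq).
      rewrite Cexp_plus.
      replace (Cexp (RtoC (- (tau * t)))) with (RtoC (exp (- (tau * t)))).
      - ring.
      - unfold Cexp, Re, Im, RtoC. simpl. rewrite cos_0, sin_0. Ceq. }
    set (x := exp (- (tau * t))) in *. assert (Px : 0 < x) by apply exp_pos.
    set (u := Cexp (Ci * RtoC tau * RtoC s)) in *.
    assert (Uu : (Cconj u * u)%C = RtoC 1).
    { unfold u. rewrite Cexp_conj, <- Cexp_plus.
      replace (Cconj (Ci * RtoC tau * RtoC s) + Ci * RtoC tau * RtoC s)%C with (RtoC 0) by Ceq.
      apply Cexp_0. }
    assert (Mu : Cmod u = 1).
    { unfold u. rewrite Cmod_Cexp. replace (Re (Ci * RtoC tau * RtoC s)) with 0 by (unfold Re; simpl; ring).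
      apply exp_0. }
    assert (Key : (Cconj e * (- G w / 2 * Ci + RtoC m * G w / 2 * Cconj Ci))%C
      = (RtoC (- (x * (1 + m)) / 2) * (Cconj E0 * E w))%C).
    { rewrite EG. unfold e. rewrite !Cmult_conj.
      transitivity (RtoC (- (x * (1 + m)) / 2) * (Cconj E0 * E w) * (Cconj u * u))%C;
        [|rewrite Uu; ring].
      destruct (Cconj E0), (E w), (Cconj u), u. unfold RtoC. Ceq; field. }
    rewrite Key.
    assert (Em : Cmod (G w) = x * Cmod (E w)).
    { rewrite EG, !Cmod_mult, Mu, Cmod_R, Rabs_pos_eq by lra. ring. }
    assert (Half : B / Cmod w <= Cmod E0 / 2).
    { assert (Hb : 2 * B / Cmod E0 < Cmod w) by (unfold R2 in Hseg; lra).
      apply Rmult_le_reg_r with (Cmod w); [lra|].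
      replace (B / Cmod w * Cmod w) with B by (field; lra).
      apply Rmult_lt_compat_l with (r := Cmod E0 / 2) in Hb; [|lra].
      replace (Cmod E0 / 2 * (2 * B / Cmod E0)) with B in Hb by (field; lra). lra. }
    set (q := Re (Cconj E0 * E w)).
    assert (Q1 : Cmod E0 * Cmod E0 / 2 <= q).
    { unfold q. replace (Cconj E0 * E w)%C with (Cconj E0 * E0 + Cconj E0 * (E w - E0))%C by ring.
      assert (H1 : Re (Cconj E0 * E0) = Cmod E0 * Cmod E0).
      { rewrite Cmod_sqr. destruct E0. unfold Re, Im, Cconj. simpl. ring. }
      assert (H2 : - (Cmod E0 * (Cmod E0 / 2)) <= Re (Cconj E0 * (E w - E0))).
      { pose proof (re_le_Cmod (Cconj E0 * (E w - E0))) as H2. rewrite Cmod_mult, Cmod_conj in H2.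
        apply Rabs_le_between in H2.
        assert (Cmod E0 * Cmod (E w - E0) <= Cmod E0 * (Cmod E0 / 2)) by (apply Rmult_le_compat_l; lra).
        lra. }
      change (Cmod E0 * Cmod E0 / 2 <= Re (Cconj E0 * E0) + Re (Cconj E0 * (E w - E0))). lra. }
    assert (Q2 : Cmod (E w) <= 3 / 2 * Cmod E0).
    { replace (E w) with (E w - E0 + E0)%C by ring. eapply Rle_trans; [apply Cmod_triangle|]. lra. }
    assert (Q3 : Cmod E0 * Cmod (E w) / 3 <= q) by nra.
    assert (Ere : Re (RtoC (- (x * (1 + m)) / 2) * (Cconj E0 * E w)) = - (x * (1 + m) * q) / 2).
    { unfold q. destruct (Cconj E0 * E w)%C. unfold Re. simpl. field. }
    rewrite Ere.
    (* This is [|G| + 1/|G| >= 2], which bounds the vertical speed of [F] below even where [|G| = 1]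
       and the horizontal speed vanishes. *)
    assert (AMGM : 2 <= x * (1 + m) * Cmod (E w)).
    { replace (x * (1 + m) * Cmod (E w)) with (Cmod (G w) * (1 + m)) by (rewrite Em; ring).
      assert (Hm : Cmod (G w) * m * Cmod (G w) = 1) by (unfold m; field; lra).
      assert (Pk : 0 < Cmod (G w) * m) by nra.
      assert (Sq : 0 <= Cmod (G w) * m * ((Cmod (G w) - 1) * (Cmod (G w) - 1)))
        by (apply Rmult_le_pos; [lra|apply Rle_0_sqr]).
      replace (Cmod (G w) * m * ((Cmod (G w) - 1) * (Cmod (G w) - 1))) with
        (Cmod (G w) * m * Cmod (G w) * (Cmod (G w) - 2) + Cmod (G w) * m) in Sq by ring.
      rewrite Hm in Sq. lra. }
    assert (x * (1 + m) * (Cmod E0 * Cmod (E w) / 3) <= x * (1 + m) * q)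
      by (apply Rmult_le_compat_l; [nra|exact Q3]).
    nra. }
  assert (I : Cmod E0 / 3 * (y2 - y1) <= - (Re (Cconj e * F (s, y2)) - Re (Cconj e * F (s, y1)))).
  { destruct (MVT_gen (fun t => Re (Cconj e * F (s, t))%C) y1 y2 (fun t => Re (Cconj e * dF t)%C)) as (c & Hc & Ec).
    - rewrite Rmin_left, Rmax_right by exact Hy. intros t Ht.
      destruct (cderiv_scal (Cconj e) (fun y => F (s, y)) t (dF t) (DF t ltac:(lra))) as [D _]. exact D.
    - rewrite Rmin_left, Rmax_right by exact Hy. intros t Ht. apply continuity_pt_filterlim.
      apply (ex_derive_continuous (V := R_NormedModule) (fun t => Re (Cconj e * F (s, t))%C)).
      destruct (cderiv_scal (Cconj e) (fun y => F (s, y)) t (dF t) (DF t Ht)) as [D _].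
      eexists. exact D.
    - rewrite Rmin_left, Rmax_right in Hc by exact Hy. specialize (Cone c Hc). rewrite Ec. nra. }
  pose proof (re_le_Cmod (Cconj e * (F (s, y2) - F (s, y1)))) as J.
  rewrite Cmod_mult, Cmod_conj, Me in J.
  replace (Re (Cconj e * (F (s, y2) - F (s, y1)))) with (Re (Cconj e * F (s, y2)) - Re (Cconj e * F (s, y1))) in J.
  2:{ destruct (F (s, y1)), (F (s, y2)), (Cconj e). unfold Re. simpl. ring. }
  apply Rabs_le_between in J.
  apply Rmult_le_reg_l with (Cmod E0 / 3); [lra|]. lra.
Qed.
End AxialEnd.

(** * The vertical ray and reflection in it *)

Lemma add_inv_ge_2 (x : R) : 0 < x -> 2 <= x * (1 + / (x * x)).
Proof.
  intros H. replace (x * (1 + / (x * x))) with (2 + (x - 1) * (x - 1) * / x) by (field; lra).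
  pose proof (Rle_0_sqr (x - 1)). unfold Rsqr in H0.
  assert (0 < / x) by now apply Rinv_0_lt_compat. nra.
Qed.

(** By [vertical_expansion] the point over the ray at a given large height is unique, and it depends
    on the height in a Lipschitz way because [F] is constant along these points. The displacement
    then lies in the kernel of [dF] to first order. Up to the factor [G / 2], [dF] scales the real
    part by [|G|^-2 - 1] and the imaginary part by a nonzero factor, so [|G| = 1] and [y' = 0]. *)
Lemma straight_axis (R0 : R) (G F L : C -> C) (tau K : R) (b : C) (sg s0 : R) :
  tau <> 0 -> height_end R0 G F L (Ci * RtoC tau) 0 K ->
  (sg = 1 \/ sg = -1) ->
  (forall s, s0 <= s -> exists w, R0 < Cmod w /\ Re w = sg * s /\ F w = b) ->
  exists y0 s1, R0 < s1 /\ forall s, s1 < s -> F (sg * s, y0) = b /\ Cmod (G (sg * s, y0)) = 1.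
Proof.
  intros Htau HE Hsg Hray. pose proof (he_R0 _ _ _ _ _ _ _ HE) as HR0.
  destruct (vertical_expansion R0 G F L tau K HE) as (R1 & HR1 & VE).
  set (y := fun s => Im (epsilon (inhabits (RtoC 0)) (fun w => R0 < Cmod w /\ Re w = sg * s /\ F w = b))).
  assert (Hy : forall s, s0 <= s -> F (sg * s, y s) = b).
  { intros s Hs. pose proof (epsilon_spec (inhabits (RtoC 0)) _ (Hray s Hs)) as (_ & E1 & E2).
    rewrite <- E1. unfold y.
    set (w := epsilon _ _) in *. rewrite <- E2. f_equal. now destruct w. }
  set (s1 := Rmax s0 R1 + 1).
  assert (s0 < s1) by (unfold s1; pose proof (Rmax_l s0 R1); lra).
  assert (R1 < s1) by (unfold s1; pose proof (Rmax_r s0 R1); lra).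
  assert (Asg : Rabs sg = 1) by (destruct Hsg as [-> | ->]; [apply Rabs_pos_eq|rewrite Rabs_left]; lra).
  assert (far : forall s t, s1 <= s -> R1 < Cmod (sg * s, t)).
  { intros s t Hs. pose proof (re_le_Cmod (sg * s, t)) as B. unfold Re in B. simpl in B.
    rewrite Rabs_mult, Asg, Rabs_pos_eq in B; lra. }
  assert (VE' : forall s u v, s1 <= s -> Rabs (u - v) <= 3 * Cmod (F (sg * s, u) - F (sg * s, v))).
  { intros s u v Hs. destruct (Rle_dec u v) as [P|P].
    - rewrite Rabs_minus_sym, Cmod_sub_sym, Rabs_pos_eq by lra. apply VE; [exact P|].
      intros t _. now apply far.
    - rewrite Rabs_pos_eq by lra. apply VE; [lra|]. intros t _. now apply far. }
  (* Both conclusions come from one estimate: the two components of [dF] applied to the displacement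
     are each small against [s' - s]. *)
  assert (Main : forall s, s1 < s -> forall eps, 0 < eps -> exists d, 0 < d /\
     forall s', Rabs (s' - s) < d -> Rabs (y s' - y s) <= eps * Rabs (s' - s) /\
        Rabs (/ (Cmod (G (sg * s, y s)) * Cmod (G (sg * s, y s))) - 1) * Cmod (G (sg * s, y s)) / 2
          * Rabs (s' - s) <= eps * Rabs (s' - s)).
  { intros s Hs eps Heps. set (p := (sg * s, y s) : C).
    assert (Hp : R0 < Cmod p) by (specialize (far s (y s) ltac:(lra)); fold p in far; lra).
    pose proof (he_F _ _ _ _ _ _ _ HE p Hp) as W.
    destruct (he_G _ _ _ _ _ _ _ HE p Hp) as [G0 _]. rewrite Cconj_inv in W by exact G0.
    set (m := / (Cmod (G p) * Cmod (G p))) in *.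
    set (A := (- G p / 2)%C) in *. set (B := (RtoC m * G p / 2)%C) in *.
    set (M := Cmod A + Cmod B + 1).
    assert (HM : 1 <= M) by (unfold M; pose proof (Cmod_ge_0 A); pose proof (Cmod_ge_0 B); lra).
    destruct (W 1 Rlt_0_1) as (d1 & Hd1 & K1).
    destruct (W (eps / (1 + 3 * M))) as (d2 & Hd2 & K2); [apply Rdiv_lt_0_compat; lra|].
    set (d := Rmin (Rmin d1 (d2 / (1 + 3 * M))) (s - s1)).
    assert (d <= d1) by rmin.
    assert (D2 : d <= d2 / (1 + 3 * M)) by rmin.
    assert (d <= s - s1) by rmin.
    exists d. split; [repeat apply Rmin_pos; try lra; apply Rdiv_lt_0_compat; lra|].
    intros s' Hs'. set (ds := s' - s) in *.
    assert (Hs1 : s1 < s') by (apply Rabs_def2 in Hs'; unfold ds in Hs'; lra).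
    (* The corner [z] shares its real part with [q] and its imaginary part with [p]. Thus [F z] is
       within [M |ds|] of [F p = F q], and expansion along the vertical line through [q] bounds
       [dy]. *)
    set (z := (sg * s', y s) : C). set (q := (sg * s', y s') : C).
    assert (Ez : (z - p)%C = RtoC (sg * ds)) by (unfold z, p, ds; Ceq).
    assert (Mz : Cmod (z - p) = Rabs ds) by (rewrite Ez, Cmod_R, Rabs_mult, Asg; ring).
    assert (B1 : Cmod (F p - F z) <= M * Rabs ds).
    { specialize (K1 z ltac:(rewrite Mz; lra)). rewrite Mz in K1.
      rewrite Cmod_sub_sym.
      replace (F z - F p)%C with ((F z - F p - (A * (z - p) + B * Cconj (z - p))) + (A * (z - p) + B * Cconj (z - p)))%C by ring.
      eapply Rle_trans; [apply Cmod_triangle|].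
      pose proof (Cmod_triangle (A * (z - p)) (B * Cconj (z - p))) as T.
      rewrite !Cmod_mult, Cmod_conj, Mz in T. unfold M. lra. }
    set (dy := y s' - y s).
    assert (B2 : Rabs dy <= 3 * (M * Rabs ds)).
    { eapply Rle_trans; [apply (VE' s' (y s') (y s)); lra|]. fold z. fold q.
      assert (Eq : F q = F p) by (unfold q, p; rewrite !Hy by lra; reflexivity). rewrite Eq. lra. }
    assert (Eq : (q - p)%C = (sg * ds, dy)) by (unfold q, p, ds, dy; Ceq).
    assert (Mq : Cmod (q - p) <= (1 + 3 * M) * Rabs ds).
    { rewrite Eq. eapply Rle_trans; [apply Cmod_le_components|]. unfold Re, Im. simpl.
      rewrite Rabs_mult, Asg. lra. }
    assert (Hq : (1 + 3 * M) * Rabs ds < d2).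
    { apply Rlt_le_trans with ((1 + 3 * M) * (d2 / (1 + 3 * M))); [apply Rmult_lt_compat_l; lra|].
      right. field. lra. }
    specialize (K2 q ltac:(lra)).
    assert (Fq : F q = F p) by (unfold q, p; rewrite !Hy by lra; reflexivity).
    rewrite Fq in K2.
    assert (Bd : Cmod (A * (q - p) + B * Cconj (q - p)) <= eps * Rabs ds).
    { replace (F p - F p - (A * (q - p) + B * Cconj (q - p)))%C with (- (A * (q - p) + B * Cconj (q - p)))%C in K2 by ring.
      rewrite Cmod_opp in K2. eapply Rle_trans; [exact K2|].
      apply Rle_trans with (eps / (1 + 3 * M) * ((1 + 3 * M) * Rabs ds)).
      - apply Rmult_le_compat_l; [|exact Mq]. left. apply Rdiv_lt_0_compat; lra.
      - right. field. lra. }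
    (* Up to the factor [G p / 2], the linear part of [F] applied to the displacement. *)
    set (vv := ((m - 1) * (sg * ds), - ((1 + m) * dy)) : C).
    assert (Form : (A * (q - p) + B * Cconj (q - p))%C = (G p / 2 * vv)%C).
    { rewrite Eq. unfold A, B, vv. generalize (G p). intros g. destruct g. unfold Cconj. Ceq; field. }
    rewrite Form, Cmod_mult, Cmod_div, (Cmod_R 2), (Rabs_pos_eq 2) in Bd by (try lra; apply Cmod_neq_0; rewrite Cmod_R, Rabs_pos_eq; lra).
    assert (Pg : 0 < Cmod (G p)) by now apply Cmod_gt_0.
    assert (Pm : 0 < m) by (apply Rinv_0_lt_compat; nra).
    pose proof (re_le_Cmod vv) as V1. pose proof (im_le_Cmod vv) as V2.
    unfold vv in V1 at 1. unfold vv in V2 at 1. unfold Re, Im in V1, V2. simpl in V1, V2.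
    rewrite !Rabs_mult, Asg in V1. rewrite Rabs_Ropp, Rabs_mult, (Rabs_pos_eq (1 + m)) in V2 by lra.
    pose proof (add_inv_ge_2 _ Pg) as AG. fold m in AG.
    pose proof (Rabs_pos dy). pose proof (Rabs_pos ds).
    split.
    - fold dy. apply Rle_trans with (Cmod (G p) / 2 * ((1 + m) * Rabs dy)); [nra|].
      apply Rle_trans with (Cmod (G p) / 2 * Cmod vv); [apply Rmult_le_compat_l; lra|exact Bd].
    - apply Rle_trans with (Cmod (G p) / 2 * (Rabs (m - 1) * (1 * Rabs ds))); [right; field|].
      apply Rle_trans with (Cmod (G p) / 2 * Cmod vv); [apply Rmult_le_compat_l; lra|exact Bd]. }
  assert (Dy : forall s, s1 < s -> is_derive y s 0).
  { intros s Hs. apply is_derive_eps. intros eps Heps.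
    destruct (Main s Hs eps Heps) as (d & Hd & Kd). exists d. split; [exact Hd|].
    intros s' Hs'. replace (y s' - y s - 0 * (s' - s)) with (y s' - y s) by ring. now apply Kd. }
  assert (G1 : forall s, s1 < s -> Cmod (G (sg * s, y s)) = 1).
  { intros s Hs. set (p := (sg * s, y s) : C).
    assert (Hp : R0 < Cmod p) by (specialize (far s (y s) ltac:(lra)); fold p in far; lra).
    destruct (he_G _ _ _ _ _ _ _ HE p Hp) as [G0 _].
    assert (Pg : 0 < Cmod (G p)) by now apply Cmod_gt_0.
    set (k := Rabs (/ (Cmod (G p) * Cmod (G p)) - 1) * Cmod (G p) / 2).
    assert (Z : k <= 0).
    { apply Rnot_lt_le. intros P. destruct (Main s Hs (k / 2)) as (d & Hd & Kd); [lra|].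
      destruct (Kd (s + d / 2)) as [_ Kd2].
      { replace (s + d / 2 - s) with (d / 2) by ring. rewrite Rabs_pos_eq; lra. }
      fold p in Kd2. fold k in Kd2. replace (s + d / 2 - s) with (d / 2) in Kd2 by ring.
      rewrite Rabs_pos_eq in Kd2 by lra. nra. }
    assert (Z2 : Rabs (/ (Cmod (G p) * Cmod (G p)) - 1) = 0).
    { apply Rle_antisym; [|apply Rabs_pos]. unfold k in Z. nra. }
    assert (Z3 : / (Cmod (G p) * Cmod (G p)) = 1).
    { pose proof (Rle_abs (/ (Cmod (G p) * Cmod (G p)) - 1)).
      pose proof (Rabs_maj2 (/ (Cmod (G p) * Cmod (G p)) - 1)). lra. }
    assert (Z4 : Cmod (G p) * Cmod (G p) = 1).
    { rewrite <- (Rinv_inv (Cmod (G p) * Cmod (G p))), Z3. field. }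
    nra. }
  exists (y (s1 + 1)), s1. split; [lra|]. intros s Hs.
  assert (Ey : y s = y (s1 + 1)).
  { assert (K0 : forall u v, s1 < u -> u <= v -> y u = y v).
    { intros u v Hu Huv.
      pose proof (Rabs_increment_le y (fun _ => 0) 0 u v Huv) as Q.
      assert (Z : Rabs (y v - y u) <= 0 * (v - u)).
      { apply Q; [intros t Ht; apply Dy; lra|intros t _; rewrite Rabs_R0; lra]. }
      pose proof (Rle_abs (y v - y u)). pose proof (Rabs_maj2 (y v - y u)). lra. }
    destruct (Rle_dec s (s1 + 1)); [apply K0; lra|symmetry; apply K0; lra]. }
  rewrite <- Ey. split; [apply Hy; lra|now apply G1].
Qed.

Lemma hol_reflect (D : C -> C) (w : C) : hol D (Cconj w) -> hol (fun w => Cconj (D (Cconj w))) w.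
Proof.
  intros [l W]. exists (Cconj l).
  pose proof (wder_comp _ _ w _ _ _ _ (wder_conj w) W) as W1. cbv beta in W1.
  pose proof (wder_comp _ _ w _ _ _ _ W1 (wder_conj _)) as W2. cbv beta in W2.
  assert (C1 : Cconj 1 = RtoC 1) by Ceq.
  apply (wder_eq _ _ _ _ _ _ W2); rewrite ?Cconj_0, ?C1.
  - replace (l * 1 + 0 * 0)%C with l by ring. ring.
  - replace (l * 0 + 0 * 1)%C with (RtoC 0) by ring. rewrite Cconj_0. ring.
Qed.

(** * Reflection in the axis and comparison with a helicoid *)

Section StraightEnd.

Variables (R0 : R) (G F L : C -> C) (tau K : R) (b : C) (sg s1 : R).
Hypothesis Htau : tau <> 0.
Hypothesis HE : height_end R0 G F L (Ci * RtoC tau) 0 K.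
Hypothesis Hsg : sg = 1 \/ sg = -1.
Hypothesis Hs1 : R0 < s1.
Hypothesis Hax : forall s, s1 < s -> F (RtoC (sg * s)) = b /\ Cmod (G (RtoC (sg * s))) = 1.

Let E : C -> C := rotation_free tau G.

(** On the given half axis [|E| = 1], so [D] vanishes there. Inversion turns this half axis into a
    segment ending at 0, the centre of a disc on which the inverted [D] is differentiable thanks to
    the bounds on [E]; the identity theorem applies. *)
Lemma E_reflection : exists R1, R0 < R1 /\ forall w, R1 < Cmod w -> (E w * Cconj (E (Cconj w)))%C = RtoC 1.
Proof.
  pose proof (he_R0 _ _ _ _ _ _ _ HE) as HR0.
  destruct (E_bounded R0 G F L tau K HE) as (m & M & Hm & HM).
  set (D := fun w => (E w - / Cconj (E (Cconj w)))%C).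
  set (R1 := R0 + 1).
  assert (Nz : forall w, R1 < Cmod w -> Cconj (E (Cconj w)) <> RtoC 0).
  { intros w Hw. apply Cmod_neq_0. rewrite Cmod_conj. apply Cmod_gt_0.
    apply (E_spec R0 G F L tau K HE). rewrite Cmod_conj. unfold R1 in Hw. lra. }
  assert (HD : forall w, R1 < Cmod w -> hol D w).
  { intros w Hw. apply hol_minus.
    - destruct (E_spec R0 G F L tau K HE w) as [_ W]; [unfold R1 in Hw; lra|]. eexists; exact W.
    - apply (hol_inv (fun w => Cconj (E (Cconj w)))); [now apply Nz|].
      apply (hol_reflect E). destruct (E_spec R0 G F L tau K HE (Cconj w)) as [_ W].
      + rewrite Cmod_conj. unfold R1 in Hw. lra.
      + eexists; exact W. }
  assert (BD : forall w, R1 < Cmod w -> Cmod (D w) <= M + / m).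
  { intros w Hw. unfold D, Cminus. eapply Rle_trans; [apply Cmod_triangle|].
    rewrite Cmod_opp, Cmod_inv, Cmod_conj by now apply Nz.
    destruct (HM w Hw) as [_ H2]. destruct (HM (Cconj w)) as [H3 _]; [now rewrite Cmod_conj|].
    assert (/ Cmod (E (Cconj w)) <= / m) by (apply Rinv_le_contravar; [lra|exact H3]).
    fold E in H2, H3. lra. }
  assert (P1 : 0 < R1) by (unfold R1; lra).
  assert (Ps : 0 < s1) by lra.
  pose proof (identity_theorem (inversion D) (/ R1) (/ s1) sg (Rinv_0_lt_compat _ P1)
    (Rinv_0_lt_compat _ Ps) Hsg (inversion_hol D R1 _ P1 HD BD)) as Id.
  exists (4 * R1). split; [unfold R1; lra|]. intros w Hw.
  assert (Pw : 0 < Cmod w) by lra. assert (Nw : w <> RtoC 0) by now apply Cmod_gt_0.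
  assert (Z : inversion D (/ w) = RtoC 0).
  { apply Id.
    - intros x Hx. unfold inversion.
      assert (Pix : s1 < / x).
      { rewrite <- (Rinv_inv s1). apply Rinv_lt_contravar; [|lra].
        apply Rmult_lt_0_compat; [lra|now apply Rinv_0_lt_compat]. }
      assert (Ex : (/ RtoC (sg * x))%C = RtoC (sg * / x)).
      { rewrite <- RtoC_inv by (destruct Hsg as [-> | ->]; lra). f_equal.
        destruct Hsg as [-> | ->]; field; lra. }
      rewrite Ex. destruct (Hax (/ x) Pix) as [_ G1]. set (t := sg * / x) in *.
      assert (E1 : Cmod (E (RtoC t)) = 1).
      { unfold E, rotation_free. rewrite Cmod_mult, G1, Cmod_Cexp.
        replace (Re (- (Ci * RtoC tau * RtoC t))) with 0 by (unfold Re; simpl; ring).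
        rewrite exp_0. ring. }
      assert (Ct : Cconj (RtoC t) = RtoC t) by (unfold Cconj, RtoC; Ceq).
      assert (N1 : E (RtoC t) <> RtoC 0) by (apply Cmod_neq_0; lra).
      assert (N2 : Cconj (E (RtoC t)) <> RtoC 0) by (apply Cmod_neq_0; rewrite Cmod_conj; lra).
      unfold D. rewrite Ct.
      assert (E2 : (E (RtoC t) * Cconj (E (RtoC t)))%C = RtoC 1).
      { rewrite <- Cmod2_conj, E1. f_equal. ring. }
      replace (/ Cconj (E (RtoC t)))%C with (E (RtoC t)); [ring|].
      replace (E (RtoC t)) with (E (RtoC t) * Cconj (E (RtoC t)) * / Cconj (E (RtoC t)))%C at 1
        by (field; exact N2).
      rewrite E2. ring.
    - rewrite Cmod_inv by exact Nw. replace (/ R1 / 4) with (/ (4 * R1)) by (field; lra).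
      apply Rinv_le_contravar; lra. }
  unfold inversion in Z.
  assert (EE : (/ / w)%C = w) by (field; exact Nw). rewrite EE in Z.
  assert (DZ : D w = RtoC 0).
  { replace (D w) with (w * w * (/ w * / w * D w))%C by (field; exact Nw). rewrite Z. ring. }
  unfold D in DZ. specialize (Nz w ltac:(lra)).
  replace (E w) with (E w - / Cconj (E (Cconj w)) + / Cconj (E (Cconj w)))%C by ring.
  rewrite DZ. field. exact Nz.
Qed.

Lemma G_reflection : exists R1, R0 < R1 /\ forall w, R1 < Cmod w -> (G w * Cconj (G (Cconj w)))%C = RtoC 1.
Proof.
  destruct E_reflection as (R1 & HR1 & HR). exists R1. split; [exact HR1|]. intros w Hw.
  rewrite (G_of_E G tau w), (G_of_E G tau (Cconj w)). fold E.
  rewrite Cmult_conj, Cexp_conj.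
  transitivity ((E w * Cconj (E (Cconj w))) *
    (Cexp (Cconj (Ci * RtoC tau * Cconj w)) * Cexp (Ci * RtoC tau * w)))%C; [ring|].
  rewrite HR by exact Hw.
  replace (Cconj (Ci * RtoC tau * Cconj w)) with (- (Ci * RtoC tau * w))%C.
  - rewrite Cexp_opp. ring.
  - destruct w. unfold Cconj. Ceq.
Qed.

(* Reflecting in the axis sends [F - b] to its opposite, so [F = b] on both
   halves of the axis. *)
Lemma axis_both_sides : exists R1, R0 < R1 /\ forall t, R1 < Rabs t ->
  F (RtoC t) = b /\ Cmod (G (RtoC t)) = 1.
Proof.
  pose proof (he_R0 _ _ _ _ _ _ _ HE) as HR0.
  destruct G_reflection as (R1 & HR1 & HR).
  assert (Ct : forall t, Cconj (RtoC t) = RtoC t) by (intros t; unfold Cconj, RtoC; Ceq).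
  set (S := fun w => (F w + F (Cconj w))%C).
  (* The reflection identity turns [conj (1 / G)] at a point into [G] at its mirror image, so the
     derivatives of the two summands cancel. The exterior of a disc is connected, which carries the
     value [b] to the other half axis. *)
  assert (WS : forall w, R1 < Cmod w -> Rbar_lt (Cmod w) p_infty -> wder S w 0 0).
  { intros w Hw _. assert (Hw' : R0 < Cmod (Cconj w)) by (rewrite Cmod_conj; lra).
    pose proof (he_F _ _ _ _ _ _ _ HE w ltac:(lra)) as W1.
    pose proof (he_F _ _ _ _ _ _ _ HE (Cconj w) Hw') as W2.
    pose proof (wder_comp _ _ w _ _ _ _ (wder_conj w) W2) as W3. cbv beta in W3.
    destruct (he_G _ _ _ _ _ _ _ HE w ltac:(lra)) as [G0 _].
    destruct (he_G _ _ _ _ _ _ _ HE (Cconj w) Hw') as [G0' _].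
    assert (Nc : Cconj (G (Cconj w)) <> RtoC 0).
    { apply Cmod_neq_0. rewrite Cmod_conj. now apply Cmod_gt_0. }
    assert (Nc' : Cconj (G w) <> RtoC 0).
    { apply Cmod_neq_0. rewrite Cmod_conj. now apply Cmod_gt_0. }
    assert (E1 : Cconj (/ G (Cconj w)) = G w).
    { rewrite Cinv_conj by exact G0'.
      replace (G w) with (G w * Cconj (G (Cconj w)) * / Cconj (G (Cconj w)))%C by (field; exact Nc).
      rewrite HR by exact Hw. ring. }
    assert (E2 : Cconj (/ G w) = G (Cconj w)).
    { rewrite Cinv_conj by exact G0.
      assert (H2 : (G (Cconj w) * Cconj (G w))%C = RtoC 1).
      { pose proof (HR (Cconj w) ltac:(rewrite Cmod_conj; lra)) as H2. rewrite Cconj_conj in H2. exact H2. }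
      replace (G (Cconj w)) with (G (Cconj w) * Cconj (G w) * / Cconj (G w))%C by (field; exact Nc').
      rewrite H2. ring. }
    assert (C1 : Cconj 1 = RtoC 1) by Ceq.
    apply (wder_eq _ _ _ _ _ _ (wder_plus _ _ _ _ _ _ _ W1 W3)).
    - rewrite E1, C1. field.
    - rewrite E2, Cconj_0. field. }
  set (t1 := Rmax s1 R1 + 1).
  assert (s1 < t1) by (unfold t1; pose proof (Rmax_l s1 R1); lra).
  assert (R1 < t1) by (unfold t1; pose proof (Rmax_r s1 R1); lra).
  set (p := RtoC (sg * t1)).
  assert (Mp : Cmod p = t1).
  { unfold p. rewrite Cmod_R. destruct Hsg as [-> | ->]; [rewrite Rabs_pos_eq|rewrite Rabs_left]; lra. }
  assert (Sp : S p = (b + b)%C).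
  { unfold S, p. rewrite Ct. destruct (Hax t1) as [F1 _]; [lra|]. now rewrite F1. }
  exists R1. split; [exact HR1|]. intros t Ht.
  assert (Mt : Cmod (RtoC t) = Rabs t) by apply Cmod_R.
  split.
  - assert (St : S (RtoC t) = S p).
    { apply (annulus_constant S R1 p_infty); try lra; try exact WS; simpl; auto; lra. }
    rewrite Sp in St. unfold S in St. rewrite Ct in St.
    replace (F (RtoC t)) with ((F (RtoC t) + F (RtoC t)) / 2)%C by field. rewrite St. field.
  - pose proof (HR (RtoC t) ltac:(lra)) as H1. rewrite Ct, <- Cmod2_conj in H1.
    injection H1 as H1. pose proof (Cmod_ge_0 (G (RtoC t))). nra.
Qed.

Lemma sinh_le_cosh (x : R) : Rabs (sinh x) <= cosh x.
Proof.
  unfold sinh, cosh. pose proof (exp_pos x). pose proof (exp_pos (- x)). apply Rabs_le. lra.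
Qed.

Lemma cosh_ge_1 (x : R) : 1 <= cosh x.
Proof.
  unfold cosh. pose proof (exp_ineq1_le x). pose proof (exp_ineq1_le (- x)). lra.
Qed.

(** If [L] were exactly [i tau], then [F] would be a constant plus [(conj (1 / G) - G) / (2 i tau)].
    The discrepancy [D] vanishes on the axis and its derivative is at most a multiple of
    [cosh (tau y) / |w|^2]; integration from the axis bounds it. Replacing [E] by its limit costs a
    further relative error [O(1/w)]. *)
Theorem helicoidal_asymptotics : exists (E0 : C) (R1 A : R), Cmod E0 = 1 /\ R0 < R1 /\ 0 <= A /\
  forall w, R1 < Cmod w ->
    Cmod (F w - (b + E0 * Cexp (Ci * RtoC tau * RtoC (Re w)) / (Ci * RtoC tau) * RtoC (sinh (tau * Im w))))
      <= A * cosh (tau * Im w) / Cmod w.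
Proof.
  pose proof (he_R0 _ _ _ _ _ _ _ HE) as HR0.
  pose proof (axial_K R0 G F L tau K HE) as HK.
  assert (Pt : 0 < Rabs tau) by now apply Rabs_pos_lt.
  destruct axis_both_sides as (Ra & HRa & Axis).
  destruct (E_limit R0 G F L tau K HE) as (E0 & B & Rb & _ & HB & HRb & T). fold E in T.
  set (u := fun s : R => Cexp (Ci * RtoC tau * RtoC s)).
  assert (Mu : forall s, Cmod (u s) = 1).
  { intros s. unfold u. rewrite Cmod_Cexp. replace (Re (Ci * RtoC tau * RtoC s)) with 0 by (unfold Re; simpl; ring).
    apply exp_0. }
  (* The term [2 * B] puts [|E|] between 1/2 and 2. *)
  set (R2 := Rmax Ra Rb + 2 * B + 1).
  assert (Ra < R2) by (unfold R2; pose proof (Rmax_l Ra Rb); lra).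
  assert (Rb < R2) by (unfold R2; pose proof (Rmax_r Ra Rb); lra).
  assert (HR2B : 2 * B + 1 <= R2) by (unfold R2; pose proof (Rmax_l Ra Rb); lra).
  assert (ME0 : Cmod E0 = 1).
  { assert (Near : forall t, R2 < t -> Rabs (Cmod E0 - 1) <= B / t).
    { intros t Ht. assert (Mt : Cmod (RtoC t) = t) by (rewrite Cmod_R, Rabs_pos_eq; lra).
      destruct (Axis t) as [_ G1]; [rewrite Rabs_pos_eq; lra|].
      assert (E1 : Cmod (E (RtoC t)) = 1).
      { unfold E, rotation_free. rewrite Cmod_mult, G1, Cmod_Cexp.
        replace (Re (- (Ci * RtoC tau * RtoC t))) with 0 by (unfold Re; simpl; ring).
        rewrite exp_0. ring. }
      specialize (T (RtoC t)). rewrite Mt in T. specialize (T ltac:(lra)).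
      pose proof (Cmod_triangle_rev (E (RtoC t)) E0). pose proof (Cmod_triangle_rev E0 (E (RtoC t))) as T2.
      rewrite Cmod_sub_sym in T2. apply Rabs_le. lra. }
    apply Rminus_diag_uniq. destruct (Req_dec (Cmod E0 - 1) 0) as [Z|Z]; [exact Z|exfalso].
    assert (P : 0 < Rabs (Cmod E0 - 1)) by now apply Rabs_pos_lt.
    set (t := R2 + (B + 1) / Rabs (Cmod E0 - 1)).
    assert (0 < (B + 1) / Rabs (Cmod E0 - 1)) by (apply Rdiv_lt_0_compat; lra).
    specialize (Near t ltac:(unfold t; lra)). assert (0 < t) by (unfold t; lra).
    assert (Rabs (Cmod E0 - 1) * t <= B).
    { apply Rle_trans with (B / t * t); [apply Rmult_le_compat_r; lra|right; field; lra]. }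
    assert (Rabs (Cmod E0 - 1) * ((B + 1) / Rabs (Cmod E0 - 1)) = B + 1) by (field; lra).
    assert (Rabs (Cmod E0 - 1) * ((B + 1) / Rabs (Cmod E0 - 1)) <= Rabs (Cmod E0 - 1) * t)
      by (apply Rmult_le_compat_l; unfold t; lra). lra. }
  assert (NE0 : E0 <> RtoC 0) by (apply Cmod_neq_0; lra).
  assert (EB : forall w, R2 < Cmod w -> / 2 <= Cmod (E w) <= 2).
  { intros w Hw. specialize (T w ltac:(lra)).
    assert (B / Cmod w <= / 2).
    { apply Rmult_le_reg_r with (Cmod w); [lra|]. replace (B / Cmod w * Cmod w) with B by (field; lra). lra. }
    pose proof (Cmod_triangle_rev (E w) E0). pose proof (Cmod_triangle_rev E0 (E w)) as T2.
    rewrite Cmod_sub_sym in T2. lra. }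
  assert (Eu : forall w, Cexp (Ci * RtoC tau * w) = (RtoC (exp (- (tau * Im w))) * u (Re w))%C).
  { intros w. unfold u. transitivity (Cexp (RtoC (- (tau * Im w)) + Ci * RtoC tau * RtoC (Re w))).
    - f_equal. destruct w. unfold Re, Im. Ceq.
    - rewrite Cexp_plus. f_equal. unfold Cexp, Re, Im, RtoC. simpl. rewrite cos_0, sin_0. Ceq. }
  assert (GE : forall w, G w = (E w * (RtoC (exp (- (tau * Im w))) * u (Re w)))%C).
  { intros w. rewrite (G_of_E G tau w), Eu. reflexivity. }
  set (it := (Ci * RtoC tau)%C).
  assert (Mit : Cmod it = Rabs tau) by (unfold it; rewrite Cmod_mult, Cmod_Ci, Cmod_R; ring).
  assert (Nit : it <> RtoC 0) by (apply Cmod_neq_0; lra).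
  assert (N2 : RtoC 2 <> RtoC 0) by (apply Cmod_neq_0; rewrite Cmod_R, Rabs_pos_eq; lra).
  set (D := fun w => (F w - (b + (Cconj (/ G w) - G w) / (2 * it)))%C).
  (* Comes from [|G| + 1/|G| <= 4 cosh (tau y)] and [|L - i tau| <= K / |w|^2], after division by
     [2 |tau|]. *)
  set (kap := 2 * K / Rabs tau).
  assert (Hkap : 0 <= kap) by (apply Rmult_le_pos; [lra|left; now apply Rinv_0_lt_compat]).
  assert (WD : forall w, R2 < Cmod w -> exists da db, wder D w da db /\
     Cmod da + Cmod db <= kap * cosh (tau * Im w) / (Cmod w * Cmod w)).
  { intros w Hw. destruct (he_G _ _ _ _ _ _ _ HE w ltac:(lra)) as [G0 WG].
    pose proof (he_F _ _ _ _ _ _ _ HE w ltac:(lra)) as WF.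
    set (l := (L w - it)%C).
    exists (G w * l / (2 * it))%C, (Cconj (/ G w) * Cconj l / (2 * it))%C. split.
    - pose proof (wder_comp _ _ _ _ _ _ _ (holo_inv _ _ _ G0 WG) (wder_conj _)) as W1. cbv beta in W1.
      pose proof (wder_plus _ _ _ _ _ _ _ WF
        (wder_RtoC_scal _ _ _ _ (- / (2 * it)) (wder_plus _ _ _ _ _ _ _ W1
           (wder_RtoC_scal _ _ _ _ (-1) WG)))) as W2. cbv beta in W2.
      pose proof (wder_plus _ _ _ _ _ _ _ W2 (wder_const (- b) w)) as W3. cbv beta in W3.
      assert (Cit : Cconj it = (- it)%C) by (unfold it, Cconj; Ceq).
      apply (wder_ext _ D _ _ _ 1 Rlt_0_1) in W3.
      + apply (wder_eq _ _ _ _ _ _ W3).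
        * rewrite Cconj_0. unfold l. field. auto.
        * replace (- (G w * L w) / (G w * G w))%C with (- (L w * / G w))%C by (field; exact G0).
          unfold l. rewrite Cminus_conj, Cit.
          assert (E1 : Cconj (- (L w * / G w)) = (- (Cconj (L w) * Cconj (/ G w)))%C).
          { rewrite <- Cmult_conj. unfold Cconj. Ceq. }
          rewrite E1. field. auto.
      + intros z _. unfold D. field. auto.
    - assert (M2 : Cmod (2 * it) = 2 * Rabs tau) by (rewrite Cmod_mult, Mit, Cmod_R, Rabs_pos_eq; lra).
      assert (Ni2 : (2 * it)%C <> RtoC 0) by now apply Cmult_neq_0.
      rewrite !Cmod_div, !Cmod_mult, !Cmod_conj, Mit, (Cmod_R 2), (Rabs_pos_eq 2), Cmod_inv by (auto; lra).
      assert (Mg : Cmod (G w) = exp (- (tau * Im w)) * Cmod (E w)).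
      { rewrite GE, !Cmod_mult, Mu, Cmod_R, Rabs_pos_eq by (left; apply exp_pos). ring. }
      destruct (EB w Hw) as [Eb1 Eb2].
      pose proof (exp_pos (- (tau * Im w))) as X1. pose proof (exp_pos (tau * Im w)) as X2.
      assert (X3 : / exp (- (tau * Im w)) = exp (tau * Im w)) by (rewrite exp_Ropp, Rinv_inv; reflexivity).
      assert (S1 : Cmod (G w) + / Cmod (G w) <= 4 * cosh (tau * Im w)).
      { rewrite Mg, Rinv_mult, X3. unfold cosh.
        assert (/ Cmod (E w) <= 2) by (rewrite <- (Rinv_inv 2); apply Rinv_le_contravar; lra).
        assert (0 < / Cmod (E w)) by (apply Rinv_0_lt_compat; lra). nra. }
      pose proof (axial_L R0 G F L tau K HE w ltac:(lra)) as Hl. fold it in Hl. fold l in Hl.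
      pose proof (Cmod_ge_0 l).
      assert (Pw : 0 < Cmod w * Cmod w) by nra.
      replace (Cmod (G w) * Cmod l / (2 * Rabs tau) + / Cmod (G w) * Cmod l / (2 * Rabs tau))
        with ((Cmod (G w) + / Cmod (G w)) * Cmod l / (2 * Rabs tau)).
      2:{ assert (0 < Cmod (G w)) by now apply Cmod_gt_0. field. lra. }
      apply Rle_trans with (4 * cosh (tau * Im w) * (K / (Cmod w * Cmod w)) / (2 * Rabs tau)).
      + apply Rmult_le_compat_r; [left; apply Rinv_0_lt_compat; lra|].
        apply Rmult_le_compat; try lra.
        assert (0 < Cmod (G w)) by now apply Cmod_gt_0.
        assert (0 < / Cmod (G w)) by now apply Rinv_0_lt_compat. lra.
      + right. unfold kap. field. lra. }
  assert (DP : forall (phi : R -> C) t d, R2 < Cmod (phi t) -> cderiv phi t d ->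
     exists d', cderiv (fun t => D (phi t)) t d' /\
       Cmod d' <= kap * cosh (tau * Im (phi t)) / (Cmod (phi t) * Cmod (phi t)) * Cmod d).
  { intros phi t d Hphi Dphi. destruct (WD _ Hphi) as (da & db & W & Bd).
    exists (da * d + db * Cconj d)%C. split; [exact (wder_cderiv _ _ _ _ _ _ Dphi W)|].
    eapply Rle_trans; [apply Cmod_triangle|]. rewrite !Cmod_mult, Cmod_conj, <- Rmult_plus_distr_r.
    apply Rmult_le_compat_r; [apply Cmod_ge_0|exact Bd]. }
  assert (D0 : forall t, R2 < Rabs t -> D (RtoC t) = RtoC 0).
  { intros t Ht. destruct (Axis t) as [F1 G1]; [lra|]. unfold D. rewrite F1.
    destruct (he_G _ _ _ _ _ _ _ HE (RtoC t)) as [G0 _]; [rewrite Cmod_R; lra|].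
    rewrite Cconj_inv, G1 by exact G0. replace (/ (1 * 1)) with 1 by field. field. auto. }
  (* Integrating [cosh] along the vertical line gives [sinh / tau], so the exponential growth is not
     multiplied by the length of the path. The line must miss the removed disc, hence the condition
     on [s]. *)
  assert (VertD : forall s y, R2 < Rabs s ->
     Cmod (D (s, y)) <= kap * cosh (tau * y) / (s * s) / Rabs tau).
  { intros s y Hs.
    assert (Ps : 0 < s * s) by (destruct (Rle_dec 0 s);
      [rewrite Rabs_pos_eq in Hs by lra|rewrite Rabs_left in Hs by lra]; nra).
    set (e := if Rle_dec 0 y then 1 else -1).
    assert (He : e * Rabs y = y).
    { unfold e. destruct Rle_dec; [rewrite Rabs_pos_eq|rewrite Rabs_left]; lra. }
    assert (He2 : Rabs e = 1).
    { unfold e. destruct Rle_dec; [apply Rabs_pos_eq|rewrite Rabs_left]; lra. }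
    set (phi := fun t => (s, e * t) : C).
    assert (Far : forall t, Rabs s <= Cmod (phi t)) by (intros t; apply (re_le_Cmod (phi t))).
    assert (Dphi : forall t, cderiv phi t (0, e)).
    { intros t. split; unfold phi, Re, Im; simpl; auto_derive; trivial; ring. }
    assert (Me : Cmod (0, e) = 1).
    { replace ((0, e) : C) with (Ci * RtoC e)%C by Ceq. rewrite Cmod_mult, Cmod_Ci, Cmod_R, He2. ring. }
    set (dd := fun t => epsilon (inhabits (RtoC 0)) (fun d' => cderiv (fun t => D (phi t)) t d' /\
       Cmod d' <= kap * cosh (tau * Im (phi t)) / (Cmod (phi t) * Cmod (phi t)) * Cmod (0, e))).
    assert (Hdd : forall t, cderiv (fun t => D (phi t)) t (dd t) /\
       Cmod (dd t) <= kap * cosh (tau * Im (phi t)) / (Cmod (phi t) * Cmod (phi t)) * Cmod (0, e)).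
    { intros t. unfold dd. apply epsilon_spec. apply DP; [specialize (Far t); lra|apply Dphi]. }
    pose proof (Cmod_increment_le (fun t => D (phi t)) dd (fun t => kap / (s * s) * (sinh (e * tau * t) / (e * tau)))
      (fun t => kap / (s * s) * cosh (tau * (e * t))) 0 (Rabs y) (Rabs_pos y)) as Q.
    cbv beta in Q.
    assert (P1 : phi (Rabs y) = (s, y)) by (unfold phi; now rewrite He).
    assert (P0 : phi 0 = RtoC s) by (unfold phi; now rewrite Rmult_0_r).
    rewrite P1, P0, D0, Csub_0_r in Q by exact Hs.
    assert (Net : e * tau <> 0).
    { intros Z. apply Rmult_integral in Z. destruct Z as [Z|Z]; [|now apply Htau].
      rewrite Z, Rabs_R0 in He2. lra. }
    eapply Rle_trans; [apply Q|].
    - intros t _. apply Hdd.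
    - intros t _. unfold sinh, cosh. auto_derive; [trivial|].
      replace (tau * (e * t)) with (e * tau * t) by ring. field.
      repeat split; intros Z; [rewrite Z in Ps; lra| |]; apply Net; rewrite Z; ring.
    - intros t _. destruct (Hdd t) as [_ Bt]. eapply Rle_trans; [exact Bt|].
      rewrite Me, Rmult_1_r. unfold phi at 1. unfold Im. simpl.
      apply Rle_trans with (kap * cosh (tau * (e * t)) / (s * s)); [|right; field; intros Z; rewrite Z in Ps; lra].
      apply Rmult_le_compat_l; [apply Rmult_le_pos; [lra|pose proof (cosh_ge_1 (tau * (e * t))); lra]|].
      apply Rinv_le_contravar; [exact Ps|].
      replace (s * s) with (Rabs s * Rabs s) by (unfold Rabs; destruct Rcase_abs; ring).
      specialize (Far t). pose proof (Rabs_pos s). apply Rmult_le_compat; lra.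
    - replace (e * tau * 0) with 0 by ring. rewrite sinh_0.
      replace (e * tau * Rabs y) with (tau * y) by (rewrite <- He at 1; ring).
      assert (Pss : 0 <= kap / (s * s)) by (apply Rmult_le_pos; [lra|left; now apply Rinv_0_lt_compat]).
      assert (sinh (tau * y) / (e * tau) <= cosh (tau * y) / Rabs tau).
      { eapply Rle_trans; [apply Rle_abs|]. unfold Rdiv. rewrite Rabs_mult, Rabs_inv, Rabs_mult, He2, Rmult_1_l.
        apply Rmult_le_compat_r; [left; now apply Rinv_0_lt_compat|apply sinh_le_cosh]. }
      replace (kap * cosh (tau * y) / (s * s) / Rabs tau) with (kap / (s * s) * (cosh (tau * y) / Rabs tau))
        by (field; split; try lra; intros Z; rewrite Z in Ps; lra).
      replace (0 / (e * tau)) with 0 by (unfold Rdiv; ring).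
      nra. }
  (* Over the removed disc a vertical path from the axis is blocked. A horizontal one is used
     instead: [cosh] is constant along it, and a length of at most [|y|] costs one of the two powers
     of [1 / |y|]. *)
  assert (HorD : forall s s' y, R2 < Rabs y -> Rabs (s' - s) <= Rabs y ->
     Cmod (D (s', y) - D (s, y)) <= kap * cosh (tau * y) / Rabs y).
  { intros s s' y Hy Hss.
    set (phi := fun t => ((s, y) + RtoC t * RtoC (s' - s))%C).
    assert (Im_phi : forall t, Im (phi t) = y) by (intros t; unfold phi, Im; simpl; ring).
    assert (Far : forall t, Rabs y <= Cmod (phi t)).
    { intros t. pose proof (im_le_Cmod (phi t)) as Q. now rewrite Im_phi in Q. }
    set (dd := fun t => epsilon (inhabits (RtoC 0)) (fun d' => cderiv (fun t => D (phi t)) t d' /\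
       Cmod d' <= kap * cosh (tau * Im (phi t)) / (Cmod (phi t) * Cmod (phi t)) * Cmod (RtoC (s' - s)))).
    assert (Hdd : forall t, cderiv (fun t => D (phi t)) t (dd t) /\
       Cmod (dd t) <= kap * cosh (tau * Im (phi t)) / (Cmod (phi t) * Cmod (phi t)) * Cmod (RtoC (s' - s))).
    { intros t. unfold dd. apply epsilon_spec. apply DP; [specialize (Far t); lra|apply cderiv_linear]. }
    pose proof (Cmod_increment_le_const (fun t => D (phi t)) dd (kap * cosh (tau * y) / Rabs y) 0 1 Rle_0_1) as Q.
    cbv beta in Q.
    replace (phi 1) with ((s', y) : C) in Q by (unfold phi; Ceq).
    replace (phi 0) with ((s, y) : C) in Q by (unfold phi; Ceq).
    rewrite Rminus_0_r, Rmult_1_r in Q. apply Q.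
    - intros t _. apply Hdd.
    - intros t _. destruct (Hdd t) as [_ Bt]. eapply Rle_trans; [exact Bt|].
      rewrite Im_phi, Cmod_R. specialize (Far t).
      assert (Py : 0 < Rabs y) by lra.
      pose proof (cosh_ge_1 (tau * y)).
      assert (Pk : 0 <= kap * cosh (tau * y)) by (apply Rmult_le_pos; lra).
      apply Rle_trans with (kap * cosh (tau * y) / (Rabs y * Rabs y) * Rabs y).
      + apply Rmult_le_compat; [|apply Rabs_pos| |exact Hss].
        * apply Rmult_le_pos; [exact Pk|]. left. apply Rinv_0_lt_compat. nra.
        * apply Rmult_le_compat_l; [exact Pk|]. apply Rinv_le_contravar; [nra|]. apply Rmult_le_compat; lra.
      + right. field. lra. }
  set (A1 := 2 * kap * (/ Rabs tau + 1)).
  assert (Pit : 0 < / Rabs tau) by now apply Rinv_0_lt_compat.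
  assert (Est : forall w, 2 * R2 < Cmod w -> Cmod (D w) <= A1 * cosh (tau * Im w) / Cmod w).
  { intros [s y] Hw. change (Im (s, y)) with y. set (m := Cmod (s, y)) in *.
    pose proof (Cmod_le_components (s, y)) as Hm. fold m in Hm.
    change (Re (s, y)) with s in Hm. change (Im (s, y)) with y in Hm.
    set (c := cosh (tau * y)). assert (Hc : 1 <= c) by apply cosh_ge_1.
    assert (Pkc : 0 <= kap * c) by (apply Rmult_le_pos; lra).
    assert (Vb : forall x, m / 2 <= Rabs x -> Cmod (D (x, y)) <= 2 * kap * c * / Rabs tau / m).
    { intros x Hx. eapply Rle_trans; [apply VertD; lra|]. fold c.
      assert (Hxx : m / 2 <= x * x).
      { replace (x * x) with (Rabs x * Rabs x) by (unfold Rabs; destruct Rcase_abs; ring). nra. }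
      unfold Rdiv at 1. replace (2 * kap * c * / Rabs tau / m) with (kap * c * / (m / 2) * / Rabs tau) by (field; lra).
      apply Rmult_le_compat_r; [lra|]. unfold Rdiv. apply Rmult_le_compat_l; [exact Pkc|].
      apply Rinv_le_contravar; lra. }
    assert (Split : A1 * c / m = 2 * kap * c * / Rabs tau / m + 2 * kap * c / m) by (unfold A1; field; lra).
    assert (P2 : 0 <= 2 * kap * c / m).
    { apply Rmult_le_pos; [lra|left; apply Rinv_0_lt_compat; lra]. }
    destruct (Rle_dec (Rabs y) (Rabs s)) as [Hsy|Hsy].
    - specialize (Vb s ltac:(lra)). lra.
    - set (x := if Rle_dec 0 s then Rabs y else - Rabs y).
      assert (Ax : Rabs x = Rabs y).
      { unfold x. destruct Rle_dec; [|rewrite Rabs_Ropp]; apply Rabs_Rabsolu. }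
      assert (Sx : Rabs (s - x) <= Rabs y).
      { apply Rnot_le_lt in Hsy. unfold x. destruct Rle_dec as [P|P].
        - rewrite (Rabs_pos_eq s) in Hsy by exact P. apply Rabs_le. lra.
        - rewrite (Rabs_left s) in Hsy by lra. apply Rabs_le. lra. }
      specialize (Vb x ltac:(lra)).
      pose proof (HorD x s y ltac:(lra) Sx) as Hb. fold c in Hb.
      assert (Hb2 : kap * c / Rabs y <= 2 * kap * c / m).
      { replace (2 * kap * c / m) with (kap * c * / (m / 2)) by (field; lra).
        apply Rmult_le_compat_l; [exact Pkc|]. apply Rinv_le_contravar; lra. }
      replace (D (s, y)) with (D (s, y) - D (x, y) + D (x, y))%C by ring.
      eapply Rle_trans; [apply Cmod_triangle|]. lra. }
  exists E0, (2 * R2), (A1 + 2 * B / Rabs tau). split; [exact ME0|]. split; [lra|].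
  assert (PA1 : 0 <= A1) by (unfold A1; apply Rmult_le_pos; lra).
  assert (PB : 0 <= 2 * B / Rabs tau) by (apply Rmult_le_pos; lra).
  split; [lra|]. intros w Hw.
  change (Cmod (F w - (b + E0 * u (Re w) / it * RtoC (sinh (tau * Im w))))
    <= (A1 + 2 * B / Rabs tau) * cosh (tau * Im w) / Cmod w).
  specialize (Est w Hw). destruct (he_G _ _ _ _ _ _ _ HE w ltac:(lra)) as [G0 _].
  destruct (E_spec R0 G F L tau K HE w ltac:(lra)) as [Ew0 _]. fold E in Ew0.
  set (x := exp (- (tau * Im w))). set (x' := exp (tau * Im w)).
  assert (Px : 0 < x) by apply exp_pos. assert (Px' : 0 < x') by apply exp_pos.
  assert (Xx : x * x' = 1).
  { unfold x, x'. rewrite <- exp_plus. replace (- (tau * Im w) + tau * Im w) with 0 by ring. apply exp_0. }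
  assert (GI : Cconj (/ G w) = (Cconj (/ E w) * (RtoC x' * u (Re w)))%C).
  { rewrite GE. fold x.
    assert (Nx : RtoC x <> RtoC 0) by (apply Cmod_neq_0; rewrite Cmod_R, Rabs_pos_eq; lra).
    assert (Nu : u (Re w) <> RtoC 0) by (apply Cmod_neq_0; rewrite Mu; lra).
    assert (I1 : (/ (E w * (RtoC x * u (Re w))))%C = (/ E w * (/ RtoC x * / u (Re w)))%C) by (field; auto).
    rewrite I1, !Cmult_conj. f_equal. f_equal.
    - rewrite <- RtoC_inv by lra.
      replace (/ x) with x'.
      + unfold Cconj, RtoC. Ceq.
      + apply Rmult_eq_reg_l with x; [rewrite Xx; field; lra|lra].
    - rewrite Cconj_inv by exact Nu. rewrite Mu. replace (/ (1 * 1)) with 1 by field. ring. }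
  assert (CE0 : Cconj (/ E0) = E0).
  { rewrite Cconj_inv, ME0 by exact NE0. replace (/ (1 * 1)) with 1 by field. ring. }
  (* Since [|E0| = 1], the conjugate of [1 / E0] is [E0]; with [E0] in place of [E] the quotient in
     [D] becomes exactly the [sinh] term. *)
  assert (Dif : (F w - (b + E0 * u (Re w) / it * RtoC (sinh (tau * Im w))))%C =
    (D w + (RtoC x' * u (Re w) * (Cconj (/ E w) - Cconj (/ E0)) - RtoC x * u (Re w) * (E w - E0)) / (2 * it))%C).
  { unfold D. rewrite GI, GE, CE0. unfold sinh. fold x. fold x'.
    unfold Rdiv. rewrite RtoC_mult, RtoC_minus, RtoC_inv by lra. field. auto. }
  rewrite Dif. eapply Rle_trans; [apply Cmod_triangle|].
  specialize (T w ltac:(lra)). destruct (EB w ltac:(lra)) as [Eb1 Eb2].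
  assert (Q1 : Cmod (Cconj (/ E w) - Cconj (/ E0)) <= 2 * (B / Cmod w)).
  { rewrite <- Cminus_conj, Cmod_conj.
    replace (/ E w - / E0)%C with ((E0 - E w) * / (E w * E0))%C by (field; auto).
    rewrite Cmod_mult, Cmod_inv, Cmod_mult, ME0, Rmult_1_r, Cmod_sub_sym by now apply Cmult_neq_0.
    assert (/ Cmod (E w) <= 2) by (rewrite <- (Rinv_inv 2); apply Rinv_le_contravar; lra).
    assert (0 < / Cmod (E w)) by (apply Rinv_0_lt_compat; lra).
    pose proof (Cmod_ge_0 (E w - E0)). nra. }
  assert (Q2 : Cmod ((RtoC x' * u (Re w) * (Cconj (/ E w) - Cconj (/ E0)) - RtoC x * u (Re w) * (E w - E0)) / (2 * it))
     <= 2 * B / Rabs tau * cosh (tau * Im w) / Cmod w).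
  { rewrite Cmod_div, (Cmod_mult 2), Mit, Cmod_R, (Rabs_pos_eq 2) by (try lra; now apply Cmult_neq_0).
    apply Rle_trans with ((x' * (2 * (B / Cmod w)) + x * (2 * (B / Cmod w))) / (2 * Rabs tau)).
    - apply Rmult_le_compat_r; [left; apply Rinv_0_lt_compat; lra|].
      unfold Cminus at 1. eapply Rle_trans; [apply Cmod_triangle|].
      rewrite Cmod_opp, !Cmod_mult, !Cmod_R, Mu, !Rabs_pos_eq by lra. rewrite !Rmult_1_r.
      assert (0 <= B / Cmod w) by (apply Rmult_le_pos; [lra|left; apply Rinv_0_lt_compat; lra]).
      apply Rplus_le_compat; apply Rmult_le_compat_l; lra.
    - right. unfold cosh. fold x. fold x'. field. lra. }
  replace ((A1 + 2 * B / Rabs tau) * cosh (tau * Im w) / Cmod w) with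
    (A1 * cosh (tau * Im w) / Cmod w + 2 * B / Rabs tau * cosh (tau * Im w) / Cmod w) by (field; lra).
  lra.
Qed.

End StraightEnd.

(** * Helicoids *)

(** The integral of the data [g = e^z], [dh = - i dz], with constants that put the axis of the
    helicoid on the [x3]-axis. *)
Definition helicoid_param (z : C) : R3 :=
  (- sin (Im z) * sinh (Re z), cos (Im z) * sinh (Re z), Im z).

Lemma horizontal_helicoid_param (z : C) :
  horizontal_part helicoid_param z = (Ci / 2 * (Cexp z - Cconj (Cexp (- z))))%C.
Proof.
  destruct z as [u v]. unfold horizontal_part, helicoid_param, x1, x2, Cexp, Re, Im, sinh. simpl.
  rewrite cos_neg, sin_neg. Ceq; field.
Qed.

Lemma wder_horizontal_helicoid (p : C) :
  wder (horizontal_part helicoid_param) p (Ci / 2 * Cexp p) (Ci / 2 * Cconj (Cexp (- p))).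
Proof.
  assert (W1 : wder (fun z => - z)%C p (- (1)) 0).
  { apply (wder_ext (fun z => -1 * z)%C _ _ _ _ 1); [lra|intros; ring|].
    apply (wder_eq _ _ _ _ _ _ (wder_RtoC_scal _ _ _ _ (-1) (wder_id p))); ring. }
  pose proof (wder_comp _ _ _ _ _ _ _ (holo_comp _ _ _ _ _ W1 (wder_Cexp (- p)%C)) (wder_conj _)) as W2.
  cbv beta in W2.
  pose proof (wder_RtoC_scal _ _ _ _ (Ci / 2) (wder_plus _ _ _ _ _ _ _ (wder_Cexp p)
    (wder_RtoC_scal _ _ _ _ (-1) W2))) as W3. cbv beta in W3.
  apply (wder_ext _ (horizontal_part helicoid_param) _ _ _ 1 Rlt_0_1) in W3.
  - apply (wder_eq _ _ _ _ _ _ W3).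
    + rewrite Cconj_0. ring.
    + rewrite Cmult_conj. replace (Cconj (- (1))) with (- (1))%C by Ceq. ring.
  - intros z _. rewrite horizontal_helicoid_param. ring.
Qed.

(** Recasts Wirtinger expansions as the real differential that [immersion_on] asks for. The
    coefficients of the third component are conjugate because it is real. *)
Lemma filterdiff_R3 (Y : C -> R3) (p : C) (a b c : C) :
  wder (horizontal_part Y) p a b -> wder (fun z => RtoC (x3 (Y z))) p c (Cconj c) ->
  filterdiff (K := R_AbsRing) (U := C_R_NormedModule)
    (V := prod_NormedModule R_AbsRing
            (prod_NormedModule R_AbsRing R_NormedModule R_NormedModule) R_NormedModule)
    Y (locally p)
    (fun h => (Re (a * h + b * Cconj h)%C, Im (a * h + b * Cconj h)%C, Re (c * h + Cconj c * Cconj h)%C)).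
Proof.
  intros WH W3.
  assert (Nb : forall q : R3, @norm R_AbsRing (prod_NormedModule R_AbsRing
      (prod_NormedModule R_AbsRing R_NormedModule R_NormedModule) R_NormedModule) q
      <= Cmod (x1 q, x2 q) + Rabs (x3 q)).
  { intros [[q1 q2] q3]. unfold norm. simpl. unfold prod_norm. simpl.
    change (prod_norm (K := R_AbsRing) (U := R_NormedModule) (V := R_NormedModule) (q1, q2))
      with (@norm R_AbsRing C_R_NormedModule (q1, q2)).
    rewrite norm_C_R. unfold norm. simpl. unfold abs. simpl.
    pose proof (Cmod_ge_0 (q1, q2)). pose proof (Rabs_pos q3).
    unfold x1, x2, x3. simpl. rewrite <- (sqrt_Rsqr (Cmod (q1, q2) + Rabs q3)) by lra.
    apply sqrt_le_1_alt. unfold Rsqr. nra. }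
  split.
  - constructor.
    + intros u v. change (plus u v) with (u + v)%C.
      change ((Re (a * (u + v) + b * Cconj (u + v))%C, Im (a * (u + v) + b * Cconj (u + v))%C,
          Re (c * (u + v) + Cconj c * Cconj (u + v))%C) =
        (Re (a * u + b * Cconj u)%C + Re (a * v + b * Cconj v)%C,
         Im (a * u + b * Cconj u)%C + Im (a * v + b * Cconj v)%C,
         Re (c * u + Cconj c * Cconj u)%C + Re (c * v + Cconj c * Cconj v)%C)).
      destruct a, b, c, u, v. unfold Re, Im, Cconj. simpl. f_equal; [f_equal|]; ring.
    + intros k u. replace (scal k u) with (RtoC k * u)%C.
      2:{ destruct u. unfold scal. simpl. unfold prod_scal, scal. simpl. unfold mult. simpl. Ceq. }
      change ((Re (a * (RtoC k * u) + b * Cconj (RtoC k * u))%C,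
          Im (a * (RtoC k * u) + b * Cconj (RtoC k * u))%C,
          Re (c * (RtoC k * u) + Cconj c * Cconj (RtoC k * u))%C) =
        (k * Re (a * u + b * Cconj u)%C, k * Im (a * u + b * Cconj u)%C,
         k * Re (c * u + Cconj c * Cconj u)%C)).
      destruct a, b, c, u. unfold Re, Im, Cconj. simpl. f_equal; [f_equal|]; ring.
    + exists (Cmod a + Cmod b + 2 * Cmod c + 1).
      pose proof (Cmod_ge_0 a). pose proof (Cmod_ge_0 b). pose proof (Cmod_ge_0 c).
      split; [lra|]. intros h. rewrite norm_C_R.
      eapply Rle_trans; [apply Nb|]. unfold x1, x2, x3. cbn [fst snd].
      pose proof (Cmod_triangle (a * h) (b * Cconj h)) as T1.
      pose proof (Cmod_triangle (c * h) (Cconj c * Cconj h)) as T2.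
      rewrite !Cmod_mult, Cmod_conj in T1. rewrite !Cmod_mult, !Cmod_conj in T2.
      replace ((Re (a * h + b * Cconj h)%C, Im (a * h + b * Cconj h)%C) : C) with (a * h + b * Cconj h)%C
        by (symmetry; apply surjective_pairing).
      pose proof (re_le_Cmod (c * h + Cconj c * Cconj h)) as T3.
      pose proof (Cmod_ge_0 h) as Ph.
      rewrite !Rmult_plus_distr_r, Rmult_1_l. lra.
  - intros x Hx eps.
    assert (E : p = x) by exact (is_filter_lim_locally_unique
                  (K := R_AbsRing) (V := C_R_NormedModule) p x Hx).
    subst x. pose proof (cond_pos eps) as Heps.
    destruct (WH (eps / 2) ltac:(lra)) as (d1 & Hd1 & K1).
    destruct (W3 (eps / 2) ltac:(lra)) as (d2 & Hd2 & K2).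
    apply locally_Cmod. exists (Rmin d1 d2). split; [now apply Rmin_pos|].
    intros z Hz. pose proof (Rmin_l d1 d2). pose proof (Rmin_r d1 d2).
    specialize (K1 z ltac:(lra)). specialize (K2 z ltac:(lra)).
    change (minus z p) with (z - p)%C. rewrite norm_C_R. set (h := (z - p)%C) in *.
    eapply Rle_trans; [apply Nb|].
    replace (eps * Cmod h) with (eps / 2 * Cmod h + eps / 2 * Cmod h) by field.
    apply Rplus_le_compat.
    + eapply Rle_trans; [|exact K1]. right. f_equal.
    + eapply Rle_trans; [|exact K2]. eapply Rle_trans; [|apply re_le_Cmod]. right. f_equal.
Qed.

Lemma is_path_integral (Phi phi : C -> C) (gamma dgamma : R -> C) :
  (forall z, wder Phi z (phi z) 0) -> (forall z, hol phi z) ->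
  (forall t, 0 <= t <= 1 -> C1_at gamma dgamma t) ->
  path_integral phi gamma dgamma = (Phi (gamma 1) - Phi (gamma 0))%C.
Proof.
  intros HP Hphi HC. apply CInt_unique.
  apply (is_CInt_derive (fun t => Phi (gamma t))); [lra| |].
  - intros t Ht. destruct (HC t Ht) as [H1 _]. apply cderiv_is_derive in H1.
    pose proof (wder_cderiv _ _ _ _ _ _ H1 (HP (gamma t))) as W.
    rewrite Cmult_0_l, Cplus_0_r in W. exact W.
  - intros t Ht. destruct (HC t Ht) as [H1 H2]. apply cderiv_is_derive in H1.
    apply rcont_mult.
    + apply rcont_ccont; [exact (cderiv_rcont _ _ _ H1)|]. apply hol_ccont, Hphi.
    + now apply rcont_continuous.
Qed.

Lemma hol_holomorphic_at (f : C -> C) (p : C) : (forall z, hol f z) -> holomorphic_at f p.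
Proof. intros H. apply holomorphic_at_hol. exists 1. split; [lra|]. intros z _. apply H. Qed.

Lemma helicoid_param_weierstrass :
  weierstrass_immersion (fun _ : C => True) Cexp (fun _ : C => (- Ci)%C) helicoid_param.
Proof.
  assert (He : forall z, hol Cexp z) by (intros z; eexists; apply wder_Cexp).
  assert (Hi : forall z, hol (fun z => / Cexp z)%C z).
  { intros z. apply hol_inv; [apply Cexp_neq_0|apply He]. }
  assert (Inv : forall z, (/ Cexp z)%C = Cexp (- z)).
  { intros z. pose proof (Cexp_neq_0 z).
    replace (Cexp (- z)) with (Cexp (- z) * Cexp z * / Cexp z)%C by (field; auto).
    rewrite Cexp_opp. ring. }
  assert (Wi : forall z, wder (fun z => / Cexp z)%C z (- / Cexp z) 0).
  { intros z. pose proof (Cexp_neq_0 z).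
    apply (wder_eq _ _ _ _ _ _ (holo_inv _ _ _ (Cexp_neq_0 z) (wder_Cexp z))); [field; auto|reflexivity]. }
  constructor.
  - intros p _. left. now apply hol_holomorphic_at.
  - intros p _. apply hol_holomorphic_at. intros z. apply hol_const.
  - intros p _.
    assert (W3 : wder (fun z => RtoC (x3 (helicoid_param z))) p (- Ci / 2) (Cconj (- Ci / 2))).
    { apply (wder_ext (fun z => RtoC (Re (- Ci * z)%C)) _ _ _ _ 1); [lra| |].
      - intros z _. destruct z. unfold helicoid_param, x3, Re, Im. simpl. f_equal. ring.
      - assert (W' : wder (fun z => RtoC (Re (- Ci * z)%C)) p (- Ci * 1 / 2) (Cconj (- Ci * 1) / 2)).
        { apply wder_Re. apply (wder_eq _ _ _ _ _ _ (wder_RtoC_scal _ _ _ _ (- Ci) (wder_id p))); ring. }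
        apply (wder_eq _ _ _ _ _ _ W'); [field|].
        unfold Cconj, Ci. Ceq; field. }
    eexists. split; [exact (filterdiff_R3 _ _ _ _ _ (wder_horizontal_helicoid p) W3)|].
    intros [v1 v2] Hv.
    pose proof (f_equal x1 Hv) as E1. pose proof (f_equal x2 Hv) as E2.
    pose proof (f_equal x3 Hv) as E3. clear Hv.
    unfold x1, x2, x3 in E1, E2, E3. cbn [fst snd] in E1, E2, E3.
    assert (V2 : v2 = 0).
    { unfold Re, Cconj, Ci in E3. simpl in E3. lra. }
    subst v2.
    (* Once the third component has forced the vector to be real, the horizontal part multiplies it
       by [k], whose modulus is [cosh (Re p)]. *)
    set (k := (Ci / 2 * Cexp p + Ci / 2 * Cconj (Cexp (- p)))%C).
    assert (Ek : k = (Ci * RtoC (cosh (Re p)) * Cis (Im p))%C).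
    { unfold k. destruct p as [u w]. unfold Cexp, Cis, Re, Im, cosh. simpl. rewrite cos_neg, sin_neg.
      Ceq; field. }
    assert (Z : (k * RtoC v1)%C = RtoC 0).
    { unfold k. clear - E1 E2. revert E1 E2.
      generalize (Ci / 2 * Cexp p)%C (Ci / 2 * Cconj (Cexp (- p)))%C. intros [a1 a2] [b1 b2].
      unfold Re, Im, Cconj. simpl. intros E1 E2. Ceq; lra. }
    assert (Mk : 0 < Cmod k).
    { rewrite Ek, !Cmod_mult, Cmod_Ci, Cmod_Cis, Cmod_R.
      pose proof (cosh_ge_1 (Re p)). rewrite Rabs_pos_eq; lra. }
    assert (Z2 : Cmod k * Rabs v1 = 0) by (rewrite <- Cmod_R, <- Cmod_mult, Z; apply Cmod_0).
    apply Rmult_integral in Z2. destruct Z2 as [Z2|Z2]; [lra|].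
    destruct (Req_dec v1 0) as [->|N]; [reflexivity|]. apply Rabs_no_R0 in N. lra.
  - exists (fun z => / 2 * (/ Cexp z - Cexp z) * (- Ci))%C, (fun z => Ci / 2 * (/ Cexp z + Cexp z) * (- Ci))%C.
    assert (H1 : forall z, hol (fun z => / 2 * (/ Cexp z - Cexp z) * (- Ci))%C z).
    { intros z. apply hol_mult; [|apply hol_const]. apply hol_mult; [apply hol_const|].
      apply hol_minus; auto. }
    assert (H2 : forall z, hol (fun z => Ci / 2 * (/ Cexp z + Cexp z) * (- Ci))%C z).
    { intros z. apply hol_mult; [|apply hol_const]. apply hol_mult; [apply hol_const|].
      apply hol_plus; auto. }
    split.
    + intros p _. split; [now apply hol_holomorphic_at|]. split; [now apply hol_holomorphic_at|].
      apply locally'_Cmod. exists 1. split; [lra|]. intros z _ _.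
      split; [apply Cexp_neq_0|]. split; reflexivity.
    + intros gam dgam HC.
      assert (HC' : forall t, 0 <= t <= 1 -> C1_at gam dgam t) by (intros t Ht; now apply HC).
      rewrite (is_path_integral (fun z => Ci / 2 * (/ Cexp z + Cexp z))%C _ _ _) with (2 := H1) (3 := HC').
      2:{ intros z. apply (wder_eq _ _ _ _ _ _ (wder_RtoC_scal _ _ _ _ (Ci / 2)
            (holo_plus _ _ _ _ _ (Wi z) (wder_Cexp z)))); field. apply Cexp_neq_0. }
      rewrite (is_path_integral (fun z => / 2 * (Cexp z - / Cexp z))%C _ _ _) with (2 := H2) (3 := HC').
      2:{ intros z. apply (wder_eq _ _ _ _ _ _ (wder_RtoC_scal _ _ _ _ (/ 2)
            (holo_minus _ _ _ _ _ (wder_Cexp z) (Wi z)))); [|ring].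
          transitivity (/ 2 * (Cexp z + / Cexp z))%C; [ring|].
          transitivity (- (Ci * Ci) * (/ 2 * (Cexp z + / Cexp z)))%C; [|unfold Cdiv; ring].
          replace (Ci * Ci)%C with (- (1))%C by Ceq. ring. }
      rewrite (is_path_integral (fun z => - Ci * z)%C (fun _ => - Ci)%C _ _) with (3 := HC').
      2:{ intros z. apply (wder_eq _ _ _ _ _ _ (wder_RtoC_scal _ _ _ _ (- Ci) (wder_id z))); ring. }
      2:{ intros z. apply hol_const. }
      assert (R1 : forall z, x1 (helicoid_param z) = Re (Ci / 2 * (/ Cexp z + Cexp z))%C).
      { intros z. rewrite Inv. destruct z as [u v]. unfold helicoid_param, x1, Cexp, Re, Im, sinh. simpl.
        rewrite cos_neg, sin_neg. field. }
      assert (R2 : forall z, x2 (helicoid_param z) = Re (/ 2 * (Cexp z - / Cexp z))%C).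
      { intros z. rewrite Inv. destruct z as [u v]. unfold helicoid_param, x2, Cexp, Re, Im, sinh. simpl.
        rewrite cos_neg, sin_neg. field. }
      assert (R3' : forall z, x3 (helicoid_param z) = Re (- Ci * z)%C).
      { intros z. destruct z as [u v]. unfold helicoid_param, x3, Re, Im. simpl. ring. }
      assert (Rm : forall a c : C, Re (a - c) = Re a - Re c) by reflexivity.
      rewrite !R1, !R2, !R3', !Rm. split; [|split]; ring.
Qed.

(* The helicoid with axis [x1 + i x2 = b] and pitch determined by
   [dg / g = i tau dh]; [rho] runs along the ruling at height [s]. *)
Definition helicoid_about (b E0 : C) (tau : R) (q : R3) : Prop :=
  exists s rho : R,
    ((x1 q, x2 q) : C) = (b + E0 * Cexp (Ci * RtoC tau * RtoC s) / (Ci * RtoC tau) * RtoC rho)%C /\ x3 q = s.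

(** The phase [gam] of [E0] is absorbed by a translation along the axis, the sign of [tau] by a
    reflection in [x3], and [/ Rabs tau] is the scale. Since [sinh] is onto, whole rulings are
    covered. *)
Lemma helicoid_about_helicoid (b E0 : C) (tau : R) : tau <> 0 -> Cmod E0 = 1 ->
  helicoid (helicoid_about b E0 tau).
Proof.
  intros Htau HE0. destruct (polar_form E0) as (gam & _ & Eg). rewrite HE0, Cmult_1_l in Eg.
  set (sg := if Rlt_dec 0 tau then 1 else -1).
  assert (Pt : 0 < Rabs tau) by now apply Rabs_pos_lt.
  assert (Hst : sg * tau = Rabs tau).
  { unfold sg. destruct Rlt_dec; [rewrite Rabs_pos_eq|rewrite Rabs_left]; lra. }
  assert (Ssg : sg * sg = 1) by (unfold sg; destruct Rlt_dec; ring).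
  exists helicoid_param, (fun q => (x1 q + Re b, x2 q + Im b, sg * x3 q - gam / tau)), (/ Rabs tau).
  split; [exact helicoid_param_weierstrass|]. split; [|split].
  - intros p q. unfold dist3, x1, x2, x3. simpl. f_equal.
    replace (sg * snd p - gam / tau - (sg * snd q - gam / tau)) with (sg * (snd p - snd q)) by ring.
    transitivity ((fst (fst p) - fst (fst q)) ^ 2 + (snd (fst p) - snd (fst q)) ^ 2 +
      (sg * sg) * (snd p - snd q) ^ 2); [ring|rewrite Ssg; ring].
  - now apply Rinv_0_lt_compat.
  - assert (Key : forall s rho,
      (E0 * Cexp (Ci * RtoC tau * RtoC s) / (Ci * RtoC tau) * RtoC rho)%C =
      (- sin (tau * s + gam) * (- sg * rho) / Rabs tau, cos (tau * s + gam) * (- sg * rho) / Rabs tau)).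
    { intros s rho.
      assert (Eu : (E0 * Cexp (Ci * RtoC tau * RtoC s))%C = Cis (tau * s + gam)).
      { rewrite Eg. unfold Cexp, Cis, Re, Im. simpl.
        replace ((0 * tau - 1 * 0) * s - (0 * 0 + 1 * tau) * 0) with 0 by ring.
        replace ((0 * tau - 1 * 0) * 0 + (0 * 0 + 1 * tau) * s) with (tau * s) by ring.
        rewrite exp_0, cos_plus, sin_plus. Ceq. }
      rewrite Eu.
      assert (Ei : (/ (Ci * RtoC tau))%C = (- (Ci * RtoC (sg / Rabs tau)))%C).
      { assert (N : (Ci * RtoC tau)%C <> RtoC 0).
        { apply Cmod_neq_0. rewrite Cmod_mult, Cmod_Ci, Cmod_R. lra. }
        assert (H : (- (Ci * RtoC (sg / Rabs tau)) * (Ci * RtoC tau))%C = RtoC 1).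
        { transitivity (- (Ci * Ci) * (RtoC (sg / Rabs tau) * RtoC tau))%C; [ring|].
          rewrite <- RtoC_mult. replace (sg / Rabs tau * tau) with 1 by (rewrite <- Hst at 1; field; split; [exact Htau|intros Z; rewrite Z in Ssg; lra]).
          replace (Ci * Ci)%C with (- (1))%C by Ceq. ring. }
        replace (- (Ci * RtoC (sg / Rabs tau)))%C with
          (- (Ci * RtoC (sg / Rabs tau)) * (Ci * RtoC tau) * / (Ci * RtoC tau))%C by (field; split; [|apply Cmod_neq_0; rewrite Cmod_Ci; lra];
            intros Z; apply Htau; now injection Z).
        rewrite H. ring. }
      unfold Cdiv. rewrite Ei. unfold Cis. Ceq; unfold Rdiv; ring. }
    intros q. split.
    + intros (s & rho & Eq & E3). exists (arcsinh (- sg * rho), tau * s + gam).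
      unfold helicoid_param, x1, x2, x3 in *. unfold Re at 1 2, Im at 1 2 3. simpl.
      rewrite sinh_arcsinh. rewrite Key in Eq.
      destruct q as [[q1 q2] q3]. simpl in *. injection Eq as Q1 Q2. subst q3.
      rewrite Q1, Q2. unfold Re, Im.
      apply injective_projections; [apply injective_projections|]; simpl.
      * field. lra.
      * field. lra.
      * replace (sg * (/ Rabs tau * (tau * s + gam))) with ((sg * tau) * (s + gam / tau) * / Rabs tau) by (field; lra).
        rewrite Hst. field. lra.
    + intros [[u v] Eq]. subst q. exists ((v - gam) / tau), (- sg * sinh u).
      rewrite Key. unfold helicoid_param, x1, x2, x3, Re, Im. simpl.
      replace (tau * ((v - gam) / tau) + gam) with v by (field; exact Htau).
      replace (- sg * (- sg * sinh u)) with (sinh u) by (transitivity (sg * sg * sinh u); [rewrite Ssg; ring|ring]).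
      split.
      * destruct b. Ceq; field; lra.
      * transitivity (sg * tau * v / (tau * Rabs tau) - gam / tau); [field; lra|]. rewrite Hst. field. lra.
Qed.

(** * Embeddedness and asymptotics *)

(** Moves the axis [Im w = y0] to the real line. Beyond [R1] one has [|w + d| >= |w| / 2], which
    accounts for the factor 4. *)
Lemma height_end_shift (R0 : R) (G F L : C -> C) (tau K y0 : R) :
  height_end R0 G F L (Ci * RtoC tau) 0 K -> exists R1, R0 <= R1 /\
  forall w, R1 < Cmod w -> R0 < Cmod (w + (0, y0)) /\
  height_end R1 (fun w => G (w + (0, y0))%C) (fun w => F (w + (0, y0))%C) (fun w => L (w + (0, y0))%C)
    (Ci * RtoC tau) 0 (4 * K).
Proof.
  intros HE. pose proof (he_R0 _ _ _ _ _ _ _ HE) as HR0. pose proof (axial_K _ _ _ _ _ _ HE) as HK.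
  set (d := (0, y0) : C).
  assert (Md : Cmod d = Rabs y0).
  { replace d with (Ci * RtoC y0)%C by (unfold d; Ceq). rewrite Cmod_mult, Cmod_Ci, Cmod_R. ring. }
  pose proof (Rabs_pos y0) as Py.
  exists (R0 + 2 * Rabs y0). split; [lra|].
  assert (B : forall w, R0 + 2 * Rabs y0 < Cmod w -> R0 < Cmod (w + d) /\ Cmod w / 2 <= Cmod (w + d)).
  { intros w Hw. pose proof (Cmod_triangle_rev w (- d)) as T. rewrite Cmod_opp, Md in T.
    replace (w - - d)%C with (w + d)%C in T by ring. lra. }
  assert (W : forall w, wder (fun w => w + d)%C w 1 0).
  { intros w. apply (wder_eq _ _ _ _ _ _ (holo_plus _ _ _ _ _ (wder_id w) (wder_const d w))); ring. }
  intros w0 Hw0. split; [now apply B|]. constructor.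
  - lra.
  - intros w Hw. destruct (he_G _ _ _ _ _ _ _ HE (w + d)%C) as [G0 WG]; [now apply B|].
    split; [exact G0|]. apply (wder_eq _ _ _ _ _ _ (holo_comp _ _ _ _ _ (W w) WG)); ring.
  - intros w Hw. pose proof (he_F _ _ _ _ _ _ _ HE (w + d)%C) as WF. specialize (WF (proj1 (B w Hw))).
    apply (wder_eq _ _ _ _ _ _ (wder_comp _ _ _ _ _ _ _ (W w) WF)).
    + rewrite Cconj_0. ring.
    + replace (Cconj 1) with (RtoC 1) by Ceq. ring.
  - intros w Hw. destruct (B w Hw) as [B1 B2].
    pose proof (axial_L _ _ _ _ _ _ HE (w + d)%C B1) as BL.
    replace (L (w + d) - (Ci * RtoC tau + 0 / w))%C with (L (w + d)%C - Ci * RtoC tau)%C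
      by (unfold Cdiv; ring).
    eapply Rle_trans; [exact BL|].
    replace (4 * K / (Cmod w * Cmod w)) with (K * / (Cmod w / 2 * (Cmod w / 2))) by (field; lra).
    apply Rmult_le_compat_l; [exact HK|]. apply Rinv_le_contravar; [nra|]. apply Rmult_le_compat; lra.
Qed.

Lemma dist3_le (p q : R3) :
  dist3 p q <= Cmod ((x1 p, x2 p) - (x1 q, x2 q)) + Rabs (x3 p - x3 q).
Proof.
  set (A := Cmod ((x1 p, x2 p) - (x1 q, x2 q))). set (B := x3 p - x3 q).
  assert (HA : 0 <= A) by apply Cmod_ge_0. pose proof (Rabs_pos B).
  assert (EA : A ^ 2 = (x1 p - x1 q) ^ 2 + (x2 p - x2 q) ^ 2).
  { unfold A. rewrite Cmod2_alt. unfold Re, Im. simpl. ring. }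
  unfold dist3. fold B. rewrite <- EA.
  rewrite <- (sqrt_Rsqr (A + Rabs B)) by lra. apply sqrt_le_1_alt. unfold Rsqr.
  rewrite <- (pow2_abs B). nra.
Qed.

Lemma dist3_ge (p q : R3) :
  Rabs (x1 p - x1 q) <= dist3 p q /\ Rabs (x2 p - x2 q) <= dist3 p q /\
  Rabs (x3 p - x3 q) <= dist3 p q /\ Cmod ((x1 p, x2 p) - (x1 q, x2 q)) <= dist3 p q.
Proof.
  unfold dist3. set (a := x1 p - x1 q). set (b := x2 p - x2 q). set (c := x3 p - x3 q).
  pose proof (pow2_ge_0 a). pose proof (pow2_ge_0 b). pose proof (pow2_ge_0 c).
  rewrite <- (sqrt_pow2 (Rabs a)), <- (sqrt_pow2 (Rabs b)), <- (sqrt_pow2 (Rabs c)) by apply Rabs_pos.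
  rewrite !pow2_abs.
  repeat split; try (apply sqrt_le_1_alt; lra).
  unfold Cmod. apply sqrt_le_1_alt. simpl fst. simpl snd. fold a. fold b. change (x1 p + - x1 q) with a.
  change (x2 p + - x2 q) with b. lra.
Qed.

Lemma sinh_abs_ge (x : R) : Rabs x <= Rabs (sinh x).
Proof.
  assert (P : forall x, 0 <= x -> x <= sinh x).
  { intros z Hz.
    destruct (MVT_gen (fun t => sinh t - t) 0 z (fun t => cosh t - 1)) as (c & _ & E).
    - intros t _. unfold sinh, cosh. auto_derive; [trivial|field].
    - intros t _. apply continuity_pt_filterlim.
      apply (ex_derive_continuous (V := R_NormedModule) (fun t => sinh t - t)).
      unfold sinh. auto_derive. trivial.
    - rewrite sinh_0 in E. pose proof (cosh_ge_1 c). nra. }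
  destruct (Rle_dec 0 x) as [H|H].
  - rewrite !Rabs_pos_eq; [now apply P|specialize (P x H); lra|exact H].
  - specialize (P (- x) ltac:(lra)).
    assert (E : sinh (- x) = - sinh x) by (unfold sinh; rewrite Ropp_involutive; field).
    rewrite E in P. rewrite !Rabs_left; lra.
Qed.

(** Away from the axis this makes the [cosh] error relative to the main term; it rests on
    [exp z >= 2] for [z >= 1]. *)
Lemma cosh_le_2sinh (x : R) : 1 <= Rabs x -> cosh x <= 2 * Rabs (sinh x).
Proof.
  assert (P : forall z, 1 <= z -> cosh z <= 2 * sinh z).
  { intros z Hz. unfold cosh, sinh.
    pose proof (exp_ineq1_le z). pose proof (exp_pos (- z)).
    assert (exp z * exp (- z) = 1) by (rewrite <- exp_plus, Rplus_opp_r; apply exp_0).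
    assert (2 * exp (- z) <= 1) by nra. lra. }
  intros H. unfold Rabs in H. destruct Rcase_abs as [N|N].
  - specialize (P (- x) H).
    assert (E : sinh (- x) = - sinh x) by (unfold sinh; rewrite Ropp_involutive; field).
    assert (E' : cosh (- x) = cosh x) by (unfold cosh; rewrite Ropp_involutive; field).
    rewrite E, E' in P. pose proof (Rabs_maj2 (sinh x)). lra.
  - specialize (P x H). pose proof (Rle_abs (sinh x)). lra.
Qed.

Lemma atan_abs_le (x : R) : Rabs (atan x) <= Rabs x.
Proof.
  assert (P : forall a b, a <= b -> Rabs (atan b - atan a) <= 1 * (b - a)).
  { intros a b Hab. apply (Rabs_increment_le atan (fun t => / (1 + t * t))); [exact Hab| |].
    - intros t _. pose proof (derivable_pt_lim_atan t) as D. apply is_derive_Reals in D.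
      replace (/ (1 + t * t)) with (/ (1 + t ^ 2)) by (f_equal; ring). exact D.
    - intros t _. rewrite Rabs_pos_eq by (left; apply Rinv_0_lt_compat; nra).
      rewrite <- Rinv_1. apply Rinv_le_contravar; nra. }
  destruct (Rle_dec 0 x) as [H|H].
  - specialize (P 0 x H). rewrite atan_0, Rminus_0_r in P. rewrite (Rabs_pos_eq x); lra.
  - specialize (P x 0 ltac:(lra)). rewrite atan_0 in P. rewrite (Rabs_left x) by lra.
    replace (0 - atan x) with (- atan x) in P by ring. rewrite Rabs_Ropp in P. lra.
Qed.

(** * From the asymptotic expansion to an embedded sub-end near a helicoid *)

Section Conclusion.

Variables (r r1 R0 : R) (g f : C -> C) (X : C -> R3) (h k : C -> C).
Variables (b E0 : C) (tau A : R).
Hypothesis Htau : tau <> 0.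
Hypothesis HE0 : Cmod E0 = 1.
Hypothesis HA : 0 <= A.
Hypothesis HR0 : 1 < R0.
Hypothesis Hend : minimal_annular_end r g f X.
Hypothesis Hr1 : 0 < r1 < r.
Hypothesis Hki : forall z, z <> RtoC 0 -> Cmod z < r1 -> R0 < Cmod (h z) -> k (h z) = z.
Hypothesis Hinf : forall M, exists rho, 0 < rho < r1 /\
  forall z, z <> RtoC 0 -> Cmod z < rho -> M < Cmod (h z).
Hypothesis Hx3 : forall z, z <> RtoC 0 -> Cmod z < r1 -> x3 (X z) = Re (h z).

Let F (w : C) : C := horizontal_part X (k w).
Let amp (s : R) : C := (E0 * Cexp (Ci * RtoC tau * RtoC s) / (Ci * RtoC tau))%C.

Hypothesis Hasym : forall w, R0 < Cmod w ->
  Cmod (F w - (b + amp (Re w) * RtoC (sinh (tau * Im w)))) <= A * cosh (tau * Im w) / Cmod w.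
Hypothesis Hexp : forall s y1 y2, y1 <= y2 ->
  (forall t, y1 <= t <= y2 -> R0 < Cmod (s, t)) -> y2 - y1 <= 3 * Cmod (F (s, y2) - F (s, y1)).

Let Ptau : 0 < Rabs tau.
Proof. now apply Rabs_pos_lt. Qed.

Lemma amp_neq_0_den : (Ci * RtoC tau)%C <> RtoC 0.
Proof. apply Cmod_neq_0. rewrite Cmod_mult, Cmod_Ci, Cmod_R. lra. Qed.

Lemma Cmod_amp (s : R) : Cmod (amp s) = / Rabs tau.
Proof.
  unfold amp. rewrite Cmod_div by exact amp_neq_0_den.
  rewrite !Cmod_mult, HE0, Cmod_Ci, Cmod_R, Cmod_Cexp.
  replace (Re (Ci * RtoC tau * RtoC s)) with 0 by (unfold Re; simpl; ring).
  rewrite exp_0. field. lra.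
Qed.

Lemma asymptotics_far (w : C) : R0 < Cmod w -> 1 <= Rabs (tau * Im w) ->
  Cmod (F w - (b + amp (Re w) * RtoC (sinh (tau * Im w))))
    <= 2 * A / Cmod w * Rabs (sinh (tau * Im w)).
Proof.
  intros Hw Hy. eapply Rle_trans; [now apply Hasym|].
  replace (2 * A / Cmod w * Rabs (sinh (tau * Im w))) with (A * (2 * Rabs (sinh (tau * Im w))) / Cmod w)
    by (field; lra).
  apply Rmult_le_compat_r; [left; apply Rinv_0_lt_compat; lra|].
  apply Rmult_le_compat_l; [exact HA|now apply cosh_le_2sinh].
Qed.

(** Two points joined by a vertical segment in the domain are separated by [Hexp]. Otherwise the
    removed disc lies between them: [sinh] then takes opposite signs, the main terms point in
    opposite directions from [b], and relative errors below 1 cannot make the values of [F] meet. *)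
Lemma height_injective : exists R2, R0 < R2 /\ forall s y y', R2 < Cmod (s, y) -> R2 < Cmod (s, y') ->
  F (s, y) = F (s, y') -> y = y'.
Proof.
  (* One [R0] pays for [|s|] and the other keeps [|y|] beyond the disc; [/ Rabs tau] ensures
     [|tau y| >= 1], and [2 * A * Rabs tau] makes the relative error less than 1. *)
  set (R2 := R0 + R0 + / Rabs tau + 2 * A * Rabs tau).
  assert (P1 : 0 < / Rabs tau) by now apply Rinv_0_lt_compat.
  assert (P2 : 0 <= 2 * A * Rabs tau) by (apply Rmult_le_pos; lra).
  exists R2. split; [unfold R2; lra|].
  assert (W : forall s y y', y <= y' -> R2 < Cmod (s, y) -> R2 < Cmod (s, y') ->
     F (s, y) = F (s, y') -> y = y').
  { intros s y y' Hyy H1 H2 E.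
    assert (fin : (forall t, y <= t <= y' -> R0 < Cmod (s, t)) -> y = y').
    { intros H. pose proof (Hexp s y y' Hyy H) as Q. rewrite E in Q.
      replace (F (s, y') - F (s, y'))%C with (RtoC 0) in Q by ring. rewrite Cmod_0 in Q. lra. }
    assert (Res : forall t, Rabs s <= Cmod (s, t)) by (intros t; apply (re_le_Cmod (s, t))).
    assert (Ims : forall t, Rabs t <= Cmod (s, t)) by (intros t; apply (im_le_Cmod (s, t))).
    destruct (Rlt_dec R0 (Rabs s)) as [Hs|Hs].
    { apply fin. intros t _. specialize (Res t). lra. }
    assert (By : forall t, R2 < Cmod (s, t) -> R0 + / Rabs tau + 2 * A * Rabs tau < Rabs t).
    { intros t Ht. pose proof (Cmod_le_components (s, t)) as Q.
      change (Re (s, t)) with s in Q. change (Im (s, t)) with t in Q. unfold R2 in Ht. lra. }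
    pose proof (By y H1) as B1. pose proof (By y' H2) as B2.
    destruct (Rle_dec 0 y) as [Py|Ny].
    { apply fin. intros t Ht. specialize (Ims t). rewrite (Rabs_pos_eq y) in B1 by lra. rewrite Rabs_pos_eq in Ims by lra. lra. }
    destruct (Rle_dec y' 0) as [Ny'|Py'].
    { apply fin. intros t Ht. specialize (Ims t).
      rewrite <- (Rabs_Ropp y'), (Rabs_pos_eq (- y')) in B2 by lra.
      rewrite <- Rabs_Ropp, Rabs_pos_eq in Ims by lra. lra. }
    exfalso.
    assert (T : forall t, / Rabs tau < Rabs t -> 1 <= Rabs (tau * t)).
    { intros t Ht. rewrite Rabs_mult. replace 1 with (Rabs tau * / Rabs tau) by (field; lra).
      apply Rmult_le_compat_l; lra. }
    pose proof (T y ltac:(lra)) as T1. pose proof (T y' ltac:(lra)) as T2.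
    pose proof (asymptotics_far (s, y) ltac:(unfold R2 in H1; lra) T1) as A1.
    pose proof (asymptotics_far (s, y') ltac:(unfold R2 in H2; lra) T2) as A2.
    rewrite E in A1. change (Re (s, y)) with s in A1. change (Im (s, y)) with y in A1.
    change (Re (s, y')) with s in A2. change (Im (s, y')) with y' in A2.
    set (S := sinh (tau * y)) in *. set (S' := sinh (tau * y')) in *.
    pose proof (sinh_abs_ge (tau * y)) as L1. fold S in L1.
    pose proof (sinh_abs_ge (tau * y')) as L2. fold S' in L2.
    assert (Sgn : Rabs (S' - S) = Rabs S' + Rabs S).
    { assert (Hneg : forall x, x < 0 -> sinh x < 0) by (intros x Hx; rewrite <- sinh_0; now apply sinh_lt).
      assert (Hpos : forall x, 0 < x -> 0 < sinh x) by (intros x Hx; rewrite <- sinh_0; now apply sinh_lt).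
      destruct (Rlt_dec 0 tau) as [Pt|Nt].
      - assert (S < 0) by (apply Hneg; nra). assert (0 < S') by (apply Hpos; nra).
        rewrite (Rabs_pos_eq S'), (Rabs_left S), Rabs_pos_eq by lra. ring.
      - assert (0 < S) by (apply Hpos; nra). assert (S' < 0) by (apply Hneg; nra).
        rewrite (Rabs_pos_eq S), (Rabs_left S'), Rabs_left by lra. ring. }
    assert (D : / Rabs tau * (Rabs S' + Rabs S) <= 2 * A / Cmod (s, y') * Rabs S' + 2 * A / Cmod (s, y) * Rabs S).
    { rewrite <- Sgn, <- (Cmod_amp s), <- Cmod_R, <- Cmod_mult.
      replace (amp s * RtoC (S' - S))%C with
        (- (F (s, y') - (b + amp s * RtoC S')) + (F (s, y') - (b + amp s * RtoC S)))%C
        by (rewrite RtoC_minus; ring).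
      eapply Rle_trans; [apply Cmod_triangle|]. rewrite Cmod_opp. lra. }
    assert (Sm : forall m, R2 < m -> 2 * A / m <= / Rabs tau * (2 * A * Rabs tau / R2)).
    { intros m Hm. replace (/ Rabs tau * (2 * A * Rabs tau / R2)) with (2 * A * / R2) by (field; unfold R2; lra).
      apply Rmult_le_compat_l; [lra|]. apply Rinv_le_contravar; unfold R2 in *; lra. }
    assert (Frac : 2 * A * Rabs tau / R2 < 1).
    { apply Rmult_lt_reg_r with R2; [unfold R2; lra|].
      replace (2 * A * Rabs tau / R2 * R2) with (2 * A * Rabs tau) by (field; unfold R2; lra). unfold R2. lra. }
    pose proof (Sm _ H1) as S1. pose proof (Sm _ H2) as S2.
    set (q := 2 * A * Rabs tau / R2) in *.
    assert (Rabs S' + Rabs S <= q * (Rabs S' + Rabs S)).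
    { apply Rmult_le_reg_l with (/ Rabs tau); [exact P1|].
      eapply Rle_trans; [exact D|].
      replace (/ Rabs tau * (q * (Rabs S' + Rabs S))) with
        (/ Rabs tau * q * Rabs S' + / Rabs tau * q * Rabs S) by ring.
      apply Rplus_le_compat; apply Rmult_le_compat_r; try apply Rabs_pos; lra. }
    nra. }
  intros s y y' H1 H2 E. destruct (Rle_dec y y').
  - now apply (W s).
  - symmetry. apply (W s); auto. lra.
Qed.

(** At bounded height [Im w] must be large, and then [F] grows at least like a multiple of [|Im w|]
    because [|sinh x| >= |x|]. This keeps the end from accumulating on itself. *)
Lemma height_proper (M : R) : exists R3, R0 < R3 /\ forall w, R3 < Cmod w -> M < Rabs (Re w) \/ M < Cmod (F w).
Proof.
  pose proof (Rabs_pos M) as PM. pose proof (Rle_abs M).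
  assert (P1 : 0 < / Rabs tau) by now apply Rinv_0_lt_compat.
  assert (P2 : 0 <= 4 * A * Rabs tau) by (apply Rmult_le_pos; lra).
  pose proof (Cmod_ge_0 b).
  (* The term [4 * A * Rabs tau] keeps the error below half of the main term, and the last one makes
     the other half exceed [Rabs M + Cmod b]. *)
  set (R3 := R0 + Rabs M + / Rabs tau + 4 * A * Rabs tau + 2 * (Rabs M + Cmod b)).
  exists R3. split; [unfold R3; lra|]. intros w Hw.
  destruct (Rlt_dec M (Rabs (Re w))) as [L|L]; [now left|right].
  pose proof (Cmod_le_components w) as Q.
  assert (By : / Rabs tau + 2 * (Rabs M + Cmod b) < Rabs (Im w)) by (unfold R3 in Hw; lra).
  assert (T : 1 <= Rabs (tau * Im w)).
  { rewrite Rabs_mult. replace 1 with (Rabs tau * / Rabs tau) by (field; lra).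
    apply Rmult_le_compat_l; lra. }
  pose proof (asymptotics_far w ltac:(unfold R3 in Hw; lra) T) as A1.
  set (S := sinh (tau * Im w)) in *.
  pose proof (sinh_abs_ge (tau * Im w)) as L1. fold S in L1. rewrite Rabs_mult in L1.
  assert (Mt : Cmod (amp (Re w) * RtoC S) = / Rabs tau * Rabs S) by now rewrite Cmod_mult, Cmod_amp, Cmod_R.
  assert (T2 : / Rabs tau * Rabs S <= Cmod (F w) + Cmod b + 2 * A / Cmod w * Rabs S).
  { rewrite <- Mt.
    replace (amp (Re w) * RtoC S)%C with (- (F w - (b + amp (Re w) * RtoC S)) + F w + - b)%C by ring.
    eapply Rle_trans; [eapply Rle_trans; [apply Cmod_triangle|]; apply Rplus_le_compat_r, Cmod_triangle|].
    rewrite !Cmod_opp. lra. }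
  assert (T3 : 2 * A / Cmod w <= / Rabs tau / 2).
  { apply Rmult_le_reg_r with (Cmod w); [unfold R3 in Hw; lra|].
    replace (2 * A / Cmod w * Cmod w) with (2 * A) by (field; unfold R3 in Hw; lra).
    apply Rle_trans with (/ Rabs tau / 2 * (4 * A * Rabs tau)); [right; field; lra|].
    apply Rmult_le_compat_l; [lra|unfold R3 in Hw; lra]. }
  assert (T4 : 2 * A / Cmod w * Rabs S <= / Rabs tau / 2 * Rabs S)
    by (apply Rmult_le_compat_r; [apply Rabs_pos|exact T3]).
  assert (T5 : Rabs (Im w) <= / Rabs tau * Rabs S).
  { replace (Rabs (Im w)) with (/ Rabs tau * (Rabs tau * Rabs (Im w))) by (field; lra).
    apply Rmult_le_compat_l; lra. }
  lra.
Qed.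

(** Equal images have equal [x3 = Re h], so the question is confined to one vertical line of the
    w-plane. *)
Lemma sub_end_injective : exists s, 0 < s < r1 /\
  forall z w, punctured_disk s z -> punctured_disk s w -> X z = X w -> z = w.
Proof.
  destruct height_injective as (R2 & HR2 & Inj).
  destruct (Hinf R2) as (rho & Hrho & Big).
  exists (rho / 2). split; [lra|]. intros z w [Z1 Z2] [W1 W2] E.
  assert (Nz : z <> RtoC 0) by now apply Cmod_gt_0.
  assert (Nw : w <> RtoC 0) by now apply Cmod_gt_0.
  pose proof (Big z Nz ltac:(lra)) as Bz. pose proof (Big w Nw ltac:(lra)) as Bw.
  assert (Kz : k (h z) = z) by (apply Hki; auto; lra).
  assert (Kw : k (h w) = w) by (apply Hki; auto; lra).
  assert (Es : Re (h z) = Re (h w)) by (rewrite <- !Hx3 by (auto; lra); now rewrite E).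
  assert (EF : F (h z) = F (h w)) by (unfold F, horizontal_part; now rewrite Kz, Kw, E).
  rewrite <- Kz, <- Kw. f_equal.
  destruct (h z) as [s y], (h w) as [s' y']. unfold Re in Es. simpl in Es. subst s'.
  f_equal. now apply (Inj s).
Qed.

(** For continuity of the inverse at [X z]: by properness, points near the puncture stay at distance
    at least 1 from [X z], and on the remaining compact annulus injectivity bounds the distance
    below away from [z]. *)
Lemma sub_end_embedded : exists s, 0 < s < r1 /\ embedded_end s X.
Proof.
  destruct sub_end_injective as (s & Hs & Inj). exists s. split; [exact Hs|].
  destruct Hend as [Hr HW HC].
  assert (Sub : forall z, punctured_disk s z -> punctured_disk r z) by (unfold punctured_disk; intros; lra).
  split; [|split; [|split; [exact Inj|]]].
  - intros p Hp. apply (is_immersion _ _ _ _ HW). unfold punctured_disk, open_punctured_disk in *. lra.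
  - now apply (continuous_on_subset (punctured_disk r)).
  - intros z Dz eps Heps.
    set (M := Cmod (x1 (X z), x2 (X z)) + Rabs (x3 (X z)) + 1).
    destruct (height_proper M) as (R3 & HR3 & Pr).
    destruct (Hinf R3) as (rho & Hrho & Big).
    assert (Near0 : forall w, w <> RtoC 0 -> Cmod w < rho -> 1 <= dist3 (X w) (X z)).
    { intros w Nw Hw. pose proof (Big w Nw Hw) as Bw.
      assert (Kw : k (h w) = w) by (apply Hki; auto; lra).
      destruct (dist3_ge (X w) (X z)) as (_ & _ & D3 & D12).
      pose proof (Cmod_ge_0 (x1 (X z), x2 (X z))). pose proof (Rabs_pos (x3 (X z))).
      destruct (Pr (h w) Bw) as [L|L].
      - rewrite <- Hx3 in L by (auto; lra). pose proof (Rabs_triang_inv (x3 (X w)) (x3 (X z))).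
        unfold M in L. lra.
      - unfold F, horizontal_part in L. rewrite Kw in L.
        pose proof (Cmod_triangle_rev (x1 (X w), x2 (X w)) (x1 (X z), x2 (X z))).
        unfold M in L. lra. }
    destruct (compact_local_uniform s (fun w d => annulus rho s w -> eps <= Cmod (w - z) ->
        d <= dist3 (X w) (X z))) as (d & Hd & K).
    + intros w d d' _ Hdd Q A1 A2. specialize (Q A1 A2). lra.
    + intros t. destruct (classic (annulus rho s t)) as [At|Nt].
      2:{ destruct (annulus_closed _ _ _ Nt) as (e & He & Ke). exists e. split; [exact He|].
          intros w Hw A1. now destruct (Ke w Hw). }
      destruct (Rlt_dec (Cmod (t - z)) eps) as [Lt|Ge].
      { exists (eps - Cmod (t - z)). split; [lra|]. intros w Hw _ A2.
        pose proof (Cmod_sub_triangle w t z). lra. }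
      assert (Dt : punctured_disk s t) by (unfold annulus, punctured_disk in *; lra).
      assert (Nx : X t <> X z).
      { intros E. apply Inj in E; auto. subst t. apply Ge.
        rewrite Cmod_sub_self. exact Heps. }
      (* The largest coordinate gap between [X t] and [X z]; half of it survives a small move of
         [t]. *)
      set (eta := Rmax (Rabs (x1 (X t) - x1 (X z)))
        (Rmax (Rabs (x2 (X t) - x2 (X z))) (Rabs (x3 (X t) - x3 (X z))))).
      assert (Heta : 0 < eta).
      { apply Rnot_le_lt. intros Z. apply Nx.
        pose proof (Rmax_l (Rabs (x1 (X t) - x1 (X z))) (Rmax (Rabs (x2 (X t) - x2 (X z))) (Rabs (x3 (X t) - x3 (X z))))).
        pose proof (Rmax_r (Rabs (x1 (X t) - x1 (X z))) (Rmax (Rabs (x2 (X t) - x2 (X z))) (Rabs (x3 (X t) - x3 (X z))))).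
        pose proof (Rmax_l (Rabs (x2 (X t) - x2 (X z))) (Rabs (x3 (X t) - x3 (X z)))).
        pose proof (Rmax_r (Rabs (x2 (X t) - x2 (X z))) (Rabs (x3 (X t) - x3 (X z)))).
        fold eta in H, H0.
        assert (Zr : forall u v, Rabs (u - v) <= 0 -> u = v).
        { intros u v Hu. pose proof (Rle_abs (u - v)). pose proof (Rabs_maj2 (u - v)). lra. }
        destruct (X t) as [[a1 a2] a3], (X z) as [[b1 b2] b3]. unfold x1, x2, x3 in *. simpl in *.
        rewrite (Zr a1 b1), (Zr a2 b2), (Zr a3 b3) by lra. reflexivity. }
      destruct (continuous_on_eps _ X t (eta / 2) HC (Sub t Dt)) as (e & He & Ke); [lra|].
      exists (Rmin e (eta / 2)). split; [apply Rmin_pos; lra|].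
      intros w Hw A1 _. pose proof (Rmin_l e (eta / 2)). pose proof (Rmin_r e (eta / 2)).
      destruct (Ke w) as (K1 & K2 & K3); [unfold annulus, punctured_disk in *; lra|lra|].
      destruct (dist3_ge (X w) (X z)) as (D1 & D2 & D3 & _).
      assert (Tri : forall u v x D, Rabs (u - v) < eta / 2 -> Rabs (u - x) <= D -> Rabs (v - x) - eta / 2 <= D).
      { intros u v x D H1 H2. replace (v - x) with (- (u - v) + (u - x)) by ring.
        pose proof (Rabs_triang (- (u - v)) (u - x)). rewrite Rabs_Ropp in H3. lra. }
      pose proof (Tri _ _ _ _ K1 D1). pose proof (Tri _ _ _ _ K2 D2). pose proof (Tri _ _ _ _ K3 D3).
      assert (eta - eta / 2 <= dist3 (X w) (X z)).
      { unfold eta at 1. unfold Rmax. repeat destruct Rle_dec; lra. }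
      lra.
    + exists (Rmin d 1). split; [apply Rmin_pos; lra|]. intros w Dw Hw.
      pose proof (Rmin_l d 1). pose proof (Rmin_r d 1).
      apply Rnot_le_lt. intros L.
      destruct (Rlt_dec (Cmod w) rho) as [Lr|Gr].
      * assert (w <> RtoC 0) by (apply Cmod_gt_0, Dw). specialize (Near0 w H1 Lr). lra.
      * assert (Aw : annulus rho s w) by (unfold annulus, punctured_disk in *; lra).
        specialize (K w ltac:(unfold punctured_disk in Dw; lra) Aw L). lra.
Qed.

(* A point of the end with [|tau y| >= 1] is moved vertically onto the helicoid,
   by turning the generating line; closer to the axis it is moved horizontally. *)
Lemma near_helicoid (eps : R) : 0 < eps -> exists R3, R0 < R3 /\ forall w p, R3 < Cmod w ->
  ((x1 p, x2 p) : C) = F w -> x3 p = Re w ->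
  exists q, helicoid_about b E0 tau q /\ dist3 p q < eps.
Proof.
  intros Heps.
  assert (P2 : 0 <= 4 * A * Rabs tau) by (apply Rmult_le_pos; lra).
  assert (P3 : 0 < (4 * A + 1) / eps) by (apply Rdiv_lt_0_compat; lra).
  (* The term [4 * A * Rabs tau] keeps the relative error [kap] at most 1/2; the last one gives
     [4 * A / |w| < eps], the bound reached in both cases. *)
  set (R3 := R0 + 4 * A * Rabs tau + (4 * A + 1) / eps).
  exists R3. split; [unfold R3; lra|]. intros w p Hw E12 E3.
  assert (Hw0 : R0 < Cmod w) by (unfold R3 in Hw; lra). assert (Pw : 0 < Cmod w) by lra.
  assert (Sm : 4 * A / Cmod w < eps).
  { apply Rmult_lt_reg_r with (Cmod w); [lra|].
    replace (4 * A / Cmod w * Cmod w) with (4 * A) by (field; lra).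
    apply Rlt_le_trans with (eps * ((4 * A + 1) / eps)); [replace (eps * ((4 * A + 1) / eps)) with (4 * A + 1) by (field; lra); lra|].
    apply Rmult_le_compat_l; [lra|unfold R3 in Hw; lra]. }
  set (s := Re w) in *. set (S := sinh (tau * Im w)).
  assert (Na : amp s <> RtoC 0).
  { apply Cmod_neq_0. rewrite Cmod_amp. now apply Rinv_0_lt_compat. }
  (* Position relative to the axis in the frame of the ruling at height [s]: real values lie on the
     helicoid, and [S] is the approximate position. *)
  set (ze := ((F w - b) / amp s)%C).
  assert (EF : F w = (b + amp s * ze)%C) by (unfold ze; field; exact Na).
  assert (Ez : Cmod (F w - (b + amp s * RtoC S)) = / Rabs tau * Cmod (ze - RtoC S)).
  { rewrite EF. replace (b + amp s * ze - (b + amp s * RtoC S))%C with (amp s * (ze - RtoC S))%C by ring.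
    now rewrite Cmod_mult, Cmod_amp. }
  assert (Ptau' : 0 < / Rabs tau) by now apply Rinv_0_lt_compat.
  destruct (Rle_dec 1 (Rabs (tau * Im w))) as [Far|Close].
  - pose proof (asymptotics_far w Hw0 Far) as B. fold s in B. fold S in B. rewrite Ez in B.
    set (kap := 2 * A * Rabs tau / Cmod w).
    assert (Hk0 : 0 <= kap) by (unfold kap; apply Rmult_le_pos; [lra|left; now apply Rinv_0_lt_compat]).
    assert (Hk : kap <= / 2).
    { apply Rmult_le_reg_r with (Cmod w); [lra|].
      unfold kap. replace (2 * A * Rabs tau / Cmod w * Cmod w) with (2 * A * Rabs tau) by (field; lra).
      unfold R3 in Hw. lra. }
    assert (Bz : Cmod (ze - RtoC S) <= kap * Rabs S).
    { apply Rmult_le_reg_l with (/ Rabs tau); [exact Ptau'|]. eapply Rle_trans; [exact B|].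
      right. unfold kap. field. lra. }
    pose proof (re_le_Cmod (ze - RtoC S)) as Q1. pose proof (im_le_Cmod (ze - RtoC S)) as Q2.
    assert (PS : 0 < Rabs S).
    { pose proof (sinh_abs_ge (tau * Im w)) as Q. fold S in Q. lra. }
    destruct ze as [zr zi] eqn:Eze.
    change (Re ((zr, zi) - RtoC S)) with (zr - S) in Q1.
    assert (Q2' : Rabs zi <= kap * Rabs S).
    { eapply Rle_trans; [|eapply Rle_trans; [exact Q2|exact Bz]]. right. f_equal. unfold Im. simpl. ring. }
    assert (Hzr : Rabs S / 2 <= Rabs zr).
    { pose proof (Rabs_triang (- (zr - S)) zr) as T. replace (- (zr - S) + zr) with S in T by ring.
      rewrite Rabs_Ropp in T. assert (kap * Rabs S <= / 2 * Rabs S) by (apply Rmult_le_compat_r; lra). lra. }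
    assert (Nzr : zr <> 0) by (intros ->; rewrite Rabs_R0 in Hzr; lra).
    (* Polar coordinates in which [rho] takes the sign of [zr], so that the angle [atan x] is small
       on both halves of the ruling. *)
    set (x := zi / zr). set (rho := zr * sqrt (1 + Rsqr x)).
    assert (Hx : Rabs x <= 2 * kap).
    { unfold x, Rdiv. rewrite Rabs_mult, Rabs_inv.
      apply Rmult_le_reg_r with (Rabs zr); [lra|].
      rewrite Rmult_assoc, Rinv_l, Rmult_1_r by lra.
      apply Rle_trans with (2 * kap * (Rabs S / 2)); [lra|]. apply Rmult_le_compat_l; lra. }
    assert (Psq : 0 < sqrt (1 + Rsqr x)) by (apply sqrt_lt_R0; unfold Rsqr; nra).
    assert (Pol : ((zr, zi) : C) = (RtoC rho * Cis (atan x))%C).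
    { unfold Cis. rewrite cos_atan, sin_atan. unfold rho.
      assert (Ex : zi = zr * x) by (unfold x; field; exact Nzr).
      apply injective_projections; simpl; [field; lra|]. rewrite Ex at 1. field. lra. }
    set (s' := s + atan x / tau).
    assert (Amp : (amp s * (zr, zi))%C = (amp s' * RtoC rho)%C).
    { rewrite Pol. unfold amp.
      replace (Cexp (Ci * RtoC tau * RtoC s')) with (Cexp (Ci * RtoC tau * RtoC s) * Cis (atan x))%C.
      - field. split; [|apply Cmod_neq_0; rewrite Cmod_Ci; lra]. intros Z. apply Htau. now injection Z.
      - replace (Cis (atan x)) with (Cexp (Ci * RtoC tau * RtoC (atan x / tau))).
        + rewrite <- Cexp_plus. f_equal. unfold s'. rewrite RtoC_plus. ring.
        + unfold Cexp, Cis, Re, Im. simpl.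
          replace ((0 * tau - 1 * 0) * (atan x / tau) - (0 * 0 + 1 * tau) * 0) with 0 by ring.
          replace ((0 * tau - 1 * 0) * 0 + (0 * 0 + 1 * tau) * (atan x / tau)) with (atan x) by (field; exact Htau).
          rewrite exp_0. f_equal; ring. }
    exists (x1 p, x2 p, s'). split.
    + exists s', rho. split; [|reflexivity].
      change ((x1 p, x2 p) = (b + amp s' * RtoC rho)%C). rewrite E12, EF, Amp. reflexivity.
    + eapply Rle_lt_trans; [apply dist3_le|].
      change (x1 (x1 p, x2 p, s')) with (x1 p). change (x2 (x1 p, x2 p, s')) with (x2 p).
      change (x3 (x1 p, x2 p, s')) with s'.
      replace ((x1 p, x2 p) - (x1 p, x2 p))%C with (RtoC 0) by ring. rewrite Cmod_0, E3.
      replace (s - s') with (- (atan x / tau)) by (unfold s'; ring).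
      rewrite Rabs_Ropp. unfold Rdiv. rewrite Rabs_mult, Rabs_inv.
      pose proof (atan_abs_le x).
      apply Rle_lt_trans with (2 * kap * / Rabs tau).
      * rewrite Rplus_0_l. apply Rmult_le_compat_r; lra.
      * replace (2 * kap * / Rabs tau) with (4 * A / Cmod w) by (unfold kap; field; lra). exact Sm.
  (* Here [exp (tau y)] lies between 1/3 and 3, so [cosh] is at most [(3 + 1/3) / 2]; the error is
     then absolute, and dropping the imaginary part of [ze] suffices. *)
  - assert (Hc : cosh (tau * Im w) <= 2).
    { unfold cosh. pose proof exp_le_3 as E1.
      assert (B1 : forall x, Rabs x <= 1 -> 0 < exp x <= 3).
      { intros x Hx. split; [apply exp_pos|]. apply Rle_trans with (exp 1); [|exact E1].
        apply exp_le. pose proof (Rle_abs x). lra. }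
      assert (Ha : Rabs (tau * Im w) <= 1) by lra.
      pose proof (exp_ineq1_le (tau * Im w)). pose proof (exp_pos (tau * Im w)). pose proof (exp_pos (- (tau * Im w))).
      assert (Hm : exp (tau * Im w) * exp (- (tau * Im w)) = 1) by (rewrite <- exp_plus, Rplus_opp_r; apply exp_0).
      assert (B2 : / 3 <= exp (tau * Im w) <= 3).
      { destruct (B1 (- (tau * Im w)) ltac:(rewrite Rabs_Ropp; lra)) as [_ U].
        split; [|now apply B1]. nra. }
      assert (0 <= (3 - exp (tau * Im w)) * (exp (tau * Im w) - / 3)) by (apply Rmult_le_pos; lra).
      assert (exp (tau * Im w) + exp (- (tau * Im w)) <= 3 + / 3 + 0).
      { apply Rmult_le_reg_l with (exp (tau * Im w)); [lra|].
        rewrite Rmult_plus_distr_l, Hm. lra. }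
      lra. }
    pose proof (Hasym w Hw0) as B. fold s in B. fold S in B. rewrite Ez in B.
    set (q := (b + amp s * RtoC (Re ze))%C).
    exists (Re q, Im q, s). split.
    + exists s, (Re ze). split; [|reflexivity]. unfold x1, x2. simpl.
      change ((Re q, Im q) = q). now destruct q.
    + eapply Rle_lt_trans; [apply dist3_le|].
      change (x1 (Re q, Im q, s)) with (Re q). change (x2 (Re q, Im q, s)) with (Im q).
      change (x3 (Re q, Im q, s)) with s.
      rewrite E12, E3. replace ((Re q, Im q) : C) with q by now destruct q.
      replace (s - s) with 0 by ring. rewrite Rabs_R0, Rplus_0_r.
      rewrite EF. unfold q.
      replace (b + amp s * ze - (b + amp s * RtoC (Re ze)))%C with (amp s * (Ci * RtoC (Im ze)))%C
        by (destruct ze; unfold Re, Im; destruct (amp s), b; Ceq).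
      rewrite !Cmod_mult, Cmod_amp, Cmod_Ci, Cmod_R.
      pose proof (im_le_Cmod (ze - RtoC S)) as Q.
      replace (Im (ze - RtoC S)) with (Im ze) in Q by (destruct ze; unfold Im; simpl; ring).
      apply Rle_lt_trans with (/ Rabs tau * Cmod (ze - RtoC S)); [apply Rmult_le_compat_l; lra|].
      eapply Rle_lt_trans; [exact B|]. apply Rle_lt_trans with (2 := Sm).
      apply Rmult_le_compat_r; [left; now apply Rinv_0_lt_compat|].
      assert (A * cosh (tau * Im w) <= A * 2) by (apply Rmult_le_compat_l; lra). lra.
Qed.

Theorem helicoidal_conclusion : exists s, 0 < s < r /\ embedded_end s X /\
  exists H, helicoid H /\ asymptotic_to s X H.
Proof.
  destruct sub_end_embedded as (s & Hs & Emb). exists s. split; [lra|]. split; [exact Emb|].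
  exists (helicoid_about b E0 tau). split; [now apply helicoid_about_helicoid|].
  intros eps Heps. destruct (near_helicoid eps Heps) as (R3 & HR3 & N).
  destruct (Hinf R3) as (rho & Hrho & Big).
  exists (Rmin s (rho / 2)). split; [split; [apply Rmin_pos; lra|apply Rmin_l]|].
  intros p (z & [D1 D2] & ->).
  pose proof (Rmin_l s (rho / 2)). pose proof (Rmin_r s (rho / 2)).
  assert (Nz : z <> RtoC 0) by now apply Cmod_gt_0.
  pose proof (Big z Nz ltac:(lra)) as Bz.
  apply (N (h z)); [exact Bz| |].
  - unfold F. rewrite Hki by (auto; lra). reflexivity.
  - apply Hx3; [exact Nz|lra].
Qed.

End Conclusion.

Theorem theorem1 (r : R) (g f : C -> C) (X : C -> R3)
  (Hend : minimal_annular_end r g f X)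
  (Hcomplete : complete_end r X)
  (Hdg : has_pole (dlog g) (RtoC 0) 2)
  (Hdh : has_pole f (RtoC 0) 2)
  (Hres : has_residue f (RtoC 0) (RtoC 0))
  (Hvertical : contains_ray (image X (punctured_disk r)) vertical)
  (Hhorizontal : contains_ray (image X (punctured_disk r)) horizontal) :
  exists s : R, 0 < s < r /\
    embedded_end s X /\
    exists H : R3 -> Prop, helicoid H /\ asymptotic_to s X H.
Proof.
  destruct (end_in_height_coordinate r g f X Hend Hdg Hdh Hres)
    as (r1 & R0 & K & h & k & L & al & be & Hr1 & Hal & Hk & Hki & Hinf & Hx3 & HE).
  destruct (vertical_ray_height r g f X r1 R0 h k Hend Hki Hinf Hx3 Hvertical)
    as (b & sg & s0 & Hsg & Vray).
  destruct (horizontal_ray_height r g f X r1 R0 h k Hend Hki Hinf Hx3 Hhorizontal)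
    as (c & a & v & Hv & Hray).
  pose proof (horizontal_ray_al _ _ _ _ _ _ _ HE c a v Hv Hray) as Ral.
  pose proof (vertical_ray_be _ _ _ _ _ _ _ HE b sg s0 Ral Hsg Vray) as Ebe.
  set (tau := Im al).
  assert (Eal : al = (Ci * RtoC tau)%C).
  { unfold tau. destruct al as [a1 a2]. unfold Re in Ral. simpl in Ral. subst a1. unfold Im. Ceq. }
  assert (Htau : tau <> 0).
  { intros Z. apply Hal. rewrite Eal, Z. ring. }
  rewrite Eal, Ebe in HE.
  destruct (straight_axis _ _ _ _ _ _ b sg s0 Htau HE Hsg Vray) as (y0 & s1 & Hs1 & Ax).
  destruct (height_end_shift _ _ _ _ _ _ y0 HE) as (R1 & HR1 & Sh).
  assert (HR0 : 1 < R0) by exact (he_R0 _ _ _ _ _ _ _ HE).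
  (* Any point beyond [R1] releases the shifted end, which does not depend on it. *)
  destruct (Sh (RtoC (R1 + 1))) as [_ HE1]; [rewrite Cmod_R, Rabs_pos_eq; lra|].
  (* Subtracting the imaginary constant [d] from [h] puts the axis on the real line and leaves
     [x3 = Re h] unchanged. *)
  set (d := (0, y0) : C) in *.
  set (k' := fun w => k (w + d)%C).
  set (h' := fun z => (h z - d)%C).
  set (s2 := Rmax s1 R1 + 1).
  assert (s1 < s2) by (unfold s2; pose proof (Rmax_l s1 R1); lra).
  assert (R1 < s2) by (unfold s2; pose proof (Rmax_r s1 R1); lra).
  assert (Ax1 : forall s, s2 < s ->
     horizontal_part X (k (RtoC (sg * s) + d)%C) = b /\ Cmod (g (k (RtoC (sg * s) + d)%C)) = 1).
  { intros s Hs. replace (RtoC (sg * s) + d)%C with ((sg * s, y0) : C) by (unfold d; Ceq).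
    apply Ax. lra. }
  destruct (helicoidal_asymptotics _ _ _ _ _ _ b sg s2 Htau HE1 Hsg ltac:(lra) Ax1)
    as (E0 & Ra & A & ME0 & HRa & HA & T1).
  destruct (vertical_expansion _ _ _ _ _ _ HE1) as (Rb & HRb & T2).
  set (R2 := Rmax Ra Rb).
  assert (Ra <= R2) by apply Rmax_l. assert (Rb <= R2) by apply Rmax_r.
  assert (Inf' : forall M, exists rho, 0 < rho < r1 /\
    forall z, z <> RtoC 0 -> Cmod z < rho -> M < Cmod (h' z)).
  { intros M. destruct (Hinf (M + Cmod d)) as (rho & Hrho & B). exists rho. split; [exact Hrho|].
    intros z Nz Hz. specialize (B z Nz Hz). pose proof (Cmod_triangle_rev (h z) d). unfold h'. lra. }
  apply (helicoidal_conclusion r r1 R2 g f X h' k' b E0 tau A); auto.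
  - lra.
  - intros z Nz Hz Bz. unfold k', h'. replace (h z - d + d)%C with (h z) by ring.
    apply Hki; auto. destruct (Sh (h z - d)%C) as [B _]; [unfold h' in Bz; lra|].
    replace (h z - d + d)%C with (h z) in B by ring. exact B.
  - intros z Nz Hz. rewrite Hx3 by auto. unfold h', d, Re. simpl. ring.
  - intros w Hw. apply T1. lra.
  - intros s y1 y2 Hy Hseg. apply T2; [exact Hy|]. intros t Ht. specialize (Hseg t Ht). lra.
Qed.
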